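(* Let $f=h+\overline{g}\in\mathcal{C}_H^0$. Then for every $n\ge2$ the section $s_{n,n}(f)$ is close-to-convex in the disk $|z|<1/4$. In particular, $s_{n,n}(f)$ is univalent and sense-preserving in $|z|<1/4$ for every $n\ge2$. The number $1/4$ cannot be replaced by a greater one; that is, for no $r>1/4$ do these assertions hold, with $|z|<1/4$ replaced by $|z|<r$, for all $f\in\mathcal{C}_H^0$ and all $n\ge2$.
   Context: Let $\mathbb{D}=\{z\in\mathbb{C}:|z|<1\}$. $\mathcal{H}_0$ is the class of complex-valued harmonic functions $f=h+\overline{g}$ on $\mathbb{D}$, where $h,g$ are analytic on $\mathbb{D}$ with $h(0)=0$, $h'(0)=1$, $g(0)=0$, $g'(0)=0$; thus $h(z)=z+\sum_{k\ge2}a_kz^k$ and $g(z)=\sum_{k\ge2}b_kz^k$. A harmonic function $h+\overline{g}$ is sense-preserving in a disk if its Jacobian $|h'|^2-|g'|^2$ is positive there. $\mathcal{C}_H^0$ is the class of $f\in\mathcal{H}_0$ that are sense-preserving and univalent (injective) in $\mathbb{D}$ and for which $f(\mathbb{D})$ is convex. For $n\ge2$, $s_{n,n}(f)(z)=s_n(h)(z)+\overline{s_n(g)(z)}$, where $s_n(h)(z)=z+\sum_{k=2}^na_kz^k$ and $s_n(g)(z)=\sum_{k=2}^nb_kz^k$. A domain is close-to-convex if its complement in $\mathbb{C}$ can be written as a union of non-intersecting half-lines. A harmonic function is close-to-convex in $|z|<r$ if it is univalent there and the image of $|z|<r$ is a close-to-convex domain. *)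

(* Defs.v *)
(* Stdlib reals with Coquelicot's complex numbers. *)
From Stdlib Require Export Reals.
From Coquelicot Require Export Coquelicot.

Open Scope R_scope.

Definition disk (r : R) : C -> Prop := fun z => Cmod z < r.

Definition image (f : C -> C) (A : C -> Prop) : C -> Prop :=
  fun w => exists z, A z /\ w = f z.

(* [f] is the sum of the power series with coefficients [a], centred at [z0],
   in some neighbourhood of [z0]. *)
Definition expands_at (f : C -> C) (z0 : C) (a : nat -> C) : Prop :=
  exists rho : R, 0 < rho /\
    forall z : C, Cmod (z - z0)%C < rho ->
      @is_pseries C_AbsRing C_NormedModule a (z - z0)%C (f z).

Definition analytic_on (A : C -> Prop) (f : C -> C) : Prop :=
  forall z0 : C, A z0 -> exists a : nat -> C, expands_at f z0 a.

(* A harmonic function is handled through its pair (h, g) of analytic and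
   co-analytic parts; the normalisation g(0) = 0 makes the pair unique. *)
Definition harmonic (h g : C -> C) : C -> C := fun z => (h z + Cconj (g z))%C.

Definition univalent_on (A : C -> Prop) (f : C -> C) : Prop :=
  forall z w : C, A z -> A w -> f z = f w -> z = w.

(* [C_derive] is the complex derivative; the functions it is applied to are
   analytic on [A], so its default value is never used. *)
Definition jacobian (h g : C -> C) (z : C) : R :=
  Cmod (C_derive h z) ^ 2 - Cmod (C_derive g z) ^ 2.

Definition sense_preserving_on (A : C -> Prop) (h g : C -> C) : Prop :=
  forall z : C, A z -> 0 < jacobian h g z.

Definition convex_set (A : C -> Prop) : Prop :=
  forall (p q : C) (t : R), A p -> A q -> 0 <= t <= 1 ->
    A (RtoC (1 - t) * p + RtoC t * q)%C.

Definition class_H0 (h g : C -> C) : Prop :=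
  analytic_on (disk 1) h /\ analytic_on (disk 1) g /\
  h (RtoC 0) = RtoC 0 /\ C_derive h (RtoC 0) = RtoC 1 /\
  g (RtoC 0) = RtoC 0 /\ C_derive g (RtoC 0) = RtoC 0.

Definition class_CH0 (h g : C -> C) : Prop :=
  class_H0 h g /\
  sense_preserving_on (disk 1) h g /\
  univalent_on (disk 1) (harmonic h g) /\
  convex_set (image (harmonic h g) (disk 1)).

(* s_n(h) and s_n(g), in terms of the Taylor coefficients of h and g at 0. *)
Definition section_h (a : nat -> C) (n : nat) : C -> C :=
  fun z => (z + sum_n_m (fun k => (a k * z ^ k)%C) 2 n)%C.

Definition section_g (b : nat -> C) (n : nat) : C -> C :=
  fun z => sum_n_m (fun k => (b k * z ^ k)%C) 2 n.

Definition connected_set (A : C -> Prop) : Prop :=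
  forall U V : C -> Prop, open U -> open V ->
    (forall z, A z -> U z \/ V z) ->
    (exists z, A z /\ U z) -> (exists z, A z /\ V z) ->
    exists z, A z /\ U z /\ V z.

Definition domain (A : C -> Prop) : Prop :=
  (exists z, A z) /\ open A /\ connected_set A.

(* A half-line may contain its origin or not.  With pairwise disjoint half-lines
   of both kinds, the definition of [close_to_convex_domain] is the usual one, in
   which the half-lines are closed and do not intersect, except that the origin of
   one may lie on another: to pass from one form to the other, add or remove
   origins (the complement of a domain is closed). *)
Definition half_line (L : C -> Prop) : Prop :=
  exists p d : C, d <> RtoC 0 /\
    ((forall z, L z <-> exists t : R, 0 <= t /\ z = (p + RtoC t * d)%C) \/
     (forall z, L z <-> exists t : R, 0 < t /\ z = (p + RtoC t * d)%C)).

Definition close_to_convex_domain (D : C -> Prop) : Prop :=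
  domain D /\
  exists F : (C -> Prop) -> Prop,
    (forall L, F L -> half_line L) /\
    (forall L M, F L -> F M -> (exists z, L z /\ M z) -> forall z, L z <-> M z) /\
    (forall z, ~ D z <-> exists L, F L /\ L z).

Definition close_to_convex_on (A : C -> Prop) (f : C -> C) : Prop :=
  univalent_on A f /\ close_to_convex_domain (image f A).

(* [P h_n g_n] holds for the analytic and co-analytic parts of s_{n,n}(f), for
   all f in the class C_H^0 and all n >= 2.  The sequences [a] and [b] exist
   because h and g are analytic at 0, and they are unique. *)
Definition for_all_sections (P : (C -> C) -> (C -> C) -> Prop) : Prop :=
  forall (h g : C -> C) (a b : nat -> C) (n : nat),
    class_CH0 h g ->
    expands_at h (RtoC 0) a ->
    expands_at g (RtoC 0) b ->
    (2 <= n)%nat ->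
    P (section_h a n) (section_g b n).

(* Main.v *)
(* If f = h + conj g is convex and |eps| = 1, then F = h + eps g is univalent: along the
   f-preimage z(t) of a segment with direction a one has, for increments X of h and Y of g
   between times t0 and t, (t - t0) Re (conj a (X + eps Y)) = |X|^2 - |Y|^2 > 0 whenever
   F takes the same value at both ends. Gronwall's area theorem for the odd transform
   sqrt (F(z^2)) then gives F = z / V^2, V = 1 + sum v_m z^m, with
   sum (2m - 1) |v_m|^2 <= 1, so that F is close to z / (1 + v_1 z)^2, the closer the larger
   |v_1| is; an explicit estimate yields Re s_n(F)' > 0 in |z| < 1/4. Choosing eps suitably,
   |s_n(g)'| < Re s_n(h)', so p |-> s_{n,n}(f)(p) is strictly accretive, hence injective, and
   the rays f(p) + t p, t >= 0, |p| = 1/4, are disjoint and fill the complement of the image.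
   The area theorem is obtained from the inequality
   sum_jk c_j conj c_k ln (d + |w_j - w_k|^2) <= 0 for sum c_j = 0, applied to w_j = H(z_j) at
   equidistributed points of a circle. Sharpness: the half-plane mapping and n = 2. *)
Require Import Defs.
From Stdlib Require Import Lra Lia Psatz Classical ClassicalEpsilon FunctionalExtensionality.

Local Open Scope R_scope.

(** * Finite sums of complex numbers *)

(** The energy inequality replaces the area omitted by [H]: no Jordan curve, winding number or
    double integral is needed. Write |H z - H w|^2 = |1/z - 1/w|^2 |T|^2, where T = [Tk] has no
    zeros because [H] is univalent. For the weights c = z H'(z), truncated, and up to errors that
    vanish in the limit, the first factor contributes at least -(1/r^2 + S) to the energy, with S =
    sum k |b_k|^2 r^(2k), and the second exactly 2 S. As the total is at most 0, S <= 1/r^2; then r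
    tends to 1. The bound for Re s_n(F)' must hold for all n and is tight: for the Koebe function
    the section of degree 2 has derivative 0 at -1/4. With s = |v_1| the area theorem leaves 1 - s^2
    for the coefficients v_2, v_3, ..., so the deviation from sum (k+1)^2 (al z)^k, al = - v_1, is
    of order sqrt (1 - s^2); it vanishes exactly where the main part has no slack. An inequality of
    means turns the square root into a polynomial, and what remains is the positivity of two
    polynomials in s and Re (al z). *)

Definition cdot (z w : C) : R := fst z * fst w + snd z * snd w.

Lemma Cmod_sq (z : C) : Cmod z ^ 2 = cdot z z.
Proof.
  unfold Cmod, cdot. rewrite pow2_sqrt; [ring|].
  pose proof (pow2_ge_0 (fst z)); pose proof (pow2_ge_0 (snd z)); lra.
Qed.

Lemma cdot_le (z w : C) : cdot z w <= Cmod z * Cmod w.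
Proof.
  apply Rle_trans with (Rabs (cdot z w)); [apply Rle_abs|].
  rewrite <- (Rabs_right (Cmod z * Cmod w)).
  2: { apply Rle_ge, Rmult_le_pos; apply Cmod_ge_0. }
  apply Rsqr_le_abs_0. rewrite Rsqr_mult.
  rewrite !Rsqr_pow2, !Cmod_sq. unfold cdot.
  pose proof (pow2_ge_0 (fst z * snd w - snd z * fst w)). nra.
Qed.

Lemma cdot_comm (z w : C) : cdot z w = cdot w z.
Proof. unfold cdot. ring. Qed.

Lemma cdot_abs_le (z w : C) : Rabs (cdot z w) <= Cmod z * Cmod w.
Proof.
  apply Rabs_le. split; [|apply cdot_le].
  replace (cdot z w) with (- cdot (- z)%C w) by (unfold cdot; simpl; ring).
  apply Ropp_le_contravar. rewrite <- (Cmod_opp z). apply cdot_le.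
Qed.

Lemma fst_le_Cmod (z : C) : Rabs (fst z) <= Cmod z.
Proof. apply Rle_trans with (2 := Rmax_Cmod z), Rmax_l. Qed.

Lemma snd_le_Cmod (z : C) : Rabs (snd z) <= Cmod z.
Proof. apply Rle_trans with (2 := Rmax_Cmod z), Rmax_r. Qed.

Lemma Cmod_le_abs (z : C) : Cmod z <= Rabs (fst z) + Rabs (snd z).
Proof.
  apply Rsqr_incr_0_var.
  2: { apply Rplus_le_le_0_compat; apply Rabs_pos. }
  rewrite !Rsqr_pow2, Cmod_sq. unfold cdot.
  rewrite <- !(Rsqr_pow2 (_ + _)). unfold Rsqr.
  pose proof (Rabs_pos (fst z)); pose proof (Rabs_pos (snd z)).
  pose proof (pow2_abs (fst z)); pose proof (pow2_abs (snd z)). nra.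
Qed.

Lemma Cmod_conj (z : C) : Cmod (Cconj z) = Cmod z.
Proof. unfold Cmod. simpl. f_equal. ring. Qed.

Lemma Cmod_lt_of_sq (z : C) (r : R) : 0 <= r -> cdot z z < r ^ 2 -> Cmod z < r.
Proof.
  intros Hr H. rewrite <- Cmod_sq in H. pose proof (Cmod_ge_0 z). nra.
Qed.

Lemma Cmod_minus_sym (z w : C) : Cmod (z - w) = Cmod (w - z).
Proof. rewrite <- Cmod_opp. f_equal. ring. Qed.

Lemma Cmod_triangle_sub (z w : C) : Cmod z - Cmod w <= Cmod (z - w).
Proof.
  pose proof (Cmod_triangle (z - w) w).
  replace (z - w + w)%C with z in H by ring. lra.
Qed.

Lemma Cmod_RtoC (x : R) : 0 <= x -> Cmod (RtoC x) = x.
Proof. intros. rewrite Cmod_R. apply Rabs_right. lra. Qed.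

Ltac ceq := apply injective_projections; simpl.

(** Half-open sums: [csum f n] has the [n] terms [f 0, ..., f (n - 1)], whereas [sum_n f n] also
    contains [f n]. *)
Fixpoint csum (f : nat -> C) (n : nat) : C :=
  match n with O => RtoC 0 | S m => (csum f m + f m)%C end.

Fixpoint rsum (f : nat -> R) (n : nat) : R :=
  match n with O => 0 | S m => rsum f m + f m end.

Arguments csum f%_C_scope n%_nat_scope.

Arguments rsum f%_R_scope n%_nat_scope.

Lemma csum_ext (f g : nat -> C) n :
  (forall k, (k < n)%nat -> f k = g k) -> csum f n = csum g n.
Proof.
  induction n; intros H; simpl; auto.
  rewrite IHn by auto. rewrite H by lia. reflexivity.
Qed.

Lemma rsum_ext (f g : nat -> R) n :
  (forall k, (k < n)%nat -> f k = g k) -> rsum f n = rsum g n.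
Proof.
  induction n; intros H; simpl; auto.
  rewrite IHn by auto. rewrite H by lia. reflexivity.
Qed.

Lemma csum_plus f g n : csum (fun k => f k + g k)%C n = (csum f n + csum g n)%C.
Proof. induction n; simpl; [ring|rewrite IHn; ring]. Qed.

Lemma csum_minus f g n : csum (fun k => f k - g k)%C n = (csum f n - csum g n)%C.
Proof. induction n; simpl; [ring|rewrite IHn; ring]. Qed.

Lemma csum_scal c f n : csum (fun k => c * f k)%C n = (c * csum f n)%C.
Proof. induction n; simpl; [ring|rewrite IHn; ring]. Qed.

Lemma csum_scal_r c f n : csum (fun k => f k * c)%C n = (csum f n * c)%C.
Proof. induction n; simpl; [ring|rewrite IHn; ring]. Qed.

Lemma csum_0 f n : (forall k, (k < n)%nat -> f k = RtoC 0) -> csum f n = RtoC 0.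
Proof.
  induction n; intros H; simpl; auto. rewrite IHn, H by auto with arith. ring.
Qed.

Lemma csum_const c n : csum (fun _ => c) n = (RtoC (INR n) * c)%C.
Proof.
  induction n; [simpl; ring|]. rewrite S_INR. simpl csum. rewrite IHn, RtoC_plus. ring.
Qed.

Lemma csum_swap (f : nat -> nat -> C) n m :
  csum (fun i => csum (f i) m) n = csum (fun j => csum (fun i => f i j) n) m.
Proof.
  induction n; simpl.
  - symmetry. apply csum_0. auto.
  - rewrite IHn, <- csum_plus. reflexivity.
Qed.

Lemma csum_add f n m : csum f (n + m) = (csum f n + csum (fun k => f (n + k)%nat) m)%C.
Proof.
  induction m.
  - rewrite Nat.add_0_r. simpl. ring.
  - rewrite Nat.add_succ_r. simpl. rewrite IHm. ring.
Qed.

Lemma csum_S_l f n : csum f (S n) = (f O + csum (fun k => f (S k)) n)%C.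
Proof. change (S n) with (1 + n)%nat. rewrite csum_add. simpl. ring. Qed.

Lemma csum_single f n i : (i < n)%nat ->
  (forall k, (k < n)%nat -> k <> i -> f k = RtoC 0) -> csum f n = f i.
Proof.
  intros Hi H. induction n; [lia|]. simpl. destruct (Nat.eq_dec i n) as [->|Hn].
  - rewrite csum_0; [ring|]. intros k Hk. apply H; lia.
  - rewrite IHn; [rewrite (H n) by lia; ring|lia|]. intros; apply H; lia.
Qed.

Lemma csum_conj f n : Cconj (csum f n) = csum (fun k => Cconj (f k)) n.
Proof. induction n; simpl; [ceq; ring|rewrite <- IHn; ceq; ring]. Qed.

Lemma fst_csum f n : fst (csum f n) = rsum (fun k => fst (f k)) n.
Proof. induction n; simpl; auto. rewrite IHn. reflexivity. Qed.

Lemma snd_csum f n : snd (csum f n) = rsum (fun k => snd (f k)) n.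
Proof. induction n; simpl; auto. rewrite IHn. reflexivity. Qed.

Lemma rsum_plus f g n : rsum (fun k => f k + g k) n = rsum f n + rsum g n.
Proof. induction n; simpl; [ring|rewrite IHn; ring]. Qed.

Lemma rsum_scal c f n : rsum (fun k => c * f k) n = c * rsum f n.
Proof. induction n; simpl; [ring|rewrite IHn; ring]. Qed.

Lemma rsum_scal_r c f n : rsum (fun k => f k * c) n = rsum f n * c.
Proof. induction n; simpl; [ring|rewrite IHn; ring]. Qed.

Lemma rsum_const c n : rsum (fun _ => c) n = INR n * c.
Proof. induction n; [simpl; ring|]. rewrite S_INR. simpl rsum. rewrite IHn. ring. Qed.

Lemma rsum_0 f n : (forall k, (k < n)%nat -> f k = 0) -> rsum f n = 0.
Proof.
  induction n; intros H; simpl; auto. rewrite IHn, H by auto with arith. ring.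
Qed.

Lemma rsum_le f g n : (forall k, (k < n)%nat -> f k <= g k) -> rsum f n <= rsum g n.
Proof.
  induction n; intros H; simpl; [lra|].
  apply Rplus_le_compat; [apply IHn; auto|apply H; lia].
Qed.

Lemma rsum_nonneg f n : (forall k, (k < n)%nat -> 0 <= f k) -> 0 <= rsum f n.
Proof.
  intros H. apply Rle_trans with (rsum (fun _ => 0) n); [rewrite rsum_0; auto; lra|].
  apply rsum_le; auto.
Qed.

Lemma rsum_swap (f : nat -> nat -> R) n m :
  rsum (fun i => rsum (f i) m) n = rsum (fun j => rsum (fun i => f i j) n) m.
Proof.
  induction n; simpl.
  - symmetry. apply rsum_0. auto.
  - rewrite IHn, <- rsum_plus. reflexivity.
Qed.

Lemma rsum_add f n m : rsum f (n + m) = rsum f n + rsum (fun k => f (n + k)%nat) m.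
Proof.
  induction m.
  - rewrite Nat.add_0_r. simpl. ring.
  - rewrite Nat.add_succ_r. simpl. rewrite IHm. ring.
Qed.

Lemma rsum_S_l f n : rsum f (S n) = f O + rsum (fun k => f (S k)) n.
Proof. change (S n) with (1 + n)%nat. rewrite rsum_add. simpl. ring. Qed.

Lemma rsum_mono f n m : (n <= m)%nat -> (forall k, 0 <= f k) -> rsum f n <= rsum f m.
Proof.
  intros H Hf. replace m with (n + (m - n))%nat by lia. rewrite rsum_add.
  assert (0 <= rsum (fun k => f (n + k)%nat) (m - n)) by (apply rsum_nonneg; auto). lra.
Qed.

Lemma rsum_term f n i : (i < n)%nat -> (forall k, 0 <= f k) -> f i <= rsum f n.
Proof.
  intros H Hf. apply Rle_trans with (rsum f (S i)); [|apply rsum_mono; auto].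
  simpl. pose proof (rsum_nonneg f i (fun k _ => Hf k)). lra.
Qed.

Lemma Cmod_csum f n : Cmod (csum f n) <= rsum (fun k => Cmod (f k)) n.
Proof.
  induction n; simpl; [rewrite Cmod_0; lra|].
  eapply Rle_trans; [apply Cmod_triangle|]. lra.
Qed.

Lemma Rabs_rsum f n : Rabs (rsum f n) <= rsum (fun k => Rabs (f k)) n.
Proof.
  induction n; simpl; [rewrite Rabs_R0; lra|].
  eapply Rle_trans; [apply Rabs_triang|]. lra.
Qed.

Lemma rsum_CS f g n :
  rsum (fun k => f k * g k) n ^ 2 <= rsum (fun k => f k ^ 2) n * rsum (fun k => g k ^ 2) n.
Proof.
  induction n; cbn [rsum]; [lra|].
  set (A := rsum (fun k => f k ^ 2) n) in *. set (B := rsum (fun k => g k ^ 2) n) in *.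
  set (S0 := rsum (fun k => f k * g k) n) in *.
  assert (HA : 0 <= A) by (apply rsum_nonneg; intros; apply pow2_ge_0).
  assert (HB : 0 <= B) by (apply rsum_nonneg; intros; apply pow2_ge_0).
  assert (H2 : 2 * S0 * (f n * g n) <= A * g n ^ 2 + B * f n ^ 2).
  { destruct (Rle_dec (2 * S0 * (f n * g n)) 0).
    - pose proof (pow2_ge_0 (g n)); pose proof (pow2_ge_0 (f n)). nra.
    (* Compare squares: [4 S0^2 (f g)^2 <= 4 A B (f g)^2 <= (A g^2 + B f^2)^2], the first by the
       induction hypothesis. *)
    - apply Rsqr_incr_0_var.
      2: { pose proof (pow2_ge_0 (g n)); pose proof (pow2_ge_0 (f n)). nra. }
      unfold Rsqr.
      assert (S0 ^ 2 * (f n * g n) ^ 2 <= A * B * (f n * g n) ^ 2).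
      { apply Rmult_le_compat_r; [apply pow2_ge_0|exact IHn]. }
      pose proof (pow2_ge_0 (A * g n ^ 2 - B * f n ^ 2)). nra. }
  replace ((S0 + f n * g n) ^ 2) with (S0 ^ 2 + 2 * S0 * (f n * g n) + f n ^ 2 * g n ^ 2) by ring.
  replace ((A + f n ^ 2) * (B + g n ^ 2))
    with (A * B + (A * g n ^ 2 + B * f n ^ 2) + f n ^ 2 * g n ^ 2) by ring.
  lra.
Qed.

Lemma geom_sum_le x n : 0 <= x < 1 -> rsum (fun k => x ^ k) n <= / (1 - x).
Proof.
  intros H. assert (E : rsum (fun k => x ^ k) n * (1 - x) = 1 - x ^ n).
  { induction n; simpl; [ring|]. rewrite Rmult_plus_distr_r, IHn. ring. }
  apply Rmult_le_reg_r with (1 - x); [lra|]. rewrite E, Rinv_l by lra.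
  pose proof (pow_le x n (proj1 H)). lra.
Qed.

Lemma cgeom_sum (x : C) n : (csum (fun k => x ^ k) n * (1 - x) = 1 - x ^ n)%C.
Proof.
  induction n; [simpl; ring|]. rewrite Cpow_S. simpl csum. rewrite Cmult_plus_distr_r, IHn. ring.
Qed.

Lemma pow_small (x eps : R) : 0 <= x < 1 -> 0 < eps ->
  exists N, forall n, (N <= n)%nat -> x ^ n < eps.
Proof.
  intros Hx He. destruct (pow_lt_1_zero x) with (y := eps) as [N HN]; auto.
  { rewrite Rabs_right; lra. }
  exists N. intros n Hn. specialize (HN n Hn). rewrite Rabs_right in HN; auto.
  apply Rle_ge, pow_le; lra.
Qed.

(** Bernoulli's inequality for [1 / x = 1 + h]: [(1 + h)^k >= 1 + k h]. *)
Lemma INR_pow_bounded x : 0 <= x < 1 -> exists K, 0 < K /\ forall k, INR k * x ^ k <= K.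
Proof.
  intros [H0 H1]. destruct (Req_dec x 0) as [->|Hx].
  { exists 1. split; [lra|]. intros [|k]; simpl; [lra|]. rewrite Rmult_0_l, Rmult_0_r. lra. }
  set (h := / x - 1). assert (Hh : 0 < h).
  { unfold h. apply Rlt_0_minus. rewrite <- Rinv_1. apply Rinv_lt_contravar; lra. }
  exists (/ h). split; [apply Rinv_0_lt_compat; auto|]. intros k.
  pose proof (poly k h Hh) as P. replace (1 + h) with (/ x) in P by (unfold h; ring).
  rewrite pow_inv in P.
  assert (0 < x ^ k) by (apply pow_lt; lra).
  apply Rmult_le_reg_l with h; auto. rewrite Rinv_r by lra.
  apply (Rmult_le_compat_r (x ^ k)) in P; [|lra]. rewrite Rinv_l in P by lra. nra.
Qed.

Lemma INR_sq_pow_bounded x : 0 <= x < 1 ->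
  exists y K, 0 <= y < 1 /\ 0 < K /\ forall k, INR k ^ 2 * x ^ k <= K * y ^ k.
Proof.
  intros H.
  (* [x <= y ^ 3], so that [k x^k] is absorbed twice by [y^k]. *)
  set (y := (x + 2) / 3). assert (Hy : 0 <= y < 1) by (unfold y; lra).
  (* Here [y^3 - x = (1 - x)^2 (8 + x) / 27]. *)
  assert (Hxy : x <= y ^ 3).
  { unfold y. assert (0 <= (1 - x) ^ 2 * (8 + x)) by (apply Rmult_le_pos; [apply pow2_ge_0|lra]). nra. }
  destruct (INR_pow_bounded y Hy) as (K & HK & B).
  exists y, (K ^ 2). repeat split; try lra; [nra|]. intros k.
  apply Rle_trans with (INR k ^ 2 * (y ^ 3) ^ k).
  { apply Rmult_le_compat_l; [apply pow2_ge_0|]. apply pow_incr. lra. }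
  rewrite <- pow_mult. replace (3 * k)%nat with (k + k + k)%nat by lia. rewrite !pow_add.
  pose proof (B k). assert (0 <= INR k * y ^ k) by (apply Rmult_le_pos; [apply pos_INR|apply pow_le; lra]).
  pose proof (pow_le y k (proj1 Hy)).
  replace (INR k ^ 2 * (y ^ k * y ^ k * y ^ k)) with ((INR k * y ^ k) ^ 2 * y ^ k) by ring.
  apply Rmult_le_compat_r; auto. apply pow_incr. lra.
Qed.

Arguments cdot (z w)%_C_scope.

Definition ccont (f : C -> C) (z : C) : Prop :=
  forall eps, 0 < eps -> exists del, 0 < del /\
    forall w, Cmod (w - z) < del -> Cmod (f w - f z) < eps.

(** A first-order expansion free of quotients, so that [u = 0] is no exception; [cderiv_C_derive]
    links it to the derivative in the statement. *)
Definition cderiv (f : C -> C) (z d : C) : Prop :=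
  forall eps, 0 < eps -> exists del, 0 < del /\
    forall u, Cmod u < del -> Cmod (f (z + u) - f z - d * u)%C <= eps * Cmod u.

Local Open Scope C_scope.

(** * Complex differentiation *)

Lemma ccont_const c z : ccont (fun _ => c) z.
Proof.
  intros e He. exists 1%R. split; [lra|]. intros. replace (c - c) with (RtoC 0) by ring.
  rewrite Cmod_0. auto.
Qed.

Lemma ccont_id z : ccont (fun w => w) z.
Proof. intros e He. exists e. auto. Qed.

Lemma ccont_plus f g z : ccont f z -> ccont g z -> ccont (fun w => f w + g w) z.
Proof.
  intros Hf Hg e He. destruct (Hf (e / 2)%R) as (d1 & ? & H1); [lra|].
  destruct (Hg (e / 2)%R) as (d2 & ? & H2); [lra|].
  exists (Rmin d1 d2). split; [apply Rmin_glb_lt; auto|]. intros w Hw.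
  replace (f w + g w - (f z + g z)) with ((f w - f z) + (g w - g z)) by ring.
  eapply Rle_lt_trans; [apply Cmod_triangle|].
  specialize (H1 w (Rlt_le_trans _ _ _ Hw (Rmin_l _ _))).
  specialize (H2 w (Rlt_le_trans _ _ _ Hw (Rmin_r _ _))). lra.
Qed.

Lemma ccont_mult f g z : ccont f z -> ccont g z -> ccont (fun w => f w * g w) z.
Proof.
  intros Hf Hg e He. set (M := (Cmod (f z) + Cmod (g z) + 1)%R).
  assert (HM : (0 < M)%R) by (unfold M; pose proof (Cmod_ge_0 (f z)); pose proof (Cmod_ge_0 (g z)); lra).
  set (e' := Rmin 1 (e / (2 * M))).
  assert (He' : (0 < e')%R).
  { apply Rmin_glb_lt; [lra|]. apply Rdiv_lt_0_compat; lra. }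
  destruct (Hf e' He') as (d1 & ? & H1). destruct (Hg e' He') as (d2 & ? & H2).
  exists (Rmin d1 d2). split; [apply Rmin_glb_lt; auto|]. intros w Hw.
  specialize (H1 w (Rlt_le_trans _ _ _ Hw (Rmin_l _ _))).
  specialize (H2 w (Rlt_le_trans _ _ _ Hw (Rmin_r _ _))).
  replace (f w * g w - f z * g z)
    with ((f w - f z) * (g w - g z) + f z * (g w - g z) + (f w - f z) * g z) by ring.
  eapply Rle_lt_trans; [apply Cmod_triangle|].
  eapply Rle_lt_trans; [apply Rplus_le_compat_r, Cmod_triangle|]. rewrite !Cmod_mult.
  assert (e' <= 1)%R by apply Rmin_l.
  assert (e' * (2 * M) <= e)%R.
  { apply Rle_trans with (e / (2 * M) * (2 * M))%R; [apply Rmult_le_compat_r; [lra|apply Rmin_r]|].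
    right. field. lra. }
  pose proof (Cmod_ge_0 (f z)); pose proof (Cmod_ge_0 (g z)).
  pose proof (Cmod_ge_0 (f w - f z)); pose proof (Cmod_ge_0 (g w - g z)).
  assert (Cmod (f w - f z) * Cmod (g w - g z) <= e' * 1)%R by nra.
  assert (Cmod (f z) * Cmod (g w - g z) <= Cmod (f z) * e')%R by nra.
  assert (Cmod (f w - f z) * Cmod (g z) <= e' * Cmod (g z))%R by nra.
  unfold M in *. nra.
Qed.

Lemma ccont_opp f z : ccont f z -> ccont (fun w => - f w) z.
Proof.
  intros Hf e He. destruct (Hf e He) as (d & ? & H). exists d. split; auto. intros w Hw.
  replace (- f w - - f z) with (- (f w - f z)) by ring. rewrite Cmod_opp. auto.
Qed.

Lemma ccont_minus f g z : ccont f z -> ccont g z -> ccont (fun w => f w - g w) z.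
Proof. intros. apply (ccont_plus f (fun w => - g w)); auto. apply ccont_opp; auto. Qed.

Lemma ccont_comp f g z : ccont g z -> ccont f (g z) -> ccont (fun w => f (g w)) z.
Proof.
  intros Hg Hf e He. destruct (Hf e He) as (d & Hd & H). destruct (Hg d Hd) as (d' & ? & H').
  exists d'. split; auto.
Qed.

Lemma ccont_pow f z n : ccont f z -> ccont (fun w => f w ^ n) z.
Proof.
  intros H. induction n; simpl; [apply ccont_const|].
  apply (ccont_mult f (fun w => f w ^ n)); auto.
Qed.

Lemma ccont_nonzero f z : ccont f z -> f z <> 0 ->
  exists d, (0 < d)%R /\ forall w, (Cmod (w - z) < d)%R -> (Cmod (f z) / 2 <= Cmod (f w))%R.
Proof.
  intros Hf Hz. assert (0 < Cmod (f z))%R by (apply Cmod_gt_0; auto).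
  destruct (Hf (Cmod (f z) / 2)%R) as (d & ? & Hd); [lra|]. exists d. split; auto.
  intros w Hw. specialize (Hd w Hw). rewrite Cmod_minus_sym in Hd.
  pose proof (Cmod_triangle_sub (f z) (f w)). lra.
Qed.

Lemma ccont_inv f z : ccont f z -> f z <> 0 -> ccont (fun w => / f w) z.
Proof.
  intros Hf Hz e He. assert (0 < Cmod (f z))%R by (apply Cmod_gt_0; auto).
  set (m := Cmod (f z)) in *. destruct (ccont_nonzero f z Hf Hz) as (d1 & ? & H1). fold m in H1.
  destruct (Hf (e * (m * m / 2))%R) as (d2 & ? & H2).
  { apply Rmult_lt_0_compat; auto. apply Rdiv_lt_0_compat; nra. }
  exists (Rmin d1 d2). split; [apply Rmin_glb_lt; auto|]. intros w Hw.
  specialize (H1 w (Rlt_le_trans _ _ _ Hw (Rmin_l _ _))).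
  specialize (H2 w (Rlt_le_trans _ _ _ Hw (Rmin_r _ _))).
  assert (Hw0 : f w <> 0) by (intros E; rewrite E, Cmod_0 in H1; lra).
  replace (/ f w - / f z) with ((f z - f w) / (f z * f w)) by (field; auto).
  rewrite Cmod_div by (apply Cmult_neq_0; auto). rewrite Cmod_mult, Cmod_minus_sym. fold m.
  apply Rmult_lt_reg_r with (m * Cmod (f w))%R; [nra|].
  unfold Rdiv. rewrite Rmult_assoc, Rinv_l by nra. rewrite Rmult_1_r.
  eapply Rlt_le_trans; [apply H2|]. apply Rmult_le_compat_l; nra.
Qed.

Lemma ccont_ext_loc f g z r : (0 < r)%R ->
  (forall w, (Cmod (w - z) < r)%R -> f w = g w) -> ccont f z -> ccont g z.
Proof.
  intros Hr E Hf e He. destruct (Hf e He) as (d & ? & Hd). exists (Rmin d r).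
  split; [apply Rmin_glb_lt; auto|]. intros w Hw. rewrite <- !E.
  - apply Hd. eapply Rlt_le_trans; [apply Hw|apply Rmin_l].
  - replace (z - z) with (RtoC 0) by ring. rewrite Cmod_0. auto.
  - eapply Rlt_le_trans; [apply Hw|apply Rmin_r].
Qed.

(* Carathéodory's form of the derivative reduces the differentiation rules to those for continuity. *)
Lemma cderiv_slope f z d : cderiv f z d <->
  exists phi r, (0 < r)%R /\ phi (RtoC 0) = d /\ ccont phi 0 /\
    forall u, (Cmod u < r)%R -> f (z + u) = f z + phi u * u.
Proof.
  split.
  - intros H. exists (fun u => if Ceq_dec u 0 then d else (f (z + u) - f z) / u), 1%R.
    repeat split; [lra| | |].
    + destruct (Ceq_dec 0 0); congruence.
    + intros e He. destruct (H (e / 2)%R) as (del & Hdel & H'); [lra|]. exists del. split; auto.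
      intros u Hu. replace (u - 0) with u in Hu by ring.
      destruct (Ceq_dec 0 0) as [_|]; [|congruence].
      destruct (Ceq_dec u 0) as [->|Hu0].
      { replace (d - d) with (RtoC 0) by ring. rewrite Cmod_0; auto. }
      assert (0 < Cmod u)%R by (apply Cmod_gt_0; auto).
      replace ((f (z + u) - f z) / u - d) with ((f (z + u) - f z - d * u) / u) by (field; auto).
      rewrite Cmod_div by auto. specialize (H' u Hu).
      apply Rmult_lt_reg_r with (Cmod u); auto. unfold Rdiv at 1.
      rewrite Rmult_assoc, Rinv_l by lra. nra.
    + intros u _. destruct (Ceq_dec u 0) as [->|Hu0].
      * replace (z + 0) with z by ring. ring.
      * field. auto.
  - intros (phi & r & Hr & H0 & Hc & H) e He. destruct (Hc e He) as (del & Hdel & H').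
    exists (Rmin del r). split; [apply Rmin_glb_lt; auto|]. intros u Hu.
    rewrite H by (eapply Rlt_le_trans; [apply Hu|apply Rmin_r]).
    replace (f z + phi u * u - f z - d * u) with ((phi u - d) * u) by ring.
    rewrite Cmod_mult. apply Rmult_le_compat_r; [apply Cmod_ge_0|].
    rewrite <- H0. left. apply H'. replace (u - 0) with u by ring.
    eapply Rlt_le_trans; [apply Hu|apply Rmin_l].
Qed.

Lemma cderiv_ext_loc f g z d r : (0 < r)%R ->
  (forall w, (Cmod (w - z) < r)%R -> f w = g w) -> cderiv f z d -> cderiv g z d.
Proof.
  intros Hr E Hf e He. destruct (Hf e He) as (del & ? & Hd). exists (Rmin del r).
  split; [apply Rmin_glb_lt; auto|]. intros u Hu. rewrite <- !E.
  - apply Hd. eapply Rlt_le_trans; [apply Hu|apply Rmin_l].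
  - replace (z - z) with (RtoC 0) by ring. rewrite Cmod_0. auto.
  - replace (z + u - z) with u by ring. eapply Rlt_le_trans; [apply Hu|apply Rmin_r].
Qed.

Lemma cderiv_ccont f z d : cderiv f z d -> ccont f z.
Proof.
  intros H. apply cderiv_slope in H. destruct H as (phi & r & Hr & H0 & Hc & H).
  assert (Hs : ccont (fun w => w - z) z) by (apply ccont_minus; [apply ccont_id|apply ccont_const]).
  apply ccont_ext_loc with (f := fun w => f z + phi (w - z) * (w - z)) (r := r); auto.
  { intros w Hw. rewrite <- H by auto. f_equal. ring. }
  apply ccont_plus; [apply ccont_const|]. apply (ccont_mult (fun w => phi (w - z))); auto.
  apply ccont_comp; auto. replace (z - z) with (RtoC 0) by ring. auto.
Qed.

Lemma cderiv_eq f z a b : cderiv f z a -> a = b -> cderiv f z b.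
Proof. intros H <-. exact H. Qed.

Lemma cderiv_const c z : cderiv (fun _ => c) z 0.
Proof.
  intros e He. exists 1%R. split; [lra|]. intros. replace (c - c - 0 * u) with (RtoC 0) by ring.
  rewrite Cmod_0. pose proof (Cmod_ge_0 u). nra.
Qed.

Lemma cderiv_id z : cderiv (fun w => w) z 1.
Proof.
  intros e He. exists 1%R. split; [lra|]. intros. replace (z + u - z - 1 * u) with (RtoC 0) by ring.
  rewrite Cmod_0. pose proof (Cmod_ge_0 u). nra.
Qed.

Lemma shift_cont f z : ccont f z -> ccont (fun u => f (z + u)) 0.
Proof.
  intros H. apply ccont_comp; [apply ccont_plus; [apply ccont_const|apply ccont_id]|].
  replace (z + 0) with z by ring. auto.
Qed.

Lemma cderiv_plus f g z a b : cderiv f z a -> cderiv g z b -> cderiv (fun w => f w + g w) z (a + b).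
Proof.
  intros Hf Hg. apply cderiv_slope in Hf. apply cderiv_slope in Hg. apply cderiv_slope.
  destruct Hf as (p & r & Hr & P0 & Pc & P), Hg as (q & s & Hs & Q0 & Qc & Q).
  exists (fun u => p u + q u), (Rmin r s). repeat split.
  - apply Rmin_glb_lt; auto.
  - congruence.
  - apply ccont_plus; auto.
  - intros u Hu. rewrite P, Q; [ring| |]; eapply Rlt_le_trans; eauto; [apply Rmin_r|apply Rmin_l].
Qed.

Lemma cderiv_mult f g z a b :
  cderiv f z a -> cderiv g z b -> cderiv (fun w => f w * g w) z (a * g z + f z * b).
Proof.
  intros Hf Hg. pose proof (cderiv_ccont _ _ _ Hg) as Cg.
  apply cderiv_slope in Hf. apply cderiv_slope in Hg. apply cderiv_slope.
  destruct Hf as (p & r & Hr & P0 & Pc & P), Hg as (q & s & Hs & Q0 & Qc & Q).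
  exists (fun u => p u * g (z + u) + f z * q u), (Rmin r s). repeat split.
  - apply Rmin_glb_lt; auto.
  - rewrite P0, Q0. replace (z + 0) with z by ring. reflexivity.
  - apply ccont_plus; apply ccont_mult; auto; [apply shift_cont; auto|apply ccont_const].
  - intros u Hu. rewrite P, Q; [ring| |]; eapply Rlt_le_trans; eauto; [apply Rmin_r|apply Rmin_l].
Qed.

Lemma cderiv_scal c f z a : cderiv f z a -> cderiv (fun w => c * f w) z (c * a).
Proof.
  intros Hf. replace (c * a) with (0 * f z + c * a) by ring.
  apply (cderiv_mult (fun _ => c)); auto. apply cderiv_const.
Qed.

Lemma cderiv_opp f z a : cderiv f z a -> cderiv (fun w => - f w) z (- a).
Proof.
  intros H. replace (- a) with (- (1) * a) by ring.
  apply cderiv_ext_loc with (f := fun w => - (1) * f w) (r := 1%R); [lra| |apply cderiv_scal; auto].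
  intros; ring.
Qed.

Lemma cderiv_minus f g z a b : cderiv f z a -> cderiv g z b -> cderiv (fun w => f w - g w) z (a - b).
Proof. intros. apply (cderiv_plus f (fun w => - g w)); auto. apply cderiv_opp; auto. Qed.

Lemma cderiv_comp f g z a b :
  cderiv g z b -> cderiv f (g z) a -> cderiv (fun w => f (g w)) z (a * b).
Proof.
  intros Hg Hf. apply cderiv_slope in Hf. apply cderiv_slope in Hg. apply cderiv_slope.
  destruct Hf as (p & r & Hr & P0 & Pc & P), Hg as (q & s & Hs & Q0 & Qc & Q).
  assert (Hqu : ccont (fun u => q u * u) 0) by (apply ccont_mult; [auto|apply ccont_id]).
  destruct (Hqu r Hr) as (t & Ht & H).
  exists (fun u => p (q u * u) * q u), (Rmin s t). repeat split.
  - apply Rmin_glb_lt; auto.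
  - replace (q 0 * 0) with (RtoC 0) by ring. congruence.
  - apply ccont_mult; auto. apply (ccont_comp p (fun u => q u * u)); auto.
    replace (q 0 * 0) with (RtoC 0) by ring. auto.
  - intros u Hu. rewrite Q by (eapply Rlt_le_trans; [apply Hu|apply Rmin_l]).
    rewrite P; [ring|]. specialize (H u).
    replace (q u * u - q 0 * 0) with (q u * u) in H by ring. apply H.
    replace (u - 0) with u by ring. eapply Rlt_le_trans; [apply Hu|apply Rmin_r].
Qed.

Lemma cderiv_Cinv (z : C) : z <> 0 -> cderiv (fun w => / w) z (- / (z * z)).
Proof.
  intros Hz. apply cderiv_slope.
  exists (fun u => - / (z * (z + u))), (Cmod z). repeat split.
  - apply Cmod_gt_0; auto.
  - replace (z + 0) with z by ring. reflexivity.
  - apply ccont_opp. apply (ccont_inv (fun u => z * (z + u))).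
    + apply ccont_mult; [apply ccont_const|apply ccont_plus; [apply ccont_const|apply ccont_id]].
    + replace (z + 0) with z by ring. apply Cmult_neq_0; auto.
  - intros u Hu. assert (z + u <> 0).
    { intros E. replace u with (- z) in Hu by (replace u with (z + u - z) by ring; rewrite E; ring).
      rewrite Cmod_opp in Hu. lra. }
    field. auto.
Qed.

Lemma cderiv_inv f z a : cderiv f z a -> f z <> 0 -> cderiv (fun w => / f w) z (- a / (f z * f z)).
Proof.
  intros Hf Hz. replace (- a / (f z * f z)) with (- / (f z * f z) * a) by (field; auto).
  apply (cderiv_comp (fun w => / w) f); auto. apply cderiv_Cinv; auto.
Qed.

Lemma cderiv_pow (z : C) n : cderiv (fun w => w ^ n) z (RtoC (INR n) * z ^ (n - 1)).
Proof.
  induction n.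
  - simpl. replace (0 * 1) with (RtoC 0) by ring. apply cderiv_const.
  - replace (RtoC (INR (S n)) * z ^ (S n - 1)) with (1 * z ^ n + z * (RtoC (INR n) * z ^ (n - 1))).
    + apply (cderiv_mult (fun w => w) (fun w => w ^ n)); auto. apply cderiv_id.
    + replace (S n - 1)%nat with n by lia. rewrite S_INR, RtoC_plus.
      destruct n; [simpl; ring|]. replace (S n - 1)%nat with n by lia. simpl. ring.
Qed.

Lemma cderiv_unique f z a b : cderiv f z a -> cderiv f z b -> a = b.
Proof.
  intros Ha Hb. apply NNPP. intros Hne.
  assert (He : (0 < Cmod (a - b))%R) by (apply Cmod_gt_0; intros E; apply Hne, Ceq_minus; auto).
  set (e := (Cmod (a - b) / 4)%R). assert (0 < e)%R by (unfold e; lra).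
  destruct (Ha e) as (d1 & ? & H1); auto. destruct (Hb e) as (d2 & ? & H2); auto.
  set (t := (Rmin d1 d2 / 2)%R). assert (0 < Rmin d1 d2)%R by (apply Rmin_glb_lt; auto).
  assert (Ht : (0 < t)%R) by (unfold t; lra).
  assert (Hu : Cmod (RtoC t) = t) by (apply Cmod_RtoC; lra).
  assert (Hm : (t < d1 /\ t < d2)%R).
  { unfold t. pose proof (Rmin_l d1 d2); pose proof (Rmin_r d1 d2); lra. }
  specialize (H1 (RtoC t)). specialize (H2 (RtoC t)). rewrite Hu in *.
  specialize (H1 (proj1 Hm)). specialize (H2 (proj2 Hm)).
  pose proof (Cmod_triangle (f (z + RtoC t) - f z - b * RtoC t) (- (f (z + RtoC t) - f z - a * RtoC t))) as HT.
  rewrite Cmod_opp in HT.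
  replace (f (z + RtoC t) - f z - b * RtoC t + - (f (z + RtoC t) - f z - a * RtoC t))
    with ((a - b) * RtoC t) in HT by ring.
  rewrite Cmod_mult, Hu in HT. unfold e in *. nra.
Qed.

Lemma cderiv_is_derive (f : C -> C) (z d : C) : cderiv f z d -> @is_derive C_AbsRing C_NormedModule f z d.
Proof.
  intros H. split.
  - apply is_linear_scal_l.
  - intros x Hx. apply (is_filter_lim_locally_unique (V := AbsRing_NormedModule C_AbsRing)) in Hx.
    intros eps. destruct (H eps (cond_pos eps)) as (del & Hdel & H').
    exists (mkposreal del Hdel). intros y Hy. subst x. change C in y. change C in z.
    specialize (H' (y - z)). replace (z + (y - z)) with y in H' by ring.
    assert (Hy' : (Cmod (y - z) < del)%R) by apply Hy. specialize (H' Hy').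
    replace (f y - f z - d * (y - z)) with (f y - f z - (y - z) * d) in H' by ring. exact H'.
Qed.

Lemma cderiv_C_derive f z d : cderiv f z d -> C_derive f z = d.
Proof. intros H. apply is_C_derive_unique, cderiv_is_derive, H. Qed.

(** Continuity of the derivative is included: it permits differentiation under the integral sign,
    and Cauchy's formula then follows without Goursat's lemma. *)
Definition holo (r : R) (f f' : C -> C) : Prop :=
  forall z, (Cmod z < r)%R -> cderiv f z (f' z) /\ ccont f' z.

(** * Cluster points and compactness in the plane *)

Lemma real_cluster (u : nat -> R) (M : R) : (forall n, (Rabs (u n) <= M)%R) ->
  exists l, forall eps N, (0 < eps)%R -> exists n, (N <= n)%nat /\ (Rabs (u n - l) < eps)%R.
Proof.
  intros H. destruct (Bolzano_Weierstrass u (fun x => (- M <= x <= M)%R)) as [l Hl].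
  - apply compact_P3.
  - intros n. specialize (H n). apply Rabs_le_between in H. auto.
  - exists l. intros e N He. destruct (Hl (fun x => (Rabs (x - l) < e)%R) N) as (p & Hp & Hv).
    + exists (mkposreal e He). intros x Hx. exact Hx.
    + exists p. auto.
Qed.

(** The imaginary parts are clustered along a subsequence [p] on which the real parts already
    converge. *)
Lemma complex_cluster (u : nat -> C) (M : R) : (forall n, (Cmod (u n) <= M)%R) ->
  exists l, forall eps N, (0 < eps)%R -> exists n, (N <= n)%nat /\ (Cmod (u n - l) < eps)%R.
Proof.
  intros H. destruct (real_cluster (fun n => fst (u n)) M) as [a Ha].
  { intros n. eapply Rle_trans; [apply fst_le_Cmod|apply H]. }
  assert (Hp : forall n : nat, {p : nat | (n <= p)%nat /\ (Rabs (fst (u p) - a) < / (INR n + 1))%R}).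
  { intros n. apply constructive_indefinite_description. apply (Ha (/ (INR n + 1))%R n).
    apply Rinv_0_lt_compat. pose proof (pos_INR n). lra. }
  set (p := fun n => proj1_sig (Hp n)).
  destruct (real_cluster (fun n => snd (u (p n))) M) as [b Hb].
  { intros n. eapply Rle_trans; [apply snd_le_Cmod|apply H]. }
  exists (a, b). intros e N He.
  destruct (archimed_cor1 (e / 2)) as (K & HK & HK0); [lra|].
  destruct (Hb (e / 2)%R (Nat.max N K)) as (n & Hn & Hbn); [lra|].
  exists (p n). pose proof (proj2_sig (Hp n)) as [Hpn Han]. fold (p n) in Hpn, Han.
  split; [lia|]. eapply Rle_lt_trans; [apply Cmod_le_abs|]. simpl.
  assert (/ (INR n + 1) < e / 2)%R.
  { eapply Rlt_trans; [|apply HK]. apply Rinv_lt_contravar.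
    - apply Rmult_lt_0_compat; [apply lt_0_INR; auto|pose proof (pos_INR n); lra].
    - assert (INR K <= INR n)%R by (apply le_INR; lia). lra. }
  unfold Rminus in *. lra.
Qed.

Definition cclosed (K : C -> Prop) : Prop :=
  forall x, (forall eps, (0 < eps)%R -> exists y, K y /\ (Cmod (y - x) < eps)%R) -> K x.

Lemma cclosed_ball (c : C) r : cclosed (fun x => (Cmod (x - c) <= r)%R).
Proof.
  intros x Hx. apply le_epsilon. intros e He. destruct (Hx e He) as (y & Hy & Hd).
  replace (x - c) with ((y - c) - (y - x)) by ring. unfold Cminus at 1.
  eapply Rle_trans; [apply Cmod_triangle|]. rewrite Cmod_opp. lra.
Qed.

Lemma cclosed_circle r : cclosed (fun x => Cmod x = r).
Proof.
  intros x Hx. apply cond_eq. intros e He. destruct (Hx e He) as (y & Hy & Hd). rewrite <- Hy.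
  pose proof (Cmod_triangle_sub x y). pose proof (Cmod_triangle_sub y x).
  rewrite (Cmod_minus_sym x y) in H. apply Rabs_lt_between. lra.
Qed.

(** Otherwise points of [K] with [|F| > n] cluster at a point of [K], and near it continuity bounds
    [F]. *)
Lemma compact_bounded (K : C -> Prop) (F : C -> C) (M0 : R) : (forall x, K x -> (Cmod x <= M0)%R) ->
  cclosed K -> (forall x, K x -> ccont F x) -> exists M, (0 <= M)%R /\ forall x, K x -> (Cmod (F x) <= M)%R.
Proof.
  intros HB HC HF. apply NNPP. intros Hn.
  assert (Hu : forall n : nat, {x | K x /\ (INR n < Cmod (F x))%R}).
  { intros n. apply constructive_indefinite_description. apply NNPP. intros Hne. apply Hn.
    exists (INR n). split; [apply pos_INR|]. intros x Kx. apply Rnot_lt_le. intros Hlt. apply Hne. eauto. }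
  set (u := fun n => proj1_sig (Hu n)).
  assert (Hu1 : forall n, K (u n)) by (intros n; apply (proj2_sig (Hu n))).
  assert (Hu2 : forall n, (INR n < Cmod (F (u n)))%R) by (intros n; apply (proj2_sig (Hu n))).
  destruct (complex_cluster u M0) as [l Hl]; [auto|].
  assert (Kl : K l).
  { apply HC. intros e He. destruct (Hl e O He) as (n & _ & Hd). eauto. }
  destruct (HF l Kl 1%R) as (d & Hd & Hc); [lra|].
  destruct (nfloor_ex (Cmod (F l) + 2)) as (N & HN); [pose proof (Cmod_ge_0 (F l)); lra|].
  destruct (Hl d (S N) Hd) as (n & Hn1 & Hd1). specialize (Hc _ Hd1). specialize (Hu2 n).
  pose proof (Cmod_triangle_sub (F (u n)) (F l)). assert (INR (S N) <= INR n)%R by (apply le_INR; auto).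
  rewrite S_INR in H0. lra.
Qed.

(** * Series and power series *)

Definition cser (f : nat -> C) (l : C) : Prop :=
  forall eps, (0 < eps)%R -> exists N, forall n, (N <= n)%nat -> (Cmod (csum f n - l) < eps)%R.

Definition csums (a : nat -> C) (z l : C) : Prop := cser (fun k => a k * z ^ k) l.

Lemma cser_ext f g l : (forall k, f k = g k) -> cser f l -> cser g l.
Proof.
  intros E H e He. destruct (H e He) as [N HN]. exists N. intros n Hn.
  rewrite (csum_ext g f) by auto. auto.
Qed.

Lemma cser_plus f g l m : cser f l -> cser g m -> cser (fun k => f k + g k) (l + m).
Proof.
  intros Hf Hg e He. destruct (Hf (e / 2)%R) as [N1 H1]; [lra|].
  destruct (Hg (e / 2)%R) as [N2 H2]; [lra|]. exists (Nat.max N1 N2). intros n Hn.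
  rewrite csum_plus. replace (csum f n + csum g n - (l + m)) with (csum f n - l + (csum g n - m)) by ring.
  eapply Rle_lt_trans; [apply Cmod_triangle|].
  specialize (H1 n ltac:(lia)). specialize (H2 n ltac:(lia)). lra.
Qed.

Lemma cser_scal c f l : cser f l -> cser (fun k => c * f k) (c * l).
Proof.
  intros Hf e He. pose proof (Cmod_ge_0 c).
  destruct (Hf (e / (Cmod c + 1))%R) as [N HN]; [apply Rdiv_lt_0_compat; lra|].
  exists N. intros n Hn. rewrite csum_scal.
  replace (c * csum f n - c * l) with (c * (csum f n - l)) by ring. rewrite Cmod_mult.
  specialize (HN n Hn). apply Rle_lt_trans with (Cmod c * (e / (Cmod c + 1)))%R.
  - apply Rmult_le_compat_l; lra.
  - apply Rlt_le_trans with ((Cmod c + 1) * (e / (Cmod c + 1)))%R; [|right; field; lra].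
    apply Rmult_lt_compat_r; [apply Rdiv_lt_0_compat; lra|lra].
Qed.

Lemma cser_minus f g l m : cser f l -> cser g m -> cser (fun k => f k - g k) (l - m).
Proof.
  intros Hf Hg. replace (l - m) with (l + - (1) * m) by ring.
  apply cser_ext with (fun k => f k + - (1) * g k); [intros; ring|].
  apply cser_plus; auto. apply cser_scal; auto.
Qed.

Lemma cser_le f l K n0 : (forall n, (n0 <= n)%nat -> (Cmod (csum f n) <= K)%R) ->
  cser f l -> (Cmod l <= K)%R.
Proof.
  intros Hb H. apply le_epsilon. intros e He. destruct (H e He) as [N HN].
  specialize (HN (Nat.max N n0) ltac:(lia)). specialize (Hb (Nat.max N n0) ltac:(lia)).
  rewrite Cmod_minus_sym in HN. pose proof (Cmod_triangle_sub l (csum f (Nat.max N n0))). lra.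
Qed.

Lemma cser_unique f l m : cser f l -> cser f m -> l = m.
Proof.
  intros Hl Hm. apply Ceq_minus, Cmod_eq_0. apply Rle_antisym; [|apply Cmod_ge_0].
  apply cser_le with (f := fun k => f k - f k) (n0 := O); [|apply cser_minus; auto].
  intros n _. rewrite csum_0; [rewrite Cmod_0; lra|]. intros; ring.
Qed.

Lemma cser_shift f l n : cser f l <-> cser (fun k => f (n + k)%nat) (l - csum f n).
Proof.
  split; intros H e He; destruct (H e He) as [N HN].
  - exists N. intros m Hm. specialize (HN (n + m)%nat ltac:(lia)). rewrite csum_add in HN.
    replace (csum (fun k => f (n + k)%nat) m - (l - csum f n))
      with (csum f n + csum (fun k => f (n + k)%nat) m - l) by ring. auto.
  - exists (n + N)%nat. intros m Hm. specialize (HN (m - n)%nat ltac:(lia)).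
    replace m with (n + (m - n))%nat by lia. rewrite csum_add.
    replace (csum f n + csum (fun k => f (n + k)%nat) (m - n) - l)
      with (csum (fun k => f (n + k)%nat) (m - n) - (l - csum f n)) by ring. auto.
Qed.

Lemma cser_finite (f : nat -> C) n : (forall k, (n <= k)%nat -> f k = 0) -> cser f (csum f n).
Proof.
  intros H e He. exists n. intros m Hm. replace m with (n + (m - n))%nat by lia.
  rewrite csum_add, (csum_0 (fun k => f (n + k)%nat)) by (intros; apply H; lia).
  replace (csum f n + 0 - csum f n) with (RtoC 0) by ring. rewrite Cmod_0. auto.
Qed.

Lemma csums_at_0 a : csums a 0 (a O).
Proof.
  replace (a O) with (csum (fun k => a k * 0 ^ k) 1) by (simpl; ring).
  apply cser_finite. intros [|k] Hk; [lia|]. simpl. ring.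
Qed.

Lemma cser_bounded f l : cser f l -> exists M, forall k, (Cmod (f k) <= M)%R.
Proof.
  intros H. destruct (H 1%R) as [N HN]; [lra|].
  exists (2 + rsum (fun k => Cmod (f k)) N)%R. intros k.
  assert (0 <= rsum (fun k => Cmod (f k)) N)%R by (apply rsum_nonneg; intros; apply Cmod_ge_0).
  destruct (Nat.lt_ge_cases k N).
  - pose proof (rsum_term (fun k => Cmod (f k)) N k ltac:(lia) (fun k => Cmod_ge_0 (f k))). simpl in *. lra.
  - pose proof (HN k ltac:(lia)). pose proof (HN (S k) ltac:(lia)). simpl in H3.
    replace (f k) with ((csum f k + f k - l) + - (csum f k - l)) by ring.
    eapply Rle_trans; [apply Cmod_triangle|]. rewrite Cmod_opp. lra.
Qed.

Lemma rsum_sum_n f n : rsum f (S n) = sum_n f n.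
Proof.
  induction n.
  - simpl. rewrite sum_O. ring.
  - rewrite sum_Sn, <- IHn. reflexivity.
Qed.

Lemma ex_series_geom (f : nat -> R) K y : (0 <= y < 1)%R -> (forall k, Rabs (f k) <= K * y ^ k)%R -> ex_series f.
Proof.
  intros Hy H. apply (ex_series_le f (fun k => K * y ^ k)%R); [exact H|].
  apply (ex_series_scal K (fun k => y ^ k)%R). exists (/ (1 - y))%R. apply is_series_geom.
  rewrite Rabs_right; lra.
Qed.

Lemma is_series_rsum (f : nat -> R) l : is_series f l ->
  forall e, (0 < e)%R -> exists N, forall n, (N <= n)%nat -> (Rabs (rsum f n - l) < e)%R.
Proof.
  intros H e He. apply (is_lim_seq_spec (sum_n f) l) in H. destruct (H (mkposreal e He)) as [N HN].
  exists (S N). intros [|n] Hn; [lia|]. rewrite rsum_sum_n. apply HN. lia.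
Qed.

Lemma rsum_is_series (f : nat -> R) l :
  (forall e, (0 < e)%R -> exists N, forall n, (N <= n)%nat -> (Rabs (rsum f n - l) < e)%R) -> is_series f l.
Proof.
  intros H. apply (is_lim_seq_spec (sum_n f) l). intros e. destruct (H e (cond_pos e)) as [N HN].
  exists N. intros n Hn. rewrite <- rsum_sum_n. apply HN. lia.
Qed.

Lemma cser_components (f : nat -> C) (l : C) : is_series (fun k => fst (f k)) (fst l) ->
  is_series (fun k => snd (f k)) (snd l) -> cser f l.
Proof.
  intros H1 H2 e He.
  destruct (is_series_rsum _ _ H1 (e / 2)%R) as [N1 HN1]; [lra|].
  destruct (is_series_rsum _ _ H2 (e / 2)%R) as [N2 HN2]; [lra|].
  exists (Nat.max N1 N2). intros n Hn. eapply Rle_lt_trans; [apply Cmod_le_abs|].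
  specialize (HN1 n ltac:(lia)). specialize (HN2 n ltac:(lia)). simpl.
  rewrite fst_csum, snd_csum. unfold Rminus in *. lra.
Qed.

Lemma cser_fst (f : nat -> C) (l : C) : cser f l -> is_series (fun k => fst (f k)) (fst l).
Proof.
  intros H. apply rsum_is_series. intros e He. destruct (H e He) as [N HN]. exists N.
  intros n Hn. specialize (HN n Hn). rewrite <- fst_csum.
  eapply Rle_lt_trans; [|apply HN]. eapply Rle_trans; [|apply fst_le_Cmod]. simpl. right. f_equal.
Qed.

Lemma cser_snd (f : nat -> C) (l : C) : cser f l -> is_series (fun k => snd (f k)) (snd l).
Proof.
  intros H. apply rsum_is_series. intros e He. destruct (H e He) as [N HN]. exists N.
  intros n Hn. specialize (HN n Hn). rewrite <- snd_csum.
  eapply Rle_lt_trans; [|apply HN]. eapply Rle_trans; [|apply snd_le_Cmod]. simpl. right. f_equal.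
Qed.

(** A candidate for the sum that is defined for every [f]; it is the sum once [cser_geom] supplies
    convergence. *)
Definition ctotal (f : nat -> C) : C := (Series (fun k => fst (f k)), Series (fun k => snd (f k))).

Lemma cser_geom f K y : (0 <= y < 1)%R -> (forall k, Cmod (f k) <= K * y ^ k)%R -> cser f (ctotal f).
Proof.
  intros Hy H. apply cser_components; simpl; apply Series_correct, (ex_series_geom _ K y); auto; intros k;
    eapply Rle_trans; [|apply H| |apply H]; [apply fst_le_Cmod|apply snd_le_Cmod].
Qed.

Lemma csum_geom_bound f K y n : (0 <= y < 1)%R -> (0 <= K)%R ->
  (forall k, Cmod (f k) <= K * y ^ k)%R -> (Cmod (csum f n) <= K / (1 - y))%R.
Proof.
  intros Hy HK H. eapply Rle_trans; [apply Cmod_csum|].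
  apply Rle_trans with (rsum (fun k => K * y ^ k)%R n); [apply rsum_le; auto|].
  rewrite rsum_scal. apply Rmult_le_compat_l; auto. apply geom_sum_le; auto.
Qed.

Lemma cser_tail f l K y n : (0 <= y < 1)%R -> (0 <= K)%R -> (forall k, Cmod (f k) <= K * y ^ k)%R ->
  cser f l -> (Cmod (l - csum f n) <= K * y ^ n / (1 - y))%R.
Proof.
  intros Hy HK H Hs. apply (cser_shift f l n) in Hs.
  apply cser_le with (n0 := O) (2 := Hs). intros m _.
  apply csum_geom_bound; auto.
  - apply Rmult_le_pos; auto. apply pow_le; lra.
  - intros k. rewrite Rmult_assoc, <- pow_add. auto.
Qed.

(** The working form of convergence in the disk of radius [q]: it dominates the series by a
    geometric one at every smaller radius ([pbound_term]). *)
Definition pbound (a : nat -> C) (q M : R) : Prop := forall k, (Cmod (a k) * q ^ k <= M)%R.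

Lemma pbound_nonneg a q M : (0 <= q)%R -> pbound a q M -> (0 <= M)%R.
Proof. intros Hq H. specialize (H O). simpl in H. pose proof (Cmod_ge_0 (a O)). lra. Qed.

Lemma pbound_term a q M z k : (0 < q)%R -> pbound a q M ->
  (Cmod (a k * z ^ k) <= M * (Cmod z / q) ^ k)%R.
Proof.
  intros Hq H. rewrite Cmod_mult, Cmod_pow. unfold Rdiv. rewrite Rpow_mult_distr, pow_inv.
  specialize (H k). assert (0 < q ^ k)%R by (apply pow_lt; auto).
  assert (0 <= Cmod z ^ k)%R by (apply pow_le, Cmod_ge_0).
  apply Rle_trans with (Cmod (a k) * q ^ k * (Cmod z ^ k * / q ^ k))%R.
  - right. field. lra.
  - apply Rmult_le_compat_r; auto. apply Rmult_le_pos; auto. left. apply Rinv_0_lt_compat; auto.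
Qed.

Lemma ratio_lt1 z q : (0 < q)%R -> (Cmod z < q)%R -> (0 <= Cmod z / q < 1)%R.
Proof.
  intros Hq H. pose proof (Cmod_ge_0 z). split.
  - apply Rdiv_le_0_compat; auto.
  - apply Rmult_lt_reg_r with q; auto. unfold Rdiv. rewrite Rmult_assoc, Rinv_l; lra.
Qed.

Lemma csums_pbound_0 a z l : csums a z l -> exists M, pbound a (Cmod z) M.
Proof.
  intros H. destruct (cser_bounded _ _ H) as [M HM]. exists M. intros k.
  rewrite <- Cmod_pow, <- Cmod_mult. apply HM.
Qed.

Lemma csums_pbound a q f : (0 <= q)%R ->
  (forall z, (Cmod z <= q)%R -> csums a z (f z)) -> exists M, pbound a q M.
Proof.
  intros Hq H. rewrite <- (Cmod_RtoC q Hq). eapply csums_pbound_0, H. rewrite Cmod_RtoC; lra.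
Qed.

Lemma csums_exists a q M z : (0 < q)%R -> pbound a q M -> (Cmod z < q)%R ->
  csums a z (ctotal (fun k => a k * z ^ k)).
Proof.
  intros Hq HM Hz. apply cser_geom with M (Cmod z / q)%R.
  - apply ratio_lt1; auto.
  - intros. apply pbound_term; auto.
Qed.

Definition cdcoef (a : nat -> C) (k : nat) : C := RtoC (INR (S k)) * a (S k).

(** The constant [L] depends on the two radii only and not on [a]: [grunsky_log] applies it to a
    whole family of series at once. *)
Lemma cdcoef_pbound q p : (0 < p < q)%R ->
  exists L, (0 <= L)%R /\ forall a M, pbound a q M -> pbound (cdcoef a) p (L * M).
Proof.
  intros Hp. destruct (INR_pow_bounded (p / q)) as (K & HK & B).
  { split; [apply Rdiv_le_0_compat; lra|]. apply Rmult_lt_reg_r with q; [lra|].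
    unfold Rdiv. rewrite Rmult_assoc, Rinv_l; lra. }
  exists (K / p)%R. split; [apply Rdiv_le_0_compat; lra|].
  intros a M H k. unfold cdcoef. rewrite Cmod_mult, Cmod_RtoC by apply pos_INR.
  replace (K / p * M)%R with (K * M / p)%R by (field; lra).
  specialize (B (S k)). specialize (H (S k)).
  assert (0 < q ^ S k)%R by (apply pow_lt; lra). pose proof (Cmod_ge_0 (a (S k))).
  replace (INR (S k) * Cmod (a (S k)) * p ^ k)%R
    with (INR (S k) * (p / q) ^ S k * (Cmod (a (S k)) * q ^ S k) / p)%R.
  - unfold Rdiv. apply Rmult_le_compat_r; [left; apply Rinv_0_lt_compat; lra|].
    apply Rmult_le_compat; auto.
    + apply Rmult_le_pos; [apply pos_INR|]. apply pow_le, Rdiv_le_0_compat; lra.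
    + apply Rmult_le_pos; lra.
  - unfold Rdiv. rewrite Rpow_mult_distr, pow_inv. replace (p ^ S k)%R with (p * p ^ k)%R by reflexivity.
    field. lra.
Qed.

(** The second-order Taylor remainder of a power, by induction on the exponent; the factor [m ^ 2]
    on the left avoids the exponent [k - 2]. *)
Lemma pow_second_order (u v : C) (m : R) k : (Cmod u <= m)%R -> (Cmod (u + v) <= m)%R ->
  (m ^ 2 * Cmod ((u + v) ^ k - u ^ k - RtoC (INR k) * u ^ (k - 1) * v) <= INR k ^ 2 * Cmod v ^ 2 * m ^ k)%R.
Proof.
  intros Hu Hv. assert (Hm : (0 <= m)%R) by (pose proof (Cmod_ge_0 u); lra).
  induction k.
  - replace ((u + v) ^ 0 - u ^ 0 - RtoC (INR 0) * u ^ (0 - 1) * v) with (RtoC 0) by (simpl; ring).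
    rewrite Cmod_0. simpl. lra.
  - set (E := (u + v) ^ k - u ^ k - RtoC (INR k) * u ^ (k - 1) * v) in *.
    assert (HE : (u + v) ^ S k - u ^ S k - RtoC (INR (S k)) * u ^ (S k - 1) * v
      = (u + v) * E + RtoC (INR k) * v ^ 2 * u ^ (k - 1)).
    { unfold E. replace (S k - 1)%nat with k by lia. rewrite S_INR, RtoC_plus.
      destruct k; [simpl; ring|]. replace (S k - 1)%nat with k by lia. simpl. ring. }
    rewrite HE.
    apply Rle_trans with (m ^ 2 * (m * Cmod E + INR k * Cmod v ^ 2 * Cmod (u ^ (k - 1))))%R.
    { apply Rmult_le_compat_l; [apply pow2_ge_0|].
      eapply Rle_trans; [apply Cmod_triangle|]. rewrite !Cmod_mult, Cmod_RtoC by apply pos_INR.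
      rewrite (Cmod_pow v). apply Rplus_le_compat_r. apply Rmult_le_compat_r; [apply Cmod_ge_0|auto]. }
    assert (INR k * (m ^ 2 * Cmod (u ^ (k - 1))) <= INR k * m ^ S k)%R.
    { destruct k; [simpl; lra|]. apply Rmult_le_compat_l; [apply pos_INR|].
      replace (S k - 1)%nat with k by lia. rewrite Cmod_pow.
      replace (m ^ S (S k))%R with (m ^ 2 * m ^ k)%R by (simpl; ring).
      apply Rmult_le_compat_l; [apply pow2_ge_0|]. apply pow_incr. split; [apply Cmod_ge_0|auto]. }
    rewrite S_INR. pose proof (pos_INR k). pose proof (pow2_ge_0 (Cmod v)).
    assert (0 <= m ^ S k)%R by (apply pow_le; auto).
    replace (m ^ 2 * (m * Cmod E + INR k * Cmod v ^ 2 * Cmod (u ^ (k - 1))))%R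
      with (m * (m ^ 2 * Cmod E) + Cmod v ^ 2 * (INR k * (m ^ 2 * Cmod (u ^ (k - 1)))))%R by ring.
    apply Rle_trans with (m * (INR k ^ 2 * Cmod v ^ 2 * m ^ k) + Cmod v ^ 2 * (INR k * m ^ S k))%R.
    { apply Rplus_le_compat; apply Rmult_le_compat_l; auto. }
    replace (m * (INR k ^ 2 * Cmod v ^ 2 * m ^ k) + Cmod v ^ 2 * (INR k * m ^ S k))%R
      with ((INR k ^ 2 + INR k) * (Cmod v ^ 2 * m ^ S k))%R by (simpl; ring).
    replace ((INR k + 1) ^ 2 * Cmod v ^ 2 * m ^ S k)%R
      with ((INR k + 1) ^ 2 * (Cmod v ^ 2 * m ^ S k))%R by ring.
    apply Rmult_le_compat_r; [apply Rmult_le_pos; auto|nra].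
Qed.

Lemma csums_deriv_shift a z l : csums (cdcoef a) z l ->
  cser (fun k => RtoC (INR k) * a k * z ^ (k - 1)) l.
Proof.
  intros H. apply (cser_shift _ l 1). simpl csum.
  replace (l - (0 + 0 * a O * 1)) with l by ring.
  apply cser_ext with (2 := H). intros k. unfold cdcoef.
  replace (1 + k)%nat with (S k) by lia. replace (S k - 1)%nat with k by lia. reflexivity.
Qed.

(** Summed against [|a_k| q^k <= M], the remainders of [pow_second_order] stay below a multiple [L]
    of [|u|^2]. *)
Lemma pser_cderiv a q M f z d : (0 < q)%R -> pbound a q M ->
  (forall w, (Cmod w < q)%R -> csums a w (f w)) -> (Cmod z < q)%R -> csums (cdcoef a) z d ->
  cderiv f z d.
Proof.
  intros Hq HM Hf Hz Hd. set (m := ((Cmod z + q) / 2)%R). pose proof (Cmod_ge_0 z).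
  assert (Hm : (Cmod z < m < q)%R) by (unfold m; lra).
  destruct (INR_sq_pow_bounded (m / q)) as (y & K & Hy & HK & B).
  { split; [apply Rdiv_le_0_compat; lra|]. apply Rmult_lt_reg_r with q; [lra|].
    unfold Rdiv. rewrite Rmult_assoc, Rinv_l; lra. }
  assert (HM0 : (0 <= M)%R) by (apply (pbound_nonneg a q M); [lra|auto]).
  set (L := (M * K / (1 - y) / m ^ 2)%R).
  assert (HL : (0 <= L)%R).
  { unfold L. apply Rdiv_le_0_compat; [apply Rdiv_le_0_compat; nra|apply pow_lt; lra]. }
  intros e He. exists (Rmin (m - Cmod z) (e / (L + 1))). split.
  { apply Rmin_glb_lt; [lra|apply Rdiv_lt_0_compat; lra]. }
  intros u Hu.
  assert (Hu1 : (Cmod u < m - Cmod z)%R) by (eapply Rlt_le_trans; [apply Hu|apply Rmin_l]).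
  assert (Hu2 : (Cmod u < e / (L + 1))%R) by (eapply Rlt_le_trans; [apply Hu|apply Rmin_r]).
  assert (Hzu : (Cmod (z + u) <= m)%R) by (pose proof (Cmod_triangle z u); lra).
  apply csums_deriv_shift in Hd.
  pose proof (Hf (z + u) ltac:(lra)) as H1. pose proof (Hf z ltac:(lra)) as H2.
  apply Rle_trans with (L * Cmod u ^ 2)%R.
  - assert (Hs : cser (fun k => a k * ((z + u) ^ k - z ^ k - RtoC (INR k) * z ^ (k - 1) * u))
        (f (z + u) - f z - d * u)).
    { apply cser_ext with (fun k => a k * (z + u) ^ k - a k * z ^ k - u * (RtoC (INR k) * a k * z ^ (k - 1))).
      { intros; ring. }
      replace (d * u) with (u * d) by ring.
      apply cser_minus; [apply cser_minus; auto|apply cser_scal; auto]. }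
    apply cser_le with (n0 := O) (2 := Hs). intros n _.
    apply Rle_trans with ((M * K * Cmod u ^ 2 / m ^ 2) / (1 - y))%R; [|right; unfold L; field; lra].
    apply csum_geom_bound; auto.
    { apply Rdiv_le_0_compat; [|apply pow_lt; lra]. pose proof (pow2_ge_0 (Cmod u)). apply Rmult_le_pos; nra. }
    intros k. rewrite Cmod_mult.
    pose proof (pow_second_order z u m k ltac:(lra) Hzu) as P.
    set (E := Cmod ((z + u) ^ k - z ^ k - RtoC (INR k) * z ^ (k - 1) * u)) in *.
    specialize (B k). specialize (HM k).
    assert (Hm2 : (0 < m ^ 2)%R) by (apply pow_lt; lra).
    assert (Hqk : (0 < q ^ k)%R) by (apply pow_lt; lra).
    apply Rmult_le_reg_l with (m ^ 2)%R; auto.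
    replace (m ^ 2 * (M * K * Cmod u ^ 2 / m ^ 2 * y ^ k))%R with (M * (Cmod u ^ 2 * (K * y ^ k)))%R by (field; lra).
    replace (m ^ 2 * (Cmod (a k) * E))%R with (Cmod (a k) * (m ^ 2 * E))%R by ring.
    apply Rle_trans with (Cmod (a k) * (INR k ^ 2 * Cmod u ^ 2 * m ^ k))%R.
    { apply Rmult_le_compat_l; [apply Cmod_ge_0|auto]. }
    replace (Cmod (a k) * (INR k ^ 2 * Cmod u ^ 2 * m ^ k))%R
      with ((Cmod (a k) * q ^ k) * (Cmod u ^ 2 * (INR k ^ 2 * (m / q) ^ k)))%R.
    2: { unfold Rdiv. rewrite Rpow_mult_distr, pow_inv. field. lra. }
    apply Rmult_le_compat; auto.
    + apply Rmult_le_pos; [apply Cmod_ge_0|lra].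
    + apply Rmult_le_pos; [apply pow2_ge_0|]. apply Rmult_le_pos; [apply pow2_ge_0|].
      apply pow_le, Rdiv_le_0_compat; lra.
    + apply Rmult_le_compat_l; [apply pow2_ge_0|auto].
  - pose proof (Cmod_ge_0 u).
    assert (L * Cmod u <= e)%R.
    { apply Rle_trans with (L * (e / (L + 1)))%R; [apply Rmult_le_compat_l; lra|].
      apply Rle_trans with ((L + 1) * (e / (L + 1)))%R; [|right; field; lra].
      apply Rmult_le_compat_r; [left; apply Rdiv_lt_0_compat; lra|lra]. }
    nra.
Qed.

Definition dsum (a : nat -> C) (z : C) : C := ctotal (fun k => cdcoef a k * z ^ k).

Lemma between (x R0 : R) : (x < R0)%R -> (0 <= x)%R ->
  (x < (x + R0) / 2 < R0)%R /\ (0 < (x + R0) / 2)%R.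
Proof. lra. Qed.

Lemma pser_dsum a R0 f : (forall z, (Cmod z < R0)%R -> csums a z (f z)) ->
  forall z, (Cmod z < R0)%R -> csums (cdcoef a) z (dsum a z).
Proof.
  intros Hf z Hz. destruct (between _ _ Hz (Cmod_ge_0 z)) as [Hp Hp0].
  set (p := ((Cmod z + R0) / 2)%R) in *.
  destruct (csums_pbound a ((p + R0) / 2) f) as [M HM]; [lra|intros; apply Hf; lra|].
  destruct (cdcoef_pbound ((p + R0) / 2) p) as (L & _ & HL); [lra|].
  apply csums_exists with p (L * M)%R; auto. lra.
Qed.

Lemma pser_cderiv' a R0 f : (forall z, (Cmod z < R0)%R -> csums a z (f z)) ->
  forall z, (Cmod z < R0)%R -> cderiv f z (dsum a z).
Proof.
  intros Hf z Hz. destruct (between _ _ Hz (Cmod_ge_0 z)) as [Hp Hp0].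
  destruct (csums_pbound a ((Cmod z + R0) / 2) f) as [M HM]; [lra|intros; apply Hf; lra|].
  apply pser_cderiv with a ((Cmod z + R0) / 2)%R M; auto; [|lra|].
  - intros; apply Hf; lra.
  - apply pser_dsum with R0 f; auto.
Qed.

Lemma pser_holo a R0 f : (forall z, (Cmod z < R0)%R -> csums a z (f z)) -> holo R0 f (dsum a).
Proof.
  intros Hf z Hz. split.
  - apply pser_cderiv' with R0; auto.
  - apply cderiv_ccont with (dsum (cdcoef a) z).
    apply pser_cderiv' with R0; auto. apply pser_dsum with f; auto.
Qed.

(** Strong induction: if all earlier differences vanish, then at a small real [t] the term [c_k t^k]
    is bounded by a tail of order [t^(k+1)], which is impossible for [c_k <> 0]. *)
Lemma csums_unique a b f R0 : (0 < R0)%R -> (forall z, (Cmod z < R0)%R -> csums a z (f z)) ->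
  (forall z, (Cmod z < R0)%R -> csums b z (f z)) -> forall k, a k = b k.
Proof.
  intros HR Ha Hb. set (c := fun k => a k - b k).
  assert (Hc : forall z, (Cmod z < R0)%R -> csums c z 0).
  { intros z Hz. replace (RtoC 0) with (f z - f z) by ring.
    apply cser_ext with (fun k => a k * z ^ k - b k * z ^ k); [intros; unfold c; ring|].
    apply cser_minus; [apply Ha|apply Hb]; auto. }
  assert (Hk : forall k : nat, c k = RtoC 0).
  2: { intros k. apply Ceq_minus. apply Hk. }
  set (q := (R0 / 2)%R).
  destruct (csums_pbound c q (fun _ => RtoC 0)) as [M HM]; [unfold q; lra|intros; apply Hc; unfold q in *; lra|].
  intros k. induction k as [k IH] using (well_founded_induction Wf_nat.lt_wf).
  apply NNPP. intros Hne. assert (Hck : (0 < Cmod (c k))%R) by (apply Cmod_gt_0; auto).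
  assert (HM0 : (0 <= M)%R) by (apply (pbound_nonneg c q M); [unfold q; lra|auto]).
  set (L := (2 * M / q ^ S k)%R).
  assert (Hqk : (0 < q ^ S k)%R) by (apply pow_lt; unfold q; lra).
  assert (HL : (0 <= L)%R) by (unfold L; apply Rdiv_le_0_compat; lra).
  set (t := Rmin (q / 2) (Cmod (c k) / (2 * (L + 1)))).
  assert (Ht : (0 < t)%R) by (apply Rmin_glb_lt; [unfold q; lra|apply Rdiv_lt_0_compat; lra]).
  assert (Htq : (t <= q / 2)%R) by apply Rmin_l.
  assert (HtL : (t * (L + 1) <= Cmod (c k) / 2)%R).
  { apply Rle_trans with (Cmod (c k) / (2 * (L + 1)) * (L + 1))%R; [apply Rmult_le_compat_r; [lra|apply Rmin_r]|].
    right; field; lra. }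
  assert (Hzt : Cmod (RtoC t) = t) by (apply Cmod_RtoC; lra).
  pose proof (Hc (RtoC t) ltac:(rewrite Hzt; unfold q in *; lra)) as Hs.
  assert (Hr : (0 <= t / q <= / 2)%R).
  { split; [apply Rdiv_le_0_compat; unfold q; lra|]. apply Rmult_le_reg_r with q; [unfold q; lra|].
    unfold Rdiv. rewrite Rmult_assoc, Rinv_l by (unfold q; lra). lra. }
  pose proof (cser_tail (fun k => c k * RtoC t ^ k) 0 M (t / q) (S k) ltac:(lra) HM0) as T.
  assert (T' : (Cmod (0 - csum (fun k => c k * RtoC t ^ k)%C (S k)) <= M * (t / q) ^ S k / (1 - t / q))%R).
  { apply T; auto. intros j. assert (Hq0 : (0 < q)%R) by (unfold q; lra).
    pose proof (pbound_term c q M (RtoC t) j Hq0 HM) as P. rewrite Hzt in P. exact P. }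
  simpl csum in T'. rewrite csum_0 in T' by (intros j Hj; rewrite (IH j Hj); ring).
  replace (0 - (0 + c k * RtoC t ^ k)) with (- (c k * RtoC t ^ k)) in T' by ring.
  rewrite Cmod_opp, Cmod_mult, Cmod_pow, Hzt in T'.
  assert (Htk : (0 < t ^ k)%R) by (apply pow_lt; auto).
  assert (T2 : (M * (t / q) ^ S k / (1 - t / q) <= L * t * t ^ k)%R).
  { unfold L. unfold Rdiv at 2. rewrite Rpow_mult_distr, pow_inv.
    replace (2 * M / q ^ S k * t * t ^ k)%R with (M * (t ^ S k * / q ^ S k) * 2)%R.
    2: { replace (t ^ S k)%R with (t * t ^ k)%R by reflexivity. field. lra. }
    unfold Rdiv at 1. apply Rmult_le_compat_l.
    - apply Rmult_le_pos; auto. apply Rmult_le_pos; [apply pow_le; lra|left; apply Rinv_0_lt_compat; auto].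
    - rewrite <- (Rinv_inv 2). apply Rinv_le_contravar; [|]; lra. }
  assert (Cmod (c k) * t ^ k <= L * t * t ^ k)%R by lra.
  apply Rmult_le_reg_r in H; auto. lra.
Qed.

Ltac req := lazymatch goal with |- ?a = ?b => change (@eq R a b) end.

(** * Integrals over circles and the Cauchy formula *)

Definition rderiv (g : R -> C) (t : R) (v : C) : Prop :=
  forall eps, (0 < eps)%R -> exists del, (0 < del)%R /\
    forall h, (Rabs h < del)%R -> (Cmod (g (t + h)%R - g t - RtoC h * v) <= eps * Rabs h)%R.

Definition cont2 (G : R -> R -> C) (x y : R) : Prop :=
  forall eps, (0 < eps)%R -> exists del, (0 < del)%R /\
    forall u v, (Rabs (u - x) < del)%R -> (Rabs (v - y) < del)%R -> (Cmod (G u v - G x y) < eps)%R.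

Definition rcont (g : R -> C) (t : R) : Prop :=
  forall eps, (0 < eps)%R -> exists del, (0 < del)%R /\
    forall s, (Rabs (s - t) < del)%R -> (Cmod (g s - g t) < eps)%R.

Lemma rderiv_fst g t v : rderiv g t v -> is_derive (fun s => fst (g s)) t (fst v).
Proof.
  intros H. apply is_derive_Reals. intros e He. destruct (H (e / 2)%R) as (d & Hd & H'); [lra|].
  exists (mkposreal d Hd). intros h Hh Hhd. specialize (H' h Hhd).
  assert (0 < Rabs h)%R by (apply Rabs_pos_lt; auto).
  replace ((fst (g (t + h)) - fst (g t)) / h - fst v)%R
    with ((fst (g (t + h)) - fst (g t) - h * fst v) / h)%R by (field; auto).
  unfold Rdiv. rewrite Rabs_mult, Rabs_inv. apply Rmult_lt_reg_r with (Rabs h); auto.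
  rewrite Rmult_assoc, Rinv_l by lra.
  apply Rle_lt_trans with (e / 2 * Rabs h)%R; [|nra].
  rewrite Rmult_1_r. eapply Rle_trans; [|apply H']. eapply Rle_trans; [|apply fst_le_Cmod].
  right. f_equal. simpl. ring.
Qed.

Lemma rderiv_snd g t v : rderiv g t v -> is_derive (fun s => snd (g s)) t (snd v).
Proof.
  intros H. apply is_derive_Reals. intros e He. destruct (H (e / 2)%R) as (d & Hd & H'); [lra|].
  exists (mkposreal d Hd). intros h Hh Hhd. specialize (H' h Hhd).
  assert (0 < Rabs h)%R by (apply Rabs_pos_lt; auto).
  replace ((snd (g (t + h)) - snd (g t)) / h - snd v)%R
    with ((snd (g (t + h)) - snd (g t) - h * snd v) / h)%R by (field; auto).
  unfold Rdiv. rewrite Rabs_mult, Rabs_inv. apply Rmult_lt_reg_r with (Rabs h); auto.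
  rewrite Rmult_assoc, Rinv_l by lra.
  apply Rle_lt_trans with (e / 2 * Rabs h)%R; [|nra].
  rewrite Rmult_1_r. eapply Rle_trans; [|apply H']. eapply Rle_trans; [|apply snd_le_Cmod].
  right. f_equal. simpl. ring.
Qed.

Lemma is_derive_eps (a : R -> R) t l : is_derive a t l ->
  forall eps, (0 < eps)%R -> exists del, (0 < del)%R /\
    forall h, (Rabs h < del)%R -> (Rabs (a (t + h) - a t - h * l) <= eps * Rabs h)%R.
Proof.
  intros H e He. apply is_derive_Reals in H. destruct (H e He) as [d Hd].
  exists d. split; [apply cond_pos|]. intros h Hh.
  destruct (Req_dec h 0) as [->|Hh0].
  - rewrite Rplus_0_r, Rabs_R0. replace (a t - a t - 0 * l)%R with 0%R by ring. rewrite Rabs_R0. lra.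
  - specialize (Hd h Hh0 Hh). assert (0 < Rabs h)%R by (apply Rabs_pos_lt; auto).
    replace (a (t + h) - a t - h * l)%R with (((a (t + h) - a t) / h - l) * h)%R by (field; auto).
    rewrite Rabs_mult. apply Rmult_le_compat_r; lra.
Qed.

Lemma rderiv_pair a b t a' b' : is_derive a t a' -> is_derive b t b' ->
  rderiv (fun s => (a s, b s)) t (a', b').
Proof.
  intros Ha Hb e He. destruct (is_derive_eps _ _ _ Ha (e / 2)%R) as (d1 & ? & H1); [lra|].
  destruct (is_derive_eps _ _ _ Hb (e / 2)%R) as (d2 & ? & H2); [lra|].
  exists (Rmin d1 d2). split; [apply Rmin_glb_lt; auto|]. intros h Hh.
  specialize (H1 h (Rlt_le_trans _ _ _ Hh (Rmin_l _ _))).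
  specialize (H2 h (Rlt_le_trans _ _ _ Hh (Rmin_r _ _))).
  eapply Rle_trans; [apply Cmod_le_abs|]. simpl.
  replace (a (t + h) + - a t + - (h * a' - 0 * b'))%R with (a (t + h) - a t - h * a')%R by ring.
  replace (b (t + h) + - b t + - (h * b' + 0 * a'))%R with (b (t + h) - b t - h * b')%R by ring. lra.
Qed.

Lemma rderiv_comp f g t d v : cderiv f (g t) d -> rderiv g t v -> rderiv (fun s => f (g s)) t (d * v).
Proof.
  intros Hf Hg e He. pose proof (Cmod_ge_0 d). pose proof (Cmod_ge_0 v).
  set (e1 := (e / (2 * (Cmod v + 1)))%R). set (e2 := Rmin 1 (e / (2 * (Cmod d + 1)))).
  assert (He1 : (0 < e1)%R) by (apply Rdiv_lt_0_compat; lra).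
  assert (He2 : (0 < e2)%R) by (apply Rmin_glb_lt; [lra|apply Rdiv_lt_0_compat; lra]).
  destruct (Hf e1 He1) as (d1 & Hd1 & H1). destruct (Hg e2 He2) as (d2 & Hd2 & H2).
  exists (Rmin d2 (d1 / (Cmod v + 1))). split.
  { apply Rmin_glb_lt; auto. apply Rdiv_lt_0_compat; lra. }
  intros h Hh. specialize (H2 h (Rlt_le_trans _ _ _ Hh (Rmin_l _ _))).
  assert (Hh2 : (Rabs h < d1 / (Cmod v + 1))%R) by (eapply Rlt_le_trans; [apply Hh|apply Rmin_r]).
  set (u := g (t + h)%R - g t) in *. pose proof (Rabs_pos h).
  assert (e2 <= 1)%R by apply Rmin_l.
  assert (Hu : (Cmod u <= (Cmod v + 1) * Rabs h)%R).
  { pose proof (Cmod_triangle_sub u (RtoC h * v)) as T. rewrite Cmod_mult, Cmod_R in T. nra. }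
  assert (Hu1 : (Cmod u < d1)%R).
  { apply Rle_lt_trans with (1 := Hu). apply Rlt_le_trans with ((Cmod v + 1) * (d1 / (Cmod v + 1)))%R.
    - apply Rmult_lt_compat_l; lra.
    - right; field; lra. }
  specialize (H1 u Hu1). replace (g t + u) with (g (t + h)%R) in H1 by (unfold u; ring).
  replace (f (g (t + h)%R) - f (g t) - RtoC h * (d * v))
    with ((f (g (t + h)%R) - f (g t) - d * u) + d * (u - RtoC h * v)) by ring.
  eapply Rle_trans; [apply Cmod_triangle|]. rewrite Cmod_mult.
  assert (e1 * Cmod u <= e / 2 * Rabs h)%R.
  { apply Rle_trans with (e1 * ((Cmod v + 1) * Rabs h))%R; [apply Rmult_le_compat_l; lra|].
    right. unfold e1. field. lra. }
  assert (Cmod d * (e2 * Rabs h) <= e / 2 * Rabs h)%R.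
  { rewrite <- Rmult_assoc. apply Rmult_le_compat_r; auto.
    apply Rle_trans with ((Cmod d + 1) * (e / (2 * (Cmod d + 1))))%R; [|right; field; lra].
    apply Rmult_le_compat; try lra. apply Rmin_r. }
  assert (Cmod d * Cmod (u - RtoC h * v) <= Cmod d * (e2 * Rabs h))%R by (apply Rmult_le_compat_l; auto).
  lra.
Qed.

Lemma rderiv_rcont g t v : rderiv g t v -> rcont g t.
Proof.
  intros H e He. destruct (H 1%R) as (d & Hd & H'); [lra|]. pose proof (Cmod_ge_0 v).
  exists (Rmin d (e / (Cmod v + 2))). split.
  { apply Rmin_glb_lt; auto. apply Rdiv_lt_0_compat; lra. }
  intros s Hs. specialize (H' (s - t)%R (Rlt_le_trans _ _ _ Hs (Rmin_l _ _))).
  replace (t + (s - t))%R with s in H' by ring.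
  pose proof (Cmod_triangle_sub (g s - g t) (RtoC (s - t) * v)) as T. rewrite Cmod_mult, Cmod_R in T.
  assert (Hs2 : (Rabs (s - t) < e / (Cmod v + 2))%R) by (eapply Rlt_le_trans; [apply Hs|apply Rmin_r]).
  assert (Rabs (s - t) * (Cmod v + 2) < e)%R.
  { apply Rlt_le_trans with (e / (Cmod v + 2) * (Cmod v + 2))%R; [apply Rmult_lt_compat_r; lra|right; field; lra]. }
  pose proof (Rabs_pos (s - t)). nra.
Qed.

Definition cis (t : R) : C := (cos t, sin t).

Lemma Cmod_cis t : Cmod (cis t) = 1%R.
Proof.
  unfold Cmod, cis; simpl. pose proof (sin2_cos2 t) as H. unfold Rsqr in H.
  replace (cos t * (cos t * 1) + sin t * (sin t * 1))%R with 1%R by lra. apply sqrt_1.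
Qed.

Lemma cis_plus s t : cis (s + t) = cis s * cis t.
Proof. unfold cis. rewrite cos_plus, sin_plus. ceq; ring. Qed.

Lemma cis_pow t k : cis t ^ k = cis (INR k * t).
Proof.
  induction k; [simpl; rewrite Rmult_0_l; unfold cis; rewrite cos_0, sin_0; reflexivity|].
  rewrite Cpow_S, IHk, <- cis_plus, S_INR. f_equal. ring.
Qed.

Lemma cis_nz t : cis t <> 0.
Proof. intros H. pose proof (Cmod_cis t). rewrite H, Cmod_0 in H0. lra. Qed.

Lemma cis_inv t : / cis t = Cconj (cis t).
Proof.
  assert (H : cis t * Cconj (cis t) = 1).
  { unfold cis. pose proof (sin2_cos2 t) as H. unfold Rsqr in H. ceq; lra. }
  pose proof (cis_nz t). replace (/ cis t) with (/ cis t * (cis t * Cconj (cis t))) by (rewrite H; ring).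
  field. auto.
Qed.

Lemma cis_per : cis (2 * PI) = cis 0.
Proof. unfold cis. rewrite cos_2PI, sin_2PI, cos_0, sin_0. reflexivity. Qed.

Lemma rderiv_cis t : rderiv cis t (Ci * cis t).
Proof.
  replace (Ci * cis t) with ((- sin t)%R, cos t) by (unfold cis; ceq; ring).
  apply rderiv_pair; apply is_derive_Reals; [apply derivable_pt_lim_cos|apply derivable_pt_lim_sin].
Qed.

Lemma rcont_cont2_r g x y : rcont g y -> cont2 (fun _ v => g v) x y.
Proof. intros H e He. destruct (H e He) as (d & ? & Hd). exists d. split; auto. Qed.

Lemma cont2_l x y : cont2 (fun u _ => RtoC u) x y.
Proof.
  intros e He. exists e. split; auto. intros u v Hu _. rewrite <- RtoC_minus, Cmod_R. auto.
Qed.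

Lemma cont2_const c x y : cont2 (fun _ _ => c) x y.
Proof.
  intros e He. exists 1%R. split; [lra|]. intros. replace (c - c) with (RtoC 0) by ring. rewrite Cmod_0. auto.
Qed.

Lemma cont2_comp f G x y : cont2 G x y -> ccont f (G x y) -> cont2 (fun u v => f (G u v)) x y.
Proof.
  intros HG Hf e He. destruct (Hf e He) as (d & Hd & H). destruct (HG d Hd) as (d' & ? & H').
  exists d'. split; auto.
Qed.

Lemma cont2_plus F G x y : cont2 F x y -> cont2 G x y -> cont2 (fun u v => F u v + G u v) x y.
Proof.
  intros Hf Hg e He. destruct (Hf (e / 2)%R) as (d1 & ? & H1); [lra|].
  destruct (Hg (e / 2)%R) as (d2 & ? & H2); [lra|].
  exists (Rmin d1 d2). split; [apply Rmin_glb_lt; auto|]. intros u v Hu Hv.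
  replace (F u v + G u v - (F x y + G x y)) with ((F u v - F x y) + (G u v - G x y)) by ring.
  eapply Rle_lt_trans; [apply Cmod_triangle|].
  specialize (H1 u v (Rlt_le_trans _ _ _ Hu (Rmin_l _ _)) (Rlt_le_trans _ _ _ Hv (Rmin_l _ _))).
  specialize (H2 u v (Rlt_le_trans _ _ _ Hu (Rmin_r _ _)) (Rlt_le_trans _ _ _ Hv (Rmin_r _ _))). lra.
Qed.

(* A product is a polarised combination of squares. *)
Lemma cont2_mult F G x y : cont2 F x y -> cont2 G x y -> cont2 (fun u v => F u v * G u v) x y.
Proof.
  intros Hf Hg.
  assert (Sq : forall H, cont2 H x y -> cont2 (fun u v => H u v * H u v) x y).
  { intros H HH. apply (cont2_comp (fun w => w * w) H); auto.
    apply (ccont_mult (fun w => w) (fun w => w)); apply ccont_id. }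
  assert (Sc : forall c H, cont2 H x y -> cont2 (fun u v => c * H u v) x y).
  { intros c H HH. apply (cont2_comp (fun w => c * w) H); auto.
    apply (ccont_mult (fun _ => c) (fun w => w)); [apply ccont_const|apply ccont_id]. }
  assert (Ha : cont2 (fun u v => F u v + G u v) x y) by (apply cont2_plus; auto).
  assert (Hb : cont2 (fun u v => F u v + - (1) * G u v) x y) by (apply cont2_plus; auto).
  pose proof (Sc (/ 4) _ (Sq _ Ha)) as A. pose proof (Sc (- / 4) _ (Sq _ Hb)) as B.
  pose proof (cont2_plus _ _ _ _ A B) as S0.
  intros e He. destruct (S0 e He) as (d & Hd & H). exists d. split; auto. intros u v Hu Hv.
  specialize (H u v Hu Hv). cbv beta in H.
  assert (E : forall p q : C, / 4 * ((p + q) * (p + q)) + - / 4 * ((p + - (1) * q) * (p + - (1) * q)) = p * q).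
  { intros. field. }
  rewrite !E in H. exact H.
Qed.

Lemma cont2_fst G x y : cont2 G x y -> continuity_2d_pt (fun u v => fst (G u v)) x y.
Proof.
  intros H e. destruct (H e (cond_pos e)) as (d & Hd & H'). exists (mkposreal d Hd). intros u v Hu Hv.
  eapply Rle_lt_trans; [|apply (H' u v Hu Hv)]. apply (fst_le_Cmod (G u v - G x y)).
Qed.

Lemma cont2_snd G x y : cont2 G x y -> continuity_2d_pt (fun u v => snd (G u v)) x y.
Proof.
  intros H e. destruct (H e (cond_pos e)) as (d & Hd & H'). exists (mkposreal d Hd). intros u v Hu Hv.
  eapply Rle_lt_trans; [|apply (H' u v Hu Hv)]. apply (snd_le_Cmod (G u v - G x y)).
Qed.

Lemma rcont_fst g t : rcont g t -> continuous (fun s => fst (g s)) t.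
Proof.
  intros H. apply (proj2 (filterlim_locally _ _)). intros e. destruct (H e (cond_pos e)) as (d & Hd & H').
  exists (mkposreal d Hd). intros s Hs. eapply Rle_lt_trans; [|apply (H' s Hs)].
  apply (fst_le_Cmod (g s - g t)).
Qed.

Lemma rcont_snd g t : rcont g t -> continuous (fun s => snd (g s)) t.
Proof.
  intros H. apply (proj2 (filterlim_locally _ _)). intros e. destruct (H e (cond_pos e)) as (d & Hd & H').
  exists (mkposreal d Hd). intros s Hs. eapply Rle_lt_trans; [|apply (H' s Hs)].
  apply (snd_le_Cmod (g s - g t)).
Qed.

(** * Complex integrals over one period, and integrals over circles *)

Definition cint (F : R -> C) : C :=
  (RInt (fun t => fst (F t)) 0 (2 * PI), RInt (fun t => snd (F t)) 0 (2 * PI)).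

Lemma ex_fst F : (forall t, rcont F t) -> forall a b, ex_RInt (fun t => fst (F t)) a b.
Proof. intros H a b. apply (ex_RInt_continuous (V := R_CompleteNormedModule)). intros. apply rcont_fst; auto. Qed.

Lemma ex_snd F : (forall t, rcont F t) -> forall a b, ex_RInt (fun t => snd (F t)) a b.
Proof. intros H a b. apply (ex_RInt_continuous (V := R_CompleteNormedModule)). intros. apply rcont_snd; auto. Qed.

Lemma cint_ext F G : (forall t, F t = G t) -> cint F = cint G.
Proof. intros H. unfold cint. f_equal; apply RInt_ext; intros; rewrite H; auto. Qed.

Lemma cint_plus F G : (forall t, rcont F t) -> (forall t, rcont G t) ->
  cint (fun t => F t + G t) = cint F + cint G.
Proof.
  intros HF HG. unfold cint, Cplus. cbn [fst snd]. f_equal.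
  - apply (RInt_plus (V := R_CompleteNormedModule) (fun t => fst (F t)) (fun t => fst (G t)) 0 (2 * PI));
      apply ex_fst; auto.
  - apply (RInt_plus (V := R_CompleteNormedModule) (fun t => snd (F t)) (fun t => snd (G t)) 0 (2 * PI));
      apply ex_snd; auto.
Qed.

Lemma cint_scal c F : (forall t, rcont F t) -> cint (fun t => c * F t) = c * cint F.
Proof.
  intros HF. pose proof (ex_fst F HF) as E1. pose proof (ex_snd F HF) as E2.
  assert (A : forall (k l : R) (p q : R -> R), (forall a b, ex_RInt p a b) -> (forall a b, ex_RInt q a b) ->
     RInt (fun t => k * p t + l * q t)%R 0 (2 * PI) = (k * RInt p 0 (2 * PI) + l * RInt q 0 (2 * PI))%R).
  { intros k l p q Hp Hq.
    rewrite <- (RInt_scal (V := R_CompleteNormedModule) p), <- (RInt_scal (V := R_CompleteNormedModule) q) by auto.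
    apply (RInt_plus (V := R_CompleteNormedModule) (fun t => k * p t)%R (fun t => l * q t)%R);
      apply (ex_RInt_scal (V := R_NormedModule)); auto. }
  unfold cint, Cmult. cbn [fst snd]. f_equal.
  - replace (fst c * RInt (fun t => fst (F t)) 0 (2 * PI) - snd c * RInt (fun t => snd (F t)) 0 (2 * PI))%R
      with (fst c * RInt (fun t => fst (F t)) 0 (2 * PI) + - snd c * RInt (fun t => snd (F t)) 0 (2 * PI))%R by ring.
    rewrite <- A by auto. apply RInt_ext. intros. req. ring.
  - rewrite <- A by auto. apply RInt_ext. intros. req. ring.
Qed.

Lemma cint_const c : cint (fun _ => c) = RtoC (2 * PI) * c.
Proof.
  unfold cint. rewrite !RInt_const. unfold scal; simpl; unfold mult; simpl. unfold Cmult, RtoC; cbn [fst snd]; f_equal; ring.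
Qed.

(** The components are estimated separately, hence [4 PI] in place of the sharp [2 PI]; this is the
    origin of the factor 2 in [cauchy_estimate]. *)
Lemma cint_bound F M : (forall t, rcont F t) -> (forall t, Cmod (F t) <= M)%R ->
  (Cmod (cint F) <= 4 * PI * M)%R.
Proof.
  intros HF HM. pose proof PI_RGT_0. eapply Rle_trans; [apply Cmod_le_abs|]. unfold cint. cbn [fst snd].
  assert (A : (Rabs (RInt (fun t => fst (F t)) 0 (2 * PI)) <= (2 * PI - 0) * M)%R).
  { apply (norm_RInt_le_const (V := R_NormedModule) (fun t => fst (F t))).
    - lra.
    - intros x _. eapply Rle_trans; [apply fst_le_Cmod|apply HM].
    - apply (RInt_correct (V := R_CompleteNormedModule)), ex_fst; auto. }
  assert (B : (Rabs (RInt (fun t => snd (F t)) 0 (2 * PI)) <= (2 * PI - 0) * M)%R).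
  { apply (norm_RInt_le_const (V := R_NormedModule) (fun t => snd (F t))).
    - lra.
    - intros x _. eapply Rle_trans; [apply snd_le_Cmod|apply HM].
    - apply (RInt_correct (V := R_CompleteNormedModule)), ex_snd; auto. }
  lra.
Qed.

Lemma cint_derivative G F : (forall t, rderiv G t (F t)) -> (forall t, rcont F t) ->
  G (2 * PI)%R = G 0%R -> cint F = 0.
Proof.
  intros HG HF Hp. unfold cint, RtoC. f_equal; apply (is_RInt_unique (V := R_CompleteNormedModule)).
  - replace 0%R with (minus (fst (G (2 * PI)%R)) (fst (G 0%R))) at 2.
    2: { rewrite Hp. unfold minus, plus, opp; simpl. ring. }
    apply (is_RInt_derive (V := R_CompleteNormedModule) (fun t => fst (G t))); intros.
    + apply rderiv_fst; auto.
    + apply rcont_fst; auto.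
  - replace 0%R with (minus (snd (G (2 * PI)%R)) (snd (G 0%R))) at 2.
    2: { rewrite Hp. unfold minus, plus, opp; simpl. ring. }
    apply (is_RInt_derive (V := R_CompleteNormedModule) (fun t => snd (G t))); intros.
    + apply rderiv_snd; auto.
    + apply rcont_snd; auto.
Qed.

Lemma cint_param (G D : R -> R -> C) (t : R) (eta : R) : (0 < eta)%R ->
  (forall s th, (Rabs (s - t) < eta)%R -> rderiv (fun u => G u th) s (D s th)) ->
  (forall s th, (Rabs (s - t) < eta)%R -> cont2 D s th) ->
  (forall s th, (Rabs (s - t) < eta)%R -> rcont (G s) th) ->
  is_derive (fun s => fst (cint (G s))) t (fst (cint (D t))) /\
  is_derive (fun s => snd (cint (G s))) t (snd (cint (D t))).
Proof.
  intros He HD HC HG.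
  assert (Ht : (Rabs (t - t) < eta)%R) by (rewrite Rminus_diag, Rabs_R0; auto).
  split; unfold cint; cbn [fst snd].
  - assert (E : forall s th, (Rabs (s - t) < eta)%R -> Derive (fun u => fst (G u th)) s = fst (D s th)).
    { intros. apply is_derive_unique, (rderiv_fst (fun u => G u th)); auto. }
    rewrite <- (RInt_ext (fun th => Derive (fun u => fst (G u th)) t)) by (intros; apply E; auto).
    apply (is_derive_RInt_param (fun u th => fst (G u th))).
    + exists (mkposreal eta He). intros s Hs th _. exists (fst (D s th)).
      apply (rderiv_fst (fun u => G u th)); auto.
    + intros th _. apply continuity_2d_pt_ext_loc with (f := fun u v => fst (D u v)).
      * exists (mkposreal eta He). intros u v Hu _. symmetry. apply E. auto.
      * apply cont2_fst; auto.
    + exists (mkposreal eta He). intros s Hs. apply ex_fst. intros; apply HG; auto.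
  - assert (E : forall s th, (Rabs (s - t) < eta)%R -> Derive (fun u => snd (G u th)) s = snd (D s th)).
    { intros. apply is_derive_unique, (rderiv_snd (fun u => G u th)); auto. }
    rewrite <- (RInt_ext (fun th => Derive (fun u => snd (G u th)) t)) by (intros; apply E; auto).
    apply (is_derive_RInt_param (fun u th => snd (G u th))).
    + exists (mkposreal eta He). intros s Hs th _. exists (snd (D s th)).
      apply (rderiv_snd (fun u => G u th)); auto.
    + intros th _. apply continuity_2d_pt_ext_loc with (f := fun u v => snd (D u v)).
      * exists (mkposreal eta He). intros u v Hu _. symmetry. apply E. auto.
      * apply cont2_snd; auto.
    + exists (mkposreal eta He). intros s Hs. apply ex_snd. intros; apply HG; auto.
Qed.

Lemma rcont_comp f g t : rcont g t -> ccont f (g t) -> rcont (fun s => f (g s)) t.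
Proof.
  intros HG Hf e He. destruct (Hf e He) as (d & Hd & H). destruct (HG d Hd) as (d' & ? & H').
  exists d'. split; auto.
Qed.

Lemma cderiv_lin (c z : C) : cderiv (fun w => c * w) z c.
Proof.
  assert (H : cderiv (fun w => c * w) z (c * 1)) by (apply (cderiv_scal _ (fun w => w)), cderiv_id).
  replace (c * 1) with c in H by ring. exact H.
Qed.

Lemma cderiv_exact f (z d : C) : (forall u, f (z + u) = f z + d * u) -> cderiv f z d.
Proof.
  intros H e He. exists 1%R. split; [lra|]. intros u _.
  replace (f (z + u) - f z - d * u) with (RtoC 0) by (rewrite H; ring). rewrite Cmod_0.
  pose proof (Cmod_ge_0 u). nra.
Qed.

Definition cpt (r t : R) : C := RtoC r * cis t.

Lemma Cmod_cpt r t : (0 <= r)%R -> Cmod (cpt r t) = r.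
Proof. intros. unfold cpt. rewrite Cmod_mult, Cmod_cis, Cmod_RtoC; auto. ring. Qed.

Lemma rderiv_cpt r t : rderiv (cpt r) t (Ci * cpt r t).
Proof.
  unfold cpt at 2. replace (Ci * (RtoC r * cis t)) with (RtoC r * (Ci * cis t)) by ring.
  apply (rderiv_comp (fun w => RtoC r * w) cis).
  - apply cderiv_lin.
  - apply rderiv_cis.
Qed.

(** The integral is taken against the angle, that is against [dz / (i z)], so that Cauchy's kernel
    takes the form [x / (x - w)]. *)
Definition circ (r : R) (F : C -> C) : C := cint (fun t => F (cpt r t)).

Definition cont_circ (r : R) (F : C -> C) : Prop := forall x, Cmod x = r -> ccont F x.

Lemma cont_circ_rcont r F : (0 <= r)%R -> cont_circ r F -> forall t, rcont (fun s => F (cpt r s)) t.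
Proof.
  intros Hr H t. apply (rcont_comp F (cpt r)).
  - eapply rderiv_rcont, rderiv_cpt.
  - apply H, Cmod_cpt; auto.
Qed.

Lemma circ_ext r F G : (0 <= r)%R -> (forall x, Cmod x = r -> F x = G x) -> circ r F = circ r G.
Proof. intros Hr H. apply cint_ext. intros. apply H, Cmod_cpt; auto. Qed.

Lemma circ_plus r F G : (0 <= r)%R -> cont_circ r F -> cont_circ r G ->
  circ r (fun x => F x + G x) = circ r F + circ r G.
Proof. intros. apply (cint_plus (fun t => F (cpt r t))); apply cont_circ_rcont; auto. Qed.

Lemma circ_scal r c F : (0 <= r)%R -> cont_circ r F -> circ r (fun x => c * F x) = c * circ r F.
Proof. intros. apply (cint_scal c (fun t => F (cpt r t))), cont_circ_rcont; auto. Qed.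

Lemma circ_bound r F M : (0 <= r)%R -> cont_circ r F -> (forall x, Cmod x = r -> Cmod (F x) <= M)%R ->
  (Cmod (circ r F) <= 4 * PI * M)%R.
Proof. intros. apply cint_bound; [apply cont_circ_rcont; auto|]. intros; apply H1, Cmod_cpt; auto. Qed.

(** Up to the factor [Ci] the integrand is the derivative of [g] along the circle, and the circle
    closes up. *)
Lemma circ_deriv r g g' : (0 <= r)%R -> (forall x, Cmod x = r -> cderiv g x (g' x)) ->
  cont_circ r g' -> circ r (fun x => g' x * x) = 0.
Proof.
  intros Hr Hg Hc.
  assert (E : circ r (fun x => Ci * (g' x * x)) = 0).
  { apply (cint_derivative (fun t => g (cpt r t))).
    - intros t. replace (Ci * (g' (cpt r t) * cpt r t)) with (g' (cpt r t) * (Ci * cpt r t)) by ring.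
      apply (rderiv_comp g (cpt r)); [apply Hg, Cmod_cpt; auto|apply rderiv_cpt].
    - apply (cont_circ_rcont r (fun x => Ci * (g' x * x))); auto. intros x Hx.
      apply ccont_mult; [apply ccont_const|]. apply ccont_mult; [auto|apply ccont_id].
    - unfold cpt. rewrite cis_per. reflexivity. }
  rewrite circ_scal in E; auto.
  2: { intros x Hx. apply ccont_mult; [auto|apply ccont_id]. }
  replace (circ r (fun x => g' x * x)) with (- Ci * (Ci * circ r (fun x => g' x * x))).
  - rewrite E. ring.
  - replace (- Ci * (Ci * circ r (fun x => g' x * x))) with (- (Ci * Ci) * circ r (fun x => g' x * x)) by ring.
    replace (Ci * Ci) with (- (1)) by (unfold Ci; ceq; ring). ring.
Qed.

Lemma circ_csum r (F : nat -> C -> C) n : (0 <= r)%R -> (forall k, cont_circ r (F k)) ->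
  circ r (fun x => csum (fun k => F k x) n) = csum (fun k => circ r (F k)) n.
Proof.
  intros Hr H.
  assert (Hc : forall m, cont_circ r (fun x => csum (fun k => F k x) m)).
  { induction m; intros x Hx; simpl; [apply ccont_const|].
    apply (ccont_plus (fun x => csum (fun k => F k x) m)); [apply IHm|apply H]; auto. }
  induction n; simpl.
  - unfold circ. rewrite cint_const. ring.
  - rewrite (circ_plus r (fun x => csum (fun k => F k x) n)); auto. rewrite IHn. reflexivity.
Qed.

Lemma ccont_invpow (x : C) k : x <> 0 -> ccont (fun y => (/ y) ^ k) x.
Proof. intros. apply ccont_pow, ccont_inv; auto. apply ccont_id. Qed.

Lemma circ_nz (x : C) r : (0 < r)%R -> Cmod x = r -> x <> 0.
Proof. intros Hr H E. rewrite E, Cmod_0 in H. lra. Qed.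

Lemma circ_invpow r k : (0 < r)%R ->
  circ r (fun x => (/ x) ^ k) = match k with O => RtoC (2 * PI) | _ => 0 end.
Proof.
  intros Hr. destruct k.
  - unfold circ. simpl. rewrite cint_const. ring.
  - set (g' := fun x : C => RtoC (INR (S k)) * (/ x) ^ (S k - 1) * (- / (x * x))).
    assert (Hcc : cont_circ r (fun x => (/ x) ^ S k)).
    { intros x Hx. apply ccont_invpow. apply (circ_nz x r); auto. }
    assert (H : circ r (fun x => g' x * x) = 0).
    { apply circ_deriv with (g := fun x => (/ x) ^ S k); [lra| |].
      - intros x Hx. unfold g'. apply (cderiv_comp (fun y => y ^ S k) (fun y => / y)).
        + apply cderiv_Cinv. apply (circ_nz x r); auto.
        + apply cderiv_pow.
      - intros x Hx. assert (x <> 0) by (apply (circ_nz x r); auto). unfold g'.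
        apply ccont_mult; [apply ccont_mult; [apply ccont_const|apply ccont_invpow; auto]|].
        apply ccont_opp, (ccont_inv (fun x => x * x)).
        + apply ccont_mult; apply ccont_id.
        + apply Cmult_neq_0; auto. }
    assert (Hk : RtoC (INR (S k)) <> 0).
    { intros E. apply RtoC_inj in E. pose proof (lt_0_INR (S k) ltac:(lia)). lra. }
    rewrite circ_ext with (G := fun x => - RtoC (INR (S k)) * (/ x) ^ S k) in H; [|lra|].
    + rewrite circ_scal in H; auto; [|lra].
      replace (circ r (fun x => (/ x) ^ S k))
        with (/ - RtoC (INR (S k)) * (- RtoC (INR (S k)) * circ r (fun x => (/ x) ^ S k))).
      * rewrite H. ring.
      * field. auto.
    + intros x Hx. assert (x <> 0) by (apply (circ_nz x r); auto). unfold g'.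
      replace (S k - 1)%nat with k by lia. rewrite Cpow_S. field. auto.
Qed.

(** * Cauchy's formula, Taylor expansion and Cauchy's estimate *)

Definition ccoef (r : R) (F : C -> C) (k : nat) : C := / RtoC (2 * PI) * circ r (fun x => F x * (/ x) ^ k).

Lemma two_pi_nz : RtoC (2 * PI) <> 0.
Proof. intros E. apply RtoC_inj in E. pose proof PI_RGT_0. lra. Qed.

(** The geometric expansion of [x / (x - w)] in powers of [w / x], integrated term by term; the
    remainder [Rm] is uniformly of order [(|w| / r)^n]. [F] is only continuous on the circle, so the
    case [F = 1] can evaluate the integral of the kernel before Cauchy's formula is available. *)
Lemma kernel_expand r F M w : (0 < r)%R -> (Cmod w < r)%R -> cont_circ r F ->
  (forall x, Cmod x = r -> Cmod (F x) <= M)%R ->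
  csums (ccoef r F) w (/ RtoC (2 * PI) * circ r (fun x => F x * (x / (x - w)))).
Proof.
  intros Hr Hw HF HM. pose proof PI_RGT_0.
  assert (Hxw : forall x, Cmod x = r -> x - w <> 0).
  { intros x Hx E. apply Ceq_minus in E. rewrite <- E in Hw. lra. }
  assert (HcK : cont_circ r (fun x => F x * (x / (x - w)))).
  { intros x Hx. apply ccont_mult; auto. apply ccont_mult; [apply ccont_id|].
    apply (ccont_inv (fun x => x - w)); auto. apply ccont_minus; [apply ccont_id|apply ccont_const]. }
  assert (Hck : forall k, cont_circ r (fun x => F x * (/ x) ^ k)).
  { intros k x Hx. apply ccont_mult; auto. apply ccont_invpow. apply (circ_nz x r); auto. }
  set (q := (Cmod w / r)%R). assert (Hq : (0 <= q < 1)%R) by (apply ratio_lt1; auto).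
  assert (HM0 : (0 <= M)%R).
  { eapply Rle_trans; [apply Cmod_ge_0|]. apply (HM (RtoC r)). rewrite Cmod_RtoC; lra. }
  intros e He.
  destruct (pow_small q (e / (2 * M / (1 - q) + 1))%R Hq) as [N HN].
  { apply Rdiv_lt_0_compat; auto. assert (0 <= 2 * M / (1 - q))%R by (apply Rdiv_le_0_compat; lra). lra. }
  exists N. intros n Hn. specialize (HN n Hn).
  set (Rm := fun x => w ^ n * (F x * (/ x) ^ n * (x / (x - w)))).
  assert (HcR : cont_circ r Rm).
  { intros x Hx. unfold Rm. apply ccont_mult; [apply ccont_const|]. apply ccont_mult; [apply Hck; auto|].
    apply ccont_mult; [apply ccont_id|].
    apply (ccont_inv (fun x => x - w)); auto. apply ccont_minus; [apply ccont_id|apply ccont_const]. }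
  assert (Split : circ r (fun x => F x * (x / (x - w)))
      = csum (fun k => circ r (fun x => w ^ k * (F x * (/ x) ^ k))) n + circ r Rm).
  { rewrite <- circ_csum; [|lra|].
    - rewrite <- circ_plus; [|lra| |auto].
      + apply circ_ext; [lra|]. intros x Hx. assert (Hx0 : x <> 0) by (apply (circ_nz x r); auto).
        specialize (Hxw x Hx). unfold Rm.
        rewrite (csum_ext _ (fun k => F x * (w / x) ^ k)).
        2: { intros k _. unfold Cdiv. rewrite Cpow_mult_l. ring. }
        rewrite (csum_scal (F x) (fun k => (w / x) ^ k)).
        pose proof (cgeom_sum (w / x) n) as G.
        assert (G2 : csum (fun k => (w / x) ^ k) n = (1 - (w / x) ^ n) * (x / (x - w))) by (rewrite <- G; field; auto).
        rewrite G2. unfold Cdiv. rewrite Cpow_mult_l. ring.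
      + intros x Hx. clear - Hx Hck. induction n; simpl; [apply ccont_const|].
        apply (ccont_plus (fun x => csum (fun k => w ^ k * (F x * (/ x) ^ k)) n)); auto.
        apply ccont_mult; [apply ccont_const|apply Hck; auto].
    - intros k x Hx. apply ccont_mult; [apply ccont_const|apply Hck; auto]. }
  assert (Hb : (Cmod (circ r Rm) <= 4 * PI * (M * q ^ n / (1 - q)))%R).
  { apply circ_bound; auto; [lra|]. intros x Hx. assert (Hx0 : x <> 0) by (apply (circ_nz x r); auto).
    specialize (Hxw x Hx). unfold Rm.
    replace (w ^ n * (F x * (/ x) ^ n * (x / (x - w)))) with (F x * ((w / x) ^ n * (x / (x - w)))).
    2: { unfold Cdiv. rewrite Cpow_mult_l. ring. }
    rewrite !Cmod_mult, Cmod_pow, Cmod_div by auto. rewrite Cmod_div by auto. rewrite Hx. fold q.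
    assert (Hd : (0 < r - Cmod w <= Cmod (x - w))%R).
    { pose proof (Cmod_triangle_sub x w). rewrite Hx in H0. lra. }
    unfold Rdiv at 2. rewrite Rmult_assoc.
    apply Rmult_le_compat; [apply Cmod_ge_0| |auto|].
    - apply Rmult_le_pos; [apply pow_le; lra|]. apply Rdiv_le_0_compat; lra.
    - apply Rmult_le_compat_l; [apply pow_le; lra|].
      apply Rle_trans with (r / (r - Cmod w))%R.
      + apply Rmult_le_compat_l; [lra|]. apply Rinv_le_contravar; lra.
      + right. unfold q. field. lra. }
  rewrite Split.
  replace (csum (fun k => ccoef r F k * w ^ k) n)
    with (/ RtoC (2 * PI) * csum (fun k => circ r (fun x => w ^ k * (F x * (/ x) ^ k))) n).
  2: { rewrite <- csum_scal. apply csum_ext. intros k _. rewrite circ_scal; [|lra|auto]. unfold ccoef. ring. }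
  match goal with |- (Cmod ?a < _)%R => replace a with (- (/ RtoC (2 * PI) * circ r Rm)) by ring end.
  rewrite Cmod_opp, Cmod_mult, Cmod_inv by apply two_pi_nz. rewrite Cmod_RtoC by lra.
  apply Rle_lt_trans with (/ (2 * PI) * (4 * PI * (M * q ^ n / (1 - q))))%R.
  { apply Rmult_le_compat_l; auto. left. apply Rinv_0_lt_compat. lra. }
  replace (/ (2 * PI) * (4 * PI * (M * q ^ n / (1 - q))))%R with ((2 * M / (1 - q)) * q ^ n)%R by (field; lra).
  set (L := (2 * M / (1 - q))%R) in *. assert (0 <= L)%R by (apply Rdiv_le_0_compat; lra).
  apply Rle_lt_trans with (L * (e / (L + 1)))%R; [apply Rmult_le_compat_l; lra|].
  apply Rlt_le_trans with ((L + 1) * (e / (L + 1)))%R; [|right; field; lra].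
  apply Rmult_lt_compat_r; [apply Rdiv_lt_0_compat; lra|lra].
Qed.

Lemma circ_kernel r w : (0 < r)%R -> (Cmod w < r)%R -> circ r (fun x => x / (x - w)) = RtoC (2 * PI).
Proof.
  intros Hr Hw. pose proof two_pi_nz as Hpi.
  assert (H := kernel_expand r (fun _ => 1) 1%R w Hr Hw).
  assert (H1 : csums (ccoef r (fun _ => 1)) w 1).
  { assert (Hs : csum (fun k => ccoef r (fun _ => 1) k * w ^ k) 1 = 1).
    { simpl. unfold ccoef. rewrite circ_ext with (G := fun x => (/ x) ^ 0) by (lra || (intros; ring)).
      rewrite circ_invpow by auto. simpl. field. auto. }
    refine (eq_ind _ (fun l => cser _ l) (cser_finite _ 1 _) _ Hs).
    intros [|k] Hk; [lia|]. unfold ccoef.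
    rewrite circ_ext with (G := fun x => (/ x) ^ S k) by (lra || (intros; ring)).
    rewrite circ_invpow by auto. ring. }
  assert (E : / RtoC (2 * PI) * circ r (fun x => 1 * (x / (x - w))) = 1).
  { apply cser_unique with (2 := H1). apply H.
    - intros x Hx. apply ccont_const.
    - intros. rewrite Cmod_1. lra. }
  rewrite circ_ext with (G := fun x => 1 * (x / (x - w))) by (lra || (intros; ring)).
  replace (circ r (fun x => 1 * (x / (x - w))))
    with (RtoC (2 * PI) * (/ RtoC (2 * PI) * circ r (fun x => 1 * (x / (x - w))))) by (field; auto).
  rewrite E. ring.
Qed.

Lemma Cmod_convex_comb (w x : C) (s eta r : R) : (Cmod w <= r)%R -> (Cmod x = r)%R -> (0 <= eta)%R ->
  (- eta <= s <= 1 + eta)%R -> (Cmod (w + RtoC s * (x - w)) <= (1 + 2 * eta) * r)%R.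
Proof.
  intros Hw Hx He Hs. replace (w + RtoC s * (x - w)) with (RtoC (1 - s) * w + RtoC s * x).
  2: { rewrite RtoC_minus. ring. }
  eapply Rle_trans; [apply Cmod_triangle|]. rewrite !Cmod_mult, !Cmod_R, Hx.
  pose proof (Cmod_ge_0 w).
  assert (Rabs (1 - s) + Rabs s <= 1 + 2 * eta)%R.
  { unfold Rabs; destruct (Rcase_abs (1 - s)); destruct (Rcase_abs s); lra. }
  pose proof (Rabs_pos (1 - s)). nra.
Qed.

(* The mean of [f (w + s (x - w)) x / (x - w)] over the circle does not depend on [s];
   at [s = 0] it is [f w] and at [s = 1] it is the Cauchy integral. *)
Lemma cauchy_formula R0 f f' r w : holo R0 f f' -> (0 < r < R0)%R -> (Cmod w < r)%R ->
  circ r (fun x => f x * (x / (x - w))) = RtoC (2 * PI) * f w.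
Proof.
  intros Hf Hr Hw.
  assert (Hxw : forall x, Cmod x = r -> x - w <> 0).
  { intros x Hx E. apply Ceq_minus in E. rewrite <- E in Hw. lra. }
  (* The margin [eta] lets [s] run slightly beyond [[0, 1]], so that two-sided derivatives in [s]
     exist at the end points as well. *)
  set (eta := ((R0 - r) / (4 * r))%R).
  assert (Heta : (0 < eta)%R) by (apply Rdiv_lt_0_compat; lra).
  assert (Hin : forall s x, (- eta <= s <= 1 + eta)%R -> Cmod x = r -> (Cmod (w + RtoC s * (x - w)) < R0)%R).
  { intros s x Hs Hx. eapply Rle_lt_trans; [apply Cmod_convex_comb with (eta := eta) (r := r); auto; lra|].
    unfold eta. replace ((1 + 2 * ((R0 - r) / (4 * r))) * r)%R with ((R0 + r) / 2)%R by (field; lra). lra. }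
  assert (Hk : forall x, Cmod x = r -> ccont (fun x => x / (x - w)) x).
  { intros x Hx. apply ccont_mult; [apply ccont_id|].
    apply (ccont_inv (fun x => x - w)); auto. apply ccont_minus; [apply ccont_id|apply ccont_const]. }
  set (G := fun s th => f (w + RtoC s * (cpt r th - w)) * (cpt r th / (cpt r th - w))).
  set (D := fun s th => f' (w + RtoC s * (cpt r th - w)) * cpt r th).
  assert (Hcp : forall th, Cmod (cpt r th) = r) by (intros; apply Cmod_cpt; lra).
  assert (Haff : forall s x, cont2 (fun u v => w + RtoC u * (cpt r v - w)) s x).
  { intros s x. apply cont2_plus; [apply cont2_const|]. apply (cont2_mult (fun u _ => RtoC u)); [apply cont2_l|].
    apply (cont2_plus (fun _ v => cpt r v) (fun _ _ => - w)); [|apply cont2_const].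
    apply (rcont_cont2_r (cpt r)). eapply rderiv_rcont, rderiv_cpt. }
  assert (HD : forall s th, (- eta <= s <= 1 + eta)%R -> rderiv (fun u => G u th) s (D s th)).
  { intros s th Hs. specialize (Hxw _ (Hcp th)).
    replace (D s th) with (f' (w + RtoC s * (cpt r th - w)) * (cpt r th - w) * (cpt r th / (cpt r th - w)) * 1)
      by (unfold D; field; auto).
    apply (rderiv_comp (fun z => f (w + z * (cpt r th - w)) * (cpt r th / (cpt r th - w))) RtoC).
    - set (k := cpt r th / (cpt r th - w)).
      replace (f' (w + RtoC s * (cpt r th - w)) * (cpt r th - w) * k)
        with (f' (w + RtoC s * (cpt r th - w)) * (cpt r th - w) * k + f (w + RtoC s * (cpt r th - w)) * 0) by ring.
      apply (cderiv_mult (fun z => f (w + z * (cpt r th - w))) (fun _ => k)); [|apply cderiv_const].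
      apply (cderiv_comp f (fun z => w + z * (cpt r th - w))); [|apply Hf, Hin; auto].
      apply cderiv_exact. intros; ring.
    - intros e He. exists 1%R. split; [lra|]. intros h _. rewrite RtoC_plus.
      replace (RtoC s + RtoC h - RtoC s - RtoC h * 1) with (RtoC 0) by ring. rewrite Cmod_0.
      pose proof (Rabs_pos h). nra. }
  assert (HDc : forall s th, (- eta <= s <= 1 + eta)%R -> cont2 D s th).
  { intros s th Hs. apply cont2_mult.
    - apply (cont2_comp f' (fun u v => w + RtoC u * (cpt r v - w))); [apply Haff; auto|apply Hf, Hin; auto].
    - apply (rcont_cont2_r (cpt r)). eapply rderiv_rcont, rderiv_cpt. }
  assert (HGc : forall s th, (- eta <= s <= 1 + eta)%R -> rcont (G s) th).
  { intros s th Hs. apply (rcont_comp (fun x => f (w + RtoC s * (x - w)) * (x / (x - w))) (cpt r)).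
    - eapply rderiv_rcont, rderiv_cpt.
    - apply ccont_mult; [|apply Hk; auto].
      apply (ccont_comp f (fun x => w + RtoC s * (x - w))).
      + apply ccont_plus; [apply ccont_const|]. apply ccont_mult; [apply ccont_const|].
        apply ccont_minus; [apply ccont_id|apply ccont_const].
      + eapply cderiv_ccont, Hf, Hin; auto. }
  assert (HD0 : forall s, (0 <= s <= 1)%R -> cint (D s) = 0).
  { intros s Hs. change (circ r (fun x => f' (w + RtoC s * (x - w)) * x) = 0).
    (* The integrand is [g' x * x] for [g x = f (w + s (x - w)) / s]; at [s = 0] this is replaced by
       the linear function [f' w * x]. *)
    destruct (Req_dec s 0) as [->|Hs0].
    - apply circ_deriv with (g := fun x => f' w * x); [lra| |].
      + intros x Hx. replace (f' (w + 0 * (x - w))) with (f' w * 1) by (replace (w + 0 * (x - w)) with w by ring; ring).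
        apply (cderiv_scal _ (fun x => x)), cderiv_id.
      + intros x Hx. apply ccont_ext_loc with (f := fun _ => f' w) (r := 1%R); [lra| |apply ccont_const].
        intros y _. f_equal. ring.
    - assert (Hsc : RtoC s <> 0) by (intros E; apply RtoC_inj in E; auto).
      apply circ_deriv with (g := fun x => / RtoC s * f (w + RtoC s * (x - w))); [lra| |].
      + intros x Hx. replace (f' (w + RtoC s * (x - w))) with (/ RtoC s * (f' (w + RtoC s * (x - w)) * RtoC s))
          by (field; auto).
        apply cderiv_scal. apply (cderiv_comp f (fun x => w + RtoC s * (x - w))); [|apply Hf, Hin; auto; lra].
        apply cderiv_exact. intros; ring.
      + intros x Hx. apply (ccont_comp f' (fun x => w + RtoC s * (x - w))); [|apply Hf, Hin; auto; lra].
        apply ccont_plus; [apply ccont_const|]. apply ccont_mult; [apply ccont_const|].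
        apply ccont_minus; [apply ccont_id|apply ccont_const]. }
  assert (HP : forall s, (0 <= s <= 1)%R ->
     is_derive (fun s => fst (cint (G s))) s (fst (RtoC 0)) /\ is_derive (fun s => snd (cint (G s))) s (snd (RtoC 0))).
  { intros s Hs. rewrite <- (HD0 s Hs). apply cint_param with (eta := eta); auto; intros u th Hu;
      apply Rabs_lt_between in Hu; [apply HD|apply HDc|apply HGc]; lra. }
  assert (Hconst : cint (G 0%R) = cint (G 1%R)).
  { apply injective_projections.
    - apply (eq_is_derive (V := R_NormedModule) (fun s => fst (cint (G s)))); [|lra].
      intros t Ht. apply HP. auto.
    - apply (eq_is_derive (V := R_NormedModule) (fun s => snd (cint (G s)))); [|lra].
      intros t Ht. apply HP. auto. }
  transitivity (cint (G 1%R)).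
  { apply cint_ext. intros th. unfold G. f_equal. f_equal. ring. }
  rewrite <- Hconst. rewrite <- (circ_kernel r w) by lra. rewrite Cmult_comm, <- circ_scal; [|lra|].
  - apply cint_ext. intros th. unfold G. f_equal. f_equal. ring.
  - intros x Hx. apply Hk; auto.
Qed.

Lemma holo_le R1 R2 f f' : (R1 <= R2)%R -> holo R2 f f' -> holo R1 f f'.
Proof. intros H Hf z Hz. apply Hf. lra. Qed.

Lemma holo_ccont R0 f f' z : holo R0 f f' -> (Cmod z < R0)%R -> ccont f z.
Proof. intros H Hz. eapply cderiv_ccont, H. auto. Qed.

Lemma ccoef_expand R0 f f' r : holo R0 f f' -> (0 < r < R0)%R ->
  forall z, (Cmod z < r)%R -> csums (ccoef r f) z (f z).
Proof.
  intros Hf Hr z Hz.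
  assert (Hc : cont_circ r f) by (intros x Hx; apply (holo_ccont R0 f f'); auto; lra).
  destruct (compact_bounded (fun x => Cmod x = r) f r) as (M & _ & HM).
  - intros x Hx. lra.
  - apply cclosed_circle.
  - exact Hc.
  - pose proof (kernel_expand r f M z ltac:(lra) Hz Hc HM) as K.
    rewrite (cauchy_formula R0 f f') in K by auto.
    replace (/ RtoC (2 * PI) * (RtoC (2 * PI) * f z)) with (f z) in K by (field; apply two_pi_nz).
    exact K.
Qed.

(** Circles of different radii give the same coefficients by [csums_unique], so those from the
    radius [R0 / 2] serve at every point of the disk. *)
Theorem taylor R0 f f' : holo R0 f f' -> (0 < R0)%R ->
  exists a, forall z, (Cmod z < R0)%R -> csums a z (f z).
Proof.
  intros Hf HR. exists (ccoef (R0 / 2) f). intros z Hz.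
  destruct (between _ _ Hz (Cmod_ge_0 z)) as [Hp Hp0]. set (p := ((Cmod z + R0) / 2)%R) in *.
  apply cser_ext with (fun k => ccoef p f k * z ^ k).
  - intros k. f_equal. apply (csums_unique _ _ f (R0 / 2)); [lra| |].
    + intros w Hw. apply (ccoef_expand R0 f f'); auto; try lra. unfold p in *. pose proof (Cmod_ge_0 z). lra.
    + intros w Hw. apply (ccoef_expand R0 f f'); auto; lra.
  - apply (ccoef_expand R0 f f'); auto; lra.
Qed.

Lemma cauchy_estimate R0 f f' a r M : holo R0 f f' -> (forall z, (Cmod z < R0)%R -> csums a z (f z)) ->
  (0 < r < R0)%R -> (forall x, Cmod x = r -> (Cmod (f x) <= M)%R) -> pbound a r (2 * M).
Proof.
  intros Hf Ha Hr HM k. pose proof PI_RGT_0.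
  assert (E : a k = ccoef r f k).
  { apply (csums_unique _ _ f r); [lra| |].
    - intros; apply Ha; lra.
    - apply (ccoef_expand R0 f f'); auto. }
  rewrite E. unfold ccoef. rewrite Cmod_mult, Cmod_inv, Cmod_RtoC by (apply two_pi_nz || lra).
  assert (B : (Cmod (circ r (fun x => f x * (/ x) ^ k)%C) <= 4 * PI * (M * / r ^ k))%R).
  { apply circ_bound; [lra| |].
    - intros x Hx. apply ccont_mult; [apply (holo_ccont R0 f f'); auto; lra|].
      apply ccont_invpow. apply (circ_nz x r); auto; lra.
    - intros x Hx. assert (x <> 0) by (apply (circ_nz x r); auto; lra).
      rewrite Cmod_mult, Cmod_pow, Cmod_inv, Hx, pow_inv by auto.
      apply Rmult_le_compat_r; auto. left. apply Rinv_0_lt_compat, pow_lt; lra. }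
  assert (Hrk : (0 < r ^ k)%R) by (apply pow_lt; lra).
  apply Rle_trans with (/ (2 * PI) * (4 * PI * (M * / r ^ k)) * r ^ k)%R.
  - apply Rmult_le_compat_r; [lra|]. apply Rmult_le_compat_l; auto. left. apply Rinv_0_lt_compat; lra.
  - right. field. lra.
Qed.

(** * Cauchy products and operations on holomorphic functions *)

Definition conv (a b : nat -> C) (n : nat) : C := csum (fun k => a k * b (n - k)%nat) (S n).

Lemma sum_f_R0_rsum f n : sum_f_R0 f n = rsum f (S n).
Proof. induction n; simpl in *; [ring|rewrite IHn; reflexivity]. Qed.

(** Reduced to the products of the four real component series, which converge absolutely. *)
Lemma cser_mult (x y : nat -> C) (X Y : C) K q : (0 <= q < 1)%R -> (forall k, Cmod (x k) <= K * q ^ k)%R ->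
  (forall k, Cmod (y k) <= K * q ^ k)%R -> cser x X -> cser y Y -> cser (conv x y) (X * Y).
Proof.
  intros Hq Bx By Hx Hy.
  assert (A : forall p : C -> R, (forall z, Rabs (p z) <= Cmod z)%R -> forall f : nat -> C,
     (forall k, Cmod (f k) <= K * q ^ k)%R -> ex_series (fun k => Rabs (p (f k)))).
  { intros p Hp f Hf. apply (ex_series_geom _ K q); auto. intros k. rewrite Rabs_Rabsolu.
    eapply Rle_trans; [apply Hp|apply Hf]. }
  pose proof (A _ fst_le_Cmod x Bx) as A1. pose proof (A _ snd_le_Cmod x Bx) as A2.
  pose proof (A _ fst_le_Cmod y By) as A3. pose proof (A _ snd_le_Cmod y By) as A4.
  pose proof (cser_fst _ _ Hx) as S1. pose proof (cser_snd _ _ Hx) as S2.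
  pose proof (cser_fst _ _ Hy) as S3. pose proof (cser_snd _ _ Hy) as S4.
  apply cser_components.
  - pose proof (is_series_minus _ _ _ _ (is_series_mult _ _ _ _ S1 S3 A1 A3) (is_series_mult _ _ _ _ S2 S4 A2 A4)) as P.
    apply is_series_ext with (2 := P). intros n. unfold conv. rewrite fst_csum, !sum_f_R0_rsum.
    unfold plus, opp; cbn -[rsum].
    match goal with |- ?u = _ => change (u = rsum (fun k => fst (x k) * fst (y (n - k)%nat) + -1 * (snd (x k) * snd (y (n - k)%nat)))%R (S n)) || idtac end.
    transitivity (rsum (fun k => fst (x k) * fst (y (n - k)%nat) + -1 * (snd (x k) * snd (y (n - k)%nat)))%R (S n)).
    + rewrite rsum_plus, rsum_scal. ring.
    + apply rsum_ext. intros. simpl. ring.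
  - pose proof (is_series_plus _ _ _ _ (is_series_mult _ _ _ _ S1 S4 A1 A4) (is_series_mult _ _ _ _ S2 S3 A2 A3)) as P.
    apply is_series_ext with (2 := P). intros n. unfold conv. rewrite snd_csum, !sum_f_R0_rsum.
    unfold plus; cbn -[rsum].
    transitivity (rsum (fun k => fst (x k) * snd (y (n - k)%nat) + snd (x k) * fst (y (n - k)%nat))%R (S n)).
    + rewrite rsum_plus. reflexivity.
    + apply rsum_ext. intros. simpl. ring.
Qed.

Lemma conv_pow a b z n : conv a b n * z ^ n = conv (fun k => a k * z ^ k) (fun k => b k * z ^ k) n.
Proof.
  unfold conv. rewrite <- csum_scal_r. apply csum_ext. intros k Hk.
  replace (z ^ n) with (z ^ k * z ^ (n - k)) by (rewrite <- Cpow_add_r; f_equal; lia). ring.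
Qed.

Lemma csums_mult a b R0 f g : (forall z, (Cmod z < R0)%R -> csums a z (f z)) ->
  (forall z, (Cmod z < R0)%R -> csums b z (g z)) ->
  forall z, (Cmod z < R0)%R -> csums (conv a b) z (f z * g z).
Proof.
  intros Ha Hb z Hz. destruct (between _ _ Hz (Cmod_ge_0 z)) as [Hp Hp0].
  set (p := ((Cmod z + R0) / 2)%R) in *.
  destruct (csums_pbound a p f) as [M1 H1]; [lra|intros; apply Ha; lra|].
  destruct (csums_pbound b p g) as [M2 H2]; [lra|intros; apply Hb; lra|].
  assert (Q : (0 <= Cmod z / p < 1)%R) by (apply ratio_lt1; lra).
  apply cser_ext with (conv (fun k => a k * z ^ k) (fun k => b k * z ^ k)).
  { intros; symmetry; apply conv_pow. }
  apply cser_mult with (Rmax M1 M2) (Cmod z / p)%R; auto; try apply Ha; try apply Hb; auto.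
  - intros k. eapply Rle_trans; [apply (pbound_term a p M1); auto|].
    apply Rmult_le_compat_r; [apply pow_le; lra|apply Rmax_l].
  - intros k. eapply Rle_trans; [apply (pbound_term b p M2); auto|].
    apply Rmult_le_compat_r; [apply pow_le; lra|apply Rmax_r].
Qed.

Lemma holo_mult R0 f g f' g' : holo R0 f f' -> holo R0 g g' ->
  holo R0 (fun z => f z * g z) (fun z => f' z * g z + f z * g' z).
Proof.
  intros Hf Hg z Hz. destruct (Hf z Hz) as [F1 F2], (Hg z Hz) as [G1 G2]. split.
  - apply cderiv_mult; auto.
  - pose proof (cderiv_ccont _ _ _ F1). pose proof (cderiv_ccont _ _ _ G1).
    apply ccont_plus; apply ccont_mult; auto.
Qed.

Lemma holo_inv R0 f f' : holo R0 f f' -> (forall z, (Cmod z < R0)%R -> f z <> 0) ->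
  holo R0 (fun z => / f z) (fun z => - f' z / (f z * f z)).
Proof.
  intros Hf Hz z Hzz. destruct (Hf z Hzz) as [F1 F2]. pose proof (cderiv_ccont _ _ _ F1). split.
  - apply cderiv_inv; auto.
  - apply ccont_mult; [apply ccont_opp; auto|].
    apply (ccont_inv (fun z => f z * f z)); [apply ccont_mult; auto|apply Cmult_neq_0; auto].
Qed.

Lemma holo_const R0 f : (forall z, (Cmod z < R0)%R -> cderiv f z 0) ->
  forall z, (Cmod z < R0)%R -> f z = f 0.
Proof.
  intros Hf z Hz.
  assert (H : forall t, (0 <= t <= 1)%R -> rderiv (fun t => f (RtoC t * z)) t 0).
  { intros t Ht. replace (RtoC 0) with (0 * z * 1) by ring.
    apply (rderiv_comp (fun w => f (w * z)) RtoC).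
    - apply (cderiv_comp f (fun w => w * z)).
      + apply cderiv_exact. intros; ring.
      + apply Hf. rewrite Cmod_mult, Cmod_RtoC by lra. pose proof (Cmod_ge_0 z). nra.
    - intros e He. exists 1%R. split; [lra|]. intros h _. rewrite RtoC_plus.
      replace (RtoC t + RtoC h - RtoC t - RtoC h * 1) with (RtoC 0) by ring. rewrite Cmod_0.
      pose proof (Rabs_pos h). nra. }
  transitivity (f (RtoC 1 * z)); [f_equal; ring|].
  transitivity (f (RtoC 0 * z)); [|f_equal; ring]. symmetry.
  apply injective_projections.
  - apply (eq_is_derive (V := R_NormedModule) (fun t => fst (f (RtoC t * z)))); [|lra].
    intros t Ht. apply (rderiv_fst (fun t => f (RtoC t * z)) t 0). auto.
  - apply (eq_is_derive (V := R_NormedModule) (fun t => snd (f (RtoC t * z)))); [|lra].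
    intros t Ht. apply (rderiv_snd (fun t => f (RtoC t * z)) t 0). auto.
Qed.

(** * Logarithms and kernels of negative type *)

(** The coefficients of the primitive of [l] that vanishes at 0; for [l = Y' / Y] with [Y 0 = 1] it
    is the logarithm of [Y]. *)
Definition logcoef (l : nat -> C) (k : nat) : C :=
  match k with O => 0 | S m => / RtoC (INR (S m)) * l m end.

Lemma INR_S_nz m : RtoC (INR (S m)) <> 0.
Proof. intros E. apply RtoC_inj in E. pose proof (lt_0_INR (S m) ltac:(lia)). lra. Qed.

Lemma cdcoef_logcoef l k : cdcoef (logcoef l) k = l k.
Proof. unfold cdcoef, logcoef. field. apply INR_S_nz. Qed.

Lemma logcoef_csums l R0 q : (forall z, (Cmod z < R0)%R -> csums l z (q z)) ->
  forall z, (Cmod z < R0)%R -> csums (logcoef l) z (ctotal (fun k => logcoef l k * z ^ k)).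
Proof.
  intros Hl z Hz. destruct (between _ _ Hz (Cmod_ge_0 z)) as [Hp Hp0].
  set (p := ((Cmod z + R0) / 2)%R) in *.
  destruct (csums_pbound l p q) as [M HM]; [lra|intros; apply Hl; lra|].
  apply csums_exists with p (M * p)%R; auto; [|lra].
  assert (HM0 : (0 <= M)%R) by (apply (pbound_nonneg l p M); auto; lra).
  intros [|k]; unfold logcoef.
  - rewrite Cmod_0. simpl. nra.
  - rewrite Cmod_mult, Cmod_inv, Cmod_RtoC by (apply INR_S_nz || apply pos_INR).
    specialize (HM k). change (p ^ S k)%R with (p * p ^ k)%R.
    assert (H1 : (/ INR (S k) <= 1)%R).
    { rewrite <- Rinv_1. apply Rinv_le_contravar; [lra|]. rewrite S_INR. pose proof (pos_INR k). lra. }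
    assert (0 <= Cmod (l k) * p ^ k)%R by (apply Rmult_le_pos; [apply Cmod_ge_0|apply pow_le; lra]).
    assert (0 < / INR (S k))%R by (apply Rinv_0_lt_compat, lt_0_INR; lia).
    replace (/ INR (S k) * Cmod (l k) * (p * p ^ k))%R with (/ INR (S k) * ((Cmod (l k) * p ^ k) * p))%R by ring.
    apply Rle_trans with (1 * (M * p))%R; [|lra]. apply Rmult_le_compat; try lra; nra.
Qed.

Lemma cdot_div (v g : C) : g <> 0 -> (cdot g v / cdot g g)%R = fst (v / g).
Proof.
  intros Hg. assert (H : cdot g g <> 0%R).
  { rewrite <- Cmod_sq. apply pow_nonzero. apply Cmod_gt_0 in Hg. lra. }
  unfold cdot in *. unfold Cdiv, Cinv. simpl in *. field. nra.
Qed.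

Lemma ln_Cmod_derive (g : R -> C) t v : rderiv g t v -> g t <> 0 ->
  is_derive (fun s => ln (cdot (g s) (g s))) t (2 * fst (v / g t)%C)%R.
Proof.
  intros Hg Hz. rewrite <- cdot_div by auto.
  assert (Hp : (0 < cdot (g t) (g t))%R).
  { rewrite <- Cmod_sq. apply pow_lt, Cmod_gt_0; auto. }
  pose proof (rderiv_fst _ _ _ Hg) as D1. pose proof (rderiv_snd _ _ _ Hg) as D2.
  replace (2 * (cdot (g t) v / cdot (g t) (g t)))%R with
    ((fst v * fst (g t) + fst (g t) * fst v + (snd v * snd (g t) + snd (g t) * snd v)) * / cdot (g t) (g t))%R.
  2: { unfold cdot at 2. field. lra. }
  apply (is_derive_comp (V := R_NormedModule) ln (fun s => cdot (g s) (g s))).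
  - apply is_derive_Reals. apply derivable_pt_lim_ln. auto.
  - unfold cdot. apply (is_derive_plus (V := R_NormedModule) (fun s => fst (g s) * fst (g s))%R (fun s => snd (g s) * snd (g s))%R).
    + apply is_derive_Reals. apply is_derive_Reals in D1.
      apply (derivable_pt_lim_mult (fun s => fst (g s)) (fun s => fst (g s))); auto.
    + apply is_derive_Reals. apply is_derive_Reals in D2.
      apply (derivable_pt_lim_mult (fun s => snd (g s)) (fun s => snd (g s))); auto.
Qed.

Lemma rderiv_ray f (z : C) t d : cderiv f (RtoC t * z) d -> rderiv (fun s => f (RtoC s * z)) t (d * z).
Proof.
  intros H. replace (d * z) with (d * z * 1) by ring.
  apply (rderiv_comp (fun w => f (w * z)) RtoC).
  - apply (cderiv_comp f (fun w => w * z)); auto. apply cderiv_exact. intros; ring.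
  - intros e He. exists 1%R. split; [lra|]. intros h _. rewrite RtoC_plus.
    replace (RtoC t + RtoC h - RtoC t - RtoC h * 1) with (RtoC 0) by ring. rewrite Cmod_0.
    pose proof (Rabs_pos h). nra.
Qed.

(** Only the real part of the logarithm is described, so no branch has to be chosen: [ln |Y|^2] and
    twice the real part of the series have the same derivative along the ray from 0. *)
Lemma log_series R0 Y Y' l z : holo R0 Y Y' -> (forall z, (Cmod z < R0)%R -> Y z <> 0) -> Y 0 = 1 ->
  (forall z, (Cmod z < R0)%R -> csums l z (Y' z / Y z)) -> (Cmod z < R0)%R ->
  exists s, csums (logcoef l) z s /\ ln (cdot (Y z) (Y z)) = (2 * fst s)%R.
Proof.
  intros HY Hnz H0 Hl Hz. pose proof (logcoef_csums l R0 _ Hl) as HL.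
  set (L := fun z => ctotal (fun k => logcoef l k * z ^ k)) in *.
  exists (L z). split; [apply HL; auto|].
  assert (HdL : forall w, (Cmod w < R0)%R -> cderiv L w (Y' w / Y w)).
  { intros w Hw. replace (Y' w / Y w) with (dsum (logcoef l) w).
    - apply pser_cderiv' with R0; auto.
    - apply cser_unique with (fun k => cdcoef (logcoef l) k * w ^ k).
      + apply (pser_dsum _ R0 L); auto.
      + apply cser_ext with (2 := Hl w Hw). intros k. rewrite cdcoef_logcoef. reflexivity. }
  set (P := fun t : R => RtoC t * z).
  set (phi := fun t : R => (ln (cdot (Y (P t)) (Y (P t))) - 2 * fst (L (P t)))%R).
  assert (E : phi 0%R = phi 1%R).
  { apply (eq_is_derive (V := R_NormedModule) phi); [|lra]. intros t Ht.
    assert (Htz : (Cmod (P t) < R0)%R).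
    { unfold P. rewrite Cmod_mult, Cmod_RtoC by lra. pose proof (Cmod_ge_0 z). nra. }
    replace (zero : R_NormedModule) with
      (minus (2 * fst (Y' (P t) * z / Y (P t))%C)%R (2 * fst (Y' (P t) / Y (P t) * z)%C)%R).
    2: { unfold minus, plus, opp, zero; simpl.
         replace (Y' (P t) * z / Y (P t)) with (Y' (P t) / Y (P t) * z) by (unfold Cdiv; ring).
         simpl. ring. }
    apply (is_derive_minus (V := R_NormedModule) (fun t => ln (cdot (Y (P t)) (Y (P t)))) (fun t => 2 * fst (L (P t)))%R).
    - apply (ln_Cmod_derive (fun t => Y (P t))).
      + apply rderiv_ray. apply HY; auto.
      + apply Hnz; auto.
    - apply (is_derive_scal (fun t => fst (L (P t)))).
      apply (rderiv_fst (fun t => L (P t)) t (Y' (P t) / Y (P t) * z)).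
      apply rderiv_ray, HdL; auto. }
  unfold phi, P in E.
  replace (RtoC 0 * z) with (RtoC 0) in E by ring. replace (RtoC 1 * z) with z in E by ring.
  assert (L0 : L 0 = 0).
  { assert (H00 : (Cmod (RtoC 0) < R0)%R) by (rewrite Cmod_0; pose proof (Cmod_ge_0 z); lra).
    apply cser_unique with (1 := HL _ H00).
    apply (csums_at_0 (logcoef l)). }
  rewrite L0, H0 in E. replace (cdot 1 1) with 1%R in E by (unfold cdot; simpl; ring).
  replace (fst (RtoC 0)) with 0%R in E by reflexivity. rewrite ln_1 in E. lra.
Qed.

Lemma log_1_minus (u : C) : (Cmod u < 1)%R ->
  exists s, csums (logcoef (fun _ => - (1))) u s /\ ln (cdot (1 - u) (1 - u)) = (2 * fst s)%R.
Proof.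
  intros Hu.
  assert (Hnz : forall z : C, (Cmod z < 1)%R -> 1 - z <> 0).
  { intros z Hz E. apply Ceq_minus in E. rewrite <- E, Cmod_1 in Hz. lra. }
  apply (log_series 1 (fun z => 1 - z) (fun _ => - (1))); auto.
  - intros z Hz. split; [apply cderiv_exact; intros; ring|apply ccont_const].
  - ring.
  - intros z Hz e He. destruct (pow_small (Cmod z) (e * Cmod (1 - z))) as [N HN].
    + split; [apply Cmod_ge_0|auto].
    + apply Rmult_lt_0_compat; auto. apply Cmod_gt_0; auto.
    + exists N. intros n Hn. rewrite (csum_scal (- (1)) (fun k => z ^ k)).
      assert (0 < Cmod (1 - z))%R by (apply Cmod_gt_0; auto).
      replace (- (1) * csum (fun k => z ^ k) n - - (1) / (1 - z)) with (z ^ n / (1 - z)).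
      2: { pose proof (cgeom_sum z n) as G.
           assert (G2 : csum (fun k => z ^ k) n = (1 - z ^ n) / (1 - z)) by (rewrite <- G; field; auto).
           rewrite G2. field. auto. }
      rewrite Cmod_div, Cmod_pow by auto. specialize (HN n Hn).
      apply Rmult_lt_reg_r with (Cmod (1 - z)); auto. unfold Rdiv. rewrite Rmult_assoc, Rinv_l by lra. lra.
Qed.

Local Open Scope R_scope.

(** * Quadratic forms of kernels and the logarithmic energy *)

Definition qf (n : nat) (a : nat -> R) (K : nat -> nat -> R) : R :=
  rsum (fun j => rsum (fun k => a j * a k * K j k) n) n.

Lemma qf_ext n a K K' : (forall j k, (j < n)%nat -> (k < n)%nat -> K j k = K' j k) -> qf n a K = qf n a K'.
Proof. intros H. apply rsum_ext. intros j Hj. apply rsum_ext. intros k Hk. rewrite H; auto. Qed.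

Lemma qf_plus n a K K' : qf n a (fun j k => K j k + K' j k) = qf n a K + qf n a K'.
Proof.
  unfold qf. rewrite <- rsum_plus. apply rsum_ext. intros j _. rewrite <- rsum_plus.
  apply rsum_ext. intros; ring.
Qed.

Lemma qf_scal n a c K : qf n a (fun j k => c * K j k) = c * qf n a K.
Proof.
  unfold qf. rewrite <- rsum_scal. apply rsum_ext. intros j _. rewrite <- rsum_scal.
  apply rsum_ext. intros; ring.
Qed.

Lemma qf_rsum n a (K : nat -> nat -> nat -> R) m :
  qf n a (fun j k => rsum (fun i => K i j k) m) = rsum (fun i => qf n a (K i)) m.
Proof.
  induction m; simpl.
  - unfold qf. apply rsum_0. intros. apply rsum_0. intros; ring.
  - rewrite qf_plus, IHm. reflexivity.
Qed.

Lemma qf_left n a l : rsum a n = 0 -> qf n a (fun j _ => l j) = 0.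
Proof.
  intros H. apply rsum_0. intros j _. rewrite (rsum_ext _ (fun k => (a j * l j) * a k)) by (intros; ring).
  rewrite rsum_scal, H. ring.
Qed.

Lemma qf_right n a l : rsum a n = 0 -> qf n a (fun _ k => l k) = 0.
Proof.
  intros H. unfold qf. rewrite rsum_swap. apply rsum_0. intros k _.
  rewrite (rsum_ext _ (fun j => (a k * l k) * a j)) by (intros; ring). rewrite rsum_scal, H. ring.
Qed.

(** Each factor of the power is absorbed by passing to the weights [a j * u j], [a j * v j] or
    [a j * w j]; since the induction changes the weights, [a] is quantified last. *)
Lemma qf_pow_nonneg n (u v w : nat -> R) m : forall a,
  0 <= qf n a (fun j k => (u j * u k + v j * v k + w j * w k) ^ m).
Proof.
  induction m; intros a.
  - unfold qf. rewrite (rsum_ext _ (fun j => rsum a n * a j)).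
    + rewrite rsum_scal. apply Rle_0_sqr.
    + intros j _. rewrite (rsum_ext _ (fun k => a j * a k)) by (intros; simpl; ring). rewrite rsum_scal. ring.
  - assert (E : qf n a (fun j k => (u j * u k + v j * v k + w j * w k) ^ S m) =
      qf n (fun j => a j * u j) (fun j k => (u j * u k + v j * v k + w j * w k) ^ m) +
      qf n (fun j => a j * v j) (fun j k => (u j * u k + v j * v k + w j * w k) ^ m) +
      qf n (fun j => a j * w j) (fun j k => (u j * u k + v j * v k + w j * w k) ^ m)).
    { unfold qf. rewrite <- !rsum_plus. apply rsum_ext. intros j _. rewrite <- !rsum_plus.
      apply rsum_ext. intros k _. simpl. ring. }
    rewrite E. pose proof (IHm (fun j => a j * u j)). pose proof (IHm (fun j => a j * v j)).
    pose proof (IHm (fun j => a j * w j)). lra.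
Qed.

Lemma is_lim_seq_rsum (F : nat -> nat -> R) (L : nat -> R) n : (forall j, (j < n)%nat -> is_lim_seq (fun m => F m j) (L j)) ->
  is_lim_seq (fun m => rsum (F m) n) (rsum L n).
Proof.
  induction n; intros H; simpl.
  - apply is_lim_seq_const.
  - apply (is_lim_seq_plus' (fun m => rsum (F m) n) (fun m => F m n)); [apply IHn; auto|apply H; lia].
Qed.

Lemma is_lim_seq_qf n a (F : nat -> nat -> nat -> R) (L : nat -> nat -> R) :
  (forall j k, (j < n)%nat -> (k < n)%nat -> is_lim_seq (fun m => F m j k) (L j k)) ->
  is_lim_seq (fun m => qf n a (F m)) (qf n a L).
Proof.
  intros H. apply is_lim_seq_rsum. intros j Hj. apply is_lim_seq_rsum. intros k Hk.
  apply (is_lim_seq_scal_l (fun m => F m j k) (a j * a k) (L j k)); auto.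
Qed.

Lemma cser_fst_lim f l : cser f l -> is_lim_seq (fun m => rsum (fun k => fst (f k)) m) (fst l).
Proof.
  intros H. apply is_lim_seq_spec. intros e. destruct (H e (cond_pos e)) as [N HN]. exists N.
  intros n Hn. rewrite <- fst_csum. eapply Rle_lt_trans; [|apply (HN n Hn)].
  apply (fst_le_Cmod (csum f n - l)%C).
Qed.

Lemma RtoC_pow (x : R) n : (RtoC x ^ n)%C = RtoC (x ^ n).
Proof. induction n; simpl; [reflexivity|]. rewrite IHn, RtoC_mult. reflexivity. Qed.

(* [- log (1 - k) = k + k^2/2 + ...], and powers of a positive semidefinite kernel are again
   positive semidefinite (Schur). *)
Lemma qf_log_nonpos n (u v w a : nat -> R) :
  (forall j k, (j < n)%nat -> (k < n)%nat -> Rabs (u j * u k + v j * v k + w j * w k) < 1) ->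
  qf n a (fun j k => ln (1 - (u j * u k + v j * v k + w j * w k))) <= 0.
Proof.
  intros H. set (K := fun j k => u j * u k + v j * v k + w j * w k) in *.
  set (cf := fun m => match m with O => 0 | S i => - / INR (S i) end).
  assert (L : is_lim_seq (fun m => qf n a (fun j k => rsum (fun i => cf i * K j k ^ i) m))
     (qf n a (fun j k => ln (1 - K j k)))).
  { apply is_lim_seq_qf. intros j k Hj Hk. specialize (H j k Hj Hk).
    destruct (log_1_minus (RtoC (K j k))) as (s & Hs & E); [rewrite Cmod_R; exact H|].
    assert (E2 : ln (1 - K j k) = fst s).
    { replace (cdot (1 - RtoC (K j k)) (1 - RtoC (K j k))) with ((1 - K j k) * (1 - K j k)) in E
        by (unfold cdot; simpl; ring).
      apply Rabs_lt_between in H. change (K j k) with (u j * u k + v j * v k + w j * w k) in *.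
      rewrite ln_mult in E by lra. lra. }
    rewrite E2. apply is_lim_seq_ext with (2 := cser_fst_lim _ _ Hs).
    intros m. apply rsum_ext. intros i _. rewrite RtoC_pow. destruct i; unfold logcoef, cf.
    - simpl. ring.
    - rewrite <- RtoC_inv by (apply not_0_INR; lia). rewrite <- !RtoC_opp, <- !RtoC_mult. cbn [fst RtoC]. ring. }
  apply (is_lim_seq_le _ (fun _ => 0) _ 0) with (2 := L); [|apply is_lim_seq_const].
  intros m. rewrite qf_rsum. apply Rle_trans with (rsum (fun _ => 0) m); [|rewrite rsum_0; auto; lra].
  apply rsum_le. intros i _. rewrite qf_scal.
  pose proof (qf_pow_nonneg n u v w i a) as P. fold K in P. unfold cf. destruct i; [lra|].
  assert (0 < / INR (S i)) by (apply Rinv_0_lt_compat, lt_0_INR; lia).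
  change (fun j k => K j k ^ S i) with (fun j k => (u j * u k + v j * v k + w j * w k) ^ S i). nra.
Qed.

(* With [v = (|w|^2, sqrt(2d) Re w, sqrt(2d) Im w) / (d + |w|^2)] (stereographic projection),
   [d (d + |w - w'|^2) = (d + |w|^2) (d + |w'|^2) (1 - <v, v'>)]. *)
Lemma energy_real n (a : nat -> R) (z : nat -> C) d : 0 < d -> rsum a n = 0 ->
  qf n a (fun j k => ln (d + cdot (z j - z k) (z j - z k))) <= 0.
Proof.
  intros Hd Ha.
  set (N := fun j => cdot (z j) (z j)).
  assert (HN : forall j, 0 <= N j).
  { intros j. unfold N. rewrite <- Cmod_sq. apply pow2_ge_0. }
  assert (Hs : sqrt (2 * d) * sqrt (2 * d) = 2 * d) by (apply sqrt_sqrt; lra).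
  set (s := sqrt (2 * d)) in *. clearbody s.
  set (u := fun j => N j / (d + N j)).
  set (v := fun j => s * fst (z j) / (d + N j)).
  set (w := fun j => s * snd (z j) / (d + N j)).
  assert (EK : forall j k, u j * u k + v j * v k + w j * w k =
    (N j * N k + 2 * d * cdot (z j) (z k)) / ((d + N j) * (d + N k))).
  { intros j k. pose proof (HN j). pose proof (HN k). unfold u, v, w, cdot. rewrite <- Hs. field. lra. }
  assert (E1 : forall j k, 1 - (u j * u k + v j * v k + w j * w k) =
    d * (d + cdot (z j - z k) (z j - z k)) / ((d + N j) * (d + N k))).
  { intros j k. rewrite EK. pose proof (HN j). pose proof (HN k).
    replace (cdot (z j - z k) (z j - z k)) with (N j + N k - 2 * cdot (z j) (z k))
      by (unfold N, cdot; simpl; ring).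
    field. lra. }
  assert (HD : forall p q : C, 0 <= cdot (p - q) (p - q)) by (intros; rewrite <- Cmod_sq; apply pow2_ge_0).
  (* The summands that depend on one index only drop out, because the weights sum to 0. *)
  rewrite (qf_ext n a _ (fun j k => ((ln (d + N j) + ln (d + N k)) + (- ln d))
     + ln (1 - (u j * u k + v j * v k + w j * w k)))).
  - rewrite !qf_plus, (qf_left n a (fun j => ln (d + N j))), (qf_right n a (fun j => ln (d + N j))),
      (qf_left n a (fun _ => - ln d)) by auto.
    apply Rle_trans with (0 + 0 + 0 + 0); [|lra]. apply Rplus_le_compat_l. apply qf_log_nonpos.
    intros j k _ _. pose proof (HN j) as Hj. pose proof (HN k) as Hk.
    assert (P : 0 < (d + N j) * (d + N k)) by (apply Rmult_lt_0_compat; lra).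
    apply Rabs_lt_between. split.
    (* The bound from below rests on [|z_j + z_k|^2 >= 0], as the bound from above rests on
       [|z_j - z_k|^2 >= 0]. *)
    + rewrite EK. apply Rmult_lt_reg_r with ((d + N j) * (d + N k)); auto.
      unfold Rdiv. rewrite Rmult_assoc, Rinv_l by lra.
      pose proof (HD (z j) (- z k)%C) as Q.
      replace (cdot (z j - - z k) (z j - - z k)) with (N j + N k + 2 * cdot (z j) (z k)) in Q
        by (unfold N, cdot; simpl; ring).
      assert (0 <= N j * N k) by (apply Rmult_le_pos; auto). nra.
    + assert (0 < 1 - (u j * u k + v j * v k + w j * w k)); [|lra].
      rewrite E1. apply Rdiv_lt_0_compat; auto. pose proof (HD (z j) (z k)). nra.
  - intros j k _ _. rewrite E1. pose proof (HN j). pose proof (HN k). pose proof (HD (z j) (z k)).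
    rewrite ln_div, !ln_mult by (try apply Rmult_lt_0_compat; lra). ring.
Qed.

(** The Hermitian form [sum g_j conj(g_k) K j k] reduced to its real part: [cdot (g j) (g k)] is the
    real part of [g_j conj(g_k)]. *)
Definition hf (n : nat) (g : nat -> C) (K : nat -> nat -> R) : R :=
  rsum (fun j => rsum (fun k => cdot (g j) (g k) * K j k) n) n.

Arguments hf n%_nat_scope g%_C_scope K%_R_scope.

Lemma hf_qf n g K : hf n g K = qf n (fun j => fst (g j)) K + qf n (fun j => snd (g j)) K.
Proof.
  unfold hf, qf. rewrite <- rsum_plus. apply rsum_ext. intros j _. rewrite <- rsum_plus.
  apply rsum_ext. intros k _. unfold cdot. ring.
Qed.

Lemma energy n (g z : nat -> C) d : 0 < d -> csum g n = 0 ->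
  hf n g (fun j k => ln (d + cdot (z j - z k) (z j - z k))) <= 0.
Proof.
  intros Hd Hg. rewrite hf_qf.
  pose proof (energy_real n (fun j => fst (g j)) z d Hd). pose proof (energy_real n (fun j => snd (g j)) z d Hd).
  rewrite <- fst_csum, <- snd_csum, Hg in *. simpl in *. specialize (H eq_refl). specialize (H0 eq_refl). lra.
Qed.

Local Open Scope C_scope.

(** * The area theorem *)

Definition rt (N j : nat) : C := cis (2 * PI * INR j / INR N).

Lemma Cmod_rt N j : Cmod (rt N j) = 1%R.
Proof. apply Cmod_cis. Qed.

Lemma rt_conj N j : rt N j * Cconj (rt N j) = 1.
Proof. unfold rt. rewrite <- cis_inv. field. apply cis_nz. Qed.

Lemma cis_ne_1 t : (0 < t < 2 * PI)%R -> cis t <> 1.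
Proof.
  intros Ht E. assert (Hc : cos t = 1%R) by (change (cos t) with (fst (cis t)); rewrite E; reflexivity).
  replace t with (2 * (t / 2))%R in Hc by field. rewrite cos_2a_sin in Hc.
  assert (0 < sin (t / 2))%R by (apply sin_gt_0; lra). nra.
Qed.

Lemma rt_pow_swap N j k : rt N j ^ k = rt N k ^ j.
Proof. unfold rt. rewrite !cis_pow. f_equal. unfold Rdiv. ring. Qed.

Lemma rt_pow_N N k : (0 < N)%nat -> rt N k ^ N = 1.
Proof.
  intros HN. unfold rt. rewrite cis_pow.
  replace (INR N * (2 * PI * INR k / INR N))%R with (0 + 2 * INR k * PI)%R.
  - unfold cis. rewrite cos_period, sin_period, cos_0, sin_0. reflexivity.
  - field. apply not_0_INR. lia.
Qed.

Lemma rt_sum N k : (0 < k < N)%nat -> csum (fun j => rt N j ^ k) N = 0.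
Proof.
  intros Hk. rewrite (csum_ext _ (fun j => rt N k ^ j)) by (intros; apply rt_pow_swap).
  assert (Hne : 1 - rt N k <> 0).
  { intros E. apply Ceq_minus in E. symmetry in E. revert E. apply cis_ne_1.
    assert (0 < INR k)%R by (apply lt_0_INR; lia). assert (INR k < INR N)%R by (apply lt_INR; lia).
    pose proof PI_RGT_0. split.
    - apply Rdiv_lt_0_compat; [|lra]. apply Rmult_lt_0_compat; lra.
    - apply Rmult_lt_reg_r with (INR N); [lra|]. unfold Rdiv. rewrite Rmult_assoc, Rinv_l by lra.
      rewrite Rmult_1_r. apply Rmult_lt_compat_l; lra. }
  pose proof (cgeom_sum (rt N k) N) as G. rewrite rt_pow_N in G by lia.
  replace (csum (fun j => rt N k ^ j) N) with (csum (fun k0 => rt N k ^ k0) N * (1 - rt N k) / (1 - rt N k)) by (field; auto).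
  rewrite G. unfold Cdiv. ring.
Qed.

Lemma Cconj_mult z w : Cconj (z * w) = Cconj z * Cconj w.
Proof. ceq; ring. Qed.

Lemma Cconj_pow z n : Cconj (z ^ n) = Cconj z ^ n.
Proof. induction n; simpl; [ceq; ring|]. rewrite Cconj_mult, IHn. reflexivity. Qed.

Lemma Cconj_conj z : Cconj (Cconj z) = z.
Proof. ceq; ring. Qed.

Lemma Cconj_RtoC x : Cconj (RtoC x) = RtoC x.
Proof. ceq; ring. Qed.

(** The two inequalities say [|a - b| < N], which excludes aliasing. *)
Lemma rt_orth N a b : (a < b + N)%nat -> (b < a + N)%nat ->
  csum (fun j => rt N j ^ a * Cconj (rt N j) ^ b) N = if Nat.eq_dec a b then RtoC (INR N) else 0.
Proof.
  intros H1 H2. destruct (Nat.eq_dec a b) as [->|Hne].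
  - rewrite (csum_ext _ (fun _ => 1)).
    + rewrite csum_const. ring.
    + intros j _. rewrite <- Cpow_mult_l, rt_conj, Cpow_1_l. reflexivity.
  - destruct (Nat.lt_ge_cases b a) as [H|H].
    + rewrite (csum_ext _ (fun j => rt N j ^ (a - b))).
      * apply rt_sum. lia.
      * intros j _. replace (rt N j ^ a) with (rt N j ^ (a - b) * rt N j ^ b) by (rewrite <- Cpow_add_r; f_equal; lia).
        rewrite <- Cmult_assoc, <- Cpow_mult_l, rt_conj, Cpow_1_l. ring.
    + rewrite (csum_ext _ (fun j => Cconj (rt N j ^ (b - a)))).
      * rewrite <- csum_conj, rt_sum by lia. ceq; ring.
      * intros j _. rewrite Cconj_pow.
        replace (Cconj (rt N j) ^ b) with (Cconj (rt N j) ^ a * Cconj (rt N j) ^ (b - a)) by (rewrite <- Cpow_add_r; f_equal; lia).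
        rewrite Cmult_assoc, <- Cpow_mult_l, rt_conj, Cpow_1_l. ring.
Qed.

Definition zz (r : R) (N j : nat) : C := RtoC r * rt N j.

Lemma Cmod_zz r N j : (0 <= r)%R -> Cmod (zz r N j) = r.
Proof. intros. unfold zz. rewrite Cmod_mult, Cmod_rt, Cmod_RtoC by auto. ring. Qed.

(* On [|z| = r] this is [- 1/z + sum_(k <= M) k b_k z^k], a truncation of [z H'(z)] for [H = 1/z + sum b_k z^k]. *)
Definition gam (b : nat -> C) (r : R) (M : nat) (z : C) : C :=
  - / RtoC (r ^ 2) * Cconj z + csum (fun k => RtoC (INR k) * b k * z ^ k) (S M).

Lemma RtoC_nz (x : R) : x <> 0%R -> RtoC x <> 0.
Proof. intros H E. apply H, RtoC_inj, E. Qed.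

Lemma zz_conj r N j : Cconj (zz r N j) = RtoC r * Cconj (rt N j).
Proof. unfold zz. rewrite Cconj_mult, Cconj_RtoC. reflexivity. Qed.

Lemma gam_fourier b r M N p q : (0 < r)%R -> (p + M < q + N)%nat -> (q < p + N)%nat -> (q + 1 < p + N)%nat ->
  (p < q + 1 + N)%nat ->
  csum (fun j => gam b r M (zz r N j) * (rt N j ^ p * Cconj (rt N j) ^ q)) N =
  RtoC (INR N) * ((if Nat.eq_dec p (q + 1) then - / RtoC r else 0) +
    csum (fun k => if Nat.eq_dec (k + p) q then RtoC (INR k) * b k * RtoC r ^ k else 0) (S M)).
Proof.
  intros Hr H1 H2 H3 H4.
  rewrite (csum_ext _ (fun j => - / RtoC r * (rt N j ^ p * Cconj (rt N j) ^ (q + 1)) +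
    csum (fun k => RtoC (INR k) * b k * RtoC r ^ k * (rt N j ^ (k + p) * Cconj (rt N j) ^ q)) (S M))).
  - rewrite csum_plus, csum_scal, rt_orth, csum_swap by lia.
    rewrite Cmult_plus_distr_l. f_equal.
    + destruct (Nat.eq_dec p (q + 1)); ring.
    + rewrite <- csum_scal. apply csum_ext. intros k Hk. rewrite csum_scal, rt_orth by lia.
      destruct (Nat.eq_dec (k + p) q); ring.
  - intros j _. unfold gam. rewrite zz_conj, Cmult_plus_distr_r, <- csum_scal_r. f_equal.
    + rewrite Cpow_add_r. simpl. rewrite RtoC_mult, RtoC_mult. field.
      apply RtoC_nz; lra.
    + apply csum_ext. intros k Hk. unfold zz. rewrite Cpow_mult_l, Cpow_add_r. ring.
Qed.

Lemma gam_sum b r M N : (0 < r)%R -> (M + 1 < N)%nat -> csum (fun j => gam b r M (zz r N j)) N = 0.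
Proof.
  intros Hr HM. rewrite (csum_ext _ (fun j => gam b r M (zz r N j) * (rt N j ^ 0 * Cconj (rt N j) ^ 0))) by (intros; simpl; ring).
  rewrite gam_fourier by (auto; lia). destruct (Nat.eq_dec 0 (0 + 1)); [lia|].
  rewrite csum_0; [ring|]. intros k Hk. destruct (Nat.eq_dec (k + 0) 0); auto.
  replace k with O by lia. simpl. ring.
Qed.

Definition trunc (M : nat) (b : nat -> C) (k : nat) : C := if Compare_dec.le_dec k M then b k else 0.

Lemma gam_neg b r M N i : (0 < r)%R -> (1 <= i)%nat -> (M + i + 1 < N)%nat ->
  csum (fun j => gam b r M (zz r N j) * Cconj (rt N j) ^ i) N
  = RtoC (INR N) * (RtoC (INR i) * trunc M b i * RtoC r ^ i).
Proof.
  intros Hr Hi HN. rewrite (csum_ext _ (fun j => gam b r M (zz r N j) * (rt N j ^ 0 * Cconj (rt N j) ^ i))) by (intros; simpl; ring).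
  rewrite gam_fourier by (auto; lia). destruct (Nat.eq_dec 0 (i + 1)); [lia|]. f_equal. rewrite Cplus_0_l.
  unfold trunc. destruct (Compare_dec.le_dec i M).
  - rewrite (csum_single _ _ i); [|lia|].
    + destruct (Nat.eq_dec (i + 0) i); [reflexivity|lia].
    + intros k Hk Hne. destruct (Nat.eq_dec (k + 0) i); [lia|auto].
  - rewrite csum_0; [ring|]. intros k Hk. destruct (Nat.eq_dec (k + 0) i); [lia|auto].
Qed.

Lemma gam_pos b r M N i : (0 < r)%R -> (1 <= i)%nat -> (M + i + 1 < N)%nat ->
  csum (fun j => gam b r M (zz r N j) * rt N j ^ i) N
  = RtoC (INR N) * (if Nat.eq_dec i 1 then - / RtoC r else 0).
Proof.
  intros Hr Hi HN. rewrite (csum_ext _ (fun j => gam b r M (zz r N j) * (rt N j ^ i * Cconj (rt N j) ^ 0))) by (intros; simpl; ring).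
  rewrite gam_fourier by (auto; lia). f_equal.
  rewrite csum_0; [|intros k Hk; destruct (Nat.eq_dec (k + i) 0); [lia|auto]].
  replace (0 + 1)%nat with 1%nat by lia. destruct (Nat.eq_dec i 1); ring.
Qed.

(** Apart from the frequency -1, [gam] has positive frequencies only, so of a polynomial without
    constant term it sees nothing but the linear coefficient. *)
Lemma gam_poly b r M N c d : (0 < r)%R -> (1 <= d)%nat -> (M + d + 1 < N)%nat -> c O = RtoC 0 ->
  csum (fun j => gam b r M (zz r N j) * csum (fun i => c i * zz r N j ^ i) (S d)) N = RtoC (INR N) * - c 1%nat.
Proof.
  intros Hr Hd HN Hc.
  rewrite (csum_ext _ (fun j => csum (fun i => c i * RtoC r ^ i * (gam b r M (zz r N j) * rt N j ^ i)) (S d))).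
  2: { intros j _. rewrite <- csum_scal. apply csum_ext. intros i _. unfold zz. rewrite Cpow_mult_l. ring. }
  rewrite csum_swap, (csum_single _ _ 1%nat); [|lia|].
  - rewrite csum_scal, gam_pos by (auto; lia). simpl. field. apply RtoC_nz. lra.
  - intros i Hi Hne. rewrite csum_scal. destruct i; [rewrite Hc; ring|].
    rewrite gam_pos by (auto; lia). destruct (Nat.eq_dec (S i) 1); [lia|]. ring.
Qed.

Lemma gam_conj_pow b r M N m : (0 < r)%R -> (M + m + 1 < N)%nat ->
  csum (fun j => Cconj (gam b r M (zz r N j)) * zz r N j ^ m) N
  = RtoC (INR N) * (RtoC (INR m) * Cconj (trunc M b m) * RtoC (r ^ 2) ^ m).
Proof.
  intros Hr HN. destruct m.
  - rewrite (csum_ext _ (fun j => Cconj (gam b r M (zz r N j)))) by (intros; simpl; ring).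
    rewrite <- csum_conj, gam_sum by (auto; lia). simpl. ceq; ring.
  - set (m' := S m) in *.
    rewrite (csum_ext _ (fun j => RtoC r ^ m' * Cconj (gam b r M (zz r N j) * Cconj (rt N j) ^ m'))).
    + rewrite csum_scal, <- csum_conj, gam_neg by (auto; unfold m'; lia).
      rewrite !Cconj_mult, !Cconj_RtoC, Cconj_pow, Cconj_RtoC.
      replace (RtoC (r ^ 2)) with (RtoC r * RtoC r) by (rewrite <- RtoC_mult; f_equal; ring).
      rewrite Cpow_mult_l. ring.
    + intros j _. rewrite Cconj_mult, Cconj_pow, Cconj_conj. unfold zz. rewrite Cpow_mult_l. ring.
Qed.

Lemma gam_bound b r M : (0 < r)%R -> exists G, (0 <= G)%R /\ forall z, Cmod z = r -> (Cmod (gam b r M z) <= G)%R.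
Proof.
  intros Hr. exists (/ r ^ 2 * r + rsum (fun k => INR k * Cmod (b k) * r ^ k) (S M))%R. split.
  - assert (0 < / r ^ 2 * r)%R by (apply Rmult_lt_0_compat; auto; apply Rinv_0_lt_compat, pow_lt; auto).
    assert (0 <= rsum (fun k => INR k * Cmod (b k) * r ^ k) (S M))%R; [|lra].
    apply rsum_nonneg. intros. apply Rmult_le_pos; [apply Rmult_le_pos; [apply pos_INR|apply Cmod_ge_0]|apply pow_le; lra].
  - intros z Hz. unfold gam. eapply Rle_trans; [apply Cmod_triangle|]. apply Rplus_le_compat.
    + rewrite Cmod_mult, Cmod_opp, Cmod_conj, Hz, Cmod_inv, Cmod_RtoC.
      * lra.
      * apply pow_le; lra.
      * apply RtoC_nz, pow_nonzero; lra.
    + eapply Rle_trans; [apply Cmod_csum|]. right. apply rsum_ext. intros k _.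
      rewrite !Cmod_mult, Cmod_pow, Hz, Cmod_RtoC by apply pos_INR. reflexivity.
Qed.

(** The contribution of the imaginary parts vanishes: [K] is symmetric, while the imaginary part of
    [g_j conj(g_k)] is antisymmetric. *)
Lemma hf_re_symmetric n (g : nat -> C) (K : nat -> nat -> C) : (forall j k, K j k = K k j) ->
  hf n g (fun j k => fst (K j k)) = fst (csum (fun k => csum (fun j => g j * K j k) n * Cconj (g k)) n).
Proof.
  intros HK.
  assert (A : rsum (fun j => rsum (fun k => (snd (g j) * fst (g k) - fst (g j) * snd (g k)) * snd (K j k))%R n) n = 0%R).
  { set (W := fun j k => ((snd (g j) * fst (g k) - fst (g j) * snd (g k)) * snd (K j k))%R).
    assert (E : rsum (fun j => rsum (W j) n) n = (- rsum (fun j => rsum (W j) n) n)%R).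
    { rewrite rsum_swap at 1.
      replace (- rsum (fun j => rsum (W j) n) n)%R with (-1 * rsum (fun j => rsum (W j) n) n)%R by ring.
      rewrite <- rsum_scal. apply rsum_ext. intros j _. rewrite <- rsum_scal. apply rsum_ext. intros k _.
      unfold W. rewrite (HK j k). ring. }
    unfold W in E. lra. }
  rewrite fst_csum.
  rewrite (rsum_ext _ (fun k => rsum (fun j => cdot (g j) (g k) * fst (K j k)
     + -1 * ((snd (g j) * fst (g k) - fst (g j) * snd (g k)) * snd (K j k)))%R n)).
  - rewrite rsum_swap. unfold hf.
    rewrite (rsum_ext (fun j => rsum (fun i => cdot (g j) (g i) * fst (K j i) + -1 * ((snd (g j) * fst (g i) - fst (g j) * snd (g i)) * snd (K j i)))%R n)
      (fun j => rsum (fun k => cdot (g j) (g k) * fst (K j k))%R n + -1 * rsum (fun k => (snd (g j) * fst (g k) - fst (g j) * snd (g k)) * snd (K j k))%R n)%R).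
    + rewrite rsum_plus, rsum_scal, A. ring.
    + intros j _. rewrite rsum_plus, rsum_scal. reflexivity.
  - intros k _. rewrite <- csum_scal_r, fst_csum. apply rsum_ext. intros j _. unfold cdot. simpl. ring.
Qed.

Lemma hf_plus n g K K' : hf n g (fun j k => K j k + K' j k)%R = (hf n g K + hf n g K')%R.
Proof. rewrite !hf_qf, !qf_plus. ring. Qed.

Lemma hf_scal n g c K : hf n g (fun j k => c * K j k)%R = (c * hf n g K)%R.
Proof. rewrite !hf_qf, !qf_scal. ring. Qed.

Lemma hf_rsum n g (K : nat -> nat -> nat -> R) m :
  hf n g (fun j k => rsum (fun i => K i j k) m) = rsum (fun i => hf n g (K i)) m.
Proof.
  rewrite hf_qf, !qf_rsum, <- rsum_plus. apply rsum_ext. intros. rewrite hf_qf. reflexivity.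
Qed.

Lemma hf_ext n g K K' : (forall j k, (j < n)%nat -> (k < n)%nat -> K j k = K' j k) -> hf n g K = hf n g K'.
Proof. intros H. rewrite !hf_qf. f_equal; apply qf_ext; auto. Qed.

Lemma hf_const n g c : csum g n = 0 -> hf n g (fun _ _ => c) = 0%R.
Proof.
  intros H. rewrite hf_qf, !(qf_left n _ (fun _ => c)); [ring| |].
  - rewrite <- snd_csum, H. reflexivity.
  - rewrite <- fst_csum, H. reflexivity.
Qed.

Lemma hf_abs_le n g K G (Q : nat -> nat -> R) : (forall j, (j < n)%nat -> (Cmod (g j) <= G)%R) ->
  (forall j k, (j < n)%nat -> (k < n)%nat -> (Rabs (K j k) <= Q j k)%R) ->
  (Rabs (hf n g K) <= G ^ 2 * rsum (fun j => rsum (Q j) n) n)%R.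
Proof.
  intros HG HQ. unfold hf. eapply Rle_trans; [apply Rabs_rsum|]. rewrite <- rsum_scal. apply rsum_le. intros j Hj.
  eapply Rle_trans; [apply Rabs_rsum|]. rewrite <- rsum_scal. apply rsum_le. intros k Hk.
  rewrite Rabs_mult. apply Rmult_le_compat; try apply Rabs_pos; auto.
  eapply Rle_trans; [apply cdot_abs_le|]. simpl. rewrite Rmult_1_r.
  apply Rmult_le_compat; try apply Cmod_ge_0; auto.
Qed.

(** The divided difference [(z^k - w^k) / (z - w)], extended to the diagonal ([ee_diff],
    [ee_diag]). *)
Definition ee (k : nat) (z w : C) : C := csum (fun i => z ^ i * w ^ (k - 1 - i)) k.

(** The part of degree [m], homogeneous in [(z, w)], of the quotient of differences [Tk]; the factor
    [z w] comes from clearing [1/z - 1/w]. *)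
Definition tc (b : nat -> C) (z w : C) (m : nat) : C :=
  match m with O => 1 | S k => - b k * (z * w * ee k z w) end.

(* For [H = 1/z + sum b_k z^k], [Tk b z w = (H z - H w) / (1/z - 1/w)]. *)
Definition Tk (b : nat -> C) (z w : C) : C := ctotal (tc b z w).

Lemma csum_rev f n : csum f n = csum (fun k => f (n - 1 - k)%nat) n.
Proof.
  induction n; [reflexivity|]. rewrite (csum_S_l (fun k => f (S n - 1 - k)%nat)). simpl csum at 1.
  replace (S n - 1 - 0)%nat with n by lia. rewrite IHn.
  rewrite (csum_ext (fun k => f (S n - 1 - S k)%nat) (fun k => f (n - 1 - k)%nat)) by (intros; f_equal; lia). ring.
Qed.

Lemma ee_sym k z w : ee k z w = ee k w z.
Proof.
  unfold ee. rewrite csum_rev. apply csum_ext. intros i Hi.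
  replace (k - 1 - (k - 1 - i))%nat with i by lia. ring.
Qed.

Lemma tc_sym b z w m : tc b z w m = tc b w z m.
Proof. destruct m; simpl; auto. rewrite ee_sym. ring. Qed.

Lemma ee_S k z w : ee (S k) z w = w * ee k z w + z ^ k.
Proof.
  unfold ee. cbn [csum]. rewrite <- csum_scal. f_equal.
  - apply csum_ext. intros i Hi. replace (S k - 1 - i)%nat with (S (k - 1 - i)) by lia. rewrite Cpow_S. ring.
  - replace (S k - 1 - k)%nat with O by lia. simpl. ring.
Qed.

Lemma ee_diff k z w : (z - w) * ee k z w = z ^ k - w ^ k.
Proof.
  induction k; [unfold ee; simpl; ring|]. rewrite ee_S, !Cpow_S.
  replace ((z - w) * (w * ee k z w + z ^ k)) with (w * ((z - w) * ee k z w) + (z - w) * z ^ k) by ring.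
  rewrite IHk. ring.
Qed.

Lemma ee_diag k z : ee k z z = RtoC (INR k) * z ^ (k - 1).
Proof.
  induction k; [unfold ee; simpl; ring|]. rewrite ee_S, IHk, S_INR, RtoC_plus.
  replace (S k - 1)%nat with k by lia. destruct k; [simpl; ring|].
  replace (S k - 1)%nat with k by lia. simpl. ring.
Qed.

Lemma ee_bound k z w rho : (Cmod z <= rho)%R -> (Cmod w <= rho)%R -> (rho * Cmod (ee k z w) <= INR k * rho ^ k)%R.
Proof.
  intros Hz Hw. pose proof (Cmod_ge_0 z).
  induction k; [unfold ee; simpl; rewrite Cmod_0; lra|].
  rewrite ee_S, S_INR. apply Rle_trans with (rho * (rho * Cmod (ee k z w) + rho ^ k))%R.
  - apply Rmult_le_compat_l; [lra|]. eapply Rle_trans; [apply Cmod_triangle|].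
    rewrite Cmod_mult, Cmod_pow. apply Rplus_le_compat.
    + apply Rmult_le_compat_r; [apply Cmod_ge_0|auto].
    + apply pow_incr. lra.
  - simpl. assert (0 <= rho ^ k)%R by (apply pow_le; lra). nra.
Qed.

Lemma zwee_bound k z w rho : (Cmod z <= rho)%R -> (Cmod w <= rho)%R ->
  (Cmod (z * w * ee k z w) <= INR k * rho ^ S k)%R.
Proof.
  intros Hz Hw. pose proof (Cmod_ge_0 z). pose proof (Cmod_ge_0 w). pose proof (Cmod_ge_0 (ee k z w)).
  rewrite !Cmod_mult. pose proof (ee_bound k z w rho Hz Hw).
  apply Rle_trans with (rho * (rho * Cmod (ee k z w)))%R.
  - rewrite <- Rmult_assoc. apply Rmult_le_compat_r; auto. apply Rmult_le_compat; auto.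
  - simpl. replace (INR k * (rho * rho ^ k))%R with (rho * (INR k * rho ^ k))%R by ring.
    apply Rmult_le_compat_l; lra.
Qed.

Lemma tc_homog b z w t m : tc b (t * z) (t * w) m = tc b z w m * t ^ m.
Proof.
  destruct m; [simpl; ring|]. unfold tc.
  assert (E : t * ee m (t * z) (t * w) = t ^ m * ee m z w).
  { induction m; [unfold ee; simpl; ring|]. rewrite !ee_S.
    replace (t * (t * w * ee m (t * z) (t * w) + (t * z) ^ m))
      with (t * w * (t * ee m (t * z) (t * w)) + t * (t * z) ^ m) by ring.
    rewrite IHm, Cpow_mult_l, Cpow_S. ring. }
  replace (- b m * (t * z * (t * w) * ee m (t * z) (t * w)))
    with (- b m * (z * w * t) * (t * ee m (t * z) (t * w))) by ring.
  rewrite E, Cpow_S. ring.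
Qed.

Lemma tc_pbound b q M rho sig : (0 < q)%R -> (0 < rho)%R -> (0 < sig)%R -> (rho * sig < q)%R -> pbound b q M ->
  exists M', (0 <= M')%R /\ forall z w, (Cmod z <= rho)%R -> (Cmod w <= rho)%R -> pbound (tc b z w) sig M'.
Proof.
  intros Hq Hr Hs Hrs HM. assert (HM0 : (0 <= M)%R) by (apply (pbound_nonneg b q M); auto; lra).
  assert (Hx : (0 <= rho * sig / q < 1)%R).
  { split; [apply Rdiv_le_0_compat; nra|]. apply Rmult_lt_reg_r with q; auto. unfold Rdiv.
    rewrite Rmult_assoc, Rinv_l; lra. }
  destruct (INR_pow_bounded _ Hx) as (K & HK & B).
  exists (1 + M * K * (rho * sig))%R. split.
  { assert (0 <= M * K * (rho * sig))%R by (apply Rmult_le_pos; nra). lra. }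
  intros z w Hz Hw [|k].
  - simpl. rewrite Cmod_1. assert (0 <= M * K * (rho * sig))%R by (apply Rmult_le_pos; nra). lra.
  - unfold tc. rewrite Cmod_mult, Cmod_opp. pose proof (zwee_bound k z w rho Hz Hw) as P.
    assert (Hsk : (0 < sig ^ S k)%R) by (apply pow_lt; auto).
    apply Rle_trans with (Cmod (b k) * (INR k * rho ^ S k) * sig ^ S k)%R.
    { apply Rmult_le_compat_r; [lra|]. apply Rmult_le_compat_l; [apply Cmod_ge_0|auto]. }
    specialize (HM k). specialize (B k). assert (Hqk : (0 < q ^ k)%R) by (apply pow_lt; auto).
    replace (Cmod (b k) * (INR k * rho ^ S k) * sig ^ S k)%R
      with ((Cmod (b k) * q ^ k) * (INR k * (rho * sig / q) ^ k) * (rho * sig))%R.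
    2: { unfold Rdiv. rewrite !Rpow_mult_distr, pow_inv. simpl. field. lra. }
    apply Rle_trans with (M * K * (rho * sig))%R; [|lra].
    apply Rmult_le_compat_r; [nra|]. apply Rmult_le_compat; auto.
    + apply Rmult_le_pos; [apply Cmod_ge_0|lra].
    + apply Rmult_le_pos; [apply pos_INR|]. apply pow_le; lra.
Qed.

(** Radius of convergence at least 1. *)
Definition all_pbound (b : nat -> C) : Prop := forall q, (0 < q < 1)%R -> exists M, pbound b q M.

(** The kernel on the complex line through [(z, w)]: by homogeneity it is [Tk b (t z) (t w)], a
    power series in the single variable [t], to which [log_series] applies. *)
Definition Yk (b : nat -> C) (z w t : C) : C := ctotal (fun m => tc b z w m * t ^ m).

Lemma Yk_Tk b z w t : Yk b z w t = Tk b (t * z) (t * w).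
Proof.
  unfold Yk, Tk. f_equal. apply functional_extensionality. intros m. symmetry. apply tc_homog.
Qed.

Lemma Yk_csums b rho z w t : all_pbound b -> (0 < rho < 1)%R -> (Cmod z <= rho)%R -> (Cmod w <= rho)%R ->
  (Cmod t < / rho)%R -> csums (tc b z w) t (Yk b z w t).
Proof.
  intros Hb Hr Hz Hw Ht. destruct (between _ _ Ht (Cmod_ge_0 t)) as [Hs Hs0].
  set (sig := ((Cmod t + / rho) / 2)%R) in *.
  assert (Hrs : (rho * sig < 1)%R).
  { apply Rlt_le_trans with (rho * / rho)%R; [apply Rmult_lt_compat_l; lra|right; field; lra]. }
  assert (Hrs0 : (0 < rho * sig)%R) by (apply Rmult_lt_0_compat; lra).
  destruct (Hb ((rho * sig + 1) / 2)%R) as [M HM]; [lra|].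
  destruct (tc_pbound b ((rho * sig + 1) / 2) M rho sig) as (M' & _ & HM'); try lra; auto.
  apply csums_exists with sig M'; auto. lra.
Qed.

Lemma Tk_cser b z w : all_pbound b -> (Cmod z < 1)%R -> (Cmod w < 1)%R -> cser (tc b z w) (Tk b z w).
Proof.
  intros Hb Hz Hw. set (m := Rmax (Cmod z) (Cmod w)).
  assert (Hm : (0 <= m < 1)%R).
  { unfold m. split; [apply Rle_trans with (2 := Rmax_l _ _), Cmod_ge_0|apply Rmax_lub_lt; auto]. }
  assert (H1 : (Cmod 1 < / ((m + 1) / 2))%R).
  { rewrite Cmod_1. rewrite <- Rinv_1 at 1. apply Rinv_lt_contravar; lra. }
  pose proof (Rmax_l (Cmod z) (Cmod w)). pose proof (Rmax_r (Cmod z) (Cmod w)). fold m in H, H0.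
  pose proof (Yk_csums b ((m + 1) / 2) z w 1 Hb ltac:(lra) ltac:(lra) ltac:(lra) H1) as Y.
  rewrite Yk_Tk in Y. replace (1 * z) with z in Y by ring. replace (1 * w) with w in Y by ring.
  apply cser_ext with (2 := Y). intros k. rewrite Cpow_1_l. ring.
Qed.

(** This is [(w - z) Tk = z w (H z - H w)] with all denominators cleared, so that it holds at 0 and
    on the diagonal too. *)
Lemma Tk_diff b B z w : all_pbound b -> (forall z, (Cmod z < 1)%R -> csums b z (B z)) ->
  (Cmod z < 1)%R -> (Cmod w < 1)%R -> (w - z) * Tk b z w = (w - z) + z * w * (B z - B w).
Proof.
  intros Hb HB Hz Hw. apply cser_unique with (fun m => (w - z) * tc b z w m).
  - apply cser_scal, Tk_cser; auto.
  - apply (cser_shift _ _ 1). cbn [csum].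
    replace ((w - z) + z * w * (B z - B w) - (0 + (w - z) * tc b z w 0)) with (z * w * (B z - B w)) by (simpl; ring).
    apply cser_ext with (fun k => z * w * (b k * z ^ k - b k * w ^ k)).
    + intros k. replace (1 + k)%nat with (S k) by lia. unfold tc.
      replace ((w - z) * (- b k * (z * w * ee k z w))) with (b k * (z * w) * ((z - w) * ee k z w)) by ring.
      rewrite ee_diff. ring.
    + apply cser_scal, cser_minus; apply HB; auto.
Qed.

(** On the diagonal the kernel is [- z^2 H'(z)]; its nonvanishing there is local univalence. *)
Lemma Tk_diag b B B' z : all_pbound b -> (forall z, (Cmod z < 1)%R -> csums b z (B z)) ->
  (Cmod z < 1)%R -> cderiv B z B' -> Tk b z z = 1 - z * z * B'.
Proof.
  intros Hb HB Hz HB'. apply cser_unique with (tc b z z).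
  - apply Tk_cser; auto.
  - apply (cser_shift _ _ 1). cbn [csum].
    replace (1 - z * z * B' - (0 + tc b z z 0)) with (- (z * z) * B') by (simpl; ring).
    apply cser_ext with (fun k => - (z * z) * (RtoC (INR k) * b k * z ^ (k - 1))).
    + intros k. replace (1 + k)%nat with (S k) by lia. unfold tc. rewrite ee_diag. ring.
    + apply cser_scal. apply csums_deriv_shift.
      rewrite (cderiv_unique B z B' (dsum b z)); auto.
      * apply (pser_dsum b 1 B); auto.
      * apply (pser_cderiv' b 1 B); auto.
Qed.

Lemma Tk_zero b w : all_pbound b -> (Cmod w < 1)%R -> Tk b 0 w = 1.
Proof.
  intros Hb Hw. apply cser_unique with (tc b 0 w).
  - apply Tk_cser; auto. rewrite Cmod_0. lra.
  - replace (RtoC 1) with (csum (tc b 0 w) 1) by (simpl; ring).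
    apply cser_finite. intros [|k] Hk; [lia|]. simpl. ring.
Qed.

Lemma Tk_sym b z w : Tk b z w = Tk b w z.
Proof. unfold Tk. f_equal. apply functional_extensionality. intros; apply tc_sym. Qed.

Lemma pow_lipschitz (z z' : C) rho a : (Cmod z <= rho)%R -> (Cmod z' <= rho)%R ->
  (rho * Cmod (z ^ a - z' ^ a) <= INR a * rho ^ a * Cmod (z - z'))%R.
Proof.
  intros H H'. rewrite <- ee_diff, Cmod_mult. pose proof (ee_bound a z z' rho H H').
  pose proof (Cmod_ge_0 (z - z')). nra.
Qed.

(** In each monomial [z^(i+1) w^(k-i)] one variable is changed at a time. *)
Lemma zwee_lipschitz k z w z' w' rho : (0 < rho)%R -> (Cmod z <= rho)%R -> (Cmod w <= rho)%R ->
  (Cmod z' <= rho)%R -> (Cmod w' <= rho)%R ->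
  (Cmod (z * w * ee k z w - z' * w' * ee k z' w') <= (2 * INR k ^ 2) * rho ^ k * (Cmod (z - z') + Cmod (w - w')))%R.
Proof.
  intros Hr Hz Hw Hz' Hw'. set (D := (Cmod (z - z') + Cmod (w - w'))%R).
  assert (HD : (0 <= D)%R) by (unfold D; pose proof (Cmod_ge_0 (z - z')); pose proof (Cmod_ge_0 (w - w')); lra).
  replace (z * w * ee k z w - z' * w' * ee k z' w')
    with (csum (fun i => z ^ S i * w ^ (k - i) - z' ^ S i * w' ^ (k - i)) k).
  2: { rewrite csum_minus. unfold ee. rewrite <- !csum_scal. f_equal; apply csum_ext; intros i Hi;
       (replace (k - i)%nat with (S (k - 1 - i)) by lia); rewrite !Cpow_S; ring. }
  eapply Rle_trans; [apply Cmod_csum|].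
  apply Rle_trans with (rsum (fun _ => 2 * INR k * rho ^ k * D)%R k).
  2: { rewrite rsum_const. right. ring. }
  apply rsum_le. intros i Hi.
  replace (z ^ S i * w ^ (k - i) - z' ^ S i * w' ^ (k - i))
    with ((z ^ S i - z' ^ S i) * w ^ (k - i) + z' ^ S i * (w ^ (k - i) - w' ^ (k - i))) by ring.
  eapply Rle_trans; [apply Cmod_triangle|]. rewrite !Cmod_mult, !Cmod_pow.
  pose proof (pow_lipschitz z z' rho (S i) Hz Hz') as P1.
  pose proof (pow_lipschitz w w' rho (k - i) Hw Hw') as P2.
  assert (Q1 : (Cmod w ^ (k - i) <= rho ^ (k - i))%R) by (apply pow_incr; split; [apply Cmod_ge_0|auto]).
  assert (Q2 : (Cmod z' ^ S i <= rho ^ S i)%R) by (apply pow_incr; split; [apply Cmod_ge_0|auto]).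
  assert (HI : (INR (S i) <= INR k)%R) by (apply le_INR; lia).
  assert (HI2 : (INR (k - i) <= INR k)%R) by (apply le_INR; lia).
  assert (Epow : (rho ^ S i * rho ^ (k - i) = rho * rho ^ k)%R).
  { rewrite <- pow_add. replace (S i + (k - i))%nat with (S k) by lia. reflexivity. }
  apply Rmult_le_reg_l with rho; auto.
  set (X := Cmod (z ^ S i - z' ^ S i)) in *. set (Y := Cmod (w ^ (k - i) - w' ^ (k - i))) in *.
  assert (0 <= X)%R by apply Cmod_ge_0. assert (0 <= Y)%R by apply Cmod_ge_0.
  assert (Hrk : (0 < rho ^ k)%R) by (apply pow_lt; auto).
  assert (Hri : (0 < rho ^ S i)%R) by (apply pow_lt; auto).
  assert (Hrki : (0 < rho ^ (k - i))%R) by (apply pow_lt; auto).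
  assert (0 <= INR (S i))%R by apply pos_INR. assert (0 <= INR (k - i))%R by apply pos_INR.
  assert (A1 : (rho * (X * Cmod w ^ (k - i)) <= INR k * (rho * rho ^ k) * Cmod (z - z'))%R).
  { apply Rle_trans with ((rho * X) * rho ^ (k - i))%R.
    - rewrite <- Rmult_assoc. apply Rmult_le_compat_l; [nra|auto].
    - apply Rle_trans with (INR (S i) * rho ^ S i * Cmod (z - z') * rho ^ (k - i))%R.
      + apply Rmult_le_compat_r; lra.
      + rewrite <- Epow. replace (INR (S i) * rho ^ S i * Cmod (z - z') * rho ^ (k - i))%R
          with (INR (S i) * (rho ^ S i * rho ^ (k - i)) * Cmod (z - z'))%R by ring.
        apply Rmult_le_compat_r; [apply Cmod_ge_0|]. apply Rmult_le_compat_r; [nra|auto]. }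
  assert (A2 : (rho * (Cmod z' ^ S i * Y) <= INR k * (rho * rho ^ k) * Cmod (w - w'))%R).
  { apply Rle_trans with (rho ^ S i * (rho * Y))%R.
    - replace (rho * (Cmod z' ^ S i * Y))%R with (Cmod z' ^ S i * (rho * Y))%R by ring.
      apply Rmult_le_compat_r; [nra|auto].
    - apply Rle_trans with (rho ^ S i * (INR (k - i) * rho ^ (k - i) * Cmod (w - w')))%R.
      + apply Rmult_le_compat_l; lra.
      + rewrite <- Epow. replace (rho ^ S i * (INR (k - i) * rho ^ (k - i) * Cmod (w - w')))%R
          with (INR (k - i) * (rho ^ S i * rho ^ (k - i)) * Cmod (w - w'))%R by ring.
        apply Rmult_le_compat_r; [apply Cmod_ge_0|]. apply Rmult_le_compat_r; [nra|auto]. }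
  assert (0 <= INR k)%R by apply pos_INR.
  assert (0 <= INR k * (rho * rho ^ k) * D)%R by (apply Rmult_le_pos; [apply Rmult_le_pos; nra|auto]).
  unfold D in *. nra.
Qed.

Lemma Tk_lipschitz b rho : all_pbound b -> (0 < rho < 1)%R -> exists L, (0 <= L)%R /\
  forall z w z' w', (Cmod z <= rho)%R -> (Cmod w <= rho)%R -> (Cmod z' <= rho)%R -> (Cmod w' <= rho)%R ->
  (Cmod (Tk b z w - Tk b z' w') <= L * (Cmod (z - z') + Cmod (w - w')))%R.
Proof.
  intros Hb Hr. set (q := ((rho + 1) / 2)%R). destruct (Hb q) as [M HM]; [unfold q; lra|].
  assert (HM0 : (0 <= M)%R) by (apply (pbound_nonneg b q M); auto; unfold q; lra).
  assert (Hx : (0 <= rho / q < 1)%R).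
  { split; [apply Rdiv_le_0_compat; unfold q; lra|]. apply Rmult_lt_reg_r with q; [unfold q; lra|]. unfold Rdiv.
    rewrite Rmult_assoc, Rinv_l; unfold q; lra. }
  destruct (INR_sq_pow_bounded _ Hx) as (y & K & Hy & HK & B).
  exists (2 * M * K / (1 - y))%R. split.
  { apply Rdiv_le_0_compat; nra. }
  intros z w z' w' Hz Hw Hz' Hw'. set (D := (Cmod (z - z') + Cmod (w - w'))%R).
  assert (HD : (0 <= D)%R) by (unfold D; pose proof (Cmod_ge_0 (z - z')); pose proof (Cmod_ge_0 (w - w')); lra).
  assert (S1 : cser (fun m => tc b z w m - tc b z' w' m) (Tk b z w - Tk b z' w')).
  { apply cser_minus; apply Tk_cser; auto; lra. }
  apply (cser_shift _ _ 1) in S1. cbn [csum tc] in S1.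
  replace (Tk b z w - Tk b z' w' - (0 + (1 - 1))) with (Tk b z w - Tk b z' w') in S1 by ring.
  apply cser_le with (n0 := O) (2 := S1). intros n _.
  apply Rle_trans with ((2 * M * K * D) / (1 - y))%R; [|right; field; lra].
  apply csum_geom_bound; auto; [apply Rmult_le_pos; nra|].
  intros k. replace (1 + k)%nat with (S k) by lia. unfold tc.
  replace (- b k * (z * w * ee k z w) - - b k * (z' * w' * ee k z' w'))
    with (- b k * (z * w * ee k z w - z' * w' * ee k z' w')) by ring.
  rewrite Cmod_mult, Cmod_opp. pose proof (zwee_lipschitz k z w z' w' rho ltac:(lra) Hz Hw Hz' Hw') as P. fold D in P.
  specialize (HM k). specialize (B k). assert (Hqk : (0 < q ^ k)%R) by (apply pow_lt; unfold q; lra).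
  apply Rle_trans with (Cmod (b k) * (2 * INR k ^ 2 * rho ^ k * D))%R.
  { apply Rmult_le_compat_l; [apply Cmod_ge_0|auto]. }
  replace (Cmod (b k) * (2 * INR k ^ 2 * rho ^ k * D))%R
    with (2 * D * ((Cmod (b k) * q ^ k) * (INR k ^ 2 * (rho / q) ^ k)))%R.
  2: { unfold Rdiv. rewrite Rpow_mult_distr, pow_inv. field. lra. }
  replace (2 * M * K * D * y ^ k)%R with (2 * D * (M * (K * y ^ k)))%R by ring.
  apply Rmult_le_compat_l; [lra|]. apply Rmult_le_compat; auto.
  - apply Rmult_le_pos; [apply Cmod_ge_0|lra].
  - apply Rmult_le_pos; [apply pow2_ge_0|apply pow_le; lra].
Qed.

Lemma pair_cluster (u v : nat -> C) M : (forall n, Cmod (u n) <= M)%R -> (forall n, Cmod (v n) <= M)%R ->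
  exists a b, forall eps N, (0 < eps)%R -> exists n, (N <= n)%nat /\ (Cmod (u n - a) < eps)%R /\ (Cmod (v n - b) < eps)%R.
Proof.
  intros Hu Hv. destruct (complex_cluster u M Hu) as [a Ha].
  assert (Hp : forall n : nat, {p : nat | (n <= p)%nat /\ (Cmod (u p - a) < / (INR n + 1))%R}).
  { intros n. apply constructive_indefinite_description. apply (Ha (/ (INR n + 1))%R n).
    apply Rinv_0_lt_compat. pose proof (pos_INR n). lra. }
  set (p := fun n => proj1_sig (Hp n)).
  destruct (complex_cluster (fun n => v (p n)) M) as [b Hb]; [intros; apply Hv|].
  exists a, b. intros e N He. destruct (archimed_cor1 e He) as (K & HK & HK0).
  destruct (Hb e (Nat.max N K) He) as (n & Hn & Hbn).
  exists (p n). pose proof (proj2_sig (Hp n)) as [Hpn Han]. fold (p n) in Hpn, Han.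
  repeat split; [lia| |auto]. eapply Rlt_trans; [apply Han|]. eapply Rlt_trans; [|apply HK].
  apply Rinv_lt_contravar.
  - apply Rmult_lt_0_compat; [apply lt_0_INR; auto|pose proof (pos_INR n); lra].
  - assert (INR K <= INR n)%R by (apply le_INR; lia). lra.
Qed.

(** Compactness: points with [|Tk| < 1 / (n + 1)] would cluster at a zero of the continuous
    kernel. *)
Lemma Tk_lower b rho : all_pbound b -> (0 < rho < 1)%R ->
  (forall z w, (Cmod z < 1)%R -> (Cmod w < 1)%R -> Tk b z w <> 0) ->
  exists m0, (0 < m0)%R /\ forall z w, (Cmod z <= rho)%R -> (Cmod w <= rho)%R -> (m0 <= Cmod (Tk b z w))%R.
Proof.
  intros Hb Hr HT. apply NNPP. intros Hn.
  assert (Hu : forall n : nat, {x : C * C | (Cmod (fst x) <= rho)%R /\ (Cmod (snd x) <= rho)%R /\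
     (Cmod (Tk b (fst x) (snd x)) < / (INR n + 1))%R}).
  { intros n. apply constructive_indefinite_description. apply NNPP. intros Hne. apply Hn.
    exists (/ (INR n + 1))%R. split; [apply Rinv_0_lt_compat; pose proof (pos_INR n); lra|].
    intros z w Hz Hw. apply Rnot_lt_le. intros Hlt. apply Hne. exists (z, w). auto. }
  set (x := fun n => proj1_sig (Hu n)).
  assert (Hx : forall n, (Cmod (fst (x n)) <= rho)%R /\ (Cmod (snd (x n)) <= rho)%R /\
     (Cmod (Tk b (fst (x n)) (snd (x n))) < / (INR n + 1))%R) by (intros n; apply (proj2_sig (Hu n))).
  destruct (pair_cluster (fun n => fst (x n)) (fun n => snd (x n)) rho) as (z & w & Hc); [intros; apply Hx..|].
  assert (Hz : (Cmod z <= rho)%R).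
  { apply le_epsilon. intros e He. destruct (Hc e O He) as (n & _ & H1 & _). destruct (Hx n) as [H2 _].
    rewrite Cmod_minus_sym in H1. pose proof (Cmod_triangle_sub z (fst (x n))). lra. }
  assert (Hw : (Cmod w <= rho)%R).
  { apply le_epsilon. intros e He. destruct (Hc e O He) as (n & _ & _ & H1). destruct (Hx n) as (_ & H2 & _).
    rewrite Cmod_minus_sym in H1. pose proof (Cmod_triangle_sub w (snd (x n))). lra. }
  destruct (Tk_lipschitz b rho Hb Hr) as (L & HL & Lip).
  assert (Hpos : (0 < Cmod (Tk b z w))%R) by (apply Cmod_gt_0, HT; lra).
  set (e := (Cmod (Tk b z w) / (4 * (L + 1)))%R).
  assert (He : (0 < e)%R) by (apply Rdiv_lt_0_compat; lra).
  destruct (archimed_cor1 (Cmod (Tk b z w) / 2)) as (K & HK & HK0); [lra|].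
  destruct (Hc e K He) as (n & Hn1 & H1 & H2). destruct (Hx n) as (X1 & X2 & X3).
  specialize (Lip z w (fst (x n)) (snd (x n)) Hz Hw X1 X2).
  rewrite (Cmod_minus_sym z), (Cmod_minus_sym w) in Lip.
  pose proof (Cmod_triangle_sub (Tk b z w) (Tk b (fst (x n)) (snd (x n)))) as T.
  assert (L * (Cmod (fst (x n) - z) + Cmod (snd (x n) - w)) <= Cmod (Tk b z w) / 2)%R.
  { apply Rle_trans with ((L + 1) * (2 * e))%R; [apply Rmult_le_compat; try lra; pose proof (Cmod_ge_0 (fst (x n) - z)); pose proof (Cmod_ge_0 (snd (x n) - w)); lra|].
    right. unfold e. field. lra. }
  assert (/ (INR n + 1) < Cmod (Tk b z w) / 2)%R; [|lra].
  eapply Rlt_trans; [|apply HK]. apply Rinv_lt_contravar.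
  - apply Rmult_lt_0_compat; [apply lt_0_INR; auto|pose proof (pos_INR n); lra].
  - assert (INR K <= INR n)%R by (apply le_INR; lia). lra.
Qed.

(** Bookkeeping for [gam_poly], which sees a polynomial only through its linear coefficient [c1].
    Agreement is asked on [D] alone, since the coefficients of the logarithm are controlled on one
    circle only. *)
Definition cls (D : C -> Prop) (d : nat) (c1 : C) (F : C -> C) : Prop :=
  exists c : nat -> C, c O = RtoC 0 /\ c 1%nat = c1 /\ (forall i, (d < i)%nat -> c i = RtoC 0) /\
    forall z, D z -> F z = csum (fun i => c i * z ^ i) (S d).

Lemma cls_ext D d c1 F G : (forall z, D z -> F z = G z) -> cls D d c1 F -> cls D d c1 G.
Proof. intros E (c & H0 & H1 & H2 & H). exists c. repeat split; auto. intros. rewrite <- E; auto. Qed.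

Lemma cls_plus D d a b F G : cls D d a F -> cls D d b G -> cls D d (a + b) (fun z => F z + G z).
Proof.
  intros (c & H0 & H1 & H2 & H) (e & K0 & K1 & K2 & K). exists (fun i => c i + e i). repeat split.
  - rewrite H0, K0. ring.
  - congruence.
  - intros i Hi. rewrite H2, K2 by auto. ring.
  - intros z Dz. rewrite H, K, <- csum_plus by auto. apply csum_ext. intros; ring.
Qed.

Lemma cls_scal D d x a F : cls D d a F -> cls D d (x * a) (fun z => x * F z).
Proof.
  intros (c & H0 & H1 & H2 & H). exists (fun i => x * c i). repeat split.
  - rewrite H0. ring.
  - congruence.
  - intros i Hi. rewrite H2 by auto. ring.
  - intros z Dz. rewrite H, <- csum_scal by auto. apply csum_ext. intros; ring.
Qed.

Lemma cls_zero D d : cls D d 0 (fun _ => 0).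
Proof.
  exists (fun _ => 0). repeat split; auto. intros. rewrite csum_0; auto. intros; ring.
Qed.

Lemma cls_weaken D d d' a F : (d <= d')%nat -> cls D d a F -> cls D d' a F.
Proof.
  intros Hd (c & H0 & H1 & H2 & H). exists c. repeat split; auto.
  - intros; apply H2; lia.
  - intros z Dz. rewrite H by auto. replace (S d') with (S d + (d' - d))%nat by lia.
    rewrite csum_add, (csum_0 (fun k => c (S d + k)%nat * z ^ (S d + k))); [ring|].
    intros k _. rewrite H2 by lia. ring.
Qed.

(** A product of two polynomials without constant term has no linear term. *)
Lemma cls_mult D d e a b F G : cls D d a F -> cls D e b G -> cls D (d + e) 0 (fun z => F z * G z).
Proof.
  intros (c & H0 & H1 & H2 & H) (c' & K0 & K1 & K2 & K). exists (conv c c').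
  assert (Z : forall i, (d + e < i)%nat -> conv c c' i = RtoC 0).
  { intros i Hi. unfold conv. apply csum_0. intros k Hk. destruct (Nat.lt_ge_cases d k).
    - rewrite H2 by auto. ring.
    - rewrite (K2 (i - k)%nat) by lia. ring. }
  repeat split; auto.
  - unfold conv. simpl. rewrite H0. ring.
  - unfold conv. simpl. rewrite H0, K0. ring.
  - intros z Dz. rewrite H, K by auto.
    apply cser_unique with (fun k => conv c c' k * z ^ k).
    + apply (csums_mult c c' (Cmod z + 1) (fun z => csum (fun i => c i * z ^ i) (S d))
        (fun z => csum (fun i => c' i * z ^ i) (S e))).
      * intros w _. apply cser_finite. intros k Hk. rewrite H2 by lia. ring.
      * intros w _. apply cser_finite. intros k Hk. rewrite K2 by lia. ring.
      * lra.
    + apply cser_finite. intros k Hk. rewrite Z by lia. ring.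
Qed.

Lemma cls_csum D d n (a : nat -> C) (F : nat -> C -> C) : (forall j, (j < n)%nat -> cls D d (a j) (F j)) ->
  cls D d (csum a n) (fun z => csum (fun j => F j z) n).
Proof.
  induction n; intros H; simpl; [apply cls_zero|].
  apply (cls_plus D d (csum a n) (a n) (fun z => csum (fun j => F j z) n)); auto.
Qed.

Lemma cls_tc D b w k : cls D (S k) (- b (S k) * w ^ S k) (fun z => tc b z w (S (S k))).
Proof.
  exists (fun i => if Nat.eq_dec i 0 then RtoC 0 else if Compare_dec.le_dec i (S k) then - b (S k) * w ^ (S (S k) - i) else RtoC 0).
  repeat split; auto.
  - intros i Hi. destruct (Nat.eq_dec i 0); auto. destruct (Compare_dec.le_dec i (S k)); auto. lia.
  - intros z _. rewrite csum_S_l. destruct (Nat.eq_dec 0 0); [|lia]. unfold tc, ee.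
    rewrite <- !csum_scal. replace (0 * z ^ 0) with (RtoC 0) by ring. rewrite Cplus_0_l. apply csum_ext. intros i Hi.
    destruct (Nat.eq_dec (S i) 0); [lia|]. destruct (Compare_dec.le_dec (S i) (S k)); [|lia].
    replace (S (S k) - S i)%nat with (S (S k - 1 - i)) by lia. rewrite !Cpow_S. ring.
Qed.

(** Solving [l Y = Y'] for the coefficient of index [m] leaves [(m + 1)] times [tc] at [m + 1],
    minus products of earlier terms. By [cls_mult] these products do not touch the linear
    coefficient, which therefore stays explicit. *)
Lemma log_coef_cls (D : C -> Prop) b w (l : C -> nat -> C) : b O = RtoC 0 ->
  (forall z, D z -> forall m, conv (l z) (tc b z w) m = cdcoef (tc b z w) m) ->
  forall m, cls D (S m) (RtoC (INR (S m)) * (- b m * w ^ m)) (fun z => l z m).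
Proof.
  intros Hb0 Hrec.
  assert (T1 : forall z, tc b z w 1 = 0) by (intros; simpl; rewrite Hb0; ring).
  assert (T : forall k, cls D k (- b k * w ^ k) (fun z => tc b z w (S k))).
  { intros [|k]; [|apply cls_tc].
    replace (- b 0%nat * w ^ 0) with (RtoC 0) by (rewrite Hb0; ring).
    apply cls_ext with (fun _ => 0); [intros; rewrite T1; auto|apply cls_zero]. }
  induction m as [m IH] using (well_founded_induction Wf_nat.lt_wf).
  apply cls_ext with (fun z => RtoC (INR (S m)) * tc b z w (S m) + - (1) * csum (fun j => l z j * tc b z w (m - j)) m).
  { intros z Dz. pose proof (Hrec z Dz m) as R. unfold conv, cdcoef in R. cbn [csum] in R.
    rewrite Nat.sub_diag in R. change (tc b z w 0) with (RtoC 1) in R. rewrite <- R. ring. }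
  replace (RtoC (INR (S m)) * (- b m * w ^ m))
    with (RtoC (INR (S m)) * (- b m * w ^ m) + - (1) * csum (fun _ => 0) m) by (rewrite csum_0; [ring|auto]).
  apply cls_plus.
  - apply cls_scal. apply cls_weaken with m; auto.
  - apply cls_scal, cls_csum. intros j Hj. apply cls_weaken with (S j + (m - j - 1))%nat; [lia|].
    apply (cls_mult D (S j) (m - j - 1) (RtoC (INR (S j)) * (- b j * w ^ j)) (- b (m - j - 1)%nat * w ^ (m - j - 1))).
    + apply IH. lia.
    + apply cls_ext with (2 := T (m - j - 1)%nat). intros. f_equal. lia.
Qed.

Lemma holo_div R0 f f' g g' : holo R0 f f' -> holo R0 g g' -> (forall z, (Cmod z < R0)%R -> g z <> 0) ->
  exists h, holo R0 (fun z => f z / g z) h.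
Proof. intros Hf Hg Hz. eexists. apply holo_mult; [exact Hf|apply holo_inv; [exact Hg|auto]]. Qed.

(** The Grunsky expansion of the logarithm of [Tk], grouped by total degree [m]. Geometric decay in
    [m] requires the logarithm of [Yk] in a disk [|t| <= R1] with [R1 > 1], hence a lower bound for
    [|Tk|] on the polydisk of a radius larger than [r]. *)
Lemma grunsky_log b r : all_pbound b -> b O = RtoC 0 ->
  (forall z w, (Cmod z < 1)%R -> (Cmod w < 1)%R -> Tk b z w <> 0) -> (0 < r < 1)%R ->
  exists (n : nat -> C -> C -> C) (K q : R), (0 <= q < 1)%R /\ (0 <= K)%R /\
    (forall m z w, Cmod z = r -> Cmod w = r -> (Cmod (n m z w) <= K * q ^ m)%R) /\
    (forall m z w, n m z w = n m w z) /\
    (forall z w, Cmod z = r -> Cmod w = r -> exists s, cser (fun m => n m z w) s /\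
        ln (cdot (Tk b z w) (Tk b z w)) = (2 * fst s)%R) /\
    (forall z w, n O z w = RtoC 0) /\
    (forall m w, Cmod w = r -> cls (fun z => Cmod z = r) (S m) (- b m * w ^ m) (fun z => n (S m) z w)).
Proof.
  intros Hb Hb0 HT Hr.
  (* For [|z| = r] and [|t| <= R1] the point [t z] stays in the disk of radius [rho < 1]. The
     coefficients of the logarithmic derivative are taken on the circle of radius [R2] and estimated
     on that of radius [R3], with [1 < R3 < R2 < R1 < 1 / r]. *)
  set (rho := ((1 + r) / 2)%R). set (R1 := (rho / r)%R). set (R2 := ((1 + R1) / 2)%R). set (R3 := ((1 + R2) / 2)%R).
  assert (Hrho : (r < rho < 1)%R) by (unfold rho; lra).
  assert (HR1 : (1 < R1)%R).
  { unfold R1. apply Rmult_lt_reg_r with r; [lra|]. unfold Rdiv. rewrite Rmult_assoc, Rinv_l; lra. }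
  assert (HR1r : (R1 < / r)%R).
  { unfold R1. apply Rlt_le_trans with (1 * / r)%R; [|lra]. apply Rmult_lt_compat_r; [apply Rinv_0_lt_compat; lra|lra]. }
  assert (HR2 : (1 < R2 < R1)%R) by (unfold R2; lra). assert (HR3 : (1 < R3 < R2)%R) by (unfold R3; lra).
  destruct (Tk_lower b rho Hb ltac:(lra) HT) as (m0 & Hm0 & Hlow).
  set (sig := ((R1 + / r) / 2)%R).
  assert (Hsig : (r * sig < 1)%R).
  { apply Rlt_le_trans with (r * / r)%R; [apply Rmult_lt_compat_l; unfold sig; lra|right; field; lra]. }
  assert (Hsig0 : (0 < r * sig)%R) by (apply Rmult_lt_0_compat; unfold sig; lra).
  destruct (Hb ((r * sig + 1) / 2)%R) as [M HM]; [lra|].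
  destruct (tc_pbound b ((r * sig + 1) / 2) M r sig) as (M' & HM'0 & HM'); try lra; auto; [unfold sig; lra|].
  destruct (cdcoef_pbound sig R1) as (L & HL & HLb); [unfold sig; lra|].
  set (Md := (L * M')%R). assert (HMd : (0 <= Md)%R) by (unfold Md; nra).
  assert (Ycs : forall z w, Cmod z = r -> Cmod w = r -> forall t, (Cmod t < / r)%R -> csums (tc b z w) t (Yk b z w t)).
  { intros z w Hz Hw t Ht. apply (Yk_csums b r); auto; lra. }
  assert (Yh : forall z w, Cmod z = r -> Cmod w = r -> holo (/ r) (Yk b z w) (dsum (tc b z w))).
  { intros z w Hz Hw. apply pser_holo. apply Ycs; auto. }
  assert (Ylow : forall z w, Cmod z = r -> Cmod w = r -> forall t, (Cmod t <= R1)%R -> (m0 <= Cmod (Yk b z w t))%R).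
  { intros z w Hz Hw t Ht. rewrite Yk_Tk.
    apply Hlow; rewrite Cmod_mult, ?Hz, ?Hw; (apply Rle_trans with (R1 * r)%R; [apply Rmult_le_compat_r; lra|]);
      right; unfold R1; field; lra. }
  assert (Ynz : forall z w, Cmod z = r -> Cmod w = r -> forall t, (Cmod t <= R1)%R -> Yk b z w t <> 0).
  { intros z w Hz Hw t Ht E. pose proof (Ylow z w Hz Hw t Ht). rewrite E, Cmod_0 in H. lra. }
  set (Cb := (Md / (1 - R2 / R1) / m0)%R).
  assert (HR21 : (0 <= R2 / R1 < 1)%R).
  { split; [apply Rdiv_le_0_compat; lra|]. apply Rmult_lt_reg_r with R1; [lra|]. unfold Rdiv. rewrite Rmult_assoc, Rinv_l; lra. }
  assert (HCb : (0 <= Cb)%R) by (unfold Cb; apply Rdiv_le_0_compat; [apply Rdiv_le_0_compat; lra|auto]).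
  assert (Ydb : forall z w, Cmod z = r -> Cmod w = r -> forall t, (Cmod t <= R2)%R ->
     (Cmod (dsum (tc b z w) t / Yk b z w t) <= Cb)%R).
  { intros z w Hz Hw t Ht. rewrite Cmod_div by (apply Ynz; auto; lra). unfold Cb.
    pose proof (Ylow z w Hz Hw t ltac:(lra)) as Hl.
    apply Rmult_le_compat; [apply Cmod_ge_0|left; apply Rinv_0_lt_compat; lra| |apply Rinv_le_contravar; auto].
    assert (PB1 : pbound (cdcoef (tc b z w)) R1 Md) by (apply HLb, HM'; lra).
    assert (HtR : (0 <= Cmod t / R1 <= R2 / R1)%R).
    { pose proof (Cmod_ge_0 t). split; [apply Rdiv_le_0_compat; lra|]. apply Rmult_le_compat_r; [left; apply Rinv_0_lt_compat; lra|auto]. }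
    apply cser_le with (n0 := O) (f := fun k => cdcoef (tc b z w) k * t ^ k).
    - intros n _. apply csum_geom_bound; auto. intros k.
      eapply Rle_trans; [apply (pbound_term _ R1 Md); auto; lra|]. apply Rmult_le_compat_l; auto. apply pow_incr. lra.
    - apply (pser_dsum _ (/ r) (Yk b z w)); [apply Ycs; auto|lra]. }
  set (l := fun z w => ccoef R2 (fun t => dsum (tc b z w) t / Yk b z w t)).
  assert (Hq : forall z w, Cmod z = r -> Cmod w = r -> exists h, holo R1 (fun t => dsum (tc b z w) t / Yk b z w t) h).
  { intros z w Hz Hw. apply holo_div with (dsum (cdcoef (tc b z w))) (dsum (tc b z w)).
    - apply holo_le with (/ r)%R; [lra|]. apply pser_holo. intros t Ht. apply (pser_dsum _ (/ r) (Yk b z w)); auto.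
    - apply holo_le with (/ r)%R; [lra|]. apply Yh; auto.
    - intros t Ht. apply Ynz; auto. lra. }
  assert (Hls : forall z w, Cmod z = r -> Cmod w = r -> forall t, (Cmod t < R2)%R ->
     csums (l z w) t (dsum (tc b z w) t / Yk b z w t)).
  { intros z w Hz Hw. destruct (Hq z w Hz Hw) as [h Hh].
    apply (ccoef_expand R1 (fun t => dsum (tc b z w) t / Yk b z w t) h); auto. lra. }
  exists (fun m z w => logcoef (l z w) m), (2 * Cb * R3)%R, (/ R3)%R.
  assert (HiR3 : (0 < / R3 < 1)%R).
  { split; [apply Rinv_0_lt_compat; lra|]. rewrite <- Rinv_1. apply Rinv_lt_contravar; lra. }
  split; [lra|]. split; [nra|]. split; [|split; [|split; [|split]]].
  - intros m z w Hz Hw. destruct m as [|m]; unfold logcoef.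
    { rewrite Cmod_0. apply Rmult_le_pos; [nra|apply pow_le; lra]. }
    destruct (Hq z w Hz Hw) as [h Hh].
    assert (P : pbound (l z w) R3 (2 * Cb)).
    { apply cauchy_estimate with R2 (fun t => dsum (tc b z w) t / Yk b z w t) h; auto; [|lra|].
      - apply holo_le with R1; auto. lra.
      - intros x Hx. apply Ydb; auto. lra. }
    specialize (P m). rewrite Cmod_mult, Cmod_inv, Cmod_RtoC by (apply INR_S_nz || apply pos_INR).
    assert (H1 : (0 < / INR (S m) <= 1)%R).
    { split; [apply Rinv_0_lt_compat, lt_0_INR; lia|]. rewrite <- Rinv_1. apply Rinv_le_contravar; [lra|].
      rewrite S_INR. pose proof (pos_INR m). lra. }
    apply Rle_trans with (Cmod (l z w m)).
    { pose proof (Cmod_ge_0 (l z w m)). nra. }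
    assert (0 < R3 ^ m)%R by (apply pow_lt; lra).
    apply Rmult_le_reg_r with (R3 ^ m)%R; auto. eapply Rle_trans; [apply P|]. right.
    rewrite pow_inv. simpl. field. lra.
  - intros m z w. unfold l.
    assert (E : tc b z w = tc b w z) by (apply functional_extensionality; intros; apply tc_sym).
    unfold Yk. rewrite E. reflexivity.
  - intros z w Hz Hw.
    destruct (log_series R2 (Yk b z w) (dsum (tc b z w)) (l z w) 1) as (s & Hs & E).
    + apply holo_le with (/ r)%R; [lra|]. apply Yh; auto.
    + intros t Ht. apply Ynz; auto. lra.
    + apply cser_unique with (fun k => tc b z w k * 0 ^ k); [|apply (csums_at_0 (tc b z w))].
      apply Ycs; auto. rewrite Cmod_0. lra.
    + apply Hls; auto.
    + rewrite Cmod_1. lra.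
    + exists s. split.
      * apply cser_ext with (2 := Hs). intros k. rewrite Cpow_1_l. ring.
      * rewrite Yk_Tk in E. replace (1 * z) with z in E by ring. replace (1 * w) with w in E by ring. exact E.
  - reflexivity.
  - intros m w Hw. unfold logcoef.
    replace (- b m * w ^ m) with (/ RtoC (INR (S m)) * (RtoC (INR (S m)) * (- b m * w ^ m))) by (field; apply INR_S_nz).
    apply cls_scal. apply (log_coef_cls (fun z => Cmod z = r) b w (fun z => l z w)); auto.
    intros z Hz k. apply (csums_unique _ _ (dsum (tc b z w)) R2); [lra| |].
    + intros t Ht.
      replace (dsum (tc b z w) t) with (dsum (tc b z w) t / Yk b z w t * Yk b z w t) by (field; apply Ynz; auto; lra).
      apply (csums_mult (l z w) (tc b z w) R2 (fun t => dsum (tc b z w) t / Yk b z w t) (Yk b z w)); auto.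
      intros x Hx. apply Ycs; auto. lra.
    + intros t Ht. apply (pser_dsum _ (/ r) (Yk b z w)); [apply Ycs; auto|lra].
Qed.

(** From [cdot x y = (x conj(y) + conj(x) y) / 2] the form splits into two squared moduli. *)
Lemma hf_cos n g x : hf n g (fun j k => cdot (x j) (x k)) =
  ((Cmod (csum (fun j => g j * x j)%C n) ^ 2 + Cmod (csum (fun j => g j * Cconj (x j))%C n) ^ 2) / 2)%R.
Proof.
  rewrite (hf_ext n g _ (fun j k => fst (RtoC (cdot (x j) (x k))))) by reflexivity.
  rewrite (hf_re_symmetric n g (fun j k => RtoC (cdot (x j) (x k)))) by (intros; rewrite cdot_comm; auto).
  set (P := csum (fun j => g j * x j) n). set (Q := csum (fun j => g j * Cconj (x j)) n).
  assert (E : csum (fun k => csum (fun j => g j * RtoC (cdot (x j) (x k))) n * Cconj (g k)) n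
     = RtoC (/ 2) * (P * Cconj P + Q * Cconj Q)).
  { rewrite (csum_ext _ (fun k => RtoC (/ 2) * P * Cconj (g k * x k) + RtoC (/ 2) * Q * Cconj (g k * Cconj (x k)))).
    - rewrite csum_plus, !csum_scal, <- !csum_conj. fold P Q. ring.
    - intros k _. unfold P, Q. rewrite <- !csum_scal, <- !csum_scal_r, <- csum_plus. apply csum_ext. intros j _.
      unfold cdot. ceq; field. }
  rewrite E, !Cmod_sq. unfold cdot. simpl. field.
Qed.

(** * Discrete energies on the circle *)

Lemma ln_le_sub1 x : (0 < x)%R -> (ln x <= x - 1)%R.
Proof.
  intros Hx. pose proof (exp_ineq1_le (ln x)). rewrite exp_ln in H by auto. lra.
Qed.

(** Splitting the regularised logarithm as if [d0] were 0 costs a multiple of [d0 / (x + d0)], by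
    [ln y <= y - 1] for a quotient and for its inverse. This ratio is 1 at [x = 0], but its mean
    over the circle is small by [poisson_mean]. *)
Lemma ln_err x d0 E Em EM : (0 <= x)%R -> (0 < d0)%R -> (0 < Em)%R -> (Em <= E <= EM)%R ->
  (Rabs (ln (d0 + x * E) - ln (x + d0) - ln E) <= (/ Em + EM * (1 + / Em)) * (d0 / (x + d0)))%R.
Proof.
  intros Hx Hd HEm HE.
  assert (Ha : (0 < d0 + x * E)%R) by nra. assert (Hb : (0 < E * (x + d0))%R) by (apply Rmult_lt_0_compat; lra).
  assert (Hi : (0 < / Em)%R) by (apply Rinv_0_lt_compat; auto).
  assert (Hxd : (0 < d0 / (x + d0))%R) by (apply Rdiv_lt_0_compat; lra).
  assert (E1 : (ln (d0 + x * E) - ln (x + d0) - ln E = ln ((d0 + x * E) / (E * (x + d0))))%R).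
  { rewrite ln_div, ln_mult by lra. ring. }
  assert (E2 : (- (ln (d0 + x * E) - ln (x + d0) - ln E) = ln ((E * (x + d0)) / (d0 + x * E)))%R).
  { rewrite ln_div, ln_mult by lra. ring. }
  assert (U1 : (ln (d0 + x * E) - ln (x + d0) - ln E <= / Em * (d0 / (x + d0)))%R).
  { rewrite E1. eapply Rle_trans; [apply ln_le_sub1, Rdiv_lt_0_compat; auto|].
    replace ((d0 + x * E) / (E * (x + d0)) - 1)%R with (/ E * (1 - E) * (d0 / (x + d0)))%R by (field; lra).
    apply Rmult_le_compat_r; [lra|].
    assert (/ E <= / Em)%R by (apply Rinv_le_contravar; lra).
    replace (/ E * (1 - E))%R with (/ E - 1)%R by (field; lra). lra. }
  assert (U2 : (- (ln (d0 + x * E) - ln (x + d0) - ln E) <= EM * (1 + / Em) * (d0 / (x + d0)))%R).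
  { rewrite E2. eapply Rle_trans; [apply ln_le_sub1, Rdiv_lt_0_compat; auto|].
    replace (E * (x + d0) / (d0 + x * E) - 1)%R with ((E - 1) * d0 * / (d0 + x * E))%R by (field; lra).
    apply Rle_trans with (EM * d0 * / (d0 + x * E))%R.
    { apply Rmult_le_compat_r; [left; apply Rinv_0_lt_compat; auto|]. apply Rmult_le_compat_r; lra. }
    replace (EM * (1 + / Em) * (d0 / (x + d0)))%R with (EM * d0 * ((1 + / Em) * / (x + d0)))%R by (field; lra).
    apply Rmult_le_compat_l; [nra|].
    apply Rmult_le_reg_r with (d0 + x * E)%R; auto. rewrite Rinv_l by lra.
    apply Rmult_le_reg_r with (x + d0)%R; [lra|].
    replace ((1 + / Em) * / (x + d0) * (d0 + x * E) * (x + d0))%R with ((1 + / Em) * (d0 + x * E))%R by (field; lra).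
    assert (x <= / Em * (x * E))%R.
    { apply Rmult_le_reg_l with Em; auto. replace (Em * (/ Em * (x * E)))%R with (x * E)%R by (field; lra). nra. }
    assert (0 <= x * E)%R by nra. nra. }
  assert (0 <= EM * (1 + / Em) * (d0 / (x + d0)))%R by (apply Rmult_le_pos; nra).
  assert (0 <= / Em * (d0 / (x + d0)))%R by nra.
  rewrite Rmult_plus_distr_r. apply Rabs_le. lra.
Qed.

Definition uu (N j k : nat) : C := rt N j * Cconj (rt N k).

Lemma Cmod_uu N j k : Cmod (uu N j k) = 1%R.
Proof. unfold uu. rewrite Cmod_mult, Cmod_conj, !Cmod_rt. ring. Qed.

Lemma uu_pow N j k i : uu N j k ^ i = rt N j ^ i * Cconj (rt N k ^ i).
Proof. unfold uu. rewrite Cpow_mult_l, Cconj_pow. reflexivity. Qed.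

Lemma Cmod_ruu rho N j k : (0 < rho < 1)%R -> Cmod (RtoC rho * uu N j k) = rho.
Proof. intros. rewrite Cmod_mult, Cmod_uu, Cmod_RtoC; lra. Qed.

(* Poisson kernel: [(1 - rho^2) / |1 - rho u|^2 = Re ((1 + rho u) / (1 - rho u))] has discrete mean close to 1. *)
Lemma poisson_mean rho N k : (0 < rho < 1)%R -> (0 < N)%nat ->
  (rsum (fun j => (1 - rho) ^ 2 / cdot (1 - RtoC rho * uu N j k)%C (1 - RtoC rho * uu N j k)%C)%R N
    <= INR N * ((1 - rho) + 2 * rho ^ N))%R.
Proof.
  intros Hr HN. set (v := fun j => RtoC rho * uu N j k).
  assert (Hv : forall j, Cmod (v j) = rho) by (intros; apply Cmod_ruu; auto).
  assert (Hv1 : forall j, 1 - v j <> 0).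
  { intros j E. apply Ceq_minus in E. pose proof (Hv j). rewrite <- E, Cmod_1 in H. lra. }
  assert (Hlow : forall j, (1 - rho <= Cmod (1 - v j))%R).
  { intros j. pose proof (Cmod_triangle_sub 1 (v j)). rewrite Cmod_1, Hv in H. lra. }
  assert (Hsum : csum (fun j => csum (fun i => v j ^ S i) (N - 1)) N = 0).
  { rewrite csum_swap. apply csum_0. intros i Hi.
    rewrite (csum_ext _ (fun j => RtoC rho ^ S i * Cconj (rt N k ^ S i) * rt N j ^ S i)).
    - rewrite csum_scal, rt_sum by lia. ring.
    - intros j _. unfold v. rewrite Cpow_mult_l, uu_pow. ring. }
  (* In [(1 + v) / (1 - v)] the powers [v^1, ..., v^(N-1)] average to 0 over the roots of unity by
     [Hsum]; only the aliased remainder [v^N / (1 - v)] has to be estimated. *)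
  assert (E : forall j, ((1 - rho) ^ 2 / cdot (1 - v j) (1 - v j) =
     (1 - rho) / (1 + rho) * fst (1 + 2 * csum (fun i => v j ^ S i) (N - 1) + 2 * (v j ^ N / (1 - v j)))%C)%R).
  { intros j. specialize (Hv1 j).
    replace (1 + 2 * csum (fun i => v j ^ S i) (N - 1) + 2 * (v j ^ N / (1 - v j))) with ((1 + v j) / (1 - v j)).
    - rewrite <- cdot_div by auto.
      assert (Hc : cdot (1 - v j) (1 - v j) <> 0%R).
      { rewrite <- Cmod_sq. apply pow_nonzero. apply Cmod_gt_0 in Hv1. lra. }
      assert (Hn : cdot (v j) (v j) = (rho ^ 2)%R) by (rewrite <- Cmod_sq, Hv; auto).
      replace (cdot (1 - v j) (1 + v j)) with (1 - rho ^ 2)%R by (rewrite <- Hn; unfold cdot; simpl; ring).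
      field. split; [auto|lra].
    - rewrite (csum_ext _ (fun i => v j * v j ^ i)) by (intros; reflexivity).
      rewrite (csum_scal (v j) (fun i => v j ^ i)). pose proof (cgeom_sum (v j) (N - 1)) as G.
      assert (G2 : csum (fun i => v j ^ i) (N - 1) = (1 - v j ^ (N - 1)) / (1 - v j)) by (rewrite <- G; field; auto).
      rewrite G2. replace (v j ^ N) with (v j * v j ^ (N - 1)).
      + field. auto.
      + rewrite <- Cpow_S. f_equal. lia. }
  erewrite rsum_ext by (intros j _; exact (E j)). rewrite rsum_scal.
  rewrite <- (fst_csum (fun j => 1 + 2 * csum (fun i => v j ^ S i) (N - 1) + 2 * (v j ^ N / (1 - v j)))).
  rewrite !csum_plus, !csum_scal, csum_const, Hsum.
  set (W := csum (fun j => v j ^ N / (1 - v j)) N).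
  assert (HW : (Cmod W <= INR N * (rho ^ N / (1 - rho)))%R).
  { unfold W. eapply Rle_trans; [apply Cmod_csum|]. rewrite <- rsum_const. apply rsum_le. intros j _.
    rewrite Cmod_div, Cmod_pow, Hv by auto. apply Rmult_le_compat_l; [apply pow_le; lra|].
    apply Rinv_le_contravar; [lra|auto]. }
  assert (HN0 : (0 < INR N)%R) by (apply lt_0_INR; auto).
  assert (Hrn : (0 < rho ^ N)%R) by (apply pow_lt; lra).
  apply Rle_trans with ((1 - rho) / (1 + rho) * (INR N + 2 * (INR N * (rho ^ N / (1 - rho)))))%R.
  - apply Rmult_le_compat_l; [apply Rdiv_le_0_compat; lra|].
    pose proof (fst_le_Cmod W) as F. pose proof (Rle_abs (fst W)).
    replace (fst (RtoC (INR N) * 1 + 2 * 0 + 2 * W)) with (INR N + 2 * fst W)%R by (simpl; ring). lra.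
  - replace ((1 - rho) / (1 + rho) * (INR N + 2 * (INR N * (rho ^ N / (1 - rho)))))%R
      with (INR N * (((1 - rho) + 2 * rho ^ N) / (1 + rho)))%R by (field; lra).
    apply Rmult_le_compat_l; [lra|]. apply Rmult_le_reg_r with (1 + rho)%R; [lra|].
    unfold Rdiv. rewrite Rmult_assoc, Rinv_l by lra. nra.
Qed.

Definition Ssum (b : nat -> C) (r : R) (M : nat) : R := rsum (fun k => INR k * Cmod (b k) ^ 2 * r ^ (2 * k))%R (S M).

Lemma Ssum_trunc b r M I : (M <= I)%nat -> rsum (fun k => INR k * Cmod (trunc M b k) ^ 2 * r ^ (2 * k))%R (S I) = Ssum b r M.
Proof.
  intros H. replace (S I) with (S M + (I - M))%nat by lia. rewrite rsum_add. unfold Ssum.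
  rewrite (rsum_0 (fun k => INR (S M + k) * Cmod (trunc M b (S M + k)) ^ 2 * r ^ (2 * (S M + k)))%R).
  - rewrite Rplus_0_r. apply rsum_ext. intros k Hk. unfold trunc. destruct (Compare_dec.le_dec k M); [auto|lia].
  - intros k _. unfold trunc. destruct (Compare_dec.le_dec (S M + k) M); [lia|]. rewrite Cmod_0. simpl. ring.
Qed.

(** [ln |1 - rho u|^2] is [- 2 sum rho^i Re(u^i) / i], and [hf_cos] turns each term into squared
    Fourier coefficients of [gam]: the frequency -1 contributes [1 / r^2], the frequency [i]
    contributes [i |b_i|^2 r^(2i)], and the factors [rho^i <= 1] are dropped. *)
Lemma circle_energy b r M I rho G : (0 < r)%R -> (M <= I)%nat -> (0 < rho < 1)%R ->
  (forall z, Cmod z = r -> (Cmod (gam b r M z) <= G)%R) ->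
  let N := (M + I + 2)%nat in
  (hf N (fun j => gam b r M (zz r N j)) (fun j k => ln (cdot (1 - RtoC rho * uu N j k) (1 - RtoC rho * uu N j k)))
   >= - INR N ^ 2 * (/ r ^ 2 + Ssum b r M + G ^ 2 * (2 * rho ^ S I / (1 - rho))))%R.
Proof.
  (* The value [N = M + I + 2] is the least for which [gam_pos] and [gam_neg] hold at all
     frequencies up to [I]. *)
  intros Hr HI Hrho HG N. set (g := fun j => gam b r M (zz r N j)).
  assert (HN : (0 < INR N)%R) by (apply lt_0_INR; unfold N; lia).
  set (cf := fun i => match i with O => 0%R | S m => (- / INR (S m) * rho ^ S m)%R end).
  set (K1 := fun j k => rsum (fun i => 2 * cf i * cdot (rt N j ^ i) (rt N k ^ i))%R (S I)).
  set (D := fun j k => (ln (cdot (1 - RtoC rho * uu N j k) (1 - RtoC rho * uu N j k)) - K1 j k)%R).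
  assert (HD : forall j k, (Rabs (D j k) <= 2 * rho ^ S I / (1 - rho))%R).
  { intros j k. destruct (log_1_minus (RtoC rho * uu N j k)) as (s & Hs & E); [rewrite Cmod_ruu; lra|].
    unfold D. rewrite E.
    assert (EK : K1 j k = (2 * fst (csum (fun i => logcoef (fun _ => - (1)) i * (RtoC rho * uu N j k) ^ i)%C (S I)))%R).
    { unfold K1. rewrite fst_csum, <- rsum_scal. apply rsum_ext. intros i _.
      rewrite Cpow_mult_l, uu_pow, RtoC_pow. unfold cf, logcoef. destruct i as [|m].
      - simpl. unfold cdot. ring.
      - rewrite <- RtoC_inv by (apply not_0_INR; lia).
        set (x := rt N j ^ S m). set (y := rt N k ^ S m). set (p := (rho ^ S m)%R). set (iv := (/ INR (S m))%R).
        unfold cdot. simpl. ring. }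
    rewrite EK.
    assert (T : (Cmod (s - csum (fun i => logcoef (fun _ => - (1)) i * (RtoC rho * uu N j k) ^ i)%C (S I)) <= 1 * rho ^ S I / (1 - rho))%R).
    { apply cser_tail; auto; try lra. intros i. rewrite Cmod_mult, Cmod_pow, Cmod_ruu by auto.
      apply Rmult_le_compat_r; [apply pow_le; lra|]. destruct i as [|m]; unfold logcoef; [rewrite Cmod_0; lra|].
      rewrite Cmod_mult, Cmod_opp, Cmod_1, Cmod_inv, Cmod_RtoC by (apply INR_S_nz || apply pos_INR).
      rewrite Rmult_1_r, <- Rinv_1. apply Rinv_le_contravar; [lra|]. rewrite S_INR. pose proof (pos_INR m). lra. }
    set (cs := csum _ (S I)) in *. pose proof (fst_le_Cmod (s - cs)) as F.
    replace (2 * fst s - 2 * fst cs)%R with (2 * fst (s - cs)%C)%R by (simpl; ring).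
    rewrite Rabs_mult, (Rabs_right 2) by lra.
    replace (2 * rho ^ S I / (1 - rho))%R with (2 * (1 * rho ^ S I / (1 - rho)))%R by (field; lra). lra. }
  rewrite (hf_ext N g _ (fun j k => K1 j k + D j k)%R) by (intros; unfold D; ring).
  rewrite hf_plus.
  assert (B2 : (Rabs (hf N g D) <= G ^ 2 * rsum (fun j => rsum (fun k => 2 * rho ^ S I / (1 - rho)) N) N)%R).
  { apply hf_abs_le; auto. intros j _. apply HG, Cmod_zz. lra. }
  rewrite !rsum_const in B2. apply Rabs_le_between in B2.
  assert (B1 : (hf N g K1 >= - INR N ^ 2 * (/ r ^ 2 + Ssum b r M))%R).
  { unfold K1. rewrite hf_rsum.
    rewrite (rsum_ext _ (fun i => 2 * cf i * hf N g (fun j k => cdot (rt N j ^ i) (rt N k ^ i)))%R) by (intros; apply hf_scal).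
    apply Rle_ge.
    apply Rle_trans with (rsum (fun i => - INR N ^ 2 * ((if Nat.eq_dec i 1 then / r ^ 2 else 0) + INR i * Cmod (trunc M b i) ^ 2 * r ^ (2 * i)))%R (S I)).
    - rewrite rsum_scal, rsum_plus, Ssum_trunc by auto.
      apply Rmult_le_compat_neg_l; [pose proof (pow2_ge_0 (INR N)); lra|]. apply Rplus_le_compat_r.
      rewrite rsum_S_l. destruct I as [|I]; [simpl; assert (0 < / (r * (r * 1)))%R by (apply Rinv_0_lt_compat; nra); lra|].
      rewrite rsum_S_l, rsum_0; [simpl; lra|]. intros k _. destruct (Nat.eq_dec (S (S k)) 1); [lia|auto].
    - apply rsum_le. intros i Hi. rewrite hf_cos. destruct i as [|m].
      + simpl. lra.
      + set (i := S m) in *. unfold g.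
        rewrite gam_pos by (auto; unfold N, i in *; lia).
        rewrite (csum_ext _ (fun j => gam b r M (zz r N j) * Cconj (rt N j) ^ i)) by (intros; rewrite Cconj_pow; auto).
        rewrite gam_neg by (auto; unfold N, i in *; lia).
        rewrite !Cmod_mult, Cmod_RtoC, Cmod_pow, !Cmod_RtoC by (apply pos_INR || lra).
        assert (Hi0 : (0 < INR i)%R) by (apply lt_0_INR; unfold i; lia).
        assert (Ec : (Cmod (if Nat.eq_dec i 1 then - / RtoC r else 0) ^ 2 = if Nat.eq_dec i 1 then / r ^ 2 else 0)%R).
        { destruct (Nat.eq_dec i 1).
          - rewrite Cmod_opp, Cmod_inv, Cmod_RtoC by (lra || (apply RtoC_nz; lra)). field. lra.
          - rewrite Cmod_0. ring. }
        assert (Hp : (0 < rho ^ i <= 1)%R).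
        { split; [apply pow_lt; lra|]. rewrite <- (pow1 i). apply pow_incr. lra. }
        change (cf i) with (- / INR i * rho ^ i)%R.
        set (c1 := Cmod (if Nat.eq_dec i 1 then - / RtoC r else 0)) in *.
        set (bt := Cmod (trunc M b i)).
        assert (Hc : (0 <= (if Nat.eq_dec i 1 then / r ^ 2 else 0))%R).
        { destruct (Nat.eq_dec i 1); [|lra]. left. apply Rinv_0_lt_compat, pow_lt; auto. }
        replace (2 * (- / INR i * rho ^ i) * (((INR N * c1) ^ 2 + (INR N * (INR i * bt * r ^ i)) ^ 2) / 2))%R
          with (- INR N ^ 2 * (rho ^ i * (/ INR i * c1 ^ 2 + INR i * bt ^ 2 * r ^ (2 * i))))%R.
        2: { replace (r ^ (2 * i))%R with (r ^ i * r ^ i)%R by (rewrite <- pow_add; f_equal; lia). field. lra. }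
        apply Rmult_le_compat_neg_l; [pose proof (pow2_ge_0 (INR N)); lra|].
        rewrite Ec. assert (Hii : (/ INR i * (if Nat.eq_dec i 1 then / r ^ 2 else 0) <= if Nat.eq_dec i 1 then / r ^ 2 else 0)%R).
        { destruct (Nat.eq_dec i 1) as [->|]; [simpl INR; lra|lra]. }
        assert (Hb2 : (0 <= INR i * bt ^ 2 * r ^ (2 * i))%R).
        { apply Rmult_le_pos; [apply Rmult_le_pos; [lra|apply pow2_ge_0]|apply pow_le; lra]. }
        assert (0 <= / INR i * (if Nat.eq_dec i 1 then / r ^ 2 else 0))%R.
        { apply Rmult_le_pos; auto. left. apply Rinv_0_lt_compat; auto. }
        nra. }
  nra.
Qed.

Lemma fst_conj_mul (z : C) : fst (z * Cconj z) = (Cmod z ^ 2)%R.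
Proof. rewrite Cmod_sq. unfold cdot. simpl. ring. Qed.

(** Summation over the first point picks, by [gam_poly], the linear coefficient [- b_m w^m] of the
    part of degree [m + 1]; summation over the second point then gives [m |b_m|^2 r^(2m)]. The
    factor in [2 Re] makes this [2 S] against the single [S] lost in [circle_energy], and this
    surplus is the area theorem. *)
Lemma kernel_energy b r M I G (n : nat -> C -> C -> C) K q (E : C -> C -> R) : (0 < r)%R -> (M < I)%nat ->
  (0 <= q < 1)%R -> (0 <= K)%R ->
  (forall z, Cmod z = r -> (Cmod (gam b r M z) <= G)%R) ->
  (forall m z w, Cmod z = r -> Cmod w = r -> (Cmod (n m z w) <= K * q ^ m)%R) ->
  (forall m z w, n m z w = n m w z) ->
  (forall z w, Cmod z = r -> Cmod w = r -> exists s, cser (fun m => n m z w) s /\ E z w = (2 * fst s)%R) ->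
  (forall z w, n O z w = RtoC 0) ->
  (forall m w, Cmod w = r -> cls (fun z => Cmod z = r) (S m) (- b m * w ^ m) (fun z => n (S m) z w)) ->
  let N := (M + I + 2)%nat in
  (hf N (fun j => gam b r M (zz r N j)) (fun j k => E (zz r N j) (zz r N k))
   >= INR N ^ 2 * (2 * Ssum b r M - G ^ 2 * (2 * K * q ^ S I / (1 - q))))%R.
Proof.
  intros Hr HI Hq HK HG Hn Hsym HE Hn0 Hcls N. set (g := fun j => gam b r M (zz r N j)).
  assert (HN : (0 < INR N)%R) by (apply lt_0_INR; unfold N; lia).
  assert (Hz : forall j, Cmod (zz r N j) = r) by (intros; apply Cmod_zz; lra).
  set (K1 := fun j k => rsum (fun m => 2 * fst (n m (zz r N j) (zz r N k)))%R (S I)).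
  set (D := fun j k => (E (zz r N j) (zz r N k) - K1 j k)%R).
  assert (HD : forall j k, (Rabs (D j k) <= 2 * K * q ^ S I / (1 - q))%R).
  { intros j k. destruct (HE (zz r N j) (zz r N k)) as (s & Hs & Es); auto. unfold D, K1. rewrite Es, rsum_scal.
    rewrite <- (fst_csum (fun m => n m (zz r N j) (zz r N k))).
    assert (T : (Cmod (s - csum (fun m => n m (zz r N j) (zz r N k)) (S I)) <= K * q ^ S I / (1 - q))%R).
    { apply cser_tail; auto. }
    set (cs := csum _ (S I)) in *. pose proof (fst_le_Cmod (s - cs)) as F.
    replace (2 * fst s - 2 * fst cs)%R with (2 * fst (s - cs)%C)%R by (simpl; ring).
    rewrite Rabs_mult, (Rabs_right 2) by lra.
    replace (2 * K * q ^ S I / (1 - q))%R with (2 * (K * q ^ S I / (1 - q)))%R by (field; lra). lra. }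
  rewrite (hf_ext N g _ (fun j k => K1 j k + D j k)%R) by (intros; unfold D; ring).
  rewrite hf_plus.
  assert (B2 : (Rabs (hf N g D) <= G ^ 2 * rsum (fun j => rsum (fun k => 2 * K * q ^ S I / (1 - q)) N) N)%R).
  { apply hf_abs_le; auto. intros j _. apply HG, Hz. }
  rewrite !rsum_const in B2. apply Rabs_le_between in B2.
  assert (B1 : hf N g K1 = (INR N ^ 2 * (2 * Ssum b r M))%R); [|nra].
  unfold K1. rewrite hf_rsum.
  rewrite (rsum_ext _ (fun m => 2 * hf N g (fun j k => fst (n m (zz r N j) (zz r N k))))%R) by (intros; apply (hf_scal N g 2)).
  rewrite rsum_S_l.
  rewrite (hf_ext N g (fun j k => fst (n 0%nat (zz r N j) (zz r N k))) (fun _ _ => 0 * 0)%R) by (intros; rewrite Hn0; simpl; ring).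
  rewrite hf_scal.
  rewrite (rsum_ext _ (fun m => INR N ^ 2 * 2 * (INR m * Cmod (trunc M b m) ^ 2 * r ^ (2 * m)))%R).
  (* The shift from the degree [m + 1] to the index [m] costs one term, hence the hypothesis
     [M < I]. *)
  - rewrite rsum_scal. destruct I as [|I]; [lia|]. rewrite Ssum_trunc by lia. ring.
  - intros m Hm. rewrite (hf_re_symmetric N g (fun j k => n (S m) (zz r N j) (zz r N k))) by (intros; apply Hsym).
    rewrite (csum_ext _ (fun k => RtoC (INR N) * b m * (Cconj (g k) * zz r N k ^ m))).
    + rewrite csum_scal. unfold g. rewrite gam_conj_pow by (auto; unfold N; lia).
      replace (RtoC (INR N) * b m * (RtoC (INR N) * (RtoC (INR m) * Cconj (trunc M b m) * RtoC (r ^ 2) ^ m)))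
        with (RtoC (INR N * INR N * INR m * r ^ (2 * m)) * (trunc M b m * Cconj (trunc M b m))).
      * assert (F : forall (x : R) (w : C), fst (RtoC x * w) = (x * fst w)%R) by (intros; simpl; ring).
        rewrite F, fst_conj_mul. ring.
      * rewrite pow_mult, RtoC_pow, !RtoC_mult. unfold trunc.
        destruct (Compare_dec.le_dec m M); [ring|]. replace (Cconj 0) with (RtoC 0) by (ceq; ring). ring.
    + intros k Hk. destruct (Hcls m (zz r N k) (Hz k)) as (c & C0 & C1 & _ & C3).
      rewrite (csum_ext _ (fun j => gam b r M (zz r N j) * csum (fun i => c i * zz r N j ^ i) (S (S m)))).
      * rewrite gam_poly by (auto; unfold N; lia). rewrite C1. unfold g. ring.
      * intros j _. unfold g. rewrite C3; auto.
Qed.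

Lemma pow_tail_small q A eps : (0 <= q < 1)%R -> (0 <= A)%R -> (0 < eps)%R ->
  exists N0, forall n, (N0 <= n)%nat -> (A * q ^ n < eps)%R.
Proof.
  intros Hq HA He. destruct (pow_small q (eps / (A + 1))%R Hq) as [N0 H0]; [apply Rdiv_lt_0_compat; lra|].
  exists N0. intros n Hn. specialize (H0 n Hn). pose proof (pow_le q n (proj1 Hq)).
  apply Rle_lt_trans with ((A + 1) * q ^ n)%R; [nra|].
  apply Rlt_le_trans with ((A + 1) * (eps / (A + 1)))%R; [apply Rmult_lt_compat_l; lra|right; field; lra].
Qed.

(** The origin of the regularisation [d0]: with this constant, [|z - w|^2 + d0] is on the circle an
    exact multiple of [|1 - rho u|^2], whose logarithm has an explicit Fourier series. *)
Lemma zz_dist r N j k rho : (0 < r)%R -> (0 < rho < 1)%R ->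
  (cdot (zz r N j - zz r N k) (zz r N j - zz r N k) + r ^ 2 * (1 - rho) ^ 2 / rho
   = r ^ 2 / rho * cdot (1 - RtoC rho * uu N j k) (1 - RtoC rho * uu N j k))%R.
Proof.
  intros Hr Hrho.
  assert (A : forall i, cdot (rt N i) (rt N i) = 1%R) by (intros; rewrite <- Cmod_sq, Cmod_rt; ring).
  assert (E1 : cdot (zz r N j - zz r N k) (zz r N j - zz r N k) = (r ^ 2 * (cdot (rt N j) (rt N j) + cdot (rt N k) (rt N k) - 2 * cdot (rt N j) (rt N k)))%R)
    by (unfold zz, cdot; simpl; ring).
  assert (E2 : cdot (1 - RtoC rho * uu N j k) (1 - RtoC rho * uu N j k)
     = (1 - 2 * rho * cdot (rt N j) (rt N k) + rho ^ 2 * (cdot (rt N j) (rt N j) * cdot (rt N k) (rt N k)))%R)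
    by (unfold uu, cdot; simpl; ring).
  rewrite E1, E2, !A. field. lra.
Qed.

Lemma area_step b B r M : all_pbound b -> b O = RtoC 0 -> (forall z, (Cmod z < 1)%R -> csums b z (B z)) ->
  (forall z w, (Cmod z < 1)%R -> (Cmod w < 1)%R -> Tk b z w <> 0) -> (0 < r < 1)%R ->
  (Ssum b r M <= / r ^ 2)%R.
Proof.
  intros Hb Hb0 HB HT Hr.
  destruct (grunsky_log b r Hb Hb0 HT Hr) as (n & K & q & Hq & HK & Hn1 & Hsym & HE & Hn0 & Hcls).
  destruct (gam_bound b r M ltac:(lra)) as (G & HG0 & HG).
  destruct (Tk_lower b r Hb Hr HT) as (m0 & Hm0 & Hlow).
  destruct (Tk_lipschitz b r Hb Hr) as (L & HL & Lip).
  set (EM := ((1 + L * (2 * r)) ^ 2)%R). set (Em := (m0 ^ 2)%R).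
  assert (HEm : (0 < Em)%R) by (unfold Em; apply pow_lt; auto).
  assert (HTE : forall z w, Cmod z = r -> Cmod w = r -> (Em <= cdot (Tk b z w) (Tk b z w) <= EM)%R).
  { intros z w Hz Hw. rewrite <- Cmod_sq. pose proof (Hlow z w ltac:(lra) ltac:(lra)). split.
    - apply pow_incr. lra.
    - apply pow_incr. split; [apply Cmod_ge_0|].
      pose proof (Lip z w 0 0 ltac:(lra) ltac:(lra) ltac:(rewrite Cmod_0; lra) ltac:(rewrite Cmod_0; lra)) as P.
      rewrite Tk_zero in P by (auto; rewrite Cmod_0; lra).
      replace (z - 0) with z in P by ring. replace (w - 0) with w in P by ring. rewrite Hz, Hw in P.
      pose proof (Cmod_triangle_sub (Tk b z w) 1). rewrite Cmod_1 in H0. lra. }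
  set (Cc := (/ Em + EM * (1 + / Em))%R).
  assert (HCc : (0 < Cc)%R).
  { unfold Cc. assert (0 < / Em)%R by (apply Rinv_0_lt_compat; auto).
    assert (0 <= EM)%R by apply pow2_ge_0. nra. }
  apply le_epsilon. intros eps Heps.
  (* First [rho] is fixed close to 1, to make the splitting error [G^2 Cc (1 - rho)] small; only
     then is the number of points chosen, because the remaining errors contain
     [rho^(I+1) / (1 - rho)]. *)
  set (eta := (eps / 4 / (G ^ 2 * Cc + 1))%R).
  assert (HGC : (0 <= G ^ 2 * Cc)%R) by (apply Rmult_le_pos; [apply pow2_ge_0|lra]).
  assert (Heta : (0 < eta)%R) by (unfold eta; apply Rdiv_lt_0_compat; lra).
  set (rho := (1 - Rmin eta (1 / 2))%R).
  assert (Hrho : (0 < rho < 1)%R).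
  { unfold rho. assert (0 < Rmin eta (1 / 2))%R by (apply Rmin_glb_lt; lra). pose proof (Rmin_r eta (1 / 2)). lra. }
  assert (Hrho2 : (G ^ 2 * (Cc * (1 - rho)) < eps / 4)%R).
  { assert (1 - rho <= eta)%R by (unfold rho; pose proof (Rmin_l eta (1 / 2)); lra).
    apply Rle_lt_trans with (G ^ 2 * Cc * eta)%R; [rewrite <- Rmult_assoc; apply Rmult_le_compat_l; auto|].
    apply Rlt_le_trans with ((G ^ 2 * Cc + 1) * eta)%R; [nra|]. right. unfold eta. field. lra. }
  destruct (pow_tail_small rho (G ^ 2 * (2 / (1 - rho)))%R (eps / 4) ltac:(lra)) as [N1 H1]; [|lra|].
  { apply Rmult_le_pos; [apply pow2_ge_0|]. apply Rdiv_le_0_compat; lra. }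
  destruct (pow_tail_small q (G ^ 2 * (2 * K / (1 - q)))%R (eps / 4) Hq) as [N2 H2]; [|lra|].
  { apply Rmult_le_pos; [apply pow2_ge_0|]. apply Rdiv_le_0_compat; lra. }
  destruct (pow_tail_small rho (G ^ 2 * (Cc * 2))%R (eps / 4) ltac:(lra)) as [N3 H3]; [|lra|].
  { apply Rmult_le_pos; [apply pow2_ge_0|lra]. }
  set (I := (M + 1 + N1 + N2 + N3)%nat). set (N := (M + I + 2)%nat).
  specialize (H1 (S I) ltac:(unfold I; lia)). specialize (H2 (S I) ltac:(unfold I; lia)).
  specialize (H3 N ltac:(unfold N, I; lia)).
  set (g := fun j => gam b r M (zz r N j)).
  assert (Hg : csum g N = 0) by (apply gam_sum; unfold N; lra || lia).
  set (H := fun z => / z + B z).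
  set (d0 := (r ^ 2 * (1 - rho) ^ 2 / rho)%R).
  assert (Hd0 : (0 < d0)%R).
  { unfold d0. apply Rdiv_lt_0_compat; [|lra]. apply Rmult_lt_0_compat; apply pow_lt; lra. }
  assert (Hr4 : (0 < r ^ 4)%R) by (apply pow_lt; lra).
  assert (HN : (0 < INR N)%R) by (apply lt_0_INR; unfold N; lia).
  assert (Hz : forall j, Cmod (zz r N j) = r) by (intros; apply Cmod_zz; lra).
  (* The factor [r ^ 4] is [|z w|^2], from [|H z - H w| r^2 = |z - w| |Tk|] on the circle. *)
  pose proof (energy N g (fun j => H (zz r N j)) (d0 / r ^ 4) ltac:(apply Rdiv_lt_0_compat; auto) Hg) as En.
  set (Kc := fun j k => ln (cdot (1 - RtoC rho * uu N j k) (1 - RtoC rho * uu N j k))) in *.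
  set (Kt := fun j k => ln (cdot (Tk b (zz r N j) (zz r N k)) (Tk b (zz r N j) (zz r N k)))) in *.
  set (Ktot := fun j k => ln (d0 / r ^ 4 + cdot (H (zz r N j) - H (zz r N k)) (H (zz r N j) - H (zz r N k)))) in *.
  set (cst := (ln (r ^ 2 / rho) - ln (r ^ 4))%R).
  set (Er := fun j k => (Ktot j k - (cst + (Kc j k + Kt j k)))%R).
  assert (HEr : forall j k, (Rabs (Er j k) <= Cc * ((1 - rho) ^ 2 / cdot (1 - RtoC rho * uu N j k)%C (1 - RtoC rho * uu N j k)%C))%R).
  { intros j k. set (z := zz r N j). set (w := zz r N k).
    set (x := cdot (z - w) (z - w)). set (T := cdot (Tk b z w) (Tk b z w)).
    set (p := cdot (1 - RtoC rho * uu N j k) (1 - RtoC rho * uu N j k)).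
    assert (Hp : (0 < p)%R).
    { unfold p. rewrite <- Cmod_sq. apply pow_lt, Cmod_gt_0. intros E. apply Ceq_minus in E.
      pose proof (Cmod_ruu rho N j k Hrho) as Q. rewrite <- E, Cmod_1 in Q. lra. }
    assert (Hx : (0 <= x)%R) by (unfold x; rewrite <- Cmod_sq; apply pow2_ge_0).
    assert (HxT : cdot (H z - H w) (H z - H w) = (x * T / r ^ 4)%R).
    { assert (Hzn : z <> 0) by (apply (circ_nz z r); [lra|apply Hz]).
      assert (Hwn : w <> 0) by (apply (circ_nz w r); [lra|apply Hz]).
      pose proof (Tk_diff b B z w Hb HB ltac:(unfold z; rewrite Hz; lra) ltac:(unfold w; rewrite Hz; lra)) as TD.
      assert (E : z * w * (H z - H w) = (w - z) * Tk b z w) by (rewrite TD; unfold H; field; auto).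
      apply (f_equal Cmod) in E. rewrite !Cmod_mult in E. unfold z at 1, w at 1 in E. rewrite !Hz in E.
      rewrite <- Cmod_sq. unfold x, T. rewrite <- !Cmod_sq, (Cmod_minus_sym z w).
      replace (Cmod (w - z) ^ 2 * Cmod (Tk b z w) ^ 2)%R with ((Cmod (w - z) * Cmod (Tk b z w)) ^ 2)%R by ring.
      rewrite <- E. field. lra. }
    assert (Hxp : (x + d0 = r ^ 2 / rho * p)%R) by (apply zz_dist; lra).
    unfold Er, Ktot, Kc, Kt. fold z w. rewrite HxT. fold T p.
    assert (HTpos : (Em <= T <= EM)%R) by (apply HTE; apply Hz).
    assert (Hrr : (0 < r ^ 2 / rho)%R) by (apply Rdiv_lt_0_compat; [apply pow_lt|]; lra).
    replace (ln (d0 / r ^ 4 + x * T / r ^ 4) - (cst + (ln p + ln T)))%R with (ln (d0 + x * T) - ln (x + d0) - ln T)%R.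
    - replace ((1 - rho) ^ 2 / p)%R with (d0 / (x + d0))%R; [apply ln_err; auto|].
      rewrite Hxp. unfold d0. field. lra.
    - replace (d0 / r ^ 4 + x * T / r ^ 4)%R with ((d0 + x * T) / r ^ 4)%R by (field; lra).
      rewrite ln_div by nra. rewrite Hxp, ln_mult by auto. unfold cst. ring. }
  assert (Hsplit : (hf N g Ktot = hf N g (fun _ _ => cst) + (hf N g Kc + hf N g Kt) + hf N g Er)%R).
  { rewrite <- !hf_plus. apply hf_ext. intros j k _ _. unfold Er. ring. }
  rewrite hf_const in Hsplit by auto.
  assert (BE : (Rabs (hf N g Er) <= G ^ 2 * (Cc * (INR N ^ 2 * ((1 - rho) + 2 * rho ^ N))))%R).
  { eapply Rle_trans; [apply hf_abs_le with (G := G) (Q := fun j k => (Cc * ((1 - rho) ^ 2 / cdot (1 - RtoC rho * uu N j k)%C (1 - RtoC rho * uu N j k)%C))%R)|].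
    - intros j _. apply HG, Hz.
    - intros; apply HEr.
    - apply Rmult_le_compat_l; [apply pow2_ge_0|]. rewrite rsum_swap.
      apply Rle_trans with (rsum (fun _ => Cc * (INR N * ((1 - rho) + 2 * rho ^ N)))%R N).
      + apply rsum_le. intros k _. rewrite rsum_scal. apply Rmult_le_compat_l; [lra|].
        apply poisson_mean; auto. unfold N; lia.
      + rewrite rsum_const. right. ring. }
  pose proof (circle_energy b r M I rho G ltac:(lra) ltac:(unfold I; lia) Hrho HG) as BC. fold N g in BC. cbv zeta in BC.
  pose proof (kernel_energy b r M I G n K q (fun z w => ln (cdot (Tk b z w) (Tk b z w))) ltac:(lra) ltac:(unfold I; lia) Hq HK HG Hn1 Hsym HE Hn0 Hcls) as BT.
  cbv zeta in BT. fold N g in BT. cbv beta in BT.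
  change (hf N g Kc >= - INR N ^ 2 * (/ r ^ 2 + Ssum b r M + G ^ 2 * (2 * rho ^ S I / (1 - rho))))%R in BC.
  change (hf N g Kt >= INR N ^ 2 * (2 * Ssum b r M - G ^ 2 * (2 * K * q ^ S I / (1 - q))))%R in BT.
  apply Rabs_le_between in BE.
  assert (HN2 : (0 < INR N ^ 2)%R) by (apply pow_lt; auto).
  set (A1 := (G ^ 2 * (2 * rho ^ S I / (1 - rho)))%R) in *. set (A2 := (G ^ 2 * (2 * K * q ^ S I / (1 - q)))%R) in *.
  assert (HA1 : (A1 < eps / 4)%R).
  { unfold A1. replace (G ^ 2 * (2 * rho ^ S I / (1 - rho)))%R with (G ^ 2 * (2 / (1 - rho)) * rho ^ S I)%R by (field; lra). auto. }
  assert (HA2 : (A2 < eps / 4)%R).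
  { unfold A2. replace (G ^ 2 * (2 * K * q ^ S I / (1 - q)))%R with (G ^ 2 * (2 * K / (1 - q)) * q ^ S I)%R by (field; lra). auto. }
  assert (HA3 : (G ^ 2 * (Cc * (INR N ^ 2 * ((1 - rho) + 2 * rho ^ N))) <= INR N ^ 2 * (eps / 2))%R).
  { replace (G ^ 2 * (Cc * (INR N ^ 2 * (1 - rho + 2 * rho ^ N))))%R
      with (INR N ^ 2 * (G ^ 2 * (Cc * (1 - rho)) + G ^ 2 * (Cc * 2) * rho ^ N))%R by ring.
    apply Rmult_le_compat_l; lra. }
  apply Rmult_le_reg_l with (INR N ^ 2)%R; auto.
  assert (INR N ^ 2 * A1 <= INR N ^ 2 * (eps / 4))%R by (apply Rmult_le_compat_l; lra).
  assert (INR N ^ 2 * A2 <= INR N ^ 2 * (eps / 4))%R by (apply Rmult_le_compat_l; lra).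
  lra.
Qed.

(* Gronwall's theorem for [H = 1/z + sum b_k z^k]; injectivity of [H] is [Tk <> 0]. *)
Theorem area_theorem b B M : all_pbound b -> b O = RtoC 0 -> (forall z, (Cmod z < 1)%R -> csums b z (B z)) ->
  (forall z w, (Cmod z < 1)%R -> (Cmod w < 1)%R -> Tk b z w <> 0) ->
  (rsum (fun k => INR k * Cmod (b k) ^ 2)%R (S M) <= 1)%R.
Proof.
  intros Hb Hb0 HB HT. set (X := rsum (fun k => INR k * Cmod (b k) ^ 2)%R (S M)).
  assert (HX : (0 <= X)%R).
  { apply rsum_nonneg. intros. apply Rmult_le_pos; [apply pos_INR|apply pow2_ge_0]. }
  assert (H : forall r, (0 < r < 1)%R -> (X * r ^ (2 * M + 2) <= 1)%R).
  { intros r Hr. pose proof (area_step b B r M Hb Hb0 HB HT Hr) as A.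
    assert (Hr2 : (0 < r ^ 2)%R) by (apply pow_lt; lra).
    replace (X * r ^ (2 * M + 2))%R with ((r ^ (2 * M) * X) * r ^ 2)%R by (rewrite pow_add; ring).
    apply Rle_trans with (Ssum b r M * r ^ 2)%R.
    - apply Rmult_le_compat_r; [lra|]. unfold X, Ssum. rewrite <- rsum_scal. apply rsum_le. intros k Hk.
      rewrite Rmult_comm. apply Rmult_le_compat_l.
      + apply Rmult_le_pos; [apply pos_INR|apply pow2_ge_0].
      + replace (2 * M)%nat with (2 * k + 2 * (M - k))%nat by lia. rewrite pow_add.
        assert (0 < r ^ (2 * k))%R by (apply pow_lt; lra).
        assert (r ^ (2 * (M - k)) <= 1)%R by (rewrite <- (pow1 (2 * (M - k))); apply pow_incr; lra). nra.
    - apply Rle_trans with (/ r ^ 2 * r ^ 2)%R; [apply Rmult_le_compat_r; lra|right; field; lra]. }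
  apply Rnot_lt_le. intros Hlt.
  set (m := (2 * M + 2)%nat) in *.
  (* Bernoulli: (1 - t)^m >= 1 - m t *)
  assert (Bern : forall t, (0 <= t <= 1)%R -> (1 - INR m * t <= (1 - t) ^ m)%R).
  { intros t Ht. clear - Ht. induction m; [simpl; lra|]. rewrite S_INR. simpl.
    assert (0 <= (1 - t) ^ m <= 1)%R.
    { split; [apply pow_le; lra|]. apply Rle_trans with (1 ^ m)%R; [apply pow_incr; lra|rewrite pow1; lra]. }
    pose proof (pos_INR m). nra. }
  (* Small enough for [X (1 - m t) > 1] whenever [X > 1]. *)
  set (t := ((X - 1) / (2 * X * (INR m + 1)))%R). pose proof (pos_INR m) as Hm.
  assert (Ht0 : (0 < t)%R).
  { unfold t. apply Rdiv_lt_0_compat; [lra|]. apply Rmult_lt_0_compat; lra. }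
  assert (Htm : (t * (INR m + 1) * (2 * X) = X - 1)%R) by (unfold t; field; lra).
  assert (Ht1 : (t < 1)%R).
  { apply Rmult_lt_reg_r with ((INR m + 1) * (2 * X))%R; [apply Rmult_lt_0_compat; lra|].
    rewrite <- Rmult_assoc, Htm. nra. }
  pose proof (H (1 - t)%R ltac:(lra)) as P1. pose proof (Bern t ltac:(lra)) as P2.
  assert (P3 : (X * (1 - INR m * t) <= 1)%R).
  { apply Rle_trans with (2 := P1). apply Rmult_le_compat_l; auto. }
  assert (P4 : (t * INR m * (2 * X) <= X - 1)%R) by nra. nra.
Qed.

(** * The odd square-root transform *)

Definition Cexp (z : C) : C := RtoC (exp (fst z)) * cis (snd z).

Lemma Cexp_plus z w : Cexp (z + w) = Cexp z * Cexp w.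
Proof. unfold Cexp. simpl fst; simpl snd. rewrite exp_plus, RtoC_mult, cis_plus. ring. Qed.

Lemma Cexp_0 : Cexp 0 = 1.
Proof. unfold Cexp, cis. simpl. rewrite exp_0, cos_0, sin_0. ceq; ring. Qed.

Lemma cderiv_Cexp_0 : cderiv Cexp 0 1.
Proof.
  intros e He.
  assert (De : is_derive exp 0 1%R).
  { rewrite <- exp_0. apply is_derive_Reals, derivable_pt_lim_exp. }
  destruct (is_derive_eps exp 0 1 De (Rmin 1 (e / 8))) as (d1 & Hd1 & H1); [apply Rmin_glb_lt; lra|].
  destruct (rderiv_cis 0 (e / 16)%R) as (d2 & Hd2 & H2); [lra|].
  exists (Rmin (Rmin d1 d2) (Rmin 1 (e / 8))). split.
  { repeat apply Rmin_glb_lt; lra. }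
  intros u Hu.
  assert (Hu1 : (Cmod u < d1)%R) by (eapply Rlt_le_trans; [apply Hu|]; eapply Rle_trans; [apply Rmin_l|apply Rmin_l]).
  assert (Hu2 : (Cmod u < d2)%R) by (eapply Rlt_le_trans; [apply Hu|]; eapply Rle_trans; [apply Rmin_l|apply Rmin_r]).
  assert (Hu3 : (Cmod u < 1)%R) by (eapply Rlt_le_trans; [apply Hu|]; eapply Rle_trans; [apply Rmin_r|apply Rmin_l]).
  assert (Hu4 : (Cmod u < e / 8)%R) by (eapply Rlt_le_trans; [apply Hu|]; eapply Rle_trans; [apply Rmin_r|apply Rmin_r]).
  pose proof (fst_le_Cmod u) as Fx. pose proof (snd_le_Cmod u) as Fy.
  set (x := fst u) in *. set (y := snd u) in *.
  specialize (H1 x ltac:(lra)). specialize (H2 y ltac:(lra)). rewrite !Rplus_0_l in *. rewrite exp_0 in H1.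
  assert (c0 : cis 0 = 1) by (unfold cis; rewrite cos_0, sin_0; reflexivity). rewrite c0 in H2.
  (* The remainder of [exp x], the remainder of [cis y] multiplied by [exp x], and the mixed term
     [(exp x - 1) i y]. *)
  replace (Cexp (0 + u) - Cexp 0 - 1 * u)
    with (RtoC (exp x - 1 - x * 1) + RtoC (exp x) * (cis y - 1 - RtoC y * (Ci * 1)) + RtoC (exp x - 1) * (RtoC y * Ci)).
  2: { rewrite Cexp_0. replace (0 + u) with u by ring. unfold Cexp. fold x y.
       rewrite (surjective_pairing u). fold x y. unfold cis, Ci. ceq; ring. }
  set (X := (exp x - 1 - x * 1)%R) in *. set (Y := cis y - 1 - RtoC y * (Ci * 1)) in *.
  assert (M1 : (Rmin 1 (e / 8) <= 1)%R) by apply Rmin_l. assert (M2 : (Rmin 1 (e / 8) <= e / 8)%R) by apply Rmin_r.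
  pose proof (Rabs_pos x). pose proof (Rabs_pos y).
  assert (HX : (Rabs X <= e / 8 * Cmod u)%R) by nra.
  assert (HX1 : (Rabs X <= Rabs x)%R) by nra.
  assert (He1 : (Rabs (exp x - 1) <= 2 * Cmod u)%R).
  { replace (exp x - 1)%R with (X + x)%R by (unfold X; ring). eapply Rle_trans; [apply Rabs_triang|]. lra. }
  assert (Hex : (Rabs (exp x) <= 3)%R).
  { replace (exp x) with ((exp x - 1) + 1)%R by ring. eapply Rle_trans; [apply Rabs_triang|]. rewrite Rabs_R1. lra. }
  eapply Rle_trans; [apply Cmod_triangle|]. eapply Rle_trans; [apply Rplus_le_compat_r, Cmod_triangle|].
  rewrite !Cmod_mult, !Cmod_R, Cmod_Ci, Rmult_1_r.
  pose proof (Cmod_ge_0 u). pose proof (Cmod_ge_0 Y).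
  assert (Cmod Y <= e / 16 * Cmod u)%R by nra.
  assert (Rabs (exp x) * Cmod Y <= 3 * (e / 16 * Cmod u))%R by (apply Rmult_le_compat; try lra; apply Rabs_pos).
  assert (Rabs (exp x - 1) * Rabs y <= 2 * Cmod u * (e / 8))%R by (apply Rmult_le_compat; try lra; apply Rabs_pos).
  nra.
Qed.

Lemma cderiv_Cexp z : cderiv Cexp z (Cexp z).
Proof.
  apply cderiv_ext_loc with (f := fun w => Cexp z * Cexp (w - z)) (r := 1%R); [lra| |].
  - intros w _. rewrite <- Cexp_plus. f_equal. ring.
  - assert (H : cderiv (fun w => Cexp z * Cexp (w - z)) z (Cexp z * (1 * 1))).
    { apply cderiv_scal. apply (cderiv_comp Cexp (fun w => w - z)).
      - apply cderiv_exact. intros; ring.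
      - replace (z - z) with (RtoC 0) by ring. apply cderiv_Cexp_0. }
    replace (Cexp z * (1 * 1)) with (Cexp z) in H by ring. exact H.
Qed.

(** [V = exp (- L / 2)] with [L] the primitive of [q' / q]; then [V^2 q] has derivative 0 and the
    value 1 at 0. *)
Lemma holo_rsqrt a q : (forall z, (Cmod z < 1)%R -> csums a z (q z)) -> q 0 = 1 ->
  (forall z, (Cmod z < 1)%R -> q z <> 0) ->
  exists V, holo 1 V (fun z => - / 2 * (V z * (dsum a z / q z))) /\ V 0 = 1 /\
    forall z, (Cmod z < 1)%R -> V z * V z * q z = 1.
Proof.
  intros Ha H0 Hnz.
  pose proof (pser_holo a 1 q Ha) as Hq.
  pose proof (pser_holo (cdcoef a) 1 (dsum a) (pser_dsum a 1 q Ha)) as Hq'.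
  destruct (holo_div 1 (dsum a) (dsum (cdcoef a)) q (dsum a) Hq' Hq Hnz) as [h Hh].
  destruct (taylor 1 _ _ Hh ltac:(lra)) as [l Hl].
  pose proof (logcoef_csums l 1 _ Hl) as HL.
  set (L := fun z => ctotal (fun k => logcoef l k * z ^ k)) in *.
  assert (HdL : forall w, (Cmod w < 1)%R -> cderiv L w (dsum a w / q w)).
  { intros w Hw. replace (dsum a w / q w) with (dsum (logcoef l) w).
    - apply pser_cderiv' with 1%R; auto.
    - apply cser_unique with (fun k => cdcoef (logcoef l) k * w ^ k).
      + apply (pser_dsum _ 1 L); auto.
      + apply cser_ext with (2 := Hl w Hw). intros k. rewrite cdcoef_logcoef. reflexivity. }
  assert (H00 : (Cmod (RtoC 0) < 1)%R) by (rewrite Cmod_0; lra).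
  assert (L0 : L 0 = 0).
  { apply cser_unique with (1 := HL _ H00). apply (csums_at_0 (logcoef l)). }
  set (V := fun z => Cexp (- / 2 * L z)).
  assert (HV : forall z, (Cmod z < 1)%R -> cderiv V z (- / 2 * (V z * (dsum a z / q z)))).
  { intros z Hz. replace (- / 2 * (V z * (dsum a z / q z))) with (V z * (- / 2 * (dsum a z / q z))) by ring.
    apply (cderiv_comp Cexp (fun z => - / 2 * L z)); [apply cderiv_scal; auto|apply cderiv_Cexp]. }
  assert (V0 : V 0 = 1).
  { unfold V. rewrite L0. replace (- / 2 * 0) with (RtoC 0) by ring. apply Cexp_0. }
  exists V. split; [|split]; auto.
  - intros z Hz. split; [apply HV; auto|].
    apply ccont_mult; [apply ccont_const|]. apply ccont_mult; [eapply cderiv_ccont, HV; auto|].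
    eapply holo_ccont; eauto.
  - intros z Hz. rewrite (holo_const 1 (fun z => V z * V z * q z)); auto.
    + rewrite V0, H0. ring.
    + intros w Hw. specialize (Hnz w Hw).
      eapply cderiv_eq; [exact (cderiv_mult _ _ w _ _ (cderiv_mult V V w _ _ (HV w Hw) (HV w Hw)) (proj1 (Hq w Hw)))|].
      cbv beta. field. auto.
Qed.

(** Meant for a series in which every second term vanishes, compared with the same series without
    the gaps. *)
Lemma cser_even f g l m : cser f l -> cser g m -> (forall p, csum f (2 * p) = csum g p) -> l = m.
Proof.
  intros Hf Hg E. apply Ceq_minus, Cmod_eq_0. apply Rle_antisym; [|apply Cmod_ge_0].
  apply le_epsilon. intros e He. destruct (Hf (e / 2)%R) as [N1 H1]; [lra|].
  destruct (Hg (e / 2)%R) as [N2 H2]; [lra|].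
  specialize (H1 (2 * (N1 + N2))%nat ltac:(lia)). specialize (H2 (N1 + N2)%nat ltac:(lia)). rewrite E in H1.
  set (s := csum g (N1 + N2)) in *. rewrite Cmod_minus_sym in H1.
  replace (l - m) with ((l - s) + (s - m)) by ring. eapply Rle_trans; [apply Cmod_triangle|]. lra.
Qed.

(* The coefficients of [(V(z^2) - 1) / z]. *)
Definition oddcoef (v : nat -> C) (k : nat) : C := if Nat.odd k then v (S k / 2)%nat else 0.

Lemma oddcoef_even v p : oddcoef v (2 * p) = 0.
Proof. unfold oddcoef. rewrite Nat.odd_mul. reflexivity. Qed.

Lemma oddcoef_odd v p : oddcoef v (2 * p + 1) = v (S p).
Proof.
  unfold oddcoef. rewrite Nat.odd_add, Nat.odd_mul. change (Nat.odd 2) with false. change (Nat.odd 1) with true. cbn [xorb andb].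
  f_equal. replace (S (2 * p + 1)) with (S p * 2)%nat by lia. apply Nat.div_mul. lia.
Qed.

Lemma oddcoef_pbound v : all_pbound v -> all_pbound (oddcoef v).
Proof.
  intros Hv q Hq. destruct (Hv (q ^ 2)%R) as [M HM]; [split; [apply pow_lt; lra|nra]|].
  assert (HM0 : (0 <= M)%R) by (apply (pbound_nonneg v (q ^ 2) M); auto; apply pow2_ge_0).
  exists (M / q)%R. intros k. destruct (Nat.Even_or_Odd k) as [[p ->]|[p ->]].
  - rewrite oddcoef_even, Cmod_0, Rmult_0_l. apply Rdiv_le_0_compat; lra.
  - rewrite oddcoef_odd. specialize (HM (S p)). rewrite <- pow_mult in HM.
    apply Rmult_le_reg_r with q; [lra|]. unfold Rdiv. rewrite (Rmult_assoc M), Rinv_l, Rmult_1_r by lra.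
    eapply Rle_trans; [|apply HM]. right. replace (2 * S p)%nat with (S (2 * p + 1)) by lia. simpl. ring.
Qed.

Lemma oddcoef_fun v V z : all_pbound v -> (forall w, (Cmod w < 1)%R -> csums v w (V w)) -> v O = 1 ->
  (Cmod z < 1)%R -> z * ctotal (fun k => oddcoef v k * z ^ k) = V (z * z) - 1.
Proof.
  intros Hv HV Hv0 Hz. pose proof (Cmod_ge_0 z).
  destruct (oddcoef_pbound v Hv ((Cmod z + 1) / 2)%R) as [M HM]; [lra|].
  pose proof (csums_exists (oddcoef v) ((Cmod z + 1) / 2) M z ltac:(lra) HM ltac:(lra)) as S1.
  apply (cser_scal z) in S1.
  assert (Hzz : (Cmod (z * z) < 1)%R) by (rewrite Cmod_mult; nra).
  pose proof (HV (z * z) Hzz) as S2. apply (cser_shift _ _ 1) in S2. cbn [csum] in S2.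
  rewrite Hv0 in S2. replace (V (z * z) - (0 + 1 * (z * z) ^ 0)) with (V (z * z) - 1) in S2 by (simpl; ring).
  apply (cser_even _ _ _ _ S1 S2). intros p. induction p; [reflexivity|].
  replace (2 * S p)%nat with (S (S (2 * p))) by lia. cbn [csum]. rewrite IHp.
  rewrite oddcoef_even. replace (S (2 * p)) with (2 * p + 1)%nat by lia. rewrite oddcoef_odd.
  replace (1 + p)%nat with (S p) by lia.
  rewrite <- Cplus_assoc. f_equal. rewrite Cpow_mult_l.
  replace (z ^ (2 * p + 1)) with (z ^ p * z ^ p * z) by (rewrite Cpow_add_r, Cpow_1_r; f_equal; rewrite <- Cpow_add_r; f_equal; lia).
  simpl. ring.
Qed.

Lemma csums_all_pbound a f : (forall z, (Cmod z < 1)%R -> csums a z (f z)) -> all_pbound a.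
Proof. intros H q Hq. apply (csums_pbound a q f); [lra|]. intros; apply H; lra. Qed.

Lemma rsum_even f n : rsum f (2 * n) = rsum (fun m => f (2 * m)%nat + f (2 * m + 1)%nat)%R n.
Proof.
  induction n; [reflexivity|]. replace (2 * S n)%nat with (S (S (2 * n))) by lia. cbn [rsum]. rewrite IHn.
  replace (S (2 * n)) with (2 * n + 1)%nat by lia. ring.
Qed.

Definition delta (k : nat) : C := match k with O => 1 | _ => 0 end.

Lemma csums_delta z : csums delta z 1.
Proof.
  assert (E : csum (fun k => delta k * z ^ k) 1 = 1) by (simpl; ring).
  refine (eq_ind _ (fun l => cser _ l) (cser_finite _ 1 _) _ E). intros [|k] Hk; [lia|]. simpl. ring.
Qed.

(* The area theorem is applied to the odd function [V(z^2) / z], where [F = z / V^2] and [V = 1 + sum v_m z^m = 1 / P]. *)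
Theorem univalent_sqrt_area A F : (forall z, (Cmod z < 1)%R -> csums A z (F z)) -> A O = 0 -> A 1%nat = 1 ->
  univalent_on (disk 1) F -> (forall z, (Cmod z < 1)%R -> dsum A z <> 0) ->
  exists v p : nat -> C, v O = 1 /\ (forall n, (rsum (fun m => (2 * INR m + 1) * Cmod (v (S m)) ^ 2)%R n <= 1)%R) /\
    (forall k, conv v p k = delta k) /\ (forall k, A (S k) = conv p p k).
Proof.
  intros HA A0 A1 Hinj Hd.
  set (a := fun k => A (S k)).
  assert (Ha : forall z, (Cmod z < 1)%R -> csums a z (ctotal (fun k => a k * z ^ k))).
  { intros z Hz. destruct (between _ _ Hz (Cmod_ge_0 z)) as [Hp Hp0].
    destruct (csums_pbound A ((Cmod z + 1) / 2) F) as [M HM]; [lra|intros; apply HA; lra|].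
    apply csums_exists with ((Cmod z + 1) / 2)%R (M / ((Cmod z + 1) / 2))%R; auto; [|lra].
    intros k. specialize (HM (S k)). unfold a.
    apply Rmult_le_reg_r with ((Cmod z + 1) / 2)%R; auto. unfold Rdiv at 3. rewrite (Rmult_assoc M), Rinv_l by lra.
    simpl in HM. lra. }
  set (q := fun z => ctotal (fun k => a k * z ^ k)) in *.
  assert (Hzq : forall z, (Cmod z < 1)%R -> F z = z * q z).
  { intros z Hz. apply cser_unique with (1 := HA z Hz). apply (cser_shift _ _ 1). cbn [csum]. rewrite A0.
    replace (z * q z - (0 + 0 * z ^ 0)) with (z * q z) by (simpl; ring).
    apply cser_ext with (fun k => z * (a k * z ^ k)); [intros k; unfold a; simpl; ring|].
    apply cser_scal, Ha; auto. }
  assert (H00 : (Cmod (RtoC 0) < 1)%R) by (rewrite Cmod_0; lra).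
  assert (q0 : q 0 = 1).
  { apply cser_unique with (1 := Ha _ H00). rewrite <- A1. apply (csums_at_0 a). }
  assert (Hqnz : forall z, (Cmod z < 1)%R -> q z <> 0).
  { intros z Hz E. assert (F z = F 0) by (rewrite (Hzq z Hz), (Hzq 0 H00), E; ring).
    assert (z = 0) by (apply Hinj; auto). subst z. rewrite q0 in E. apply C1_nz. exact E. }
  pose proof (pser_holo a 1 q Ha) as Hqh.
  assert (Hdq : forall z, (Cmod z < 1)%R -> dsum A z = q z + z * dsum a z).
  { intros z Hz. apply (cderiv_unique F z); [apply pser_cderiv' with 1%R; auto|].
    assert (D : cderiv (fun w => w * q w) z (1 * q z + z * dsum a z)).
    { apply (cderiv_mult (fun w => w)); [apply cderiv_id|apply Hqh; auto]. }
    replace (1 * q z) with (q z) in D by ring.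
    apply cderiv_ext_loc with (f := fun w => w * q w) (r := (1 - Cmod z)%R); [lra| |exact D].
    intros w Hw. symmetry. apply Hzq. pose proof (Cmod_triangle_sub w z). lra. }
  destruct (holo_rsqrt a q Ha q0 Hqnz) as (V & HVh & V0 & HVq).
  destruct (taylor 1 V _ HVh ltac:(lra)) as [v HV].
  assert (v0 : v O = 1).
  { rewrite <- V0. apply cser_unique with (2 := HV _ H00). apply (csums_at_0 v). }
  pose proof (csums_all_pbound v V HV) as Hvb.
  assert (HVnz : forall z, (Cmod z < 1)%R -> V z <> 0).
  { intros z Hz E. pose proof (HVq z Hz) as H. rewrite E in H. apply C1_nz. rewrite <- H. ring. }
  set (b := oddcoef v). set (B := fun z => ctotal (fun k => b k * z ^ k)).
  pose proof (oddcoef_pbound v Hvb) as Hbb. fold b in Hbb.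
  assert (HB : forall z, (Cmod z < 1)%R -> csums b z (B z)).
  { intros z Hz. pose proof (Cmod_ge_0 z). destruct (Hbb ((Cmod z + 1) / 2)%R) as [M HM]; [lra|].
    apply csums_exists with ((Cmod z + 1) / 2)%R M; auto; lra. }
  assert (HzB : forall z, (Cmod z < 1)%R -> z * B z = V (z * z) - 1) by (intros; apply oddcoef_fun; auto).
  assert (Hsq : forall z, (Cmod z < 1)%R -> (Cmod (z * z) < 1)%R).
  { intros z Hz. rewrite Cmod_mult. pose proof (Cmod_ge_0 z). nra. }
  (* With [H z = V(z^2) / z], this is the univalence of [H]. On the diagonal the kernel is
     [V F' / q] at [z^2], which is not 0. Off the diagonal [H z = H w] gives [F(z^2) = F(w^2)],
     hence [z^2 = w^2], and [z = - w] is excluded because [H] is odd and has no zeros. *)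
  assert (HT : forall z w, (Cmod z < 1)%R -> (Cmod w < 1)%R -> Tk b z w <> 0).
  { intros z w Hz Hw.
    destruct (Ceq_dec z 0) as [->|Hz0]; [rewrite Tk_zero; auto; apply C1_nz|].
    destruct (Ceq_dec w 0) as [->|Hw0]; [rewrite Tk_sym, Tk_zero; auto; apply C1_nz|].
    destruct (Ceq_dec z w) as [<-|Hne].
    - set (s := z * z). assert (Hs : (Cmod s < 1)%R) by (apply Hsq; auto).
      pose proof (pser_holo b 1 B HB) as HBh.
      rewrite (Tk_diag b B (dsum b z)) by (auto; apply HBh; auto).
      assert (E : B z + z * dsum b z = - / 2 * (V s * (dsum a s / q s)) * (2 * z)).
      { apply (cderiv_unique (fun w => w * B w) z).
        - replace (B z + z * dsum b z) with (1 * B z + z * dsum b z) by ring.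
          apply (cderiv_mult (fun w => w)); [apply cderiv_id|apply HBh; auto].
        - apply cderiv_ext_loc with (f := fun w => V (w * w) - 1) (r := (1 - Cmod z)%R); [lra| |].
          { intros x Hx. symmetry. apply HzB. pose proof (Cmod_triangle_sub x z). lra. }
          assert (D : cderiv (fun w => V (w * w) - 1) z (- / 2 * (V s * (dsum a s / q s)) * (1 * z + z * 1) - 0)).
          { apply (cderiv_minus (fun w => V (w * w))); [|apply cderiv_const].
            apply (cderiv_comp V (fun w => w * w)); [apply (cderiv_mult (fun w => w) (fun w => w)); apply cderiv_id|].
            apply HVh; auto. }
          eapply cderiv_eq; [exact D|]. ring. }
      assert (E2 : 1 - z * z * dsum b z = V s * (dsum A s / q s)).
      { replace (z * z * dsum b z) with (z * (B z + z * dsum b z) - z * B z) by ring. rewrite E, HzB by auto.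
        fold s. rewrite Hdq by auto. replace (z * (- / 2 * (V s * (dsum a s / q s)) * (2 * z))) with (- (V s * (dsum a s / q s) * s)) by (unfold s; field; apply Hqnz; auto).
        field. apply Hqnz; auto. }
      rewrite E2. apply Cmult_neq_0; [apply HVnz; auto|]. apply Cmult_neq_0; [apply Hd; auto|].
      intros Ei. apply C1_nz. replace (RtoC 1) with (q s * / q s) by (field; apply Hqnz; auto). rewrite Ei. ring.
    - intros ET. pose proof (Tk_diff b B z w Hbb HB Hz Hw) as TD. rewrite ET in TD.
      set (s := z * z). set (t := w * w).
      assert (Hs : (Cmod s < 1)%R) by (apply Hsq; auto). assert (Ht : (Cmod t < 1)%R) by (apply Hsq; auto).
      assert (E : w * V s = z * V t).
      { pose proof (HzB z Hz) as E1. pose proof (HzB w Hw) as E2. fold s in E1. fold t in E2.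
        replace (V s) with (z * B z + 1) by (rewrite E1; ring). replace (V t) with (w * B w + 1) by (rewrite E2; ring).
        apply Ceq_minus. replace (w * (z * B z + 1) - z * (w * B w + 1)) with ((w - z) + z * w * (B z - B w)) by ring.
        rewrite <- TD. ring. }
      assert (EF : F s = F t).
      { rewrite !Hzq by auto. pose proof (HVq s Hs) as Q1. pose proof (HVq t Ht) as Q2.
        assert (E2 : t * (V s * V s) = s * (V t * V t)).
        { replace (t * (V s * V s)) with ((w * V s) * (w * V s)) by (unfold t; ring). rewrite E. unfold s; ring. }
        replace (s * q s) with (s * q s * (V t * V t * q t)) by (rewrite Q2; ring).
        replace (s * q s * (V t * V t * q t)) with (s * (V t * V t) * q s * q t) by ring.
        rewrite <- E2. replace (t * (V s * V s) * q s * q t) with (t * q t * (V s * V s * q s)) by ring. rewrite Q1. ring. }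
      assert (Est : s = t) by (apply Hinj; auto).
      assert (Hm : (z - w) * (z + w) = 0).
      { replace ((z - w) * (z + w)) with (s - t) by (unfold s, t; ring). rewrite Est. ring. }
      assert (Hzw : z + w = 0).
      { apply NNPP. intros Hn. apply (Cmult_neq_0 (z - w) (z + w)); auto. intros E0. apply Hne, Ceq_minus. auto. }
      rewrite <- Est in E. assert (E3 : (z - w) * V s = 0) by (replace ((z - w) * V s) with (z * V s - w * V s) by ring; rewrite E; ring).
      apply (Cmult_neq_0 (z - w) (V s)); auto. intros E0. apply Hne, Ceq_minus. auto. }
  destruct (taylor 1 (fun z => / V z) _ (holo_inv 1 V _ HVh HVnz) ltac:(lra)) as [p Hp].
  exists v, p. split; [auto|]. split; [|split].
  (* The coefficients of even index vanish, and the index [k = 2m + 1] carries [v_(m+1)]; this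
     produces the weights [2m + 1]. *)
  - intros n. pose proof (area_theorem b B (2 * n) Hbb ltac:(apply (oddcoef_even v 0)) HB HT) as AT.
    cbn [rsum] in AT. rewrite rsum_even in AT.
    assert (T0 : (0 <= INR (2 * n) * Cmod (b (2 * n)%nat) ^ 2)%R) by (apply Rmult_le_pos; [apply pos_INR|apply pow2_ge_0]).
    eapply Rle_trans; [|apply Rle_trans with (2 := AT); apply Rplus_le_compat_l with (1 := T0)].
    rewrite Rplus_0_r. right. apply rsum_ext. intros m _. unfold b. rewrite oddcoef_even, oddcoef_odd, Cmod_0.
    rewrite plus_INR, mult_INR. simpl. ring.
  - apply (csums_unique _ _ (fun _ => 1) 1%R); [lra| |intros; apply csums_delta].
    intros z Hz. replace (RtoC 1) with (V z * / V z) by (field; apply HVnz; auto).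
    apply (csums_mult v p 1 V (fun z => / V z)); auto.
  - apply (csums_unique _ _ q 1%R); [lra|auto|].
    intros z Hz. replace (q z) with (/ V z * / V z).
    + apply (csums_mult p p 1 (fun z => / V z) (fun z => / V z)); auto.
    + pose proof (HVq z Hz) as Q. assert (V z <> 0) by (apply HVnz; auto).
      replace (q z) with (V z * V z * q z * (/ V z * / V z)) by (field; auto). rewrite Q. ring.
Qed.

Local Open Scope R_scope.

(** * Comparison with the Koebe function *)

Definition rconv (x y : nat -> R) (k : nat) : R := rsum (fun j => x j * y (k - j)%nat) (S k).

Lemma rconv_rsum x y n : rsum (rconv x y) n = rsum (fun j => x j * rsum y (n - j)) n.
Proof.
  induction n; [reflexivity|]. cbn [rsum]. rewrite IHn. unfold rconv. cbn [rsum].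
  rewrite (rsum_ext (fun j => x j * rsum y (S n - j)) (fun j => x j * rsum y (n - j) + x j * y (n - j)%nat)).
  - rewrite rsum_plus. replace (S n - n)%nat with 1%nat by lia. rewrite Nat.sub_diag. simpl. ring.
  - intros j Hj. replace (S n - j)%nat with (S (n - j)) by lia. cbn [rsum]. ring.
Qed.

Lemma rconv_rsum_le x y n : (forall k, 0 <= x k) -> (forall k, 0 <= y k) ->
  rsum (rconv x y) n <= rsum x n * rsum y n.
Proof.
  intros Hx Hy. rewrite rconv_rsum, <- rsum_scal_r. apply rsum_le. intros j _.
  apply Rmult_le_compat_l; auto. apply rsum_mono; [lia|auto].
Qed.

(** The Leibniz rule for [r d/dr], written in coefficients. *)
Lemma rconv_weight x y k : INR k * rconv x y k = rconv (fun j => INR j * x j) y k + rconv x (fun j => INR j * y j) k.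
Proof.
  unfold rconv. rewrite <- rsum_scal, <- rsum_plus. apply rsum_ext. intros j Hj.
  rewrite minus_INR by lia. ring.
Qed.

Lemma rsum_INR_weight x K n : (forall k, x k <= K k) -> rsum (fun k => INR k * x k) n <= rsum (fun k => INR k * K k) n.
Proof. intros H. apply rsum_le. intros k _. apply Rmult_le_compat_l; [apply pos_INR|auto]. Qed.

(* As power series, [x] and [y] stand in the relation [y <= 1 / (1 - x)]. *)
Lemma major_inverse x y X X' n : (forall k, 0 <= x k) -> (forall k, 0 <= y k) ->
  (forall k, y k <= (if Nat.eq_dec k 0 then 1 else 0) + rconv x y k) ->
  rsum x n <= X -> rsum (fun k => INR k * x k) n <= X' -> X < 1 ->
  rsum y n * (1 - X) <= 1 /\ rsum (fun k => INR k * y k) n * (1 - X) <= X' * rsum y n.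
Proof.
  intros Hx Hy H HX HX' HX1.
  assert (Hy0 : 0 <= rsum y n) by (apply rsum_nonneg; auto).
  assert (Hky : forall k, 0 <= INR k * y k) by (intros; apply Rmult_le_pos; [apply pos_INR|auto]).
  assert (Hkx : forall k, 0 <= INR k * x k) by (intros; apply Rmult_le_pos; [apply pos_INR|auto]).
  assert (Hky0 : 0 <= rsum (fun k => INR k * y k) n) by (apply rsum_nonneg; auto).
  split.
  - assert (rsum y n <= rsum (fun k => if Nat.eq_dec k 0 then 1 else 0) n + rsum x n * rsum y n).
    { eapply Rle_trans; [apply rsum_le; intros; apply H|]. rewrite rsum_plus.
      apply Rplus_le_compat_l. apply rconv_rsum_le; auto. }
    assert (rsum (fun k => if Nat.eq_dec k 0 then 1 else 0) n <= 1).
    { destruct n; [simpl; lra|]. rewrite rsum_S_l, rsum_0; [simpl; lra|]. intros k _.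
      destruct (Nat.eq_dec (S k) 0); [lia|auto]. }
    nra.
  - assert (rsum (fun k => INR k * y k) n <= rsum (fun k => INR k * x k) n * rsum y n + rsum x n * rsum (fun k => INR k * y k) n).
    { eapply Rle_trans; [apply rsum_INR_weight; intros; apply H|].
      rewrite (rsum_ext _ (fun k => rconv (fun j => INR j * x j) y k + rconv x (fun j => INR j * y j) k)).
      - rewrite rsum_plus. apply Rplus_le_compat; apply rconv_rsum_le; auto.
      - intros k _. rewrite Rmult_plus_distr_l, rconv_weight. destruct (Nat.eq_dec k 0) as [->|]; simpl; ring. }
    nra.
Qed.

Lemma Cmod_conv_le a b (r : R) k : 0 <= r ->
  Cmod (conv a b k) * r ^ k <= rconv (fun j => Cmod (a j) * r ^ j) (fun j => Cmod (b j) * r ^ j) k.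
Proof.
  intros Hr. unfold conv, rconv. eapply Rle_trans; [apply Rmult_le_compat_r; [apply pow_le; auto|apply Cmod_csum]|].
  rewrite <- rsum_scal_r. apply rsum_le. intros j Hj. rewrite Cmod_mult.
  replace (r ^ k) with (r ^ j * r ^ (k - j)) by (rewrite <- pow_add; f_equal; lia). right. ring.
Qed.

Lemma conv_plus_l a b c k : conv (fun j => a j + b j)%C c k = (conv a c k + conv b c k)%C.
Proof. unfold conv. rewrite <- csum_plus. apply csum_ext. intros; ring. Qed.

Lemma conv_plus_r a b c k : conv c (fun j => a j + b j)%C k = (conv c a k + conv c b k)%C.
Proof. unfold conv. rewrite <- csum_plus. apply csum_ext. intros; ring. Qed.

Lemma conv_ext a b a' b' k : (forall j, a j = a' j) -> (forall j, b j = b' j) -> conv a b k = conv a' b' k.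
Proof. intros H1 H2. apply csum_ext. intros. rewrite H1, H2. reflexivity. Qed.

Lemma conv_pow_pow al k : conv (fun j => al ^ j)%C (fun j => al ^ j)%C k = (RtoC (INR (S k)) * al ^ k)%C.
Proof.
  unfold conv. rewrite (csum_ext _ (fun _ => (al ^ k)%C)).
  - apply csum_const.
  - intros j Hj. rewrite <- Cpow_add_r. f_equal. lia.
Qed.

(* [1 / (1 - al z + v_2 z^2 + ...)^2] against [1 / (1 - al z)^2]; [P], [G], [D] majorise [1 / V], [1 / (1 - al z)] and their difference, the primed quantities the weighted sums. *)
Lemma koebe_comparison (v p : nat -> C) (r Q D1 : R) n : v O = RtoC 1 -> (forall k, conv v p k = delta k) -> 0 <= r ->
  let al := (- v 1%nat)%C in let s := Cmod (v 1%nat) in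
  rsum (fun k => Cmod (v (S (S k))) * r ^ S (S k)) n <= Q ->
  rsum (fun k => INR (S (S k)) * (Cmod (v (S (S k))) * r ^ S (S k))) n <= D1 ->
  s * r + Q < 1 ->
  exists P P' G G' D D', 0 <= P /\ 0 <= P' /\ 0 <= G /\ 0 <= G' /\ 0 <= D /\ 0 <= D' /\
    P * (1 - (s * r + Q)) <= 1 /\ P' * (1 - (s * r + Q)) <= (s * r + D1) * P /\
    G * (1 - s * r) <= 1 /\ G' * (1 - s * r) <= s * r * G /\
    D * (1 - s * r) <= Q * P /\ D' * (1 - s * r) <= s * r * D + D1 * P + Q * P' /\
    rsum (fun k => INR (S k) * Cmod (conv p p k - RtoC (INR (S k)) * al ^ k)%C * r ^ k) n
      <= D * P + G * D + D' * P + D * P' + G' * D + G * D'.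
Proof.
  intros Hv0 Hvp Hr al s HQ HD1 HX.
  assert (Hs0 : 0 <= s) by apply Cmod_ge_0.
  assert (HQ0 : 0 <= Q).
  { eapply Rle_trans; [|apply HQ]. apply rsum_nonneg. intros. apply Rmult_le_pos; [apply Cmod_ge_0|apply pow_le; auto]. }
  (* The moduli of the coefficients of [V - 1] are split into the linear one, which both functions
     share, and the rest, which causes the difference. *)
  set (x1 := fun k => if Nat.eq_dec k 1 then s * r else 0).
  set (x2 := fun k => match k with S (S j) => Cmod (v k) * r ^ k | _ => 0 end).
  set (x := fun k => x1 k + x2 k).
  set (y := fun k => Cmod (p k) * r ^ k).
  set (g := fun k => Cmod (al ^ k)%C * r ^ k).
  set (d := fun k => (p k + - al ^ k)%C).
  set (dd := fun k => Cmod (d k) * r ^ k).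
  assert (Hrk : forall k, 0 <= r ^ k) by (intros; apply pow_le; auto).
  assert (Hx1 : forall k, 0 <= x1 k) by (intros; unfold x1; destruct (Nat.eq_dec k 1); nra).
  assert (Hx2 : forall k, 0 <= x2 k) by (intros [|[|k]]; unfold x2; try lra; apply Rmult_le_pos; [apply Cmod_ge_0|auto]).
  assert (Hx : forall k, 0 <= x k) by (intros; unfold x; specialize (Hx1 k); specialize (Hx2 k); lra).
  assert (Hy : forall k, 0 <= y k) by (intros; apply Rmult_le_pos; [apply Cmod_ge_0|auto]).
  assert (Hg : forall k, 0 <= g k) by (intros; apply Rmult_le_pos; [apply Cmod_ge_0|auto]).
  assert (Hdd : forall k, 0 <= dd k) by (intros; apply Rmult_le_pos; [apply Cmod_ge_0|auto]).
  assert (W : forall f : nat -> R, (forall k, 0 <= f k) -> forall k, 0 <= INR k * f k)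
    by (intros; apply Rmult_le_pos; [apply pos_INR|auto]).
  assert (SX1 : rsum x1 n <= s * r).
  { destruct n as [|[|m]]; [simpl; nra|simpl; unfold x1; simpl; nra|].
    rewrite rsum_S_l, rsum_S_l, rsum_0; [unfold x1; simpl; lra|]. intros k _. unfold x1. destruct (Nat.eq_dec (S (S k)) 1); [lia|auto]. }
  assert (SX1' : rsum (fun k => INR k * x1 k) n <= s * r).
  { rewrite (rsum_ext _ x1); auto. intros k _. unfold x1. destruct (Nat.eq_dec k 1) as [->|]; simpl; ring. }
  assert (SX2 : rsum x2 n <= Q).
  { apply Rle_trans with (2 := HQ). destruct n as [|[|m]].
    - simpl. lra.
    - simpl. apply Rle_trans with 0; [lra|]. pose proof (Rmult_le_pos _ _ (Cmod_ge_0 (v 2%nat)) (Hrk 2%nat)). simpl in *. lra.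
    - rewrite rsum_S_l, rsum_S_l. change (x2 0%nat) with 0. change (x2 1%nat) with 0. rewrite !Rplus_0_l.
      apply (rsum_mono (fun k => Cmod (v (S (S k))) * r ^ S (S k)) m (S (S m))); [lia|].
      intros. apply Rmult_le_pos; [apply Cmod_ge_0|auto]. }
  assert (SX2' : rsum (fun k => INR k * x2 k) n <= D1).
  { apply Rle_trans with (2 := HD1). destruct n as [|[|m]].
    - simpl. lra.
    - simpl. apply Rle_trans with 0; [lra|]. pose proof (Rmult_le_pos _ _ (Cmod_ge_0 (v 2%nat)) (Hrk 2%nat)). simpl in *. lra.
    - rewrite rsum_S_l, rsum_S_l. change (x2 0%nat) with 0. change (x2 1%nat) with 0. rewrite !Rmult_0_r, !Rplus_0_l.
      apply (rsum_mono (fun k => INR (S (S k)) * (Cmod (v (S (S k))) * r ^ S (S k))) m (S (S m))); [lia|].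
      intros. apply Rmult_le_pos; [apply pos_INR|apply Rmult_le_pos; [apply Cmod_ge_0|auto]]. }
  (* The equation [V P = 1] solved for [P]: [P = 1 + al z P - (v_2 z^2 + ...) P]. *)
  assert (Hp : forall k, p k = (delta k + al * (match k with O => 0 | S j => p j end) +
     - conv (fun j => match j with S (S i) => v j | _ => 0 end) p k)%C).
  { intros k. pose proof (Hvp k) as E. unfold conv in E. rewrite csum_S_l, Hv0, Nat.sub_0_r in E.
    unfold conv. rewrite csum_S_l. rewrite Cmult_0_l, Cplus_0_l.
    destruct k as [|k].
    - simpl in E. simpl. rewrite <- E. ring.
    - rewrite csum_S_l in E. rewrite csum_S_l. replace (S k - 1)%nat with k in * by lia.
      replace (delta (S k)) with (RtoC 0) in * by reflexivity. rewrite Cmult_0_l, Cplus_0_l.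
      replace (S k - 1)%nat with k in E by lia.
      set (T := csum (fun k0 => v (S (S k0)) * p (S k - S (S k0))%nat)%C k) in *.
      unfold al. apply Ceq_minus.
      match goal with |- (?a = _)%C => replace a with (1 * p (S k) + (v 1%nat * p k + T))%C by ring end. exact E. }
  assert (Hconv2 : forall (q : nat -> C) k, Cmod (conv (fun j => match j with S (S i) => v j | _ => 0 end) q k)%C * r ^ k
     <= rconv x2 (fun j => Cmod (q j) * r ^ j) k).
  { intros q k. eapply Rle_trans; [apply Cmod_conv_le; auto|]. apply rsum_le. intros j _.
    apply Rmult_le_compat_r; [apply Rmult_le_pos; [apply Cmod_ge_0|auto]|].
    destruct j as [|[|j]]; unfold x2; [rewrite Cmod_0; lra|rewrite Cmod_0; lra|lra]. }
  assert (Hx1c : forall (q : nat -> C) k, Cmod (al * (match k with O => 0 | S j => q j end))%C * r ^ k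
     <= rconv x1 (fun j => Cmod (q j) * r ^ j) k).
  { intros q [|k].
    - rewrite Cmult_0_r, Cmod_0. unfold rconv. simpl. unfold x1; simpl. lra.
    - unfold rconv. rewrite rsum_S_l, rsum_S_l, rsum_0.
      + unfold x1; simpl. rewrite Cmod_mult. unfold al. rewrite Cmod_opp. fold s.
        replace (k - 0)%nat with k by lia. right. ring.
      + intros j _. unfold x1. destruct (Nat.eq_dec (S (S j)) 1); [lia|ring]. }
  assert (Hrc : forall a b c k, rconv (fun j => a j + b j) c k = rconv a c k + rconv b c k).
  { intros. unfold rconv. rewrite <- rsum_plus. apply rsum_ext. intros; ring. }
  assert (Hyrec : forall k, y k <= (if Nat.eq_dec k 0 then 1 else 0) + rconv x y k).
  { intros k. unfold y at 1. rewrite Hp at 1. unfold x. rewrite Hrc.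
    apply Rle_trans with ((Cmod (delta k) + Cmod (al * (match k with O => 0 | S j => p j end))%C
      + Cmod (conv (fun j => match j with S (S i) => v j | _ => 0 end) p k)%C) * r ^ k).
    - apply Rmult_le_compat_r; auto. eapply Rle_trans; [apply Cmod_triangle|]. rewrite Cmod_opp.
      apply Rplus_le_compat_r, Cmod_triangle.
    - pose proof (Hx1c p k). pose proof (Hconv2 p k). fold y in H, H0.
      assert (Cmod (delta k) * r ^ k <= if Nat.eq_dec k 0 then 1 else 0).
      { destruct k; simpl; rewrite ?Cmod_1, ?Cmod_0; lra. }
      lra. }
  assert (Hgrec : forall k, g k <= (if Nat.eq_dec k 0 then 1 else 0) + rconv x1 g k).
  { intros [|k].
    - unfold g at 1. simpl. rewrite Cmod_1. unfold rconv. simpl. unfold x1; simpl. lra.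
    - pose proof (Hx1c (fun j => al ^ j)%C (S k)) as H. simpl Nat.eq_dec. destruct (Nat.eq_dec (S k) 0); [lia|].
      rewrite Rplus_0_l. exact H. }
  assert (Hdrec : forall k, dd k <= rconv x1 dd k + rconv x2 y k).
  (* The difference [d] of the two inverses satisfies [d = al z d - (v_2 z^2 + ...) P]. *)
  { intros k. unfold dd at 1.
    assert (E : d k = (al * (match k with O => 0 | S j => d j end) + - conv (fun j => match j with S (S i) => v j | _ => 0 end) p k)%C).
    { unfold d at 1. rewrite Hp. destruct k; simpl; unfold d; ring. }
    rewrite E. apply Rle_trans with ((Cmod (al * (match k with O => 0 | S j => d j end))%C
      + Cmod (conv (fun j => match j with S (S i) => v j | _ => 0 end) p k)%C) * r ^ k).
    - apply Rmult_le_compat_r; auto. eapply Rle_trans; [apply Cmod_triangle|]. rewrite Cmod_opp. lra.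
    - pose proof (Hx1c d k). pose proof (Hconv2 p k). fold dd in H. fold y in H0. lra. }
  destruct (major_inverse x y (s * r + Q) (s * r + D1) n) as [M1 M2]; auto.
  { unfold x. rewrite rsum_plus. lra. }
  { unfold x. rewrite (rsum_ext _ (fun k => INR k * x1 k + INR k * x2 k)) by (intros; ring). rewrite rsum_plus. lra. }
  destruct (major_inverse x1 g (s * r) (s * r) n) as [M3 M4]; auto; [lra|].
  exists (rsum y n), (rsum (fun k => INR k * y k) n), (rsum g n), (rsum (fun k => INR k * g k) n),
    (rsum dd n), (rsum (fun k => INR k * dd k) n).
  assert (N1 : 0 <= rsum y n) by (apply rsum_nonneg; auto).
  assert (N2 : 0 <= rsum (fun k => INR k * y k) n) by (apply rsum_nonneg; auto).
  assert (N3 : 0 <= rsum g n) by (apply rsum_nonneg; auto).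
  assert (N4 : 0 <= rsum (fun k => INR k * g k) n) by (apply rsum_nonneg; auto).
  assert (N5 : 0 <= rsum dd n) by (apply rsum_nonneg; auto).
  assert (N6 : 0 <= rsum (fun k => INR k * dd k) n) by (apply rsum_nonneg; auto).
  do 10 (split; [assumption|]).
  split; [|split].
  - assert (rsum dd n <= rsum x1 n * rsum dd n + rsum x2 n * rsum y n).
    { eapply Rle_trans; [apply rsum_le; intros; apply Hdrec|]. rewrite rsum_plus.
      apply Rplus_le_compat; apply rconv_rsum_le; auto. }
    nra.
  - assert (rsum (fun k => INR k * dd k) n <= rsum (fun k => INR k * x1 k) n * rsum dd n + rsum x1 n * rsum (fun k => INR k * dd k) n
       + (rsum (fun k => INR k * x2 k) n * rsum y n + rsum x2 n * rsum (fun k => INR k * y k) n)).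
    { eapply Rle_trans; [apply rsum_INR_weight; intros; apply Hdrec|].
      rewrite (rsum_ext _ (fun k => rconv (fun j => INR j * x1 j) dd k + rconv x1 (fun j => INR j * dd j) k +
        (rconv (fun j => INR j * x2 j) y k + rconv x2 (fun j => INR j * y j) k))).
      - rewrite !rsum_plus. repeat apply Rplus_le_compat; apply rconv_rsum_le; auto.
      - intros k _. rewrite Rmult_plus_distr_l, !rconv_weight. ring. }
    nra.
  (* With [P] and [G] now the two inverses as series and [D = P - G]: [P^2 - G^2 = D P + G D]. The
     weight [k + 1] gives one plain copy and, by [rconv_weight], the products with one weighted
     factor. *)
  - assert (Hterm : forall k, INR (S k) * Cmod (conv p p k - RtoC (INR (S k)) * al ^ k)%C * r ^ k
       <= rconv dd y k + rconv g dd k + (rconv (fun j => INR j * dd j) y k + rconv dd (fun j => INR j * y j) k)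
          + (rconv (fun j => INR j * g j) dd k + rconv g (fun j => INR j * dd j) k)).
    { intros k.
      assert (E : (conv p p k - RtoC (INR (S k)) * al ^ k = conv d p k + conv (fun j => al ^ j) d k)%C).
      { rewrite <- conv_pow_pow.
        assert (E1 : conv p p k = (conv d p k + conv (fun j => al ^ j) p k)%C)
          by (rewrite <- conv_plus_l; apply conv_ext; auto; intros; unfold d; ring).
        assert (E2 : conv (fun j => al ^ j)%C p k = (conv (fun j => al ^ j) d k + conv (fun j => al ^ j) (fun j => al ^ j) k)%C)
          by (rewrite <- conv_plus_r; apply conv_ext; auto; intros; unfold d; ring).
        rewrite E1, E2. ring. }
      rewrite E. pose proof (Cmod_conv_le d p r k Hr) as C1. pose proof (Cmod_conv_le (fun j => al ^ j)%C d r k Hr) as C2.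
      fold dd y in C1. fold g dd in C2.
      change (rconv (fun j => Cmod (d j) * r ^ j) (fun j => Cmod (p j) * r ^ j) k) with (rconv dd y k) in C1.
      change (rconv (fun j => Cmod (al ^ j) * r ^ j) (fun j => Cmod (d j) * r ^ j) k) with (rconv g dd k) in C2.
      apply Rle_trans with (INR (S k) * (rconv dd y k + rconv g dd k)).
      - rewrite Rmult_assoc. apply Rmult_le_compat_l; [apply pos_INR|].
        pose proof (Cmod_triangle (conv d p k) (conv (fun j => al ^ j)%C d k)).
        apply Rle_trans with ((Cmod (conv d p k) + Cmod (conv (fun j => al ^ j)%C d k)) * r ^ k).
        + apply Rmult_le_compat_r; auto.
        + rewrite Rmult_plus_distr_r; apply Rplus_le_compat; [exact C1|exact C2].
      - rewrite S_INR, Rmult_plus_distr_r, Rmult_1_l, Rmult_plus_distr_l, !rconv_weight. lra. }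
    eapply Rle_trans; [apply rsum_le; intros; apply Hterm|]. rewrite !rsum_plus.
    pose proof (rconv_rsum_le dd y n Hdd Hy). pose proof (rconv_rsum_le g dd n Hg Hdd).
    pose proof (rconv_rsum_le (fun j => INR j * dd j) y n (W _ Hdd) Hy).
    pose proof (rconv_rsum_le dd (fun j => INR j * y j) n Hdd (W _ Hy)).
    pose proof (rconv_rsum_le (fun j => INR j * g j) dd n (W _ Hg) Hdd).
    pose proof (rconv_rsum_le g (fun j => INR j * dd j) n Hg (W _ Hdd)). lra.
Qed.

(** For [|u| = s / 4] and [X = 4 Re u], the first line is the real part of
    [1 + 4 u + 9 u^2 + 16 u^3]; the second subtracts the polynomial majorant of the comparison
    error. *)
Definition quartic4 (X s : R) : R :=
  1 + X + 9 / 16 * (2 * X ^ 2 - s ^ 2) + X ^ 3 - 3 / 4 * X * s ^ 2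
  - (3 / 5 * (1 - s ^ 2) + 5 / 12 * (26 / 100 + 3 / 10 * s + 1 / 4 * s ^ 2) ^ 2).

(** Adds the real part of [25 u^4], a Chebyshev polynomial in [X / s], and subtracts the bound of
    [koebe_tail] for all later terms. *)
Definition quintic5 (X s : R) : R :=
  quartic4 X s + 25 / 256 * (8 * X ^ 4 - 8 * X ^ 2 * s ^ 2 + s ^ 4) - 529 / 10000 * s ^ 5.

Ltac simplex_nonneg :=
  repeat apply Rplus_le_le_0_compat;
  (apply Rmult_le_pos; [lra|apply Rmult_le_pos; [apply Rmult_le_pos|]; apply pow_le; assumption]).

(* On each sub-triangle of [|X| <= s <= 1] the Bernstein coefficients (in the barycentric coordinates u, w, r) are positive. *)
Lemma quartic4_pos (X s : R) : - s <= X <= s -> s <= 1 -> 1 / 100 <= quartic4 X s.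
Proof.
  intros HX Hs. pose (r := 1 - s). assert (Hr : 0 <= r) by (unfold r; lra).
  destruct (Rle_dec X 0) as [H|H].
  - pose (u := - X). pose (w := s + X).
    assert (0 <= u /\ 0 <= w) as [Hu Hw] by (unfold u, w; lra).
    enough (E : quartic4 X s - 1 / 100 = 233/8000 * (u ^ 4 * w ^ 0 * r ^ 0)
    + 2233/2000 * (u ^ 3 * w ^ 1 * r ^ 0)
    + 163/2000 * (u ^ 3 * w ^ 0 * r ^ 1)
    + 5199/4000 * (u ^ 2 * w ^ 2 * r ^ 0)
    + 1989/2000 * (u ^ 2 * w ^ 1 * r ^ 1)
    + 281/6000 * (u ^ 2 * w ^ 0 * r ^ 2)
    + 733/2000 * (u ^ 1 * w ^ 3 * r ^ 0)
    + 1989/2000 * (u ^ 1 * w ^ 2 * r ^ 1)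
    + 2531/3000 * (u ^ 1 * w ^ 1 * r ^ 2)
    + 1147/3000 * (u ^ 1 * w ^ 0 * r ^ 3)
    + 1233/8000 * (u ^ 0 * w ^ 4 * r ^ 0)
    + 2163/2000 * (u ^ 0 * w ^ 3 * r ^ 1)
    + 11531/6000 * (u ^ 0 * w ^ 2 * r ^ 2)
    + 4147/3000 * (u ^ 0 * w ^ 1 * r ^ 3)
    + 2171/6000 * (u ^ 0 * w ^ 0 * r ^ 4)).
    { apply Rminus_le_0. rewrite E. simplex_nonneg. }
    unfold quartic4, r, u, w. field.
  - pose (u := s - X). pose (w := X).
    assert (0 <= u /\ 0 <= w) as [Hu Hw] by (unfold u, w; lra).
    enough (E : quartic4 X s - 1 / 100 = 1233/8000 * (u ^ 4 * w ^ 0 * r ^ 0)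
    + 1733/2000 * (u ^ 3 * w ^ 1 * r ^ 0)
    + 2163/2000 * (u ^ 3 * w ^ 0 * r ^ 1)
    + 11199/4000 * (u ^ 2 * w ^ 2 * r ^ 0)
    + 10989/2000 * (u ^ 2 * w ^ 1 * r ^ 1)
    + 11531/6000 * (u ^ 2 * w ^ 0 * r ^ 2)
    + 9233/2000 * (u ^ 1 * w ^ 3 * r ^ 0)
    + 19989/2000 * (u ^ 1 * w ^ 2 * r ^ 1)
    + 20531/3000 * (u ^ 1 * w ^ 1 * r ^ 2)
    + 4147/3000 * (u ^ 1 * w ^ 0 * r ^ 3)
    + 20233/8000 * (u ^ 0 * w ^ 4 * r ^ 0)
    + 13163/2000 * (u ^ 0 * w ^ 3 * r ^ 1)
    + 36281/6000 * (u ^ 0 * w ^ 2 * r ^ 2)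
    + 7147/3000 * (u ^ 0 * w ^ 1 * r ^ 3)
    + 2171/6000 * (u ^ 0 * w ^ 0 * r ^ 4)).
    { apply Rminus_le_0. rewrite E. simplex_nonneg. }
    unfold quartic4, r, u, w. field.
Qed.

Lemma quintic5_pos (X s : R) : - s <= X <= s -> s <= 1 -> 1 / 100 <= quintic5 X s.
Proof.
  intros HX Hs. pose (r := 1 - s). assert (Hr : 0 <= r) by (unfold r; lra).
  destruct (Rle_dec X (- s / 2)) as [H|H]; [|destruct (Rle_dec X 0) as [H'|H']].
  - pose (u := - s - 2 * X). pose (w := 2 * (s + X)).
    assert (0 <= u /\ 0 <= w) as [Hu Hw] by (unfold u, w; lra).
    enough (E : quintic5 X s - 1 / 100 = 11821/160000 * (u ^ 5 * w ^ 0 * r ^ 0)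
    + 2821/32000 * (u ^ 4 * w ^ 1 * r ^ 0)
    + 1333/6400 * (u ^ 4 * w ^ 0 * r ^ 1)
    + 973/8000 * (u ^ 3 * w ^ 2 * r ^ 0)
    + 1483/1600 * (u ^ 3 * w ^ 1 * r ^ 1)
    + 77/600 * (u ^ 3 * w ^ 0 * r ^ 2)
    + 2473/8000 * (u ^ 2 * w ^ 3 * r ^ 0)
    + 1481/800 * (u ^ 2 * w ^ 2 * r ^ 1)
    + 227/200 * (u ^ 2 * w ^ 1 * r ^ 2)
    + 103/240 * (u ^ 2 * w ^ 0 * r ^ 3)
    + 18267/64000 * (u ^ 1 * w ^ 4 * r ^ 0)
    + 2583/1600 * (u ^ 1 * w ^ 3 * r ^ 1)
    + 1583/800 * (u ^ 1 * w ^ 2 * r ^ 2)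
    + 26/15 * (u ^ 1 * w ^ 1 * r ^ 3)
    + 893/1200 * (u ^ 1 * w ^ 0 * r ^ 4)
    + 26767/320000 * (u ^ 0 * w ^ 5 * r ^ 0)
    + 6791/12800 * (u ^ 0 * w ^ 4 * r ^ 1)
    + 2633/2400 * (u ^ 0 * w ^ 3 * r ^ 2)
    + 761/480 * (u ^ 0 * w ^ 2 * r ^ 3)
    + 1493/1200 * (u ^ 0 * w ^ 1 * r ^ 4)
    + 2171/6000 * (u ^ 0 * w ^ 0 * r ^ 5)).
    { apply Rminus_le_0. rewrite E. simplex_nonneg. }
    unfold quintic5, quartic4, r, u, w. field.
  - pose (u := - 2 * X). pose (w := s + 2 * X).
    assert (0 <= u /\ 0 <= w) as [Hu Hw] by (unfold u, w; lra).
    enough (E : quintic5 X s - 1 / 100 = 26767/320000 * (u ^ 5 * w ^ 0 * r ^ 0)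
    + 35267/64000 * (u ^ 4 * w ^ 1 * r ^ 0)
    + 6791/12800 * (u ^ 4 * w ^ 0 * r ^ 1)
    + 10973/8000 * (u ^ 3 * w ^ 2 * r ^ 0)
    + 263/100 * (u ^ 3 * w ^ 1 * r ^ 1)
    + 2633/2400 * (u ^ 3 * w ^ 0 * r ^ 2)
    + 6299/4000 * (u ^ 2 * w ^ 3 * r ^ 0)
    + 7837/1600 * (u ^ 2 * w ^ 2 * r ^ 1)
    + 3683/800 * (u ^ 2 * w ^ 1 * r ^ 2)
    + 761/480 * (u ^ 2 * w ^ 0 * r ^ 3)
    + 27821/32000 * (u ^ 1 * w ^ 4 * r ^ 0)
    + 6533/1600 * (u ^ 1 * w ^ 3 * r ^ 1)
    + 1277/200 * (u ^ 1 * w ^ 2 * r ^ 2)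
    + 553/120 * (u ^ 1 * w ^ 1 * r ^ 3)
    + 1493/1200 * (u ^ 1 * w ^ 0 * r ^ 4)
    + 31821/160000 * (u ^ 0 * w ^ 5 * r ^ 0)
    + 8533/6400 * (u ^ 0 * w ^ 4 * r ^ 1)
    + 901/300 * (u ^ 0 * w ^ 3 * r ^ 2)
    + 793/240 * (u ^ 0 * w ^ 2 * r ^ 3)
    + 2093/1200 * (u ^ 0 * w ^ 1 * r ^ 4)
    + 2171/6000 * (u ^ 0 * w ^ 0 * r ^ 5)).
    { apply Rminus_le_0. rewrite E. simplex_nonneg. }
    unfold quintic5, quartic4, r, u, w. field.
  - pose (u := s - X). pose (w := X).
    assert (0 <= u /\ 0 <= w) as [Hu Hw] by (unfold u, w; lra).
    enough (E : quintic5 X s - 1 / 100 = 31821/160000 * (u ^ 5 * w ^ 0 * r ^ 0)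
    + 39821/32000 * (u ^ 4 * w ^ 1 * r ^ 0)
    + 8533/6400 * (u ^ 4 * w ^ 0 * r ^ 1)
    + 53321/16000 * (u ^ 3 * w ^ 2 * r ^ 0)
    + 12533/1600 * (u ^ 3 * w ^ 1 * r ^ 1)
    + 901/300 * (u ^ 3 * w ^ 0 * r ^ 2)
    + 88321/16000 * (u ^ 2 * w ^ 3 * r ^ 0)
    + 57899/3200 * (u ^ 2 * w ^ 2 * r ^ 1)
    + 713/50 * (u ^ 2 * w ^ 1 * r ^ 2)
    + 793/240 * (u ^ 2 * w ^ 0 * r ^ 3)
    + 185821/32000 * (u ^ 1 * w ^ 4 * r ^ 0)
    + 32033/1600 * (u ^ 1 * w ^ 3 * r ^ 1)
    + 4577/200 * (u ^ 1 * w ^ 2 * r ^ 2)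
    + 1273/120 * (u ^ 1 * w ^ 1 * r ^ 3)
    + 2093/1200 * (u ^ 1 * w ^ 0 * r ^ 4)
    + 411821/160000 * (u ^ 0 * w ^ 5 * r ^ 0)
    + 58933/6400 * (u ^ 0 * w ^ 4 * r ^ 1)
    + 7577/600 * (u ^ 0 * w ^ 3 * r ^ 2)
    + 2023/240 * (u ^ 0 * w ^ 2 * r ^ 3)
    + 3293/1200 * (u ^ 0 * w ^ 1 * r ^ 4)
    + 2171/6000 * (u ^ 0 * w ^ 0 * r ^ 5)).
    { apply Rminus_le_0. rewrite E. simplex_nonneg. }
    unfold quintic5, quartic4, r, u, w. field.
Qed.

Definition quad (c0 c1 c2 a : R) : R := c0 + c1 * a + c2 * a ^ 2.

(* Products truncated to degree two with [a ^ 3 <= a ^ 2 / 4]. *)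
Lemma quad_mult e x y c0 c1 c2 d0 d1 d2 a : 0 <= a <= 1 / 4 -> 0 <= e ->
  0 <= x <= e * quad c0 c1 c2 a -> 0 <= y <= quad d0 d1 d2 a ->
  0 <= c0 /\ 0 <= c1 /\ 0 <= c2 /\ 0 <= d0 /\ 0 <= d1 /\ 0 <= d2 ->
  x * y <= e * quad (c0 * d0) (c0 * d1 + c1 * d0) (c0 * d2 + c1 * d1 + c2 * d0 + (c1 * d2 + c2 * d1) / 4 + c2 * d2 / 16) a.
Proof.
  intros Ha He Hx Hy (C0 & C1 & C2 & D0 & D1 & D2).
  apply Rle_trans with (e * quad c0 c1 c2 a * quad d0 d1 d2 a); [apply Rmult_le_compat; lra|].
  rewrite Rmult_assoc. apply Rmult_le_compat_l; auto. unfold quad.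
  assert (T : 0 <= (c1 * d2 + c2 * d1) * (a ^ 2 * (1 / 4 - a)) + c2 * d2 * (a ^ 2 * (1 / 16 - a ^ 2))).
  { assert (0 <= a ^ 2) by (apply pow_le; lra). assert (a ^ 2 <= 1 / 16) by nra.
    apply Rplus_le_le_0_compat; apply Rmult_le_pos.
    - apply Rplus_le_le_0_compat; apply Rmult_le_pos; auto.
    - apply Rmult_le_pos; lra.
    - apply Rmult_le_pos; auto.
    - apply Rmult_le_pos; lra. }
  lra.
Qed.

Lemma quad_le e x c0 c1 c2 d0 d1 d2 a : 0 <= a -> 0 <= e -> c0 <= d0 -> c1 <= d1 -> c2 <= d2 ->
  x <= e * quad c0 c1 c2 a -> x <= e * quad d0 d1 d2 a.
Proof.
  intros. eapply Rle_trans; [eassumption|]. apply Rmult_le_compat_l; auto. unfold quad.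
  assert (0 <= a ^ 2) by (apply pow_le; lra). nra.
Qed.

(** Applied with [a = |v_1| / 4] and [e = sqrt (1 - |v_1|^2)]. Every quantity is majorised by a
    quadratic polynomial in [a] with rounded coefficients, and those that measure the deviation from
    the Koebe function carry the factor [e]. *)
Lemma comparison_error a e Q D1 P P' G G' D D' : 0 <= a <= 1 / 4 -> 0 <= e <= 1 ->
  0 <= Q <= 368 / 10000 * e -> 0 <= D1 <= 755 / 10000 * e ->
  0 <= P -> 0 <= P' -> 0 <= G -> 0 <= G' -> 0 <= D -> 0 <= D' ->
  P * (1 - (a + Q)) <= 1 -> P' * (1 - (a + Q)) <= (a + D1) * P ->
  G * (1 - a) <= 1 -> G' * (1 - a) <= a * G ->
  D * (1 - a) <= Q * P -> D' * (1 - a) <= a * D + D1 * P + Q * P' ->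
  D * P + G * D + D' * P + D * P' + G' * D + G * D' <= e * (26 / 100 + 12 / 10 * a + 4 * a ^ 2).
Proof.
  intros Ha He HQ HD1 P0 P'0 G0 G'0 D0 D'0 HP HP' HG HG' HD HD'.
  assert (Ha2 : 0 <= a ^ 2 <= a / 4) by nra.
  (* A majorant of [1 / (1 - a)]: the tail [a^2 / (1 - a)] is at most [4/3 a^2]. *)
  set (sg := quad 1 1 (4 / 3) a).
  assert (Hsg : 1 <= sg * (1 - a)).
  { unfold sg, quad. replace ((1 + 1 * a + 4 / 3 * a ^ 2) * (1 - a)) with (1 + a ^ 2 * (1 - 4 * a) / 3) by field.
    assert (0 <= a ^ 2 * (1 - 4 * a)) by (apply Rmult_le_pos; lra). lra. }
  assert (Hsg1 : 1 <= sg <= 4 / 3) by (unfold sg, quad; lra).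
  (* A majorant of [1 / (1 - (a + Q))], since [1.052] exceeds [1 / (1 - 4/3 * 0.0368)]. *)
  set (pp := quad (1052 / 1000) (1052 / 1000) (14027 / 10000) a).
  assert (Hpp0 : 1052 / 1000 * sg <= pp) by (unfold pp, sg, quad; lra).
  assert (Hpp : 1 <= pp * (1 - (a + Q))).
  { apply Rle_trans with (1052 / 1000 * sg * (1 - (a + Q))); [|apply Rmult_le_compat_r; lra].
    assert (sg * Q <= 4 / 3 * (368 / 10000)) by (apply Rmult_le_compat; lra). nra. }
  assert (K : forall x y t c, 0 <= x -> 0 <= y -> 1 <= t * c -> 0 <= t -> x * c <= y -> x <= y * t).
  { intros x y t c Hx Hy Htc Ht Hxy. apply Rle_trans with (x * (t * c)); [nra|].
    replace (x * (t * c)) with ((x * c) * t) by ring. apply Rmult_le_compat_r; auto. }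
  assert (BP : 0 <= P <= 1 * pp) by (split; auto; apply (K P 1 pp (1 - (a + Q))); lra).
  assert (BP1 : 0 <= P <= pp) by lra.
  assert (BG : 0 <= G <= sg). { split; auto. rewrite <- (Rmult_1_l sg). apply (K G 1 sg (1 - a)); lra. }
  assert (Bsg : 0 <= sg <= 1 * quad 1 1 (4 / 3) a) by (unfold sg in *; lra).
  assert (Bpp : 0 <= pp <= 1 * quad (1052 / 1000) (1052 / 1000) (14027 / 10000) a) by (unfold pp in *; lra).
  assert (Bsg1 : 0 <= sg <= quad 1 1 (4 / 3) a) by (unfold sg in *; lra).
  assert (Bpp1 : 0 <= pp <= quad (1052 / 1000) (1052 / 1000) (14027 / 10000) a) by (unfold pp in *; lra).
  assert (BP' : 0 <= P' <= quad (836 / 10000) (12739 / 10000) (38145 / 10000) a).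
  { split; auto. assert (E1 : P' <= (a + D1) * P * pp) by (apply (K P' _ pp (1 - (a + Q))); try lra; apply Rmult_le_pos; lra).
    assert (B1 : 0 <= a + D1 <= 1 * quad (755 / 10000) 1 0 a) by (unfold quad; lra).
    assert (B2 : 0 <= (a + D1) * P) by (apply Rmult_le_pos; lra).
    pose proof (quad_mult _ _ _ _ _ _ _ _ _ a Ha Rle_0_1 B1 BP1 ltac:(lra)) as M1.
    pose proof (quad_mult _ _ _ _ _ _ _ _ _ a Ha Rle_0_1 (conj B2 M1) Bpp1 ltac:(lra)) as M2.
    rewrite <- (Rmult_1_l (quad _ _ _ a)). eapply Rle_trans; [apply E1|]. revert M2. apply quad_le; lra. }
  assert (BG' : 0 <= G' <= quad 0 1 (31112 / 10000) a).
  { split; auto. assert (E1 : G' <= a * G * sg) by (apply (K G' _ sg (1 - a)); try lra; apply Rmult_le_pos; lra).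
    assert (B1 : 0 <= a <= 1 * quad 0 1 0 a) by (unfold quad; lra).
    assert (B2 : 0 <= a * G) by (apply Rmult_le_pos; lra).
    pose proof (quad_mult _ _ _ _ _ _ _ _ _ a Ha Rle_0_1 B1 BG ltac:(lra)) as M1.
    pose proof (quad_mult _ _ _ _ _ _ _ _ _ a Ha Rle_0_1 (conj B2 M1) Bsg1 ltac:(lra)) as M2.
    rewrite <- (Rmult_1_l (quad _ _ _ a)). eapply Rle_trans; [apply E1|]. revert M2. apply quad_le; lra. }
  assert (BQ : 0 <= Q <= e * quad (368 / 10000) 0 0 a) by (unfold quad; lra).
  assert (BD1 : 0 <= D1 <= e * quad (755 / 10000) 0 0 a) by (unfold quad; lra).
  assert (BQP : 0 <= Q * P) by (apply Rmult_le_pos; lra).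
  pose proof (quad_mult _ _ _ _ _ _ _ _ _ a Ha (proj1 He) BQ BP1 ltac:(lra)) as MQP.
  assert (BD : 0 <= D <= e * quad (388 / 10000) (775 / 10000) (1721 / 10000) a).
  { split; auto. assert (E1 : D <= Q * P * sg) by (apply (K D _ sg (1 - a)); lra).
    pose proof (quad_mult _ _ _ _ _ _ _ _ _ a Ha (proj1 He) (conj BQP MQP) Bsg1 ltac:(lra)) as M2.
    eapply Rle_trans; [apply E1|]. revert M2. apply quad_le; lra. }
  assert (Ba : 0 <= a <= quad 0 1 0 a) by (unfold quad; lra).
  assert (BD' : 0 <= D' <= e * quad (8251 / 100000) (2477 / 10000) (8195 / 10000) a).
  { split; auto.
    assert (N1 : 0 <= a * D) by (apply Rmult_le_pos; lra).
    assert (N2 : 0 <= D1 * P) by (apply Rmult_le_pos; lra).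
    assert (N3 : 0 <= Q * P') by (apply Rmult_le_pos; lra).
    assert (E1 : D' <= (a * D + D1 * P + Q * P') * sg) by (apply (K D' _ sg (1 - a)); lra).
    pose proof (quad_mult _ _ _ _ _ _ _ _ _ a Ha (proj1 He) BD Ba ltac:(lra)) as M1.
    pose proof (quad_mult _ _ _ _ _ _ _ _ _ a Ha (proj1 He) BD1 BP1 ltac:(lra)) as M2.
    pose proof (quad_mult _ _ _ _ _ _ _ _ _ a Ha (proj1 He) BQ BP' ltac:(lra)) as M3.
    assert (M : 0 <= a * D + D1 * P + Q * P' <= e * quad (8251 / 100000) (16511 / 100000) (3669 / 10000) a).
    { split; [lra|]. unfold quad in M1, M2, M3 |- *. assert (0 <= e * a) by (apply Rmult_le_pos; lra). assert (0 <= e * a ^ 2) by (apply Rmult_le_pos; lra). lra. }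
    pose proof (quad_mult _ _ _ _ _ _ _ _ _ a Ha (proj1 He) M Bsg1 ltac:(lra)) as M4.
    eapply Rle_trans; [apply E1|]. revert M4. apply quad_le; try lra. }
  pose proof (quad_mult _ _ _ _ _ _ _ _ _ a Ha (proj1 He) BD BP1 ltac:(lra)) as M1.
  pose proof (quad_mult _ _ _ _ _ _ _ _ _ a Ha (proj1 He) BD BG ltac:(lra)) as M2.
  pose proof (quad_mult _ _ _ _ _ _ _ _ _ a Ha (proj1 He) BD' BP1 ltac:(lra)) as M3.
  pose proof (quad_mult _ _ _ _ _ _ _ _ _ a Ha (proj1 He) BD BP' ltac:(lra)) as M4.
  pose proof (quad_mult _ _ _ _ _ _ _ _ _ a Ha (proj1 He) BD BG' ltac:(lra)) as M5.
  pose proof (quad_mult _ _ _ _ _ _ _ _ _ a Ha (proj1 He) BD' BG ltac:(lra)) as M6.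
  unfold quad in M1, M2, M3, M4, M5, M6. assert (0 <= e * a ^ 2 <= e * a / 4).
  { split; [apply Rmult_le_pos; lra|]. unfold Rdiv. rewrite Rmult_assoc. apply Rmult_le_compat_l; lra. }
  lra.
Qed.

(** * Numerical sums at the radius 1/4 *)

Lemma weighted_CS (c x y : nat -> R) n : (forall k, 0 < c k) ->
  rsum (fun k => x k * y k) n ^ 2 <= rsum (fun k => c k * x k ^ 2) n * rsum (fun k => y k ^ 2 / c k) n.
Proof.
  intros Hc. pose proof (rsum_CS (fun k => sqrt (c k) * x k) (fun k => y k / sqrt (c k)) n) as H.
  assert (S0 : forall k, sqrt (c k) <> 0) by (intros k; apply Rgt_not_eq, sqrt_lt_R0, Hc).
  assert (S1 : forall k, sqrt (c k) * sqrt (c k) = c k) by (intros k; apply sqrt_sqrt, Rlt_le, Hc).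
  rewrite (rsum_ext _ (fun k => x k * y k)) in H by (intros; field; auto).
  rewrite (rsum_ext (fun k => (sqrt (c k) * x k) ^ 2) (fun k => c k * x k ^ 2)) in H
    by (intros k _; rewrite Rpow_mult_distr; simpl; rewrite Rmult_1_r, S1; ring).
  rewrite (rsum_ext (fun k => (y k / sqrt (c k)) ^ 2) (fun k => y k ^ 2 / c k)) in H.
  - exact H.
  - intros k _. transitivity (y k ^ 2 / (sqrt (c k) * sqrt (c k))); [field; auto|rewrite S1; reflexivity].
Qed.

(** With [m = k + 2] the terms are [16^(-m) / (2m - 1)]. The first is [1 / 768]; for the others
    [2m - 1 >= 5] leaves a geometric series. *)
Lemma area_weight_0 n : rsum (fun k => ((1 / 4) ^ S (S k)) ^ 2 / (2 * INR (S k) + 1)) n <= (368 / 10000) ^ 2.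
Proof.
  assert (H : forall n, rsum (fun k => ((1 / 4) ^ S (S k)) ^ 2 / (2 * INR (S k) + 1)) (S n)
     <= 1 / 768 + 1 / 5 / 4096 * (16 / 15) * (1 - (1 / 16) ^ n)).
  { induction n0; [simpl; lra|]. change (rsum ?f (S (S ?m))) with (rsum f (S m) + f (S m)). cbv beta.
    assert (T : ((1 / 4) ^ S (S (S n0))) ^ 2 / (2 * INR (S (S n0)) + 1) <= 1 / 5 / 4096 * (1 / 16) ^ n0).
    { replace (((1 / 4) ^ S (S (S n0))) ^ 2) with (1 / 4096 * (1 / 16) ^ n0).
      - assert (0 < (1 / 16) ^ n0) by (apply pow_lt; lra). rewrite !S_INR. pose proof (pos_INR n0).
        apply Rle_div_l; nra.
      - replace (1 / 16) with (1 / 4 * (1 / 4)) by field. rewrite Rpow_mult_distr. simpl. field. }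
    assert (E : (1 / 16) ^ S n0 = 1 / 16 * (1 / 16) ^ n0) by reflexivity. rewrite E. lra. }
  destruct n; [simpl; lra|]. eapply Rle_trans; [apply H|].
  assert (0 < (1 / 16) ^ n) by (apply pow_lt; lra). lra.
Qed.

(** With [m = k + 2] the factor [m^2] is added; [m^2 / (2m - 1) <= 3 m / 5] for [m >= 3] leaves an
    arithmetico-geometric series, whose partial sums are carried exactly by the induction. *)
Lemma area_weight_1 n :
  rsum (fun k => (INR (S (S k)) * (1 / 4) ^ S (S k)) ^ 2 / (2 * INR (S k) + 1)) n <= (755 / 10000) ^ 2.
Proof.
  assert (H : forall n, rsum (fun k => (INR (S (S k)) * (1 / 4) ^ S (S k)) ^ 2 / (2 * INR (S k) + 1)) (S n)
     <= 4 / 768 + 3 / 5 / 4096 * (736 / 225 - (16 / 15 * INR n + 736 / 225) * (1 / 16) ^ n)).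
  { induction n0; [simpl; lra|]. change (rsum ?f (S (S ?m))) with (rsum f (S m) + f (S m)). cbv beta.
    assert (T : (INR (S (S (S n0))) * (1 / 4) ^ S (S (S n0))) ^ 2 / (2 * INR (S (S n0)) + 1)
       <= 3 / 5 / 4096 * (INR n0 + 3) * (1 / 16) ^ n0).
    { replace ((INR (S (S (S n0))) * (1 / 4) ^ S (S (S n0))) ^ 2) with (1 / 4096 * (1 / 16) ^ n0 * (INR n0 + 3) ^ 2).
      - assert (0 < (1 / 16) ^ n0) by (apply pow_lt; lra). rewrite !S_INR. pose proof (pos_INR n0).
        apply Rle_div_l; [lra|]. set (N := INR n0) in *. set (q := (1 / 16) ^ n0) in *.
        replace (3 / 5 / 4096 * (N + 3) * q * (2 * (N + 1 + 1) + 1)) with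
          (1 / 4096 * q * (N + 3) ^ 2 + 1 / 4096 * q * (N * (N + 3)) / 5) by field.
        assert (0 <= q * (N * (N + 3))) by (apply Rmult_le_pos; nra). lra.
      - replace (1 / 16) with (1 / 4 * (1 / 4)) by field. rewrite !Rpow_mult_distr, !S_INR. simpl. field. }
    rewrite (S_INR n0). change ((1 / 16) ^ S n0) with (1 / 16 * (1 / 16) ^ n0).
    set (q := (1 / 16) ^ n0) in *. set (N := INR n0) in *. lra. }
  destruct n; [simpl; lra|]. eapply Rle_trans; [apply H|].
  assert (0 < (1 / 16) ^ n) by (apply pow_lt; lra). pose proof (pos_INR n).
  assert (0 <= INR n * (1 / 16) ^ n) by nra. lra.
Qed.

(** The moduli of the terms from [36 u^5] on, at [|u| = 1/4]; the induction carries the exact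
    partial sums. *)
Lemma koebe_tail n : rsum (fun k => INR (k + 6) ^ 2 * (1 / 4) ^ (k + 5)) n <= 529 / 10000.
Proof.
  assert (H : rsum (fun k => INR (k + 6) ^ 2 * (1 / 4) ^ (k + 5)) n
    <= (1460 / 27 - (4 / 3 * INR n ^ 2 + 152 / 9 * INR n + 1460 / 27) * (1 / 4) ^ n) / 1024).
  { induction n; [simpl; lra|]. cbn [rsum]. rewrite plus_INR, pow_add, (S_INR n).
    change ((1 / 4) ^ S n) with (1 / 4 * (1 / 4) ^ n). replace (INR 6) with 6 by (simpl; ring).
    set (q := (1 / 4) ^ n) in *. set (N := INR n) in *.
    replace ((1 / 4) ^ 5) with (1 / 1024) by (simpl; field). lra. }
  eapply Rle_trans; [apply H|]. assert (0 < (1 / 4) ^ n) by (apply pow_lt; lra). pose proof (pos_INR n).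
  assert (0 <= (4 / 3 * INR n ^ 2 + 152 / 9 * INR n + 1460 / 27) * (1 / 4) ^ n) by (apply Rmult_le_pos; nra). lra.
Qed.

Lemma rsum_le_of_sq x b e : 0 <= e -> 0 <= b -> x ^ 2 <= e ^ 2 * b ^ 2 -> x <= b * e.
Proof. intros He Hb H. assert (0 <= b * e) by nra. nra. Qed.

Lemma fst_ge (z : C) : - Cmod z <= fst z.
Proof. pose proof (fst_le_Cmod z). apply Rabs_le_between in H. lra. Qed.

Lemma koebe_main_part (u : C) s n : Cmod u = s / 4 -> s <= 1 -> (4 <= n)%nat ->
  1 / 100 + (3 / 5 * (1 - s ^ 2) + 5 / 12 * (26 / 100 + 3 / 10 * s + 1 / 4 * s ^ 2) ^ 2)
    <= fst (csum (fun k => RtoC (INR (S k) ^ 2) * u ^ k)%C n).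
Proof.
  intros Hu Hs Hn. assert (Hs0 : 0 <= s) by (pose proof (Cmod_ge_0 u); lra).
  set (X := 4 * fst u).
  assert (HX : - s <= X <= s).
  { pose proof (fst_le_Cmod u) as H. rewrite Hu in H. apply Rabs_le_between in H. unfold X. lra. }
  assert (HY : snd u ^ 2 = s ^ 2 / 16 - fst u ^ 2).
  { pose proof (Cmod_sq u) as H. rewrite Hu in H. unfold cdot in H. nra. }
  set (K := (fun k => RtoC (INR (S k) ^ 2) * u ^ k)%C).
  assert (K0123 : fst (csum K 4) = quartic4 X s + (3 / 5 * (1 - s ^ 2) + 5 / 12 * (26 / 100 + 3 / 10 * s + 1 / 4 * s ^ 2) ^ 2)).
  { unfold quartic4, X, K. simpl. replace (snd u * (snd u * 1)) with (snd u ^ 2) by ring.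
    transitivity (1 + 4 * fst u + 9 * (fst u ^ 2 - snd u ^ 2) + 16 * (fst u ^ 3 - 3 * fst u * snd u ^ 2)); [ring|].
    rewrite HY. field. }
  (* From [n = 5] on the term [25 u^4] is kept exactly: at [u = - 1/4] its modulus exceeds the
     margin of [quartic4]. *)
  destruct (Nat.eq_dec n 4) as [->|Hn4].
  { rewrite K0123. pose proof (quartic4_pos X s HX Hs). lra. }
  replace n with (5 + (n - 5))%nat by lia. rewrite csum_add. set (m := (n - 5)%nat).
  assert (K4 : fst (csum K 5) = fst (csum K 4) + 25 / 256 * (8 * X ^ 4 - 8 * X ^ 2 * s ^ 2 + s ^ 4)).
  { change (csum K 5) with (csum K 4 + K 4%nat)%C. change (fst (?a + ?b)%C) with (fst a + fst b). f_equal.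
    transitivity (25 * (fst u ^ 4 - 6 * fst u ^ 2 * snd u ^ 2 + (snd u ^ 2) ^ 2)).
    - unfold K. simpl. ring.
    - rewrite HY. unfold X. field. }
  assert (KT : Cmod (csum (fun k => K (5 + k)%nat) m) <= 529 / 10000 * s ^ 5).
  { eapply Rle_trans; [apply Cmod_csum|].
    apply Rle_trans with (rsum (fun k => INR (k + 6) ^ 2 * (1 / 4) ^ (k + 5)) m * s ^ 5).
    - rewrite <- rsum_scal_r. apply rsum_le. intros k _. unfold K. rewrite Cmod_mult, Cmod_pow, Hu.
      rewrite Cmod_RtoC by apply pow2_ge_0. replace (S (5 + k)) with (k + 6)%nat by lia.
      replace (5 + k)%nat with (k + 5)%nat by lia. rewrite Rmult_assoc. apply Rmult_le_compat_l; [apply pow2_ge_0|].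
      unfold Rdiv. rewrite !Rpow_mult_distr, pow1, Rmult_1_l, Rmult_comm.
      apply Rmult_le_compat_l; [apply pow_le; lra|]. rewrite pow_add.
      rewrite <- (Rmult_1_l (s ^ 5)) at 2. apply Rmult_le_compat_r; [apply pow_le; auto|].
      rewrite <- (pow1 k). apply pow_incr. lra.
    - apply Rmult_le_compat_r; [apply pow_le; auto|apply koebe_tail]. }
  pose proof (fst_ge (csum (fun k => K (5 + k)%nat) m)) as HT.
  change (fst (?a + ?b)%C) with (fst a + fst b). rewrite K4, K0123.
  pose proof (quintic5_pos X s HX Hs) as H5. unfold quintic5 in H5. lra.
Qed.

(** For [n = 2] the value [1 + 4 Re (al z)] is positive only because [|v_1| < 1], and leaves no room
    for an error term. Therefore [n = 2] and [n = 3] are computed from [p 1] and [p 2]; from [n = 4]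
    on the further Koebe terms leave enough room for the comparison. *)
Lemma section_derivative_core (v p : nat -> C) (z : C) n : v O = RtoC 1 ->
  (forall n, rsum (fun m => (2 * INR m + 1) * Cmod (v (S m)) ^ 2) n <= 1) ->
  (forall k, conv v p k = delta k) -> Cmod z = 1 / 4 -> Cmod (v 1%nat) < 1 -> (2 <= n)%nat ->
  0 < fst (csum (fun k => RtoC (INR (S k)) * conv p p k * z ^ k)%C n).
Proof.
  intros Hv0 Hv Hp Hz Hs Hn. set (s := Cmod (v 1%nat)) in *. set (al := (- v 1%nat)%C).
  assert (Hs0 : 0 <= s) by apply Cmod_ge_0.
  assert (Hu : Cmod (al * z)%C = s / 4).
  { unfold al. rewrite Cmod_mult, Cmod_opp, Hz. fold s. lra. }
  assert (P0 : p 0%nat = RtoC 1).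
  { pose proof (Hp 0%nat) as H. unfold conv in H. simpl in H. rewrite Hv0 in H. rewrite <- H. ring. }
  assert (P1 : p 1%nat = al).
  { pose proof (Hp 1%nat) as H. unfold conv in H. simpl in H. rewrite Hv0, P0 in H. unfold al.
    change (RtoC 0) with (delta 1). rewrite <- (Cplus_0_r (p 1%nat)).
    apply (f_equal (fun x => x - v 1%nat)%C) in H. ring_simplify in H. rewrite Cplus_0_r. rewrite <- H at 1. ring_simplify. ring. }
  assert (P2 : p 2%nat = (al * al - v 2%nat)%C).
  { pose proof (Hp 2%nat) as H. unfold conv in H. simpl in H. rewrite Hv0, P0, P1 in H.
    replace (p 2%nat) with ((0 + 1 * p 2%nat + v 1%nat * al + v 2%nat * 1) - v 1%nat * al - v 2%nat)%C by ring.
    rewrite H. unfold al. ring. }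
  destruct (Compare_dec.le_lt_dec 4 n) as [H4|H4].
  2: { assert (E2 : (csum (fun k => RtoC (INR (S k)) * conv p p k * z ^ k) 2 = 1 + 4 * (al * z))%C).
    { unfold conv. cbn [csum Nat.sub]. rewrite P0, P1. simpl. ceq; ring. }
    destruct (Nat.eq_dec n 2) as [->|Hn2].
    - rewrite E2. pose proof (fst_ge (al * z)%C) as H. rewrite Hu in H. simpl in *. lra.
    - replace n with 3%nat by lia.
      assert (E3 : (csum (fun k => RtoC (INR (S k)) * conv p p k * z ^ k) 3 =
        1 + 4 * (al * z) + 9 * (al * z) ^ 2 - 6 * v 2%nat * z ^ 2)%C).
      { change (csum ?f 3) with (csum f 2 + f 2%nat)%C. cbv beta. rewrite E2. unfold conv. cbn [csum Nat.sub].
        rewrite P0, P1, P2. ceq; ring. }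
      rewrite E3. set (u := (al * z)%C) in *.
      pose proof (Hv 2%nat) as A. cbn [rsum] in A. fold s in A. simpl INR in A. set (b := Cmod (v 2%nat)) in *.
      assert (Hb : 0 <= b) by apply Cmod_ge_0.
      assert (T : Cmod (6 * v 2%nat * z ^ 2)%C = 3 / 8 * b).
      { rewrite !Cmod_mult, Cmod_pow, Hz, Cmod_RtoC by lra. fold b. field. }
      pose proof (fst_le_Cmod (6 * v 2%nat * z ^ 2)%C) as T'. rewrite T in T'. apply Rabs_le_between in T'.
      assert (HX : - s <= 4 * fst u <= s).
      { pose proof (fst_le_Cmod u) as H. rewrite Hu in H. apply Rabs_le_between in H. lra. }
      assert (HY : snd u ^ 2 = s ^ 2 / 16 - fst u ^ 2).
      { pose proof (Cmod_sq u) as H. rewrite Hu in H. unfold cdot in H. nra. }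
      change (fst (?a - ?c)%C) with (fst a - fst c).
      replace (fst (1 + 4 * u + 9 * u ^ 2)%C) with (1 + 4 * fst u + 9 * (fst u ^ 2 - snd u ^ 2)) by (simpl; ring).
      rewrite HY. set (X := 4 * fst u) in *. replace (fst u) with (X / 4) by (unfold X; field).
      (* From [s^2 + 3 b^2 <= 1] and [2 b <= 1 + b^2]. *)
      assert (3 / 8 * b <= 3 / 16 + 1 / 16 * (1 - s ^ 2)) by nra. nra. }
  (* The square of [e] is what the area theorem leaves for [v_2, v_3, ...]. *)
  set (e := sqrt (1 - s ^ 2)).
  assert (He2 : e ^ 2 = 1 - s ^ 2) by (unfold e; apply pow2_sqrt; nra).
  assert (He : 0 <= e <= 1) by (assert (0 <= e) by apply sqrt_pos; nra).
  assert (A : rsum (fun k => (2 * INR (S k) + 1) * Cmod (v (S (S k))) ^ 2) n <= e ^ 2).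
  { pose proof (Hv (S n)) as H. rewrite rsum_S_l in H. fold s in H. simpl INR in H at 1. lra. }
  assert (Hc : forall k, 0 < 2 * INR (S k) + 1) by (intros k; pose proof (pos_INR (S k)); lra).
  set (Q := rsum (fun k => Cmod (v (S (S k))) * (1 / 4) ^ S (S k)) n).
  set (D1 := rsum (fun k => INR (S (S k)) * (Cmod (v (S (S k))) * (1 / 4) ^ S (S k))) n).
  assert (Hpow : forall k, 0 <= (1 / 4) ^ k) by (intros; apply pow_le; lra).
  assert (HQ : 0 <= Q <= 368 / 10000 * e).
  { split; [apply rsum_nonneg; intros; apply Rmult_le_pos; [apply Cmod_ge_0|auto]|].
    apply rsum_le_of_sq; [lra|lra|]. unfold Q.
    eapply Rle_trans; [apply (weighted_CS (fun k => 2 * INR (S k) + 1) _ _ n Hc)|].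
    apply Rmult_le_compat; auto using area_weight_0; apply rsum_nonneg; intros.
    - apply Rmult_le_pos; [apply Rlt_le, Hc|apply pow2_ge_0].
    - apply Rdiv_le_0_compat; [apply pow2_ge_0|apply Hc]. }
  assert (HD1 : 0 <= D1 <= 755 / 10000 * e).
  { split; [apply rsum_nonneg; intros; apply Rmult_le_pos; [apply pos_INR|apply Rmult_le_pos; [apply Cmod_ge_0|auto]]|].
    apply rsum_le_of_sq; [lra|lra|]. unfold D1.
    rewrite (rsum_ext _ (fun k => Cmod (v (S (S k))) * (INR (S (S k)) * (1 / 4) ^ S (S k)))) by (intros; ring).
    eapply Rle_trans; [apply (weighted_CS (fun k => 2 * INR (S k) + 1) _ _ n Hc)|].
    apply Rmult_le_compat; auto using area_weight_1; apply rsum_nonneg; intros.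
    - apply Rmult_le_pos; [apply Rlt_le, Hc|apply pow2_ge_0].
    - apply Rdiv_le_0_compat; [apply pow2_ge_0|apply Hc]. }
  destruct (koebe_comparison v p (1 / 4) Q D1 n Hv0 Hp) as (P & P' & G & G' & D & D' & HP & HP' & HG & HG' & HD & HD' & I1 & I2 & I3 & I4 & I5 & I6 & I7);
    [lra|apply Rle_refl|apply Rle_refl|fold s; lra|].
  fold s in I1, I2, I3, I4, I5, I6. fold al in I7.
  pose proof (comparison_error (s * (1 / 4)) e Q D1 P P' G G' D D' ltac:(lra) He HQ HD1 HP HP' HG HG' HD HD' I1 I2 I3 I4 I5 I6) as IE.
  set (K := (fun k => RtoC (INR (S k) ^ 2) * (al * z) ^ k)%C).
  assert (ET : Cmod (csum (fun k => RtoC (INR (S k)) * conv p p k * z ^ k - K k)%C n)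
     <= rsum (fun k => INR (S k) * Cmod (conv p p k - RtoC (INR (S k)) * al ^ k)%C * (1 / 4) ^ k) n).
  { eapply Rle_trans; [apply Cmod_csum|]. apply rsum_le. intros k _. right. unfold K.
    replace (RtoC (INR (S k)) * conv p p k * z ^ k - RtoC (INR (S k) ^ 2) * (al * z) ^ k)%C
      with (RtoC (INR (S k)) * (conv p p k - RtoC (INR (S k)) * al ^ k) * z ^ k)%C.
    - rewrite !Cmod_mult, Cmod_pow, Hz, Cmod_RtoC by apply pos_INR. reflexivity.
    - rewrite Cpow_mult_l. replace (RtoC (INR (S k) ^ 2)) with (RtoC (INR (S k)) * RtoC (INR (S k)))%C
        by (rewrite <- RtoC_mult; apply f_equal; ring). ring. }
  rewrite csum_minus in ET.
  pose proof (koebe_main_part (al * z) s n Hu ltac:(lra) H4) as HM. fold K in HM.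
  set (T := csum (fun k => RtoC (INR (S k)) * conv p p k * z ^ k)%C n) in *.
  pose proof (fst_ge (T - csum K n)%C) as F. change (fst (T - csum K n)%C) with (fst T - fst (csum K n)) in F.
  set (m := 26 / 100 + 3 / 10 * s + 1 / 4 * s ^ 2) in *.
  (* By [(6 e - 5 m)^2 >= 0]; as [e^2 = 1 - s^2], the square root disappears and the bound is a
     polynomial in [s]. *)
  assert (Em : e * m <= 3 / 5 * (1 - s ^ 2) + 5 / 12 * m ^ 2).
  { rewrite <- He2. pose proof (pow2_ge_0 (6 * e - 5 * m)). lra. }
  replace (26 / 100 + 12 / 10 * (s * (1 / 4)) + 4 * (s * (1 / 4)) ^ 2) with m in IE by (unfold m; field).
  lra.
Qed.

Lemma conv_dilate (x y : nat -> C) (c : C) k :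
  conv (fun j => x j * c ^ j)%C (fun j => y j * c ^ j)%C k = (conv x y k * c ^ k)%C.
Proof. symmetry. apply conv_pow. Qed.

(* Dilation reduces the case [|z| < 1/4] to [|z| = 1/4] with [|v_1| < 1]. *)
Lemma section_derivative_conv (v p : nat -> C) (z : C) n : v O = RtoC 1 ->
  (forall n, rsum (fun m => (2 * INR m + 1) * Cmod (v (S m)) ^ 2) n <= 1) ->
  (forall k, conv v p k = delta k) -> Cmod z < 1 / 4 -> (2 <= n)%nat ->
  0 < fst (csum (fun k => RtoC (INR (S k)) * conv p p k * z ^ k)%C n).
Proof.
  intros Hv0 Hv Hp Hz Hn. set (rho := 4 * Cmod z).
  assert (Hrho : 0 <= rho < 1) by (unfold rho; pose proof (Cmod_ge_0 z); lra).
  assert (Hw : exists w, Cmod w = 1 / 4 /\ z = (RtoC rho * w)%C).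
  { destruct (Req_dec rho 0) as [E|E].
    - exists (RtoC (1 / 4)). split; [apply Cmod_RtoC; lra|]. rewrite E, Cmult_0_l. apply Cmod_eq_0. unfold rho in E. lra.
    - assert (E' : RtoC rho <> 0%C) by (intros H; apply E; apply (f_equal fst) in H; exact H).
      exists (z / RtoC rho)%C. split; [|field; auto].
      rewrite Cmod_div, Cmod_RtoC by (auto; lra). unfold rho in *. field. intros H. apply E. rewrite H. ring. }
  destruct Hw as (w & Hw & Ez). rewrite Ez. clearbody rho. set (c := RtoC rho).
  assert (Hc : Cmod c = rho) by (apply Cmod_RtoC; lra).
  rewrite (csum_ext _ (fun k => RtoC (INR (S k)) * conv (fun j => p j * c ^ j) (fun j => p j * c ^ j) k * w ^ k)%C).
  2: { intros k _. rewrite conv_dilate, Cpow_mult_l. fold c. ring. }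
  assert (Hp1 : forall k, rho ^ k <= 1) by (intros k; rewrite <- (pow1 k); apply pow_incr; lra).
  assert (Hp0 : forall k, 0 <= rho ^ k) by (intros k; apply pow_le; lra).
  apply section_derivative_core with (v := (fun j => v j * c ^ j)%C); auto.
  - rewrite Hv0. simpl. ring.
  - intros N. eapply Rle_trans; [|apply (Hv N)]. apply rsum_le. intros k _.
    apply Rmult_le_compat_l; [pose proof (pos_INR k); lra|]. rewrite Cmod_mult, Cmod_pow, Hc.
    apply pow_incr. split; [apply Rmult_le_pos; [apply Cmod_ge_0|auto]|].
    rewrite <- Rmult_1_r. apply Rmult_le_compat_l; [apply Cmod_ge_0|auto].
  - intros k. rewrite conv_dilate, Hp. destruct k; simpl; ring.
  - rewrite Cpow_1_r, Cmod_mult, Hc. pose proof (Hv 1%nat) as H. cbn [rsum] in H. simpl INR in H.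
    pose proof (Cmod_ge_0 (v 1%nat)). nra.
Qed.

Lemma section_derivative_pos (A : nat -> C) (F : C -> C) (z : C) n :
  (forall z, Cmod z < 1 -> csums A z (F z)) -> A O = RtoC 0 -> A 1%nat = RtoC 1 ->
  univalent_on (disk 1) F -> (forall z, Cmod z < 1 -> dsum A z <> 0%C) ->
  Cmod z < 1 / 4 -> (2 <= n)%nat -> 0 < fst (csum (fun k => cdcoef A k * z ^ k)%C n).
Proof.
  intros HA A0 A1 HF Hd Hz Hn.
  destruct (univalent_sqrt_area A F HA A0 A1 HF Hd) as (v & p & Hv0 & Hv & Hp & E).
  pose proof (section_derivative_conv v p z n Hv0 Hv Hp Hz Hn) as H.
  erewrite csum_ext; [exact H|]. intros k _. unfold cdcoef. rewrite E. reflexivity.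
Qed.

(** * Accretive maps of the plane *)

(** Banach's theorem: the iterates are partial sums of a geometrically dominated series. *)
Lemma contraction_fixpoint (K : C -> Prop) (T : C -> C) (x0 : C) q : cclosed K -> K x0 -> 0 <= q < 1 ->
  (forall x, K x -> K (T x)) ->
  (forall x y, K x -> K y -> Cmod (T x - T y)%C <= q * Cmod (x - y)%C) -> exists x, K x /\ T x = x.
Proof.
  intros HK H0 Hq HT Hc. set (u := fun n => Nat.iter n T x0).
  assert (Ku : forall n, K (u n)) by (induction n; [exact H0|apply HT, IHn]).
  set (d := Cmod (u 1%nat - u 0%nat)%C).
  assert (Hd : forall n, Cmod (u (S n) - u n)%C <= d * q ^ n).
  { induction n; [unfold d; simpl; lra|]. change (u (S (S n))) with (T (u (S n))). change (u (S n)) with (T (u n)) at 2.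
    eapply Rle_trans; [apply Hc; auto|]. simpl pow. nra. }
  pose proof (cser_geom (fun k => u (S k) - u k)%C d q Hq Hd) as L.
  set (l := ctotal (fun k => u (S k) - u k)%C) in L.
  assert (Hs : forall n, csum (fun k => u (S k) - u k)%C n = (u n - u 0%nat)%C).
  { induction n; cbn [csum]; [ring|rewrite IHn; ring]. }
  set (x := (l + u 0%nat)%C).
  assert (Lx : forall e, 0 < e -> exists N, forall n, (N <= n)%nat -> Cmod (u n - x)%C < e).
  { intros e He. destruct (L e He) as [N HN]. exists N. intros n Hn. specialize (HN n Hn). rewrite Hs in HN.
    unfold x. replace (u n - (l + u 0%nat))%C with (u n - u 0%nat - l)%C by ring. exact HN. }
  assert (Kx : K x).
  { apply HK. intros e He. destruct (Lx e He) as [N HN]. exists (u N). auto. }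
  exists x. split; auto. apply Ceq_minus, Cmod_eq_0.
  destruct (Rle_lt_or_eq_dec 0 (Cmod (T x - x)%C) (Cmod_ge_0 _)) as [Hp|Hp]; auto. exfalso.
  destruct (Lx (Cmod (T x - x)%C / 2) ltac:(lra)) as [N HN].
  pose proof (HN N (le_n N)) as A1. pose proof (HN (S N) ltac:(lia)) as A2.
  pose proof (Hc x (u N) Kx (Ku N)) as A3. rewrite (Cmod_minus_sym x) in A3.
  change (T (u N)) with (u (S N)) in A3.
  pose proof (Cmod_triangle (T x - u (S N)) (u (S N) - x)) as A4.
  replace (T x - u (S N) + (u (S N) - x))%C with (T x - x)%C in A4 by ring.
  pose proof (Cmod_ge_0 (u N - x)%C). nra.
Qed.

Lemma cdot_plus_l x y z : cdot (x + y)%C z = cdot x z + cdot y z.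
Proof. unfold cdot. simpl. ring. Qed.

Lemma cdot_minus_l x y z : cdot (x - y)%C z = cdot x z - cdot y z.
Proof. unfold cdot. simpl. ring. Qed.

Lemma cdot_minus_r x y z : cdot x (y - z)%C = cdot x y - cdot x z.
Proof. unfold cdot. simpl. ring. Qed.

Lemma cdot_scal_l t x y : cdot (RtoC t * x)%C y = t * cdot x y.
Proof. unfold cdot. simpl. ring. Qed.

Definition ball_proj (c : C) (eta : R) (y : C) : C :=
  if Rle_dec (Cmod (y - c)%C) eta then y else (c + RtoC (eta / Cmod (y - c)%C) * (y - c))%C.

Lemma ball_proj_in c eta y : 0 <= eta -> Cmod (ball_proj c eta y - c)%C <= eta.
Proof.
  intros He. unfold ball_proj. destruct (Rle_dec (Cmod (y - c)%C) eta) as [H|H]; auto.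
  set (m := Cmod (y - c)%C) in *.
  replace (c + RtoC (eta / m) * (y - c) - c)%C with (RtoC (eta / m) * (y - c))%C by ring.
  rewrite Cmod_mult, Cmod_RtoC by (apply Rdiv_le_0_compat; lra). fold m. right. field. lra.
Qed.

(** The residual of the projection is an outward normal with multiplier [t], which vanishes unless
    the projection lies on the circle. The last clause, the obtuse angle property, yields
    nonexpansiveness. *)
Lemma ball_proj_normal c eta y : 0 < eta -> exists t, 0 <= t /\
  (y - ball_proj c eta y = RtoC t * (ball_proj c eta y - c))%C /\
  (t = 0 \/ Cmod (ball_proj c eta y - c)%C = eta) /\
  forall q, Cmod (q - c)%C <= eta -> cdot (y - ball_proj c eta y)%C (q - ball_proj c eta y)%C <= 0.
Proof.
  intros He. unfold ball_proj. destruct (Rle_dec (Cmod (y - c)%C) eta) as [H|H].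
  - exists 0. split; [lra|]. split; [ring|]. split; auto. intros q _. unfold cdot; simpl. lra.
  - set (m := Cmod (y - c)%C) in *. exists (m / eta - 1).
    assert (Hm : 0 < m) by lra.
    assert (E : (y - (c + RtoC (eta / m) * (y - c)) = RtoC (1 - eta / m) * (y - c))%C).
    { rewrite RtoC_minus. ring. }
    assert (Ec : (c + RtoC (eta / m) * (y - c) - c = RtoC (eta / m) * (y - c))%C) by ring.
    assert (Em : 0 <= eta / m <= 1).
    { split; [apply Rdiv_le_0_compat; lra|]. apply (Rle_div_l eta 1 m); lra. }
    assert (Em' : 1 <= m / eta) by (apply (Rle_div_r 1 m eta); lra).
    split; [lra|]. split; [|split].
    + rewrite E, Ec, Cmult_assoc, <- RtoC_mult. f_equal. apply f_equal. field. lra.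
    + right. rewrite Ec, Cmod_mult, Cmod_RtoC by lra. fold m. field. lra.
    + intros q Hq. rewrite E, cdot_scal_l.
      replace (q - (c + RtoC (eta / m) * (y - c)))%C with ((q - c) - RtoC (eta / m) * (y - c))%C by ring.
      rewrite cdot_minus_r, (cdot_comm _ (RtoC (eta / m) * _)%C), cdot_scal_l, <- Cmod_sq. fold m.
      pose proof (cdot_le (y - c) (q - c)) as D. fold m in D.
      replace (eta / m * m ^ 2) with (eta * m) by (field; lra).
      assert (m * Cmod (q - c)%C <= m * eta) by (apply Rmult_le_compat_l; lra).
      assert (0 <= (1 - eta / m) * (eta * m - cdot (y - c)%C (q - c)%C)) by (apply Rmult_le_pos; lra). lra.
Qed.

Lemma ball_proj_nonexpansive c eta x y : 0 < eta ->
  Cmod (ball_proj c eta x - ball_proj c eta y)%C <= Cmod (x - y)%C.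
Proof.
  intros He. destruct (ball_proj_normal c eta x He) as (_ & _ & _ & _ & Hx).
  destruct (ball_proj_normal c eta y He) as (_ & _ & _ & _ & Hy).
  specialize (Hx _ (ball_proj_in c eta y ltac:(lra))). specialize (Hy _ (ball_proj_in c eta x ltac:(lra))).
  set (p := ball_proj c eta x) in *. set (q := ball_proj c eta y) in *.
  pose proof (cdot_le (x - y) (p - q)) as D. pose proof (Cmod_sq (p - q)%C) as S2.
  assert (E : Cmod (p - q)%C ^ 2 <= cdot (x - y)%C (p - q)%C).
  { rewrite S2. unfold cdot in *. simpl in *. lra. }
  pose proof (Cmod_ge_0 (p - q)%C). pose proof (Cmod_ge_0 (x - y)%C).
  destruct (Req_dec (Cmod (p - q)%C) 0); nra.
Qed.

(* Solution of a variational inequality: a fixed point of the projected map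
   [p |-> proj (p + lam (w - phi p))], a contraction for small [lam]. *)
Lemma accretive_range (phi : C -> C) (c w : C) (eta mu L : R) : 0 < eta -> 0 < mu ->
  (forall p q, Cmod (p - c)%C <= eta -> Cmod (q - c)%C <= eta ->
     mu * Cmod (p - q)%C ^ 2 <= cdot (phi p - phi q)%C (p - q)%C) ->
  (forall p q, Cmod (p - c)%C <= eta -> Cmod (q - c)%C <= eta ->
     Cmod (phi p - phi q)%C <= L * Cmod (p - q)%C) ->
  exists p t, Cmod (p - c)%C <= eta /\ 0 <= t /\ (t = 0 \/ Cmod (p - c)%C = eta) /\
    w = (phi p + RtoC t * (p - c))%C.
Proof.
  (* Enlarging the Lipschitz constant to at least [mu] ensures [k2 >= 0] below. *)
  intros He Hmu Hacc HL. set (M := Rabs L + mu).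
  assert (HM : mu <= M) by (unfold M; pose proof (Rabs_pos L); lra).
  assert (HLM : forall p q, Cmod (p - c)%C <= eta -> Cmod (q - c)%C <= eta ->
     Cmod (phi p - phi q)%C <= M * Cmod (p - q)%C).
  { intros p q Hp Hq. eapply Rle_trans; [apply HL; auto|]. apply Rmult_le_compat_r; [apply Cmod_ge_0|].
    unfold M. pose proof (Rle_abs L). lra. }
  (* The minimiser of the squared contraction factor [1 - 2 lam mu + lam^2 M^2]; the minimum is
     [k2]. *)
  set (lam := mu / M ^ 2). assert (HM2 : 0 < M ^ 2) by nra.
  assert (Hlam : 0 < lam) by (unfold lam; apply Rdiv_lt_0_compat; auto).
  set (k2 := 1 - mu ^ 2 / M ^ 2).
  assert (Hk2 : 0 <= k2 < 1).
  { unfold k2. assert (0 < mu ^ 2 / M ^ 2 <= 1); [|lra]. split; [apply Rdiv_lt_0_compat; nra|].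
    apply (Rle_div_l _ 1); nra. }
  set (T := fun p => ball_proj c eta (p + RtoC lam * (w - phi p))%C).
  destruct (contraction_fixpoint (fun p => Cmod (p - c)%C <= eta) T c (sqrt k2)) as (p & Hp & Tp).
  - apply cclosed_ball.
  - replace (c - c)%C with (RtoC 0) by ring. rewrite Cmod_0. lra.
  - split; [apply sqrt_pos|]. rewrite <- sqrt_1. apply sqrt_lt_1; lra.
  - intros p _. apply ball_proj_in. lra.
  - intros x y Hx Hy. eapply Rle_trans; [apply ball_proj_nonexpansive; auto|].
    replace (x + RtoC lam * (w - phi x) - (y + RtoC lam * (w - phi y)))%C
      with ((x - y) - RtoC lam * (phi x - phi y))%C by ring.
    specialize (Hacc x y Hx Hy). specialize (HLM x y Hx Hy).
    set (d := (x - y)%C) in *. set (f := (phi x - phi y)%C) in *.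
    assert (E : Cmod (d - RtoC lam * f)%C ^ 2 <= k2 * Cmod d ^ 2).
    { assert (E1 : Cmod (d - RtoC lam * f)%C ^ 2 = Cmod d ^ 2 - 2 * lam * cdot f d + lam ^ 2 * Cmod f ^ 2).
      { rewrite !Cmod_sq. unfold cdot. simpl. ring. }
      rewrite E1. assert (F2 : Cmod f ^ 2 <= M ^ 2 * Cmod d ^ 2).
      { rewrite <- Rpow_mult_distr. apply pow_incr. split; [apply Cmod_ge_0|auto]. }
      assert (lam ^ 2 * Cmod f ^ 2 <= lam ^ 2 * (M ^ 2 * Cmod d ^ 2)) by (apply Rmult_le_compat_l; [nra|auto]).
      assert (lam * (mu * Cmod d ^ 2) <= lam * cdot f d) by (apply Rmult_le_compat_l; lra).
      replace (k2 * Cmod d ^ 2) with (Cmod d ^ 2 - 2 * (lam * (mu * Cmod d ^ 2)) + lam ^ 2 * (M ^ 2 * Cmod d ^ 2)).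
      - lra.
      - unfold k2, lam. field. lra. }
    pose proof (sqrt_pos k2). pose proof (pow2_sqrt k2 ltac:(lra)) as Sk. pose proof (Cmod_ge_0 d).
    apply Rsqr_incr_0_var; [|apply Rmult_le_pos; auto]. rewrite !Rsqr_pow2, Rpow_mult_distr, Sk. exact E.
  - destruct (ball_proj_normal c eta (p + RtoC lam * (w - phi p))%C He) as (t & Ht & E & Hor & _).
    fold (T p) in E, Hor. rewrite Tp in E, Hor. exists p, (t / lam). split; [exact Hp|]. split; [apply Rdiv_le_0_compat; lra|].
    split; [destruct Hor as [->|]; [left; field; lra|auto]|].
    assert (Hl : RtoC lam <> RtoC 0) by (intros H; apply (f_equal fst) in H; simpl in H; lra).
    rewrite RtoC_div by lra. replace w with (phi p + (p + RtoC lam * (w - phi p) - p) / RtoC lam)%C at 1 by (field; auto).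
    rewrite E. field. auto.
Qed.

(** * Increments of harmonic maps along segments *)

Lemma rderiv_segment (f : C -> C) (q d v : C) t : cderiv f (q + RtoC t * d)%C v ->
  rderiv (fun s => f (q + RtoC s * d)%C) t (v * d)%C.
Proof.
  intros H. apply (rderiv_comp f (fun s => q + RtoC s * d)%C); auto.
  intros e He. exists 1. split; [lra|]. intros u _.
  replace (q + RtoC (t + u) * d - (q + RtoC t * d) - RtoC u * d)%C with (RtoC 0) by (rewrite RtoC_plus; ring).
  rewrite Cmod_0. apply Rmult_le_pos; [lra|apply Rabs_pos].
Qed.

(** The mean value theorem holds for real functions only, so the increment is tested against a fixed
    direction [e], on which [t] depends. *)
Lemma harmonic_mvt (h g h' g' : C -> C) (p q e : C) :
  (forall t, 0 <= t <= 1 -> cderiv h (q + RtoC t * (p - q))%C (h' (q + RtoC t * (p - q))%C) /\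
     cderiv g (q + RtoC t * (p - q))%C (g' (q + RtoC t * (p - q))%C)) ->
  exists t, 0 < t < 1 /\ let x := (q + RtoC t * (p - q))%C in
    cdot (harmonic h g p - harmonic h g q)%C e = cdot (h' x * (p - q) + Cconj (g' x * (p - q)))%C e.
Proof.
  intros H. set (d := (p - q)%C) in *. set (x := fun t => (q + RtoC t * d)%C).
  destruct (MVT_cor2 (fun t => cdot (harmonic h g (x t)) e) (fun t => cdot (h' (x t) * d + Cconj (g' (x t) * d))%C e) 0 1)
    as (t & E & Ht); [lra| |].
  - intros t Ht. destruct (H t Ht) as [Hh Hg]. apply is_derive_Reals.
    pose proof (rderiv_segment _ _ _ _ _ Hh) as Dh. pose proof (rderiv_segment _ _ _ _ _ Hg) as Dg.
    pose proof (rderiv_fst _ _ _ Dh) as D1. pose proof (rderiv_snd _ _ _ Dh) as D2.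
    pose proof (rderiv_fst _ _ _ Dg) as D3. pose proof (rderiv_snd _ _ _ Dg) as D4.
    unfold cdot, harmonic. fold (x t) in *.
    apply (is_derive_ext (fun s => fst e * fst (h (x s)) + snd e * snd (h (x s)) + (fst e * fst (g (x s)) + (- snd e) * snd (g (x s))))).
    { intros s. simpl. unfold Rminus. req. ring. }
    replace (fst (h' (x t) * d + Cconj (g' (x t) * d))%C * fst e + snd (h' (x t) * d + Cconj (g' (x t) * d))%C * snd e)
      with (fst e * fst (h' (x t) * d)%C + snd e * snd (h' (x t) * d)%C +
        (fst e * fst (g' (x t) * d)%C + (- snd e) * snd (g' (x t) * d)%C)) by (simpl; ring).
    apply @is_derive_plus; apply @is_derive_plus;
      apply @is_derive_scal; assumption.
  - exists t. split; auto. cbv beta in E. rewrite Rminus_0_r, Rmult_1_r in E. fold (x t). cbv zeta. rewrite <- E.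
    replace (x 1) with p by (unfold x, d; ring). replace (x 0) with q by (unfold x, d; ring). apply cdot_minus_l.
Qed.

(** Strict convexity of the disk. It gives strict accretivity for end points on the circle too,
    although the derivatives are compared in the open disk only. *)
Lemma Cmod_segment_lt (c p q : C) eta t : 0 < eta -> Cmod (p - c)%C <= eta -> Cmod (q - c)%C <= eta -> p <> q -> 0 < t < 1 ->
  Cmod (q + RtoC t * (p - q) - c)%C < eta.
Proof.
  intros He Hp Hq Hpq Ht. apply Cmod_lt_of_sq; [lra|].
  set (a := (p - c)%C) in *. set (b := (q - c)%C) in *.
  assert (Hd : 0 < Cmod (p - q)%C) by (apply Cmod_gt_0; intros E; apply Hpq, Ceq_minus, E).
  replace (q + RtoC t * (p - q) - c)%C with (RtoC t * a + RtoC (1 - t) * b)%C by (unfold a, b; rewrite RtoC_minus; ring).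
  assert (E : cdot (RtoC t * a + RtoC (1 - t) * b)%C (RtoC t * a + RtoC (1 - t) * b)%C =
    t * Cmod a ^ 2 + (1 - t) * Cmod b ^ 2 - t * (1 - t) * Cmod (p - q)%C ^ 2).
  { rewrite !Cmod_sq. unfold a, b, cdot. simpl. ring. }
  rewrite E. pose proof (Cmod_ge_0 a). pose proof (Cmod_ge_0 b).
  assert (Cmod a ^ 2 <= eta ^ 2) by (apply pow_incr; lra). assert (Cmod b ^ 2 <= eta ^ 2) by (apply pow_incr; lra).
  assert (0 < t * (1 - t) * Cmod (p - q)%C ^ 2) by (apply Rmult_lt_0_compat; [nra|apply pow_lt; auto]). nra.
Qed.

Lemma Cmod_segment_le (c p q : C) eta t : Cmod (p - c)%C <= eta -> Cmod (q - c)%C <= eta -> 0 <= t <= 1 ->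
  Cmod (q + RtoC t * (p - q) - c)%C <= eta.
Proof.
  intros Hp Hq Ht. replace (q + RtoC t * (p - q) - c)%C with (RtoC t * (p - c) + RtoC (1 - t) * (q - c))%C by (rewrite RtoC_minus; ring).
  eapply Rle_trans; [apply Cmod_triangle|]. rewrite !Cmod_mult, !Cmod_RtoC by lra. nra.
Qed.

Lemma harmonic_lipschitz (h g h' g' : C -> C) (c : C) eta M :
  (forall z, Cmod (z - c)%C <= eta -> cderiv h z (h' z) /\ cderiv g z (g' z) /\ Cmod (h' z) + Cmod (g' z) <= M) ->
  forall p q, Cmod (p - c)%C <= eta -> Cmod (q - c)%C <= eta ->
    Cmod (harmonic h g p - harmonic h g q)%C <= M * Cmod (p - q)%C.
Proof.
  intros H p q Hp Hq. set (e := (harmonic h g p - harmonic h g q)%C).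
  destruct (harmonic_mvt h g h' g' p q e) as (t & Ht & E).
  { intros t Ht. destruct (H _ (Cmod_segment_le c p q eta t Hp Hq Ht)) as (A & B & _). auto. }
  fold e in E. cbv zeta in E. set (x := (q + RtoC t * (p - q))%C) in *.
  destruct (H x (Cmod_segment_le c p q eta t Hp Hq ltac:(lra))) as (_ & _ & HM).
  rewrite <- Cmod_sq in E. pose proof (cdot_le (h' x * (p - q) + Cconj (g' x * (p - q)))%C e) as D.
  pose proof (Cmod_triangle (h' x * (p - q)) (Cconj (g' x * (p - q)))) as T.
  rewrite Cmod_conj, !Cmod_mult in T. pose proof (Cmod_ge_0 (p - q)%C). pose proof (Cmod_ge_0 e).
  assert (Cmod (h' x * (p - q) + Cconj (g' x * (p - q)))%C <= M * Cmod (p - q)%C) by nra.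
  destruct (Req_dec (Cmod e) 0) as [Z|Z]; [rewrite Z; apply Rle_trans with (1 := Cmod_ge_0 _) (2 := H2)|nra].
Qed.

(** The antilinear term can point in any direction, so only its modulus counts. The multiplier [c]
    is 1 for the rays and [conj h'(z0)] for local surjectivity. *)
Lemma harmonic_accretive_at (a b c d : C) :
  (fst (c * a)%C - Cmod (c * Cconj b)%C) * Cmod d ^ 2 <= cdot (c * (a * d + Cconj (b * d)))%C d.
Proof.
  assert (E : cdot (c * (a * d + Cconj (b * d)))%C d = fst (c * a)%C * Cmod d ^ 2 + cdot (c * Cconj b * Cconj d)%C d).
  { rewrite Cmod_sq. unfold cdot. simpl. ring. }
  rewrite E. pose proof (cdot_abs_le (c * Cconj b * Cconj d) d) as D. apply Rabs_le_between in D.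
  rewrite Cmod_mult, Cmod_conj in D. lra.
Qed.

(** [open] in the statement refers to the product topology of [C]; this is the translation to
    disks. *)
Lemma open_Cmod (U : C -> Prop) :
  open U <-> (forall x, U x -> exists e, 0 < e /\ forall y, Cmod (y - x)%C < e -> U y).
Proof.
  split.
  - intros H x Hx. destruct (H x Hx) as [e He]. exists e. split; [apply cond_pos|]. intros y Hy. apply He.
    split; simpl; unfold AbsRing_ball, abs, minus, plus, opp; simpl.
    + eapply Rle_lt_trans; [|apply Hy]. apply (fst_le_Cmod (y - x)%C).
    + eapply Rle_lt_trans; [|apply Hy]. apply (snd_le_Cmod (y - x)%C).
  - intros H x Hx. destruct (H x Hx) as (e & He & Hy). assert (He2 : 0 < e / 2) by lra.
    exists (mkposreal _ He2). intros y [B1 B2]. apply Hy. eapply Rle_lt_trans; [apply Cmod_le_abs|].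
    unfold ball in B1, B2. simpl in B1, B2. unfold AbsRing_ball, abs, minus, plus, opp in B1, B2. simpl in *. unfold Rminus in *. lra.
Qed.

(** Two points are joined by the image of a segment, and the supremum of the parameters that lie in
    [U] is a point where [U] and [V] meet or near which they do. *)
Lemma connected_path_image (A : C -> Prop) (f : C -> C) : (forall p q t, A p -> A q -> 0 <= t <= 1 -> A (q + RtoC t * (p - q))%C) ->
  (forall z, A z -> ccont f z) -> connected_set (image f A).
Proof.
  intros HA Hf U V HU HV Hcov (w1 & (z1 & A1 & E1) & U1) (w2 & (z2 & A2 & E2) & V2).
  rewrite open_Cmod in HU. rewrite open_Cmod in HV.
  set (x := fun t => (z1 + RtoC t * (z2 - z1))%C). set (w := fun t => f (x t)).
  assert (Ax : forall t, 0 <= t <= 1 -> A (x t)) by (intros; apply HA; auto).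
  assert (Im : forall t, 0 <= t <= 1 -> image f A (w t)) by (intros t Ht; exists (x t); auto).
  assert (Cw : forall t e, 0 <= t <= 1 -> 0 < e -> exists d, 0 < d /\ forall s, Rabs (s - t) < d -> Cmod (w s - w t)%C < e).
  { intros t e Ht He. destruct (Hf _ (Ax t Ht) e He) as (d & Hd & H). pose proof (Cmod_ge_0 (z2 - z1)%C) as N.
    exists (d / (Cmod (z2 - z1)%C + 1)). split; [apply Rdiv_lt_0_compat; lra|]. intros s Hs. apply H. unfold x.
    replace (z1 + RtoC s * (z2 - z1) - (z1 + RtoC t * (z2 - z1)))%C with (RtoC (s - t) * (z2 - z1))%C by (rewrite RtoC_minus; ring).
    rewrite Cmod_mult, Cmod_R. apply Rlt_div_r in Hs; [|lra]. pose proof (Rabs_pos (s - t)). nra. }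
  destruct (completeness (fun t => 0 <= t <= 1 /\ U (w t))) as (s & Sub & Sleast).
  { exists 1. intros t [[_ H] _]. exact H. }
  { exists 0. split; [lra|]. unfold w, x. replace (z1 + RtoC 0 * (z2 - z1))%C with z1 by ring. rewrite <- E1. exact U1. }
  assert (Hs : 0 <= s <= 1).
  { split; [|apply Sleast; intros t [[_ H] _]; exact H]. apply Sub. split; [lra|]. unfold w, x.
    replace (z1 + RtoC 0 * (z2 - z1))%C with z1 by ring. rewrite <- E1. exact U1. }
  destruct (Hcov _ (Im s Hs)) as [Us|Vs].
  - destruct (Req_dec s 1) as [E|Ne].
    + exists (w s). split; auto. split; auto. rewrite E. unfold w, x.
      replace (z1 + RtoC 1 * (z2 - z1))%C with z2 by ring. rewrite <- E2. exact V2.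
    + exfalso. destruct (HU _ Us) as (e & He & Hb). destruct (Cw s e Hs He) as (d & Hd & Hw).
      set (t := s + Rmin (d / 2) (1 - s)). assert (0 < Rmin (d / 2) (1 - s)) by (apply Rmin_glb_lt; lra).
      pose proof (Rmin_l (d / 2) (1 - s)). pose proof (Rmin_r (d / 2) (1 - s)).
      assert (t <= s); [|unfold t in *; lra]. apply Sub. split; [unfold t; lra|]. apply Hb, Hw. unfold t.
      replace (s + Rmin (d / 2) (1 - s) - s) with (Rmin (d / 2) (1 - s)) by ring. rewrite Rabs_right; lra.
  - destruct (HV _ Vs) as (e & He & Hb). destruct (Cw s e Hs He) as (d & Hd & Hw).
    destruct (classic (exists t, (0 <= t <= 1 /\ U (w t)) /\ s - d < t)) as [(t & [Ht Ut] & Htd)|Hn].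
    + exists (w t). split; auto. split; auto. apply Hb, Hw. pose proof (Sub t (conj Ht Ut)). apply Rabs_def1; lra.
    + exfalso. assert (s <= s - d); [|lra]. apply Sleast. intros t Ht. apply Rnot_lt_le. intros L. apply Hn. eauto.
Qed.

(** Monotonicity of the outward normals of the disk. With strict accretivity it excludes
    [f p + t p = f q + s q] for [p <> q], whether [q] lies on the circle or, with [s = 0],
    inside. *)
Lemma ray_pairing (p q : C) (s t eta : R) : Cmod p = eta -> Cmod q <= eta -> 0 <= t -> (0 < s -> Cmod q = eta) -> 0 <= s ->
  cdot (RtoC s * q - RtoC t * p)%C (p - q)%C <= 0.
Proof.
  intros Hp Hq Ht Hs Hs0.
  assert (E : cdot (RtoC s * q - RtoC t * p)%C (p - q)%C = (s + t) * cdot p q - s * Cmod q ^ 2 - t * Cmod p ^ 2).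
  { rewrite !Cmod_sq. unfold cdot. simpl. ring. }
  rewrite E. pose proof (cdot_le p q) as D. rewrite Hp in *. pose proof (Cmod_ge_0 q).
  assert (cdot p q <= eta * eta) by nra.
  destruct (Req_dec s 0) as [->|Hs1].
  - assert (t * cdot p q <= t * (eta * eta)) by (apply Rmult_le_compat_l; auto). lra.
  - rewrite (Hs ltac:(lra)) in *. assert ((s + t) * cdot p q <= (s + t) * (eta * eta)) by (apply Rmult_le_compat_l; lra). lra.
Qed.

(* The rays [f(p) + t p], [|p| = eta], fill the complement of the image: the
   equation [w = f(p) + t p] is a limit of the solvable variational inequalities
   for [f + delta id]. *)
Lemma rays_cover (f : C -> C) (w : C) eta L : 0 < eta ->
  (forall p q, Cmod p <= eta -> Cmod q <= eta -> 0 <= cdot (f p - f q)%C (p - q)%C) ->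
  (forall p q, Cmod p <= eta -> Cmod q <= eta -> Cmod (f p - f q)%C <= L * Cmod (p - q)%C) ->
  exists p t, Cmod p <= eta /\ 0 <= t /\ (t = 0 \/ Cmod p = eta) /\ w = (f p + RtoC t * p)%C.
Proof.
  intros He Hacc HL.
  assert (M0 : forall p : C, (p - 0)%C = p) by (intros; ring).
  assert (HN : forall n, exists pt : C * R, Cmod (fst pt) <= eta /\ 0 <= snd pt /\ (snd pt = 0 \/ Cmod (fst pt) = eta) /\
     w = (f (fst pt) + RtoC (/ INR (S n)) * fst pt + RtoC (snd pt) * fst pt)%C).
  { intros n. assert (0 < / INR (S n)) by (apply Rinv_0_lt_compat, lt_0_INR; lia). set (de := / INR (S n)) in *.
    destruct (accretive_range (fun p => f p + RtoC de * p)%C 0 w eta de (L + de)) as (p & t & H1 & H2 & H3 & H4); auto.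
    - intros p q Hp Hq. rewrite !M0 in *.
      replace (f p + RtoC de * p - (f q + RtoC de * q))%C with ((f p - f q) + RtoC de * (p - q))%C by ring.
      rewrite cdot_plus_l, cdot_scal_l, <- Cmod_sq. specialize (Hacc p q Hp Hq). lra.
    - intros p q Hp Hq. rewrite !M0 in *.
      replace (f p + RtoC de * p - (f q + RtoC de * q))%C with ((f p - f q) + RtoC de * (p - q))%C by ring.
      eapply Rle_trans; [apply Cmod_triangle|]. rewrite Cmod_mult, Cmod_RtoC by lra. specialize (HL p q Hp Hq). lra.
    - rewrite M0 in *. exists (p, t). auto. }
  set (pt := fun n => proj1_sig (constructive_indefinite_description _ (HN n))).
  assert (Hpt : forall n, Cmod (fst (pt n)) <= eta /\ 0 <= snd (pt n) /\ (snd (pt n) = 0 \/ Cmod (fst (pt n)) = eta) /\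
     w = (f (fst (pt n)) + RtoC (/ INR (S n)) * fst (pt n) + RtoC (snd (pt n)) * fst (pt n))%C).
  { intros n. exact (proj2_sig (constructive_indefinite_description _ (HN n))). }
  destruct (complex_cluster (fun n => fst (pt n)) eta) as [p Hp]; [intros n; apply Hpt|].
  assert (Hpe : Cmod p <= eta).
  { rewrite <- (M0 p). apply (cclosed_ball 0 eta). intros e E. destruct (Hp e 0%nat E) as (n & _ & Hn).
    exists (fst (pt n)). rewrite M0. split; [apply Hpt|auto]. }
  (* The only possible multiplier: [w = f p + t p] with [|p| = eta] forces [|w - f p| = t eta]. *)
  set (t := Cmod (w - f p)%C / eta).
  assert (Ht : 0 <= t) by (apply Rdiv_le_0_compat; [apply Cmod_ge_0|auto]).
  (* Approximate solutions near [p]; the perturbation [q / (n + 1)] is absorbed into the error. *)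
  assert (R0 : forall e, 0 < e -> exists q s, Cmod (q - p)%C < e /\ 0 <= s /\ (s = 0 \/ Cmod q = eta) /\
     Cmod (w - f p - RtoC s * q)%C < e /\ Cmod q <= eta).
  { intros e E. set (e' := e / (Rabs L + eta + 2)).
    assert (Hden : 0 < Rabs L + eta + 2) by (pose proof (Rabs_pos L); lra).
    assert (He' : 0 < e') by (apply Rdiv_lt_0_compat; auto).
    assert (Hee : e' * (Rabs L + eta + 2) = e) by (unfold e'; field; lra).
    destruct (archimed_cor1 e' He') as (N & HN1 & HN2).
    destruct (Hp e' N He') as (n & Hn & Hpn). destruct (Hpt n) as (A1 & A2 & A3 & A4).
    exists (fst (pt n)), (snd (pt n)). repeat split; auto.
    - eapply Rlt_le_trans; [apply Hpn|]. pose proof (Rabs_pos L). nra.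
    - rewrite A4 at 1. set (q := fst (pt n)) in *. set (s := snd (pt n)) in *.
      replace (f q + RtoC (/ INR (S n)) * q + RtoC s * q - f p - RtoC s * q)%C with ((f q - f p) + RtoC (/ INR (S n)) * q)%C by ring.
      assert (Hi : 0 < / INR (S n)) by (apply Rinv_0_lt_compat, lt_0_INR; lia).
      assert (Hi2 : / INR (S n) < e').
      { eapply Rle_lt_trans; [|apply HN1]. apply Rinv_le_contravar; [apply lt_0_INR; lia|apply le_INR; lia]. }
      eapply Rle_lt_trans; [apply Cmod_triangle|]. rewrite Cmod_mult, Cmod_RtoC by lra.
      specialize (HL q p A1 Hpe). pose proof (Rle_abs L). pose proof (Cmod_ge_0 (q - p)%C). pose proof (Cmod_ge_0 q).
      assert (L * Cmod (q - p)%C <= Rabs L * e') by (pose proof (Rabs_pos L); nra). nra. }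
  exists p, t. split; auto. split; auto.
  destruct (Req_dec (Cmod p) eta) as [Ep|Ep].
  - split; auto. apply Ceq_minus. apply Cmod_eq_0.
    destruct (Rle_lt_or_eq_dec 0 _ (Cmod_ge_0 (w - (f p + RtoC t * p))%C)) as [P|P]; auto. exfalso.
    set (m := Cmod (w - (f p + RtoC t * p))%C) in *.
    assert (Hm : 0 < m / (3 + t)) by (apply Rdiv_lt_0_compat; lra).
    destruct (R0 _ Hm) as (q & s & B1 & B2 & B3 & B4 & B5). set (e := m / (3 + t)) in *.
    assert (Em : e * (3 + t) = m) by (unfold e; field; lra).
    assert (Hte : t * eta = Cmod (w - f p)%C) by (unfold t; field; lra).
    assert (St : Rabs (s - t) * eta <= e).
    { rewrite <- (Rabs_right eta) by lra. rewrite <- Rabs_mult, Rmult_minus_distr_r, Hte. apply Rabs_le.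
      destruct B3 as [->|B3].
      - replace (w - f p - RtoC 0 * q)%C with (w - f p)%C in B4 by ring. pose proof (Cmod_ge_0 (w - f p)%C). lra.
      - pose proof (Cmod_triangle_sub (w - f p) (RtoC s * q)) as T1.
        pose proof (Cmod_triangle_sub (RtoC s * q) (w - f p)) as T2. rewrite (Cmod_minus_sym (RtoC s * q)) in T2.
        rewrite Cmod_mult, Cmod_RtoC, B3 in T1, T2 by auto. lra. }
    assert (m <= e + (Rabs (s - t) * eta + t * e)).
    { unfold m. replace (w - (f p + RtoC t * p))%C with ((w - f p - RtoC s * q) + (RtoC (s - t) * q + RtoC t * (q - p)))%C
        by (rewrite RtoC_minus; ring).
      eapply Rle_trans; [apply Cmod_triangle|]. apply Rplus_le_compat; [lra|].
      eapply Rle_trans; [apply Cmod_triangle|]. rewrite !Cmod_mult, Cmod_R, Cmod_RtoC by auto.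
      apply Rplus_le_compat; [apply Rmult_le_compat_l; [apply Rabs_pos|auto]|apply Rmult_le_compat_l; lra]. }
    lra.
  (* Near an interior [p] the approximate solutions are interior, so their multipliers vanish and
     [w = f p]. *)
  - assert (Hlt : Cmod p < eta) by lra.
    assert (Z : Cmod (w - f p)%C = 0).
    { destruct (Rle_lt_or_eq_dec 0 _ (Cmod_ge_0 (w - f p)%C)) as [P|P]; auto. exfalso.
      destruct (R0 (Rmin (eta - Cmod p) (Cmod (w - f p)%C))) as (q & s & B1 & B2 & B3 & B4 & B5); [apply Rmin_glb_lt; lra|].
      destruct B3 as [->|B3].
      - replace (w - f p - RtoC 0 * q)%C with (w - f p)%C in B4 by ring. pose proof (Rmin_r (eta - Cmod p) (Cmod (w - f p)%C)). lra.
      - pose proof (Rmin_l (eta - Cmod p) (Cmod (w - f p)%C)). pose proof (Cmod_triangle_sub q p). lra. }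
    assert (t = 0) by (unfold t; rewrite Z; unfold Rdiv; ring). split; auto.
    rewrite H. apply Cmod_eq_0 in Z. apply Ceq_minus. transitivity (w - f p)%C; [ring|exact Z].
Qed.

(** The rays start at boundary values, so accretivity and the Lipschitz bound are needed on the
    closed disk; the strict inequality between the derivatives, which may fail on the circle, is
    asked in the open disk only. *)
Theorem close_to_convex_disk (h g h' g' : C -> C) eta M : 0 < eta ->
  (forall z, Cmod z <= eta -> cderiv h z (h' z) /\ cderiv g z (g' z) /\ Cmod (h' z) + Cmod (g' z) <= M) ->
  (forall z, Cmod z < eta -> Cmod (g' z) < fst (h' z)) ->
  close_to_convex_on (disk eta) (harmonic h g).
Proof.
  intros He Hd Hpos. set (f := harmonic h g).
  assert (M0 : forall p : C, (p - 0)%C = p) by (intros; ring).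
  assert (Hacc : forall p q, Cmod p <= eta -> Cmod q <= eta -> p <> q -> 0 < cdot (f p - f q)%C (p - q)%C).
  { intros p q Hp Hq Hpq. destruct (harmonic_mvt h g h' g' p q (p - q)%C) as (t & Ht & E).
    { intros t Ht. rewrite <- (M0 p) in Hp. rewrite <- (M0 q) in Hq. pose proof (Cmod_segment_le 0 p q eta t Hp Hq Ht) as S.
      rewrite M0 in S. destruct (Hd _ S) as (A & B & _). auto. }
    fold f in E. cbv zeta in E. rewrite E. set (x := (q + RtoC t * (p - q))%C) in *.
    assert (Hx : Cmod x < eta).
    { rewrite <- (M0 p) in Hp. rewrite <- (M0 q) in Hq. pose proof (Cmod_segment_lt 0 p q eta t He Hp Hq Hpq Ht) as S.
      rewrite M0 in S. exact S. }
    pose proof (harmonic_accretive_at (h' x) (g' x) 1 (p - q)%C) as A. rewrite !Cmult_1_l, Cmod_conj in A.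
    eapply Rlt_le_trans; [|exact A]. apply Rmult_lt_0_compat; [specialize (Hpos x Hx); lra|].
    apply pow_lt, Cmod_gt_0. intros E0. apply Hpq, Ceq_minus, E0. }
  assert (HL : forall p q, Cmod p <= eta -> Cmod q <= eta -> Cmod (f p - f q)%C <= M * Cmod (p - q)%C).
  { intros p q Hp Hq. apply (harmonic_lipschitz h g h' g' 0 eta M); rewrite ?M0; auto.
    intros z Hz. rewrite M0 in Hz. auto. }
  assert (Hacc0 : forall p q, Cmod p <= eta -> Cmod q <= eta -> 0 <= cdot (f p - f q)%C (p - q)%C).
  { intros p q Hp Hq. destruct (classic (p = q)) as [->|N]; [unfold cdot; simpl; lra|apply Rlt_le, Hacc; auto]. }
  assert (Ray : forall p t, Cmod p = eta -> 0 <= t -> ~ image f (disk eta) (f p + RtoC t * p)%C).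
  { intros p t Hp Ht (q & Hq & E). unfold disk in Hq. assert (N : p <> q) by (intros ->; lra).
    pose proof (Hacc p q ltac:(lra) ltac:(lra) N) as A.
    replace (f p - f q)%C with (RtoC 0 * q - RtoC t * p)%C in A by (rewrite <- E; ring).
    pose proof (ray_pairing p q 0 t eta Hp ltac:(lra) Ht ltac:(lra) ltac:(lra)). lra. }
  assert (Cov : forall w, ~ image f (disk eta) w -> exists p t, Cmod p = eta /\ 0 <= t /\ w = (f p + RtoC t * p)%C).
  { intros w Hw. destruct (rays_cover f w eta M He Hacc0 HL) as (p & t & H1 & H2 & H3 & H4).
    destruct (Req_dec (Cmod p) eta) as [E|E]; [exists p, t; auto|]. exfalso. destruct H3 as [->|H3]; [|lra].
    apply Hw. exists p. split; [unfold disk; lra|]. rewrite H4. ring. }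
  assert (Hp0 : Cmod (RtoC (eta / 2)) < eta) by (rewrite Cmod_RtoC; lra).
  split; [|split].
  - intros z w Hz Hw E. unfold disk in *. apply NNPP. intros N. pose proof (Hacc z w ltac:(lra) ltac:(lra) N) as A.
    rewrite E in A. unfold cdot in A. simpl in A. lra.
  - split; [exists (f 0%C), 0%C; split; [unfold disk; rewrite Cmod_0; auto|auto]|]. split.
    (* If [w = f z] were a limit of points on rays, their starting points would cluster at some [p]
       on the circle with [cdot (f p - f z) (p - z) <= 0], against strict accretivity. *)
    + apply open_Cmod. intros w (z & Hz & Ew). apply NNPP. intros N.
      assert (B : forall n, exists p, Cmod p = eta /\ exists t, 0 <= t /\ Cmod (f p + RtoC t * p - w)%C < / INR (S n)).
      { intros n. apply NNPP. intros N'. apply N. exists (/ INR (S n)). split; [apply Rinv_0_lt_compat, lt_0_INR; lia|].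
        intros y Hy. apply NNPP. intros Ny. destruct (Cov y Ny) as (p & t & A1 & A2 & A3). apply N'.
        exists p. split; auto. exists t. split; auto. rewrite <- A3. exact Hy. }
      unfold disk in Hz.
      set (u := fun n => proj1_sig (constructive_indefinite_description _ (B n))).
      assert (Hu : forall n, Cmod (u n) = eta /\ cdot (f (u n) - f z)%C (u n - z)%C <= / INR (S n) * (2 * eta)).
      { intros n. destruct (proj2_sig (constructive_indefinite_description _ (B n))) as (Hp & t & Ht & Hd').
        fold (u n) in Hp, Hd'. split; auto. rewrite Ew in Hd'. set (y := (f (u n) + RtoC t * u n)%C) in *.
        replace (f (u n) - f z)%C with ((y - f z) + (RtoC 0 * z - RtoC t * u n))%C by (unfold y; ring).
        rewrite cdot_plus_l. pose proof (ray_pairing (u n) z 0 t eta Hp ltac:(lra) Ht ltac:(lra) ltac:(lra)) as R1.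
        pose proof (cdot_le (y - f z) (u n - z)) as R2.
        assert (R3 : Cmod (u n - z)%C <= 2 * eta).
        { unfold Cminus. eapply Rle_trans; [apply Cmod_triangle|]. rewrite Cmod_opp. lra. }
        assert (Cmod (y - f z)%C * Cmod (u n - z)%C <= / INR (S n) * (2 * eta)); [|lra].
        apply Rmult_le_compat; try apply Cmod_ge_0; lra. }
      destruct (complex_cluster u eta) as [p Hp]; [intros n; destruct (Hu n); lra|].
      assert (Hpe : Cmod p = eta).
      { apply (cclosed_circle eta). intros e E. destruct (Hp e 0%nat E) as (n & _ & Hn). exists (u n). split; [apply Hu|auto]. }
      assert (N2 : p <> z) by (intros ->; lra).
      pose proof (Hacc p z ltac:(lra) ltac:(lra) N2) as A. set (a := cdot (f p - f z)%C (p - z)%C) in *.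
      set (e := a / (4 * eta * Rabs M + 2 * eta + 1)).
      assert (Hden : 0 < 4 * eta * Rabs M + 2 * eta + 1) by (pose proof (Rabs_pos M); nra).
      assert (Ee : 0 < e) by (apply Rdiv_lt_0_compat; auto).
      assert (Hee : e * (4 * eta * Rabs M + 2 * eta + 1) = a) by (unfold e; field; lra).
      destruct (archimed_cor1 e Ee) as (K & K1 & K2). destruct (Hp e K Ee) as (n & Hn & Hpn).
      destruct (Hu n) as (U1 & U2). set (q := u n) in *.
      assert (Hi : / INR (S n) <= e).
      { apply Rlt_le. eapply Rle_lt_trans; [|apply K1]. apply Rinv_le_contravar; [apply lt_0_INR; lia|apply le_INR; lia]. }
      assert (D : a = cdot (f p - f q)%C (p - z)%C + cdot (f q - f z)%C (p - q)%C + cdot (f q - f z)%C (q - z)%C)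
        by (unfold a, cdot; simpl; ring).
      assert (D1 : Cmod (f p - f q)%C <= Rabs M * e).
      { eapply Rle_trans; [apply HL; lra|]. rewrite Cmod_minus_sym. pose proof (Cmod_ge_0 (q - p)%C).
        apply Rle_trans with (Rabs M * Cmod (q - p)%C); [apply Rmult_le_compat_r; [auto|apply Rle_abs]|].
        apply Rmult_le_compat_l; [apply Rabs_pos|lra]. }
      assert (D2 : Cmod (p - z)%C <= 2 * eta).
      { unfold Cminus. eapply Rle_trans; [apply Cmod_triangle|]. rewrite Cmod_opp. lra. }
      assert (D2' : Cmod (q - z)%C <= 2 * eta).
      { unfold Cminus. eapply Rle_trans; [apply Cmod_triangle|]. rewrite Cmod_opp. lra. }
      assert (D3 : Cmod (f q - f z)%C <= Rabs M * (2 * eta)).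
      { eapply Rle_trans; [apply HL; lra|]. pose proof (Cmod_ge_0 (q - z)%C).
        apply Rle_trans with (Rabs M * Cmod (q - z)%C); [apply Rmult_le_compat_r; [auto|apply Rle_abs]|].
        apply Rmult_le_compat_l; [apply Rabs_pos|lra]. }
      pose proof (cdot_le (f p - f q) (p - z)) as C1. pose proof (cdot_le (f q - f z) (p - q)) as C2.
      rewrite (Cmod_minus_sym p q) in C2.
      assert (Cmod (f p - f q)%C * Cmod (p - z)%C <= Rabs M * e * (2 * eta)) by (apply Rmult_le_compat; try apply Cmod_ge_0; auto).
      assert (Cmod (f q - f z)%C * Cmod (q - p)%C <= Rabs M * (2 * eta) * e) by (apply Rmult_le_compat; try apply Cmod_ge_0; lra).
      assert (/ INR (S n) * (2 * eta) <= e * (2 * eta)) by (apply Rmult_le_compat_r; lra). lra.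
    + apply connected_path_image.
      * intros p q t Hp Hq Ht. unfold disk in *. destruct (classic (p = q)) as [->|Ne].
        { replace (q + RtoC t * (q - q))%C with q by ring. auto. }
        set (r := Rmax (Cmod p) (Cmod q)). apply Rle_lt_trans with r; [|apply Rmax_lub_lt; auto].
        rewrite <- (M0 (q + RtoC t * (p - q))%C). apply Cmod_segment_le; auto; rewrite M0; [apply Rmax_l|apply Rmax_r].
      * intros z Hz e E. unfold disk in Hz. exists (Rmin (eta - Cmod z) (e / (Rabs M + 1))).
        assert (HM : 0 < Rabs M + 1) by (pose proof (Rabs_pos M); lra).
        split; [apply Rmin_glb_lt; [lra|apply Rdiv_lt_0_compat; auto]|]. intros w Hw.
        pose proof (Rmin_l (eta - Cmod z) (e / (Rabs M + 1))). pose proof (Rmin_r (eta - Cmod z) (e / (Rabs M + 1))).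
        pose proof (Cmod_triangle_sub w z). eapply Rle_lt_trans; [apply HL; lra|].
        assert (Hw2 : Cmod (w - z)%C < e / (Rabs M + 1)) by lra. apply Rlt_div_r in Hw2; [|lra].
        pose proof (Cmod_ge_0 (w - z)%C). pose proof (Rle_abs M). nra.
  - exists (fun L => exists p, Cmod p = eta /\ forall z, L z <-> exists t, 0 <= t /\ z = (f p + RtoC t * p)%C).
    split; [|split].
    + intros L (p & Hp & HLp). exists (f p), p. split; [|left; exact HLp]. intros E. rewrite E, Cmod_0 in Hp. lra.
    + intros L1 L2 (p & Hp & H1) (q & Hq & H2) (z & Z1 & Z2). apply H1 in Z1. apply H2 in Z2.
      destruct Z1 as (t & Ht & E1), Z2 as (s & Hs & E2).
      assert (p = q) as <-.
      { apply NNPP. intros N. pose proof (Hacc p q ltac:(lra) ltac:(lra) N) as A.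
        replace (f p - f q)%C with (RtoC s * q - RtoC t * p)%C in A.
        - pose proof (ray_pairing p q s t eta Hp ltac:(lra) Ht ltac:(lra) Hs). lra.
        - apply Ceq_minus. transitivity ((f q + RtoC s * q) - (f p + RtoC t * p))%C; [ring|]. rewrite <- E1, <- E2. ring. }
      intros y. rewrite H1, H2. reflexivity.
    + intros z. split.
      * intros Nz. destruct (Cov z Nz) as (p & t & A1 & A2 & A3).
        exists (fun y => exists t, 0 <= t /\ y = (f p + RtoC t * p)%C). split; [exists p; split; auto; tauto|eauto].
      * intros (L & (p & Hp & HLp) & Lz). apply HLp in Lz. destruct Lz as (t & Ht & ->). apply Ray; auto.
Qed.

(** * Univalence of h + eps g *)

(** Since [|g'| < |h'|] at [z0], multiplication by [conj h'(z0)] makes the map strictly accretive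
    nearby; [accretive_range] then solves the equation, and for [w] close to the value at [z0] the
    normal term is 0. *)
Lemma harmonic_local_surjective (h g h' g' : C -> C) (z0 : C) eps : holo 1 h h' -> holo 1 g g' -> Cmod z0 < 1 ->
  Cmod (g' z0) < Cmod (h' z0) -> 0 < eps ->
  exists del, 0 < del /\ forall w, Cmod (w - harmonic h g z0)%C < del ->
    exists z, Cmod (z - z0)%C < eps /\ harmonic h g z = w.
Proof.
  intros Hh Hg Hz0 Hj Heps. set (f := harmonic h g). set (c := Cconj (h' z0)). set (m := Cmod (h' z0)) in *.
  assert (Hm : 0 < m) by (pose proof (Cmod_ge_0 (g' z0)); lra).
  assert (Hcm : Cmod c = m) by apply Cmod_conj.
  (* If [h'] and [g'] vary by at most a quarter of the gap, the accretivity constant is still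
     [m^2 - m k - m (m - 3 k) = 2 m k]. *)
  set (k := (m - Cmod (g' z0)) / 4). assert (Hk : 0 < k) by (unfold k; lra).
  destruct (proj2 (Hh z0 Hz0) k Hk) as (d1 & Hd1 & C1). destruct (proj2 (Hg z0 Hz0) k Hk) as (d2 & Hd2 & C2).
  set (eta := Rmin (Rmin d1 d2) (Rmin eps (1 - Cmod z0)) / 2).
  assert (Heta : 0 < eta /\ eta < d1 /\ eta < d2 /\ eta < eps /\ eta < 1 - Cmod z0).
  { unfold eta. assert (0 < Rmin (Rmin d1 d2) (Rmin eps (1 - Cmod z0))) by (repeat apply Rmin_glb_lt; lra).
    pose proof (Rmin_l (Rmin d1 d2) (Rmin eps (1 - Cmod z0))). pose proof (Rmin_r (Rmin d1 d2) (Rmin eps (1 - Cmod z0))).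
    pose proof (Rmin_l d1 d2). pose proof (Rmin_r d1 d2). pose proof (Rmin_l eps (1 - Cmod z0)). pose proof (Rmin_r eps (1 - Cmod z0)). lra. }
  destruct Heta as (E0 & E1 & E2 & E3 & E4).
  assert (Hin : forall z, Cmod (z - z0)%C <= eta -> Cmod z < 1).
  { intros z Hz. pose proof (Cmod_triangle_sub z z0). lra. }
  set (M := m + Cmod (g' z0) + 2 * k). set (mu := 2 * m * k).
  assert (Hmu : 0 < mu) by (unfold mu; nra).
  assert (HL : forall p q, Cmod (p - z0)%C <= eta -> Cmod (q - z0)%C <= eta -> Cmod (f p - f q)%C <= M * Cmod (p - q)%C).
  { apply (harmonic_lipschitz h g h' g'). intros z Hz. split; [apply Hh; auto|]. split; [apply Hg; auto|].
    specialize (C1 z ltac:(lra)). specialize (C2 z ltac:(lra)).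
    pose proof (Cmod_triangle_sub (h' z) (h' z0)). pose proof (Cmod_triangle_sub (g' z) (g' z0)). unfold M, m in *. lra. }
  assert (Hacc : forall p q, Cmod (p - z0)%C <= eta -> Cmod (q - z0)%C <= eta ->
     mu * Cmod (p - q)%C ^ 2 <= cdot (c * f p - c * f q)%C (p - q)%C).
  { intros p q Hp Hq. destruct (harmonic_mvt h g h' g' p q (Cconj c * (p - q))%C) as (t & Ht & E).
    { intros t Ht. pose proof (Hin _ (Cmod_segment_le z0 p q eta t Hp Hq Ht)) as S. split; [apply Hh; auto|apply Hg; auto]. }
    fold f in E. cbv zeta in E. set (x := (q + RtoC t * (p - q))%C) in *.
    assert (A : forall y d, cdot (c * y)%C d = cdot y (Cconj c * d)%C) by (intros; unfold cdot; simpl; ring).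
    replace (c * f p - c * f q)%C with (c * (f p - f q))%C by ring. rewrite A, E, <- A.
    eapply Rle_trans; [|apply harmonic_accretive_at]. apply Rmult_le_compat_r; [apply pow2_ge_0|].
    pose proof (Cmod_segment_le z0 p q eta t Hp Hq ltac:(lra)) as S. fold x in S.
    specialize (C1 x ltac:(lra)). specialize (C2 x ltac:(lra)).
    rewrite Cmod_mult, Cmod_conj, Hcm.
    assert (F : fst (c * h' x)%C = m ^ 2 + fst (c * (h' x - h' z0))%C).
    { unfold m, c. rewrite Cmod_sq. unfold cdot. simpl. ring. }
    pose proof (fst_le_Cmod (c * (h' x - h' z0))%C) as B. apply Rabs_le_between in B. rewrite Cmod_mult, Hcm in B.
    pose proof (Cmod_triangle_sub (g' x) (g' z0)). rewrite F. unfold mu.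
    assert (m * Cmod (h' x - h' z0)%C <= m * k) by (apply Rmult_le_compat_l; lra).
    assert (m * Cmod (g' x) <= m * (Cmod (g' z0) + k)) by (apply Rmult_le_compat_l; lra).
    assert (Cmod (g' z0) = m - 4 * k) by (unfold k; lra). rewrite H2 in *. lra. }
  exists (mu * eta / m). split; [apply Rdiv_lt_0_compat; nra|]. intros w Hw. fold f in Hw.
  destruct (accretive_range (fun z => c * f z)%C z0 (c * w)%C eta mu (m * M) E0 Hmu Hacc) as (p & t & H1 & H2 & H3 & H4).
  { intros p q Hp Hq. replace (c * f p - c * f q)%C with (c * (f p - f q))%C by ring. rewrite Cmod_mult, Hcm, Rmult_assoc.
    apply Rmult_le_compat_l; [lra|auto]. }
  exists p. split; [lra|].
  assert (Hc : c <> 0%C) by (intros Z; rewrite Z, Cmod_0 in Hcm; lra).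
  destruct (Req_dec t 0) as [->|Nt].
  - apply Ceq_minus. replace (f p - w)%C with ((c * f p - c * w) / c)%C by (field; auto).
    rewrite H4. field. auto.
  (* A nonzero normal term puts [p] on the circle around [z0], and accretivity then forces
     [m |w - f z0| >= mu eta]. *)
  - exfalso. destruct H3 as [->|H3]; [lra|].
    assert (Hz00 : Cmod (z0 - z0)%C <= eta) by (replace (z0 - z0)%C with (RtoC 0) by ring; rewrite Cmod_0; lra).
    pose proof (Hacc p z0 H1 Hz00) as A. rewrite H3 in A.
    assert (D : cdot (c * (w - f z0))%C (p - z0)%C = cdot (c * f p - c * f z0)%C (p - z0)%C + t * eta ^ 2).
    { rewrite <- H3, Cmod_sq, <- cdot_scal_l, <- cdot_plus_l. f_equal.
      replace (c * (w - f z0))%C with (c * w - c * f z0)%C by ring. rewrite H4. ring. }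
    pose proof (cdot_le (c * (w - f z0)) (p - z0)) as B. rewrite Cmod_mult, Hcm, H3 in B.
    apply Rlt_div_r in Hw; [|lra]. nra.
Qed.

(** No continuity of [phi] is assumed, because the preimages in [convex_univalent] are chosen
    pointwise. The supremum of the points where [phi] exceeds [phi 0] is attained and cannot lie
    below 1. *)
Lemma locally_increasing (phi : R -> R) :
  (forall t0, 0 <= t0 <= 1 -> exists d, 0 < d /\ forall t, 0 <= t <= 1 -> Rabs (t - t0) < d -> t <> t0 ->
     0 < (t - t0) * (phi t - phi t0)) -> phi 0 < phi 1.
Proof.
  intros H. assert (N0 : exists t, 0 <= t <= 1 /\ phi 0 < phi t).
  { destruct (H 0 ltac:(lra)) as (d & Hd & H0). set (t := Rmin (d / 2) 1).
    assert (0 < t) by (apply Rmin_glb_lt; lra). pose proof (Rmin_l (d / 2) 1) as R1. pose proof (Rmin_r (d / 2) 1) as R2. fold t in R1, R2.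
    exists t. split; [lra|]. specialize (H0 t ltac:(lra) ltac:(rewrite Rabs_right; lra) ltac:(lra)). nra. }
  destruct (completeness (fun t => 0 <= t <= 1 /\ phi 0 < phi t)) as (s & Sub & Sl).
  - exists 1. intros t [[_ H1] _]. exact H1.
  - exact N0.
  - assert (Hs0 : 0 <= s <= 1).
    { split; [|apply Sl; intros t [[_ H1] _]; exact H1]. destruct N0 as (t & Ht). pose proof (Sub t Ht). lra. }
    destruct (H s Hs0) as (d & Hd & Hloc).
    assert (Hs1 : phi 0 < phi s).
    { destruct (classic (exists t, (0 <= t <= 1 /\ phi 0 < phi t) /\ s - d < t)) as [(t & [Ht Pt] & Htd)|N].
      - pose proof (Sub t (conj Ht Pt)). destruct (Req_dec t s) as [<-|Ne]; auto.
        specialize (Hloc t Ht ltac:(apply Rabs_def1; lra) Ne). nra.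
      - exfalso. assert (s <= s - d); [|lra]. apply Sl. intros t Ht. apply Rnot_lt_le. intros L. apply N. eauto. }
    destruct (Req_dec s 1) as [<-|Ne]; auto. exfalso.
    set (t := s + Rmin (d / 2) (1 - s)). assert (0 < Rmin (d / 2) (1 - s)) by (apply Rmin_glb_lt; lra).
    pose proof (Rmin_l (d / 2) (1 - s)). pose proof (Rmin_r (d / 2) (1 - s)).
    assert (Ht : 0 <= t <= 1) by (unfold t; lra).
    specialize (Hloc t Ht ltac:(rewrite Rabs_right; unfold t; lra) ltac:(unfold t; lra)).
    assert (t <= s); [|unfold t in *; lra]. apply Sub. split; auto. unfold t in *. nra.
Qed.

(** Both [tau conj(a) = conj(X) + Y] and [tau eps conj(a) = - (X + conj(Y))] are expressed by [X]
    and [Y], and the products [X Y] cancel. *)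
Lemma convex_pairing (X Y a eps : C) (tau : R) : (eps * Cconj a = - a)%C -> (X + Cconj Y = RtoC tau * a)%C ->
  tau * fst (Cconj a * (X + eps * Y))%C = Cmod X ^ 2 - Cmod Y ^ 2.
Proof.
  intros He HX. assert (HC : (RtoC tau * Cconj a = Cconj X + Y)%C).
  { apply (f_equal Cconj) in HX. destruct X, Y, a. unfold Cconj, Cmult, Cplus, RtoC in *. simpl in *.
    injection HX. intros. f_equal; lra. }
  transitivity (fst (RtoC tau * Cconj a * X + RtoC tau * (eps * Cconj a) * Y)%C); [simpl; ring|].
  rewrite He. replace (RtoC tau * - a)%C with (- (X + Cconj Y))%C by (rewrite HX; ring). rewrite HC, !Cmod_sq.
  unfold cdot. simpl. ring.
Qed.

(* Along the preimage [Z] of the segment from [f z1] to [f z2] in the convex image,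
   the real part of [conj a * (h + eps g)] increases, by [convex_pairing]. *)
Lemma convex_univalent (h g h' g' : C -> C) (eps : C) : holo 1 h h' -> holo 1 g g' ->
  (forall z, Cmod z < 1 -> Cmod (g' z) < Cmod (h' z)) ->
  univalent_on (disk 1) (harmonic h g) -> convex_set (image (harmonic h g) (disk 1)) -> Cmod eps = 1 ->
  univalent_on (disk 1) (fun z => h z + eps * g z)%C.
Proof.
  intros Hh Hg Hj Hu Hc He z1 z2 D1 D2 HF. apply NNPP. intros Hne. set (f := harmonic h g) in *.
  set (a := (f z2 - f z1)%C).
  assert (Ha : a <> 0%C) by (intros E; apply Hne; symmetry; apply Hu; auto; apply Ceq_minus, E).
  (* Equal values of [h + eps g] at the two points mean [X = - eps Y] for the increments, which ties
     the direction of [a] to [eps]. *)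
  assert (Hea : (eps * Cconj a = - a)%C).
  { set (X := (h z2 - h z1)%C). set (Y := (g z2 - g z1)%C).
    assert (E1 : a = (X + Cconj Y)%C) by (unfold a, f, harmonic, X, Y; ceq; ring).
    assert (E2 : X = (- (eps * Y))%C).
    { apply Ceq_minus. unfold X, Y. transitivity ((h z2 + eps * g z2) - (h z1 + eps * g z1))%C; [ring|]. rewrite HF. ring. }
    assert (E3 : (eps * Cconj eps = 1)%C).
    { assert (E : (eps * Cconj eps = RtoC (Cmod eps ^ 2))%C) by (rewrite Cmod_sq; unfold cdot; ceq; ring). rewrite E, He. f_equal. ring. }
    rewrite E1, E2. replace (Cconj (- (eps * Y) + Cconj Y))%C with (- (Cconj eps * Cconj Y) + Y)%C by (ceq; ring).
    replace (eps * (- (Cconj eps * Cconj Y) + Y))%C with (- (eps * Cconj eps) * Cconj Y + eps * Y)%C by ring. rewrite E3. ring. }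
  assert (HZ : forall t, exists z, 0 <= t <= 1 -> Cmod z < 1 /\ f z = (f z1 + RtoC t * a)%C).
  { intros t. destruct (classic (0 <= t <= 1)) as [Ht|Ht]; [|exists 0%C; tauto].
    destruct (Hc (f z1) (f z2) t) as (z & Dz & Ez); auto; [exists z1; auto|exists z2; auto|].
    exists z. intros _. split; [exact Dz|]. rewrite <- Ez. unfold a. rewrite RtoC_minus. ring. }
  set (Z := fun t => proj1_sig (constructive_indefinite_description _ (HZ t))).
  assert (HZ' : forall t, 0 <= t <= 1 -> Cmod (Z t) < 1 /\ f (Z t) = (f z1 + RtoC t * a)%C).
  { intros t. exact (proj2_sig (constructive_indefinite_description _ (HZ t))). }
  assert (Z0 : Z 0 = z1).
  { destruct (HZ' 0 ltac:(lra)) as [A B]. apply Hu; auto. rewrite B. ring. }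
  assert (Z1 : Z 1 = z2).
  { destruct (HZ' 1 ltac:(lra)) as [A B]. apply Hu; auto. rewrite B. unfold a. ring. }
  set (phi := fun t => fst (Cconj a * (h (Z t) + eps * g (Z t)))%C).
  assert (L : phi 0 < phi 1).
  { apply locally_increasing. intros t0 Ht0. destruct (HZ' t0 Ht0) as [Dz0 Ez0]. set (z0 := Z t0) in *.
    set (k := (Cmod (h' z0) - Cmod (g' z0)) / 4). assert (Hk : 0 < k) by (unfold k; pose proof (Hj z0 Dz0); lra).
    destruct (proj1 (Hh z0 Dz0) k Hk) as (d1 & Hd1 & C1). destruct (proj1 (Hg z0 Dz0) k Hk) as (d2 & Hd2 & C2).
    (* Continuity of [Z] at [t0] is recovered here: local surjectivity gives a preimage near [z0],
       and injectivity identifies it with [Z t]. *)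
    destruct (harmonic_local_surjective h g h' g' z0 (Rmin (Rmin d1 d2) (1 - Cmod z0)) Hh Hg Dz0 (Hj z0 Dz0)) as (del & Hdel & HS).
    { repeat apply Rmin_glb_lt; lra. }
    fold f in HS. pose proof (Cmod_ge_0 a). exists (del / (Cmod a + 1)). split; [apply Rdiv_lt_0_compat; lra|]. intros t Ht Htt Hne'.
    destruct (HZ' t Ht) as [Dz Ez].
    assert (Etau : (f (Z t) - f z0 = RtoC (t - t0) * a)%C) by (rewrite Ez, Ez0, RtoC_minus; ring).
    destruct (HS (f (Z t))) as (z & Hz & Efz).
    { rewrite Etau, Cmod_mult, Cmod_R. apply Rlt_div_r in Htt; [|lra]. pose proof (Rabs_pos (t - t0)). nra. }
    pose proof (Rmin_l (Rmin d1 d2) (1 - Cmod z0)). pose proof (Rmin_r (Rmin d1 d2) (1 - Cmod z0)).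
    pose proof (Rmin_l d1 d2). pose proof (Rmin_r d1 d2).
    assert (Ezt : z = Z t).
    { apply Hu; auto. unfold disk. pose proof (Cmod_triangle_sub z z0). lra. }
    rewrite Ezt in Hz. set (u := (Z t - z0)%C) in *. set (X := (h (Z t) - h z0)%C). set (Y := (g (Z t) - g z0)%C).
    assert (Hu0 : 0 < Cmod u).
    { apply Cmod_gt_0. intros E. apply Ceq_minus in E. rewrite E in Etau.
      assert (RtoC (t - t0) * a = 0)%C by (rewrite <- Etau; ring). apply (f_equal Cmod) in H4.
      rewrite Cmod_mult, Cmod_R, Cmod_0 in H4. apply Cmod_gt_0 in Ha. apply Rmult_integral in H4. destruct H4 as [H4|H4]; [|lra].
      destruct (Req_dec (t - t0) 0) as [E0|E0]; [lra|apply Rabs_pos_lt in E0; lra]. }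
    specialize (C1 u ltac:(lra)). specialize (C2 u ltac:(lra)). replace (z0 + u)%C with (Z t) in C1, C2 by (unfold u; ring).
    fold X in C1. fold Y in C2.
    assert (BX : Cmod (h' z0) * Cmod u - Cmod X <= k * Cmod u).
    { rewrite <- Cmod_mult. eapply Rle_trans; [apply Cmod_triangle_sub|]. rewrite Cmod_minus_sym. exact C1. }
    assert (BY : Cmod Y - Cmod (g' z0) * Cmod u <= k * Cmod u).
    { rewrite <- Cmod_mult. eapply Rle_trans; [apply Cmod_triangle_sub|]. exact C2. }
    assert (XY : Cmod Y < Cmod X) by (unfold k in *; nra).
    assert (Hpair : (X + Cconj Y = RtoC (t - t0) * a)%C).
    { rewrite <- Etau. unfold X, Y, f, harmonic. ceq; ring. }
    replace (phi t - phi t0) with (fst (Cconj a * (X + eps * Y))%C) by (unfold phi, X, Y, z0; simpl; ring).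
    rewrite (convex_pairing X Y a eps (t - t0) Hea Hpair). pose proof (Cmod_ge_0 Y). nra. }
  unfold phi in L. rewrite Z0, Z1, HF in L. lra.
Qed.

(** * Sections *)

Lemma pow_n_Cpow (z : C) k : @pow_n C_Ring z k = (z ^ k)%C.
Proof. induction k; simpl; [reflexivity|]. rewrite IHk. reflexivity. Qed.

Lemma sum_n_csum (f : nat -> C) n : @sum_n C_AbelianMonoid f n = csum f (S n).
Proof.
  induction n; [rewrite sum_O; simpl; ring|]. rewrite sum_Sn, IHn. reflexivity.
Qed.

Lemma csums_is_pseries (a : nat -> C) (z l : C) : csums a z l <-> @is_pseries C_AbsRing C_NormedModule a z l.
Proof.
  unfold is_pseries, is_series.
  rewrite (filterlim_locally_ball_norm (U := C_NormedModule) (F := eventually)).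
  assert (E : forall n, @sum_n C_AbelianMonoid (fun k => @scal C_AbsRing C_NormedModule (pow_n z k) (a k)) n = csum (fun k => a k * z ^ k)%C (S n)).
  { intros n. rewrite sum_n_csum. apply csum_ext. intros k _. rewrite Cmult_comm, <- (pow_n_Cpow z k). reflexivity. }
  split.
  - intros H e. destruct (H e (cond_pos e)) as [N HN]. exists N. intros n Hn.
    change (Cmod (@sum_n C_AbelianMonoid (fun k => @scal C_AbsRing C_NormedModule (pow_n z k) (a k)) n - l)%C < e).
    rewrite E. apply HN. lia.
  - intros H e He. destruct (H (mkposreal e He)) as [N HN]. exists (S N). intros [|n] Hn; [lia|].
    specialize (HN n ltac:(lia)).
    change (Cmod (@sum_n C_AbelianMonoid (fun k => @scal C_AbsRing C_NormedModule (pow_n z k) (a k)) n - l)%C < e) in HN.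
    rewrite E in HN. exact HN.
Qed.

Lemma expands_at_csums f z0 a : expands_at f z0 a <->
  exists rho, 0 < rho /\ forall u, Cmod u < rho -> csums a u (f (z0 + u)%C).
Proof.
  split; intros (rho & Hr & H); exists rho; split; auto.
  - intros u Hu. apply csums_is_pseries. specialize (H (z0 + u)%C). replace (z0 + u - z0)%C with u in H by ring. auto.
  - intros z Hz. apply csums_is_pseries. specialize (H (z - z0)%C Hz). replace (z0 + (z - z0))%C with z in H by ring. exact H.
Qed.

Lemma cderiv_translate f z0 u d : cderiv (fun w => f (z0 + w)%C) u d <-> cderiv f (z0 + u)%C d.
Proof.
  split; intros H e He; destruct (H e He) as (del & Hd & H'); exists del; split; auto; intros v Hv; specialize (H' v Hv);
    replace (z0 + (u + v))%C with (z0 + u + v)%C in * by ring; exact H'.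
Qed.

Lemma ccont_translate f z0 u : ccont (fun w => f (z0 + w)%C) u -> ccont f (z0 + u)%C.
Proof.
  intros H e He. destruct (H e He) as (d & Hd & H'). exists d. split; auto. intros w Hw.
  specialize (H' (w - z0)%C). replace (z0 + (w - z0))%C with w in H' by ring. apply H'.
  replace (w - z0 - u)%C with (w - (z0 + u))%C by ring. exact Hw.
Qed.

Lemma analytic_holo r f : analytic_on (disk r) f -> holo r f (C_derive f).
Proof.
  intros H z0 Hz0. destruct (H z0 Hz0) as [a Ha]. apply expands_at_csums in Ha. destruct Ha as (rho & Hr & Ha).
  pose proof (pser_holo a rho (fun u => f (z0 + u)%C) Ha) as HH.
  assert (D : forall u, Cmod u < rho -> cderiv f (z0 + u)%C (C_derive f (z0 + u)%C) /\ C_derive f (z0 + u)%C = dsum a u).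
  { intros u Hu. destruct (HH u Hu) as [Hd _]. apply (proj1 (cderiv_translate f z0 u _)) in Hd. pose proof (cderiv_C_derive _ _ _ Hd) as E.
    rewrite E. auto. }
  assert (R0 : Cmod 0 < rho) by (rewrite Cmod_0; auto).
  replace z0 with (z0 + 0)%C by ring. split; [apply D; auto|]. apply ccont_translate.
  apply ccont_ext_loc with (f := dsum a) (r := rho); auto; [|apply HH; auto].
  intros w Hw. replace (w - 0)%C with w in Hw by ring. symmetry. apply D; auto.
Qed.

Lemma holo_analytic r f f' : holo r f f' -> analytic_on (disk r) f.
Proof.
  intros H z0 Hz0. unfold disk in Hz0. set (rho := r - Cmod z0).
  assert (Hu : forall u, Cmod u < rho -> Cmod (z0 + u)%C < r).
  { intros u Hu. pose proof (Cmod_triangle z0 u). unfold rho in Hu. lra. }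
  destruct (taylor rho (fun u => f (z0 + u)%C) (fun u => f' (z0 + u)%C)) as [a Ha].
  - intros u Hu'. destruct (H _ (Hu u Hu')) as [D Cc]. split; [apply cderiv_translate; auto|].
    apply (ccont_comp f' (fun w => z0 + w)%C); auto. apply ccont_plus; [apply ccont_const|apply ccont_id].
  - unfold rho. lra.
  - exists a. apply expands_at_csums. exists rho. split; [unfold rho; lra|exact Ha].
Qed.

Lemma sum_n_m_csum (f : nat -> C) n : (2 <= n)%nat -> @sum_n_m C_AbelianMonoid f 2 n = (csum f (S n) - f 0%nat - f 1%nat)%C.
Proof.
  intros Hn. replace n with (2 + (n - 2))%nat by lia. induction (n - 2)%nat.
  - rewrite sum_n_n. cbn [csum Nat.add]. lazymatch goal with |- ?x = ?y => change (@eq C x y) end. ring.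
  - rewrite Nat.add_succ_r, sum_n_Sm by lia. rewrite IHn0. change (@plus C_AbelianMonoid) with Cplus. cbn [csum].
    lazymatch goal with |- ?x = ?y => change (@eq C x y) end. ring.
Qed.

Lemma cderiv_poly (a : nat -> C) (z : C) n :
  cderiv (fun w => csum (fun k => a k * w ^ k) (S n))%C z (csum (fun k => cdcoef a k * z ^ k)%C n).
Proof.
  induction n.
  - simpl. apply cderiv_ext_loc with (f := fun _ => a 0%nat) (r := 1); [lra|intros; ring|apply cderiv_const].
  - change (cderiv (fun w => csum (fun k => a k * w ^ k) (S n) + a (S n) * w ^ S n)%C z
      (csum (fun k => cdcoef a k * z ^ k) n + cdcoef a n * z ^ n)%C).
    apply cderiv_plus; auto. eapply cderiv_eq; [apply cderiv_scal, cderiv_pow|].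
    replace (S n - 1)%nat with n by lia. unfold cdcoef. ring.
Qed.

Lemma section_h_csum a n (z : C) : (2 <= n)%nat -> a 0%nat = RtoC 0 -> a 1%nat = RtoC 1 ->
  section_h a n z = csum (fun k => a k * z ^ k)%C (S n).
Proof.
  intros Hn H0 H1. unfold section_h.
  replace (sum_n_m (fun k => (a k * z ^ k)%C) 2 n) with (csum (fun k => a k * z ^ k)%C (S n) - a 0%nat * z ^ 0 - a 1%nat * z ^ 1)%C
    by (symmetry; exact (sum_n_m_csum (fun k => a k * z ^ k)%C n Hn)).
  rewrite H0, H1. simpl Cpow. ring.
Qed.

Lemma section_g_csum b n (z : C) : (2 <= n)%nat -> b 0%nat = RtoC 0 -> b 1%nat = RtoC 0 ->
  section_g b n z = csum (fun k => b k * z ^ k)%C (S n).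
Proof.
  intros Hn H0 H1. unfold section_g.
  replace (sum_n_m (fun k => (b k * z ^ k)%C) 2 n) with (csum (fun k => b k * z ^ k)%C (S n) - b 0%nat * z ^ 0 - b 1%nat * z ^ 1)%C
    by (symmetry; exact (sum_n_m_csum (fun k => b k * z ^ k)%C n Hn)).
  rewrite H0, H1. simpl Cpow. ring.
Qed.

Lemma expands_at_0_global f a : analytic_on (disk 1) f -> expands_at f (RtoC 0) a ->
  forall z, Cmod z < 1 -> csums a z (f z).
Proof.
  intros Hf Ha. apply analytic_holo in Hf. destruct (taylor 1 f _ Hf) as [A HA]; [lra|].
  apply expands_at_csums in Ha. destruct Ha as (rho & Hr & Ha).
  assert (E : forall k, A k = a k).
  { apply (csums_unique A a f (Rmin 1 rho)).
    - apply Rmin_glb_lt; lra.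
    - intros z Hz. apply HA. pose proof (Rmin_l 1 rho). lra.
    - intros z Hz. rewrite <- (Cplus_0_l z) at 2. apply Ha. pose proof (Rmin_r 1 rho). lra. }
  intros z Hz. specialize (HA z Hz). revert HA. apply cser_ext. intros k. rewrite E. reflexivity.
Qed.

Lemma csums_coef_0 a f : (forall z, Cmod z < 1 -> csums a z (f z)) -> a 0%nat = f (RtoC 0).
Proof. intros H. apply (cser_unique _ _ _ (csums_at_0 a)). apply H. rewrite Cmod_0. lra. Qed.

Lemma dsum_C_derive a f : (forall z, Cmod z < 1 -> csums a z (f z)) -> forall z, Cmod z < 1 -> dsum a z = C_derive f z.
Proof. intros H z Hz. symmetry. apply cderiv_C_derive. apply (pser_cderiv' a 1 f H z Hz). Qed.

Lemma csums_coef_1 a f : (forall z, Cmod z < 1 -> csums a z (f z)) -> a 1%nat = C_derive f (RtoC 0).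
Proof.
  intros H. assert (H0 : Cmod (RtoC 0) < 1) by (rewrite Cmod_0; lra). rewrite <- (dsum_C_derive a f H _ H0).
  pose proof (cser_unique _ _ _ (pser_dsum a 1 f H _ H0) (csums_at_0 (cdcoef a))) as E. rewrite E.
  unfold cdcoef. simpl. ring.
Qed.

Lemma section_derivatives h g a b n : class_CH0 h g -> expands_at h (RtoC 0) a -> expands_at g (RtoC 0) b -> (2 <= n)%nat ->
  (a 0%nat = RtoC 0 /\ a 1%nat = RtoC 1 /\ b 0%nat = RtoC 0 /\ b 1%nat = RtoC 0) /\
  forall z, Cmod z < 1 / 4 ->
    Cmod (csum (fun k => cdcoef b k * z ^ k)%C n) < fst (csum (fun k => cdcoef a k * z ^ k)%C n).
Proof.
  intros ((Ah & Ag & h0 & h1 & g0 & g1) & Hsp & Hu & Hc) Ea Eb Hn.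
  pose proof (expands_at_0_global h a Ah Ea) as Sa. pose proof (expands_at_0_global g b Ag Eb) as Sb.
  assert (a0 : a 0%nat = RtoC 0) by (rewrite (csums_coef_0 a h Sa); auto).
  assert (a1 : a 1%nat = RtoC 1) by (rewrite (csums_coef_1 a h Sa); auto).
  assert (b0 : b 0%nat = RtoC 0) by (rewrite (csums_coef_0 b g Sb); auto).
  assert (b1 : b 1%nat = RtoC 0) by (rewrite (csums_coef_1 b g Sb); auto).
  split; [auto|]. intros z Hz.
  assert (Hj : forall w, Cmod w < 1 -> Cmod (C_derive g w) < Cmod (C_derive h w)).
  { intros w Hw. specialize (Hsp w Hw). unfold jacobian in Hsp. pose proof (Cmod_ge_0 (C_derive g w)).
    pose proof (Cmod_ge_0 (C_derive h w)). nra. }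
  set (P := csum (fun k => cdcoef a k * z ^ k)%C n). set (Q := csum (fun k => cdcoef b k * z ^ k)%C n).
  (* With this [eps] the derivative [P + eps Q] of the section of [h + eps g] becomes [P - |Q|], so
     its positive real part is the claim. *)
  assert (Heps : exists eps, Cmod eps = 1 /\ (eps * Q = - RtoC (Cmod Q))%C).
  { destruct (classic (Q = 0%C)) as [->|HQ].
    - exists 1%C. split; [apply Cmod_1|]. rewrite Cmod_0. ring.
    - exists (- RtoC (Cmod Q) / Q)%C. split; [|field; auto]. rewrite Cmod_div, Cmod_opp, Cmod_RtoC by (auto; apply Cmod_ge_0).
      field. apply Rgt_not_eq, Cmod_gt_0. auto. }
  destruct Heps as (eps & Heps & EQ).
  set (A := fun k => (a k + eps * b k)%C). set (F := fun z => (h z + eps * g z)%C).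
  assert (SA : forall z, Cmod z < 1 -> csums A z (F z)).
  { intros w Hw. unfold csums. apply cser_ext with (f := fun k => (a k * w ^ k + eps * (b k * w ^ k))%C).
    - intros k. unfold A. ring.
    - apply cser_plus; [apply Sa; auto|]. apply cser_scal. apply Sb; auto. }
  assert (Hpos : 0 < fst (csum (fun k => cdcoef A k * z ^ k)%C n)).
  { apply (section_derivative_pos A F); auto.
    - unfold A. rewrite a0, b0. ring.
    - unfold A. rewrite a1, b1. ring.
    - apply (convex_univalent h g (C_derive h) (C_derive g)); auto; apply analytic_holo; auto.
    - intros w Hw. rewrite (dsum_C_derive A F SA w Hw).
      assert (D : cderiv F w (C_derive h w + eps * C_derive g w)%C).
      { apply cderiv_plus; [apply (analytic_holo 1 h Ah w Hw)|]. apply cderiv_scal. apply (analytic_holo 1 g Ag w Hw). }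
      rewrite (cderiv_C_derive _ _ _ D). intros E. specialize (Hj w Hw).
      assert (E2 : C_derive h w = (- (eps * C_derive g w))%C).
      { apply Ceq_minus. rewrite <- E. ring. }
      rewrite E2, Cmod_opp, Cmod_mult, Heps in Hj. lra. }
  assert (E : csum (fun k => cdcoef A k * z ^ k)%C n = (P + eps * Q)%C).
  { unfold P, Q. rewrite <- (csum_scal eps (fun k => cdcoef b k * z ^ k)%C), <- csum_plus. apply csum_ext. intros k _. unfold cdcoef, A. ring. }
  rewrite E, EQ in Hpos. simpl in Hpos. lra.
Qed.

Theorem sections_close_to_convex h g a b n : class_CH0 h g -> expands_at h (RtoC 0) a -> expands_at g (RtoC 0) b -> (2 <= n)%nat ->
  close_to_convex_on (disk (1 / 4)) (harmonic (section_h a n) (section_g b n)) /\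
  sense_preserving_on (disk (1 / 4)) (section_h a n) (section_g b n).
Proof.
  intros Hcl Ea Eb Hn. destruct (section_derivatives h g a b n Hcl Ea Eb Hn) as ((a0 & a1 & b0 & b1) & Hpos).
  assert (Eh : section_h a n = fun z => csum (fun k => a k * z ^ k)%C (S n)).
  { apply functional_extensionality. intros z. apply section_h_csum; auto. }
  assert (Eg : section_g b n = fun z => csum (fun k => b k * z ^ k)%C (S n)).
  { apply functional_extensionality. intros z. apply section_g_csum; auto. }
  rewrite Eh, Eg. split.
  - apply (close_to_convex_disk _ _ (fun z => csum (fun k => cdcoef a k * z ^ k)%C n) (fun z => csum (fun k => cdcoef b k * z ^ k)%C n)
      (1 / 4) (rsum (fun k => Cmod (cdcoef a k)) n + rsum (fun k => Cmod (cdcoef b k)) n)); auto; [lra|].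
    intros z Hz. split; [apply cderiv_poly|]. split; [apply cderiv_poly|].
    assert (B : forall c, Cmod (csum (fun k => cdcoef c k * z ^ k)%C n) <= rsum (fun k => Cmod (cdcoef c k)) n).
    { intros c. eapply Rle_trans; [apply Cmod_csum|]. apply rsum_le. intros k _. rewrite Cmod_mult, Cmod_pow.
      rewrite <- (Rmult_1_r (Cmod (cdcoef c k))) at 2. apply Rmult_le_compat_l; [apply Cmod_ge_0|].
      rewrite <- (pow1 k). apply pow_incr. split; [apply Cmod_ge_0|lra]. }
    apply Rplus_le_compat; apply B.
  - intros z Hz. unfold jacobian. rewrite (cderiv_C_derive _ _ _ (cderiv_poly a z n)), (cderiv_C_derive _ _ _ (cderiv_poly b z n)).
    specialize (Hpos z Hz). pose proof (fst_le_Cmod (csum (fun k => cdcoef a k * z ^ k)%C n)) as F. apply Rabs_le_between in F.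
    set (x := Cmod (csum (fun k => cdcoef b k * z ^ k)%C n)) in *. assert (0 <= x) by apply Cmod_ge_0. nra.
Qed.

(** * The half-plane mapping *)

(* [hp_h z = (z - z^2 / 2) / (1 - z)^2] and [hp_g z = - (z^2 / 2) / (1 - z)^2]. *)
Definition hp_q (z : C) : C := (/ (1 - z))%C.

Definition hp_h (z : C) : C := (RtoC (1 / 2) * (hp_q z * hp_q z - 1))%C.

Definition hp_g (z : C) : C := (RtoC (1 / 2) * (2 * hp_q z - hp_q z * hp_q z - 1))%C.

Lemma one_minus_nz (z : C) : Cmod z < 1 -> (1 - z)%C <> 0%C.
Proof.
  intros Hz E. apply Ceq_minus in E. rewrite <- E, Cmod_1 in Hz. lra.
Qed.

Lemma cderiv_hp_q (z : C) : Cmod z < 1 -> cderiv hp_q z (hp_q z * hp_q z)%C.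
Proof.
  intros Hz. pose proof (one_minus_nz z Hz) as N.
  assert (D : cderiv (fun w => 1 - w)%C z (0 - 1)%C) by (apply cderiv_minus; [apply cderiv_const|apply cderiv_id]).
  eapply cderiv_eq; [exact (cderiv_inv _ _ _ D N)|]. unfold hp_q. field. auto.
Qed.

Lemma hp_q_z (z : C) : Cmod z < 1 -> (hp_q z - 1 = z * hp_q z)%C.
Proof. intros Hz. unfold hp_q. field. apply one_minus_nz; auto. Qed.

Definition hp_h' (z : C) : C := (hp_q z * hp_q z * hp_q z)%C.

Definition hp_g' (z : C) : C := ((1 - hp_q z) * (hp_q z * hp_q z))%C.

Lemma hp_holo : holo 1 hp_h hp_h' /\ holo 1 hp_g hp_g'.
Proof.
  assert (Cq : forall z, Cmod z < 1 -> ccont hp_q z) by (intros; eapply cderiv_ccont, cderiv_hp_q; auto).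
  split; intros z Hz; pose proof (cderiv_hp_q z Hz) as D; pose proof (cderiv_mult _ _ _ _ _ D D) as D2; specialize (Cq z Hz).
  - split.
    + eapply cderiv_eq; [apply cderiv_scal, cderiv_minus; [exact D2|apply cderiv_const]|].
      unfold hp_h'. destruct (hp_q z). ceq; field.
    + unfold hp_h'. apply ccont_mult; auto. apply ccont_mult; auto.
  - split.
    + eapply cderiv_eq; [apply cderiv_scal, cderiv_minus; [apply cderiv_minus; [apply cderiv_scal, D|exact D2]|apply cderiv_const]|].
      unfold hp_g'. destruct (hp_q z). ceq; field.
    + unfold hp_g'. apply ccont_mult; [apply ccont_minus; [apply ccont_const|auto]|apply ccont_mult; auto].
Qed.

Lemma hp_q_half_plane (z : C) : Cmod z < 1 -> 1 / 2 < fst (hp_q z).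
Proof.
  intros Hz. pose proof (one_minus_nz z Hz) as N. apply Cmod_gt_0 in N.
  pose proof (Cmod_sq (1 - z)%C) as S1. pose proof (Cmod_sq z) as S2. pose proof (Cmod_ge_0 z).
  assert (E : fst (hp_q z) = (1 - fst z) / Cmod (1 - z)%C ^ 2).
  { rewrite S1. unfold hp_q, Cinv, cdot. simpl. f_equal; ring. }
  rewrite E. assert (N2 : 0 < Cmod (1 - z)%C ^ 2) by (apply pow_lt; auto).
  assert (Z2 : Cmod z ^ 2 < 1) by nra. apply (Rlt_div_r (1 / 2) (1 - fst z) _ N2). rewrite S1. rewrite S2 in Z2. unfold cdot in *. simpl in *. lra.
Qed.

(** In the coordinate [q = 1 / (1 - z)], which maps the disk onto [Re q > 1/2], the map acts on each
    vertical line as a real scaling; injectivity and the image can be read off. *)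
Lemma hp_harmonic (z : C) : harmonic hp_h hp_g z = (fst (hp_q z) - 1, snd (hp_q z) * (2 * fst (hp_q z) - 1)).
Proof. unfold harmonic, hp_h, hp_g. destruct (hp_q z) as [x y]. ceq; field. Qed.

Lemma hp_image (w : C) : image (harmonic hp_h hp_g) (disk 1) w <-> - (1 / 2) < fst w.
Proof.
  split.
  - intros (z & Hz & ->). rewrite hp_harmonic. cbn [fst]. pose proof (hp_q_half_plane z Hz). lra.
  - intros Hw. destruct w as [s t]. simpl in Hw. set (q := (s + 1, t / (2 * (s + 1) - 1)) : C).
    assert (Nq : q <> 0%C) by (intros E; apply (f_equal fst) in E; simpl in E; lra).
    assert (Hq : hp_q (1 - / q)%C = q) by (unfold hp_q; field; split; [auto|]; replace (q - (q - 1))%C with (RtoC 1) by ring; intros E; apply (f_equal fst) in E; simpl in E; lra).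
    exists (1 - / q)%C. split.
    + unfold disk. replace (1 - / q)%C with ((q - 1) / q)%C by (field; auto). rewrite Cmod_div by auto.
      apply Cmod_gt_0 in Nq. apply (Rlt_div_l _ _ _ Nq). rewrite Rmult_1_l.
      apply Cmod_lt_of_sq; [apply Cmod_ge_0|]. rewrite Cmod_sq. unfold cdot, q. simpl. nra.
    + rewrite hp_harmonic, Hq. unfold q. simpl. f_equal; [ring|field; lra].
Qed.

Lemma hp_class : class_CH0 hp_h hp_g.
Proof.
  destruct hp_holo as [Hh Hg]. assert (Z1 : Cmod (RtoC 0) < 1) by (rewrite Cmod_0; lra).
  assert (q0 : hp_q 0 = RtoC 1) by (unfold hp_q; replace (1 - 0)%C with (RtoC 1) by ring; field; intros E; apply (f_equal fst) in E; simpl in E; lra).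
  split; [|split; [|split]].
  - split; [eapply holo_analytic, Hh|]. split; [eapply holo_analytic, Hg|].
    rewrite (cderiv_C_derive _ _ _ (proj1 (Hh _ Z1))), (cderiv_C_derive _ _ _ (proj1 (Hg _ Z1))).
    unfold hp_h, hp_g, hp_h', hp_g'. rewrite q0. repeat split; ceq; ring.
  - intros z Hz. unfold disk in Hz. unfold jacobian.
    rewrite (cderiv_C_derive _ _ _ (proj1 (Hh _ Hz))), (cderiv_C_derive _ _ _ (proj1 (Hg _ Hz))).
    unfold hp_h', hp_g'. replace (1 - hp_q z)%C with (- (z * hp_q z))%C by (rewrite <- hp_q_z by auto; ring).
    rewrite !Cmod_mult, Cmod_opp, Cmod_mult. pose proof (hp_q_half_plane z Hz). pose proof (Cmod_ge_0 z).
    assert (Hq : 0 < Cmod (hp_q z)) by (apply Cmod_gt_0; intros E; rewrite E in H; simpl in H; lra).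
    set (m := Cmod (hp_q z)) in *. replace ((m * m * m) ^ 2 - (Cmod z * m * (m * m)) ^ 2) with ((m ^ 3) ^ 2 * (1 - Cmod z ^ 2)) by ring.
    apply Rmult_lt_0_compat; [apply pow_lt, pow_lt; auto|nra].
  - intros z w Hz Hw E. rewrite !hp_harmonic in E. pose proof (f_equal fst E) as E1. pose proof (f_equal snd E) as E2. cbn [fst snd] in E1, E2.
    pose proof (hp_q_half_plane z Hz). assert (X : fst (hp_q z) = fst (hp_q w)) by lra.
    assert (Y : snd (hp_q z) = snd (hp_q w)) by (rewrite <- X in E2; apply Rmult_eq_reg_r in E2; lra).
    assert (Q : hp_q z = hp_q w) by (apply injective_projections; auto).
    pose proof (one_minus_nz z Hz). pose proof (one_minus_nz w Hw). unfold hp_q in Q.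
    replace z with (1 - / / (1 - z))%C by (field; auto). rewrite Q. field. auto.
  - intros p q t Hp Hq Ht. apply hp_image. apply hp_image in Hp. apply hp_image in Hq. simpl.
    set (m := Rmin (fst p) (fst q)). assert (Hm : - (1 / 2) < m) by (apply Rmin_glb_lt; auto).
    assert (0 <= (1 - t) * (fst p - m)) by (apply Rmult_le_pos; [lra|pose proof (Rmin_l (fst p) (fst q)); unfold m; lra]).
    assert (0 <= t * (fst q - m)) by (apply Rmult_le_pos; [lra|pose proof (Rmin_r (fst p) (fst q)); unfold m; lra]). lra.
Qed.

(** * Taylor coefficients and the second section of the half-plane mapping *)

Lemma csums_geom (z : C) : Cmod z < 1 -> csums (fun _ => RtoC 1) z (hp_q z).
Proof.
  intros Hz e He. pose proof (one_minus_nz z Hz) as N. pose proof (Cmod_ge_0 z). assert (P := N). apply Cmod_gt_0 in P.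
  destruct (pow_small (Cmod z) (e * Cmod (1 - z)%C)) as [K HK]; [lra|nra|]. exists K. intros n Hn.
  assert (E : (csum (fun k => 1 * z ^ k) n - hp_q z = - (z ^ n) * hp_q z)%C).
  { rewrite (csum_ext _ (fun k => z ^ k)%C) by (intros; ring).
    pose proof (cgeom_sum z n) as G. unfold hp_q. replace (csum (fun k => z ^ k) n)%C with ((1 - z ^ n) / (1 - z))%C by (rewrite <- G; field; auto).
    field. auto. }
  rewrite E. unfold hp_q. rewrite Cmod_mult, Cmod_opp, Cmod_pow, Cmod_inv by auto. specialize (HK n Hn).
  apply (Rlt_div_l _ _ _ P) in HK. exact HK.
Qed.

(** The convolution is the squared geometric series: for [k >= 1] the coefficients are [(k + 1) / 2]
    here and [(1 - k) / 2] for [hp_b]. *)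
Definition hp_a (k : nat) : C := (RtoC (1 / 2) * (conv (fun _ => 1) (fun _ => 1) k - delta k))%C.

Definition hp_b (k : nat) : C := (RtoC (1 / 2) * (2 * 1 - conv (fun _ => 1) (fun _ => 1) k - delta k))%C.

Lemma hp_expand : expands_at hp_h (RtoC 0) hp_a /\ expands_at hp_g (RtoC 0) hp_b.
Proof.
  pose proof (csums_mult _ _ 1 hp_q hp_q csums_geom csums_geom) as Q2.
  split; apply expands_at_csums; exists 1; (split; [lra|]); intros z Hz; rewrite Cplus_0_l.
  - apply cser_ext with (f := fun k => (RtoC (1 / 2) * (conv (fun _ => 1) (fun _ => 1) k * z ^ k - delta k * z ^ k))%C).
    + intros k. unfold hp_a. ring.
    + apply cser_scal, cser_minus; [apply Q2; auto|apply csums_delta].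
  - apply cser_ext with (f := fun k => (RtoC (1 / 2) * (2 * (1 * z ^ k) - conv (fun _ => 1) (fun _ => 1) k * z ^ k - delta k * z ^ k))%C).
    + intros k. unfold hp_b. ring.
    + apply cser_scal, cser_minus; [|apply csums_delta]. apply cser_minus; [|apply Q2; auto]. apply cser_scal. apply csums_geom; auto.
Qed.

Lemma hp_coef : hp_a 0 = RtoC 0 /\ hp_a 1 = RtoC 1 /\ hp_a 2 = RtoC (3 / 2) /\ hp_b 0 = RtoC 0 /\ hp_b 1 = RtoC 0 /\ hp_b 2 = RtoC (- (1 / 2)).
Proof. unfold hp_a, hp_b, conv. simpl. repeat split; ceq; field. Qed.

(** The section [z + 3/2 z^2 - 1/2 conj(z)^2] has imaginary part [y (1 + 4 x)], so it is real on the
    line [x = - 1/4] and takes equal values at conjugate points of that line. *)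
Lemma hp_section_not_univalent r : 1 / 4 < r -> ~ univalent_on (disk r) (harmonic (section_h hp_a 2) (section_g hp_b 2)).
Proof.
  intros Hr H. destruct hp_coef as (a0 & a1 & a2 & b0 & b1 & b2).
  set (y := (r - 1 / 4) / 2). assert (Hy : 0 < y) by (unfold y; lra).
  assert (In : forall t, Rabs t = y -> disk r (- (1 / 4), t)).
  { intros t Ht. unfold disk. eapply Rle_lt_trans; [apply Cmod_le_abs|]. simpl. rewrite Ht, Rabs_left by lra. unfold y. lra. }
  assert (E : ((- (1 / 4), y) : C) = (- (1 / 4), - y)).
  { apply H.
    - apply In, Rabs_right. lra.
    - apply In. rewrite Rabs_Ropp. apply Rabs_right. lra.
    - unfold harmonic. rewrite !section_h_csum, !section_g_csum by auto. cbn [csum]. rewrite a0, a1, a2, b0, b1, b2. ceq; field. }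
  injection E. lra.
Qed.

(** On the real axis the Jacobian is [(1 + 3 x)^2 - x^2 = (1 + 2 x) (1 + 4 x)], negative between
    [- 1/2] and [- 1/4]. *)
Lemma hp_section_not_sense_preserving r : 1 / 4 < r -> ~ sense_preserving_on (disk r) (section_h hp_a 2) (section_g hp_b 2).
Proof.
  intros Hr H. destruct hp_coef as (a0 & a1 & a2 & b0 & b1 & b2).
  (* The bound [1 / 8] keeps [x = - 1/4 - d] above [- 1/2]. *)
  set (d := Rmin ((r - 1 / 4) / 2) (1 / 8)). assert (Hd : 0 < d) by (apply Rmin_glb_lt; lra).
  pose proof (Rmin_l ((r - 1 / 4) / 2) (1 / 8)) as L1. pose proof (Rmin_r ((r - 1 / 4) / 2) (1 / 8)) as L2. fold d in L1, L2.
  set (x := - (1 / 4) - d).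
  assert (Dx : disk r (RtoC x)).
  { unfold disk. rewrite Cmod_R, Rabs_left by (unfold x; lra). unfold x. lra. }
  specialize (H _ Dx). unfold jacobian in H.
  assert (Eh : section_h hp_a 2 = fun z => csum (fun k => hp_a k * z ^ k)%C 3).
  { apply functional_extensionality. intros z. apply section_h_csum; auto. }
  assert (Eg : section_g hp_b 2 = fun z => csum (fun k => hp_b k * z ^ k)%C 3).
  { apply functional_extensionality. intros z. apply section_g_csum; auto. }
  rewrite Eh, Eg, (cderiv_C_derive _ _ _ (cderiv_poly _ _ _)), (cderiv_C_derive _ _ _ (cderiv_poly _ _ _)) in H.
  cbn [csum] in H. unfold cdcoef in H. rewrite a1, a2, b1, b2 in H.
  rewrite !Cmod_sq in H. unfold cdot in H. simpl in H. unfold x in H. nra.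
Qed.

Theorem theorem3 :
  for_all_sections
    (fun hn gn => close_to_convex_on (disk (1 / 4)) (harmonic hn gn)) /\
  for_all_sections
    (fun hn gn => univalent_on (disk (1 / 4)) (harmonic hn gn) /\
                  sense_preserving_on (disk (1 / 4)) hn gn) /\
  (forall r : R, 1 / 4 < r ->
     ~ for_all_sections
         (fun hn gn => close_to_convex_on (disk r) (harmonic hn gn)) /\
     ~ for_all_sections
         (fun hn gn => univalent_on (disk r) (harmonic hn gn)) /\
     ~ for_all_sections
         (fun hn gn => sense_preserving_on (disk r) hn gn)).
Proof.
  split; [|split].
  - intros h g a b n H Ea Eb Hn. apply (sections_close_to_convex h g a b n); assumption.
  - intros h g a b n H Ea Eb Hn. destruct (sections_close_to_convex h g a b n H Ea Eb Hn) as [[U _] S]. split; assumption.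
  - intros r Hr. destruct hp_expand as [Ea Eb].
    split; [|split]; intros H; specialize (H hp_h hp_g hp_a hp_b 2%nat hp_class Ea Eb (le_n 2)).
    + apply (hp_section_not_univalent r Hr), H.
    + apply (hp_section_not_univalent r Hr), H.
    + apply (hp_section_not_sense_preserving r Hr), H.
Qed.
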